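(* Let $0<p-1<q<\frac{N(p-1)}{(N-p)_+}$, let $\Omega\subset\mathbb R^N$ be a bounded domain of class $C^{1,1}$, $T>0$, $\Omega_T=\Omega\times(0,T]$. Let $u$ be a weak solution to $\partial_t(u^q)-\operatorname{div}(|Du|^{p-2}Du)=0$ in $\Omega_T$ with $0\le u\le M$, pick $s\in(0,T)$, fix $x_o\in\partial\Omega$ and $\rho>0$, and assume that $u$ vanishes on $(\partial\Omega\cap B_{2\rho}(x_o))\times(s,T)$. For every $\nu>0$ there exist $\gamma_1>0$ and $\bar s\in(0,\frac12)$, both depending on $N,q,p,\nu$ and $\|\partial\Omega\|_{1,1}$, such that for all $t\in(s+\nu M^{q-p+1}\rho^p,T)$ and all $x\in\Omega\cap B_{2\bar s\rho}(x_o)$ with $\operatorname{dist}(x,\partial\Omega)<\bar s\rho$, $$u(x,t)\le\gamma_1\left(\frac{\operatorname{dist}(x,\partial\Omega)}{\rho}\right)\sup_{(\Omega\cap B_{2\rho}(x_o))\times(s,T)}u.$$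
   Context: Convention: $\frac{N(p-1)}{(N-p)_+}=+\infty$ if $p\ge N$. $B_R(y)$ is the ball of center $y$ and radius $R$. A bounded domain is of class $C^{1,1}$ if near every boundary point, after a rigid motion, it is the region above the graph of a $C^{1,1}$ function; $\|\partial\Omega\|_{1,1}$ denotes a quantity controlling uniformly the $C^{1,1}$ character of $\partial\Omega$ (the $C^{1,1}$ norms of the local graph functions). Weak solution: a non-negative $u\in C(0,T;L^{q+1}(\Omega))\cap L^p(0,T;W^{1,p}(\Omega))$ with $$\iint_{\Omega_T}[-u^q\partial_t\varphi+|Du|^{p-2}Du\cdot D\varphi]\,dxdt=0$$ for all non-negative $\varphi\in W^{1,q+1}_0(0,T;L^{q+1}(\Omega))\cap L^p(0,T;W^{1,p}_0(\Omega))$. Bounded solutions are identified with their continuous representative. Vanishing of $u$ on $(\partial\Omega\cap B_{2\rho}(x_o))\times(s,T)$ is in the sense of traces: $\zeta u(\cdot,t)\in W^{1,p}_0(\Omega)$ for a.e. $t\in(s,T)$ and all $\zeta\in C_c^\infty(B_{2\rho}(x_o))$.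
   Formalization: The constants depend on the C^{1,1} norms of the local graphs, the chart radius, and also the number of such balls covering ∂Ω; with norms and radius alone the claim fails for large ρ (u=1−1/|x| in the shell 1<|x|<l of R^3, p=2). *)

(* Defs.v *)
From HB Require Import structures.
From mathcomp Require Import all_boot all_order all_algebra finmap.
From mathcomp Require Import all_classical all_reals all_analysis.
From mathcomp Require Import ring lra.

Set Implicit Arguments.
Unset Strict Implicit.
Unset Printing Implicit Defensive.

Import Order.TTheory GRing.Theory Num.Theory.
Import numFieldNormedType.Exports.

Local Open Scope classical_set_scope.
Local Open Scope ring_scope.

Section measurable_rV.
Context (R : realType) (n : nat).

(* cylinders over one coordinate: they generate the Borel sets of R^n *)
Definition coord_sets : set (set 'rV[R]_n) :=
  [set A | exists i (B : set R),
    measurable B /\ A = [set x : 'rV[R]_n | B (x 0 i)]].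

Let coord_set0 : <<s coord_sets >> set0.
Proof. exact: sigma_algebra0. Qed.

Let coord_setC A : <<s coord_sets >> A -> <<s coord_sets >> (~` A).
Proof. exact: sigma_algebraC. Qed.

Let coord_bigcup (F : (set 'rV[R]_n)^nat) :
  (forall i, <<s coord_sets >> (F i)) -> <<s coord_sets >> (\bigcup_i F i).
Proof. exact: sigma_algebra_bigcup. Qed.

HB.instance Definition _ := @isMeasurable.Build (sigma_display coord_sets)
  'rV[R]_n <<s coord_sets >> coord_set0 coord_setC coord_bigcup.

End measurable_rV.

Section lebesgue_rV.
Context (R : realType).

Definition cons_rV n (z : R * 'rV[R]_n) : 'rV[R]_n.+1 :=
  \row_i (if unlift ord0 i is Some j then z.2 0 j else z.1).

Definition uncons_rV n (x : 'rV[R]_n.+1) : R * 'rV[R]_n :=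
  (x 0 ord0, \row_j x 0 (lift ord0 j)).

Lemma cons_rVK n : cancel (@cons_rV n) (@uncons_rV n).
Proof.
move=> [t x]; rewrite /uncons_rV !mxE unlift_none/=; congr pair.
by apply/rowP => j; rewrite !mxE liftK.
Qed.

Lemma measurable_coord n (i : 'I_n) :
  measurable_fun [set: 'rV[R]_n] (fun x => x 0 i).
Proof.
by move=> _ B mB; rewrite setTI; apply: sub_sigma_algebra; exists i, B.
Qed.

Lemma measurable_fun_rV d (T : measurableType d) n (f : T -> 'rV[R]_n) :
  (forall i, measurable_fun [set: T] (fun x => f x 0 i)) ->
  measurable_fun [set: T] f.
Proof.
move=> mf; apply: (@measurability _ _ _ _ _ _ (@coord_sets R n)) => //.
move=> _ [_ [i [B [mB ->]]] <-]; exact: mf.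
Qed.

Lemma measurable_cons_rV n : measurable_fun [set: R * 'rV[R]_n] (@cons_rV n).
Proof.
apply: measurable_fun_rV => i; under eq_fun do rewrite mxE.
case: unliftP => [j _|_]; last exact: measurable_fst.
exact: (measurableT_comp (measurable_coord j) measurable_snd).
Qed.

Lemma measurable_uncons_rV n :
  measurable_fun [set: 'rV[R]_n.+1] (@uncons_rV n).
Proof.
apply: measurable_fun_pair; first exact: measurable_coord.
apply: measurable_fun_rV => j; under eq_fun do rewrite mxE.
exact: measurable_coord.
Qed.

Section step.
Variables (n : nat) (mu : {sigma_finite_measure set 'rV[R]_n -> \bar R}).

Definition lebesgue_cons : set 'rV[R]_n.+1 -> \bar R :=
  pushforward (lebesgue_measure \x mu)%E (@cons_rV n).

HB.instance Definition _ := Measure.copy lebesgue_cons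
  (measure_function_pushforward__canonical__measure_function_Measure
     (lebesgue_measure \x mu)%E (@measurable_cons_rV n)).

Let lebesgue_cons_sigma_finite : sigma_finite setT lebesgue_cons.
Proof.
have /sigma_finiteP[F [TF ndF Foo]] := sigma_finiteT (@lebesgue_measure R).
have /sigma_finiteP[G [TG ndG Goo]] := sigma_finiteT mu.
exists (fun k => @uncons_rV n @^-1` (F k `*` G k)).
  apply/seteqP; split=> // x _; rewrite -preimage_bigcup /=.
  have [k _ Fk] : (\bigcup_i F i) (uncons_rV x).1 by rewrite -TF.
  have [l _ Gl] : (\bigcup_i G i) (uncons_rV x).2 by rewrite -TG.
  exists (maxn k l) => //; split.
  - by move: Fk; apply/subsetPset/ndF/leq_maxl.
  - by move: Gl; apply/subsetPset/ndG/leq_maxr.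
move=> k; have [mF Fk] := Foo k; have [mG Gk] := Goo k.
have mFG : measurable (F k `*` G k) by exact: measurableX.
split.
  by rewrite -[X in measurable X]setTI; exact: measurable_uncons_rV.
rewrite /lebesgue_cons /pushforward -comp_preimage.
rewrite (_ : _ \o _ = id); last by apply/funext => z /=; rewrite cons_rVK.
rewrite preimage_id product_measure1E//.
by rewrite lte_mul_pinfty// ge0_fin_numE.
Qed.

HB.instance Definition _ := Measure_isSigmaFinite.Build _ _ _ lebesgue_cons
  lebesgue_cons_sigma_finite.

End step.

Fixpoint lebesgue_rV n : {sigma_finite_measure set 'rV[R]_n -> \bar R} :=
  if n is m.+1 return {sigma_finite_measure set 'rV[R]_n -> \bar R}
  then lebesgue_cons (lebesgue_rV m) else \d_ (0 : 'rV[R]_0).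

End lebesgue_rV.

Section euclidean.
Context (R : realType).

Definition dotp n (x y : 'rV[R]_n) : R := \sum_i x 0 i * y 0 i.

(* the library norm `|x| on 'rV[R]_n is the sup norm *)
Definition enorm n (x : 'rV[R]_n) : R := Num.sqrt (dotp x x).

Definition eball n (x : 'rV[R]_n) (r : R) : set 'rV[R]_n :=
  [set y | enorm (y - x) < r].

Definition boundary n (A : set 'rV[R]_n) : set 'rV[R]_n :=
  closure A `\` interior A.

Definition eucl_dist n (x : 'rV[R]_n) (A : set 'rV[R]_n) : R :=
  inf [set enorm (x - y) | y in A].

Definition init_rV n (z : 'rV[R]_n.+1) : 'rV[R]_n :=
  \row_(j < n) z 0 (lift ord_max j).

Definition basis_vec n (i : 'I_n) : 'rV[R]_n := delta_mx 0 i.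

Definition grad n (f : 'rV[R]_n -> R) (x : 'rV[R]_n) : 'rV[R]_n :=
  \row_i 'D_(basis_vec i) f x.

Definition bounded_domain n (Omega : set 'rV[R]_n) : Prop :=
  [/\ open Omega, connected Omega, Omega !=set0 & bounded_set Omega].

End euclidean.

Section C11.
Context (R : realType) (n : nat).

(* [phi] is C^{1,1} on the ball of radius [r] of R^n, each of the three parts
   of its C^{1,1} norm (sup of [phi], sup and Lipschitz constant of its
   gradient) being at most [L] *)
Definition C11_norm_le (r L : R) (phi : 'rV[R]_n -> R) : Prop :=
  forall z, enorm z < r ->
    [/\ differentiable phi z, `|phi z| <= L, enorm (grad phi z) <= L &
        forall w, enorm w < r ->
          enorm (grad phi z - grad phi w) <= L * enorm (z - w)].

(* in the orthonormal frame of origin [y] given by the rows of [U], the part of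
   [Omega] in the ball of radius [r] is the region above the graph of [phi] *)
Definition C11_chart (Omega : set 'rV[R]_n.+1) (y : 'rV[R]_n.+1) (r L : R) :
    Prop :=
  exists (U : 'M[R]_n.+1) (phi : 'rV[R]_n -> R),
    [/\ U *m U^T = 1%:M, C11_norm_le r L phi &
        forall z : 'rV[R]_n.+1, enorm z < r ->
          Omega (y + z *m U) <->
          phi (init_rV z) < z 0 ord_max].

Definition C11_domain (Omega : set 'rV[R]_n.+1) : Prop :=
  bounded_domain Omega /\
  forall y, boundary Omega y -> exists r L, 0 < r /\ C11_chart Omega y r L.

(* The quantities controlling the C^{1,1} character of the boundary: the radius
   [r] of the charts, the bound [L] on the C^{1,1} norms of the graphs, and the
   number [k] of coordinate balls of radius [r] covering the boundary.  As
   [gamma1] and [sbar] in the theorem are dimensionless and independent of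
   [rho], [r] and [L] alone cannot control them: near the inner sphere of the
   shell [1 < |x| < l] of R^3, the stationary solution 1 - 1/|x| for p = 2 has
   slope about 1, not 1/rho, for 1 << rho << l.  Every bounded C^{1,1} domain
   has a character, see [C11_domain_character]. *)
Definition C11_character (k : nat) (r L : R) (Omega : set 'rV[R]_n.+1) : Prop :=
  [/\ 0 < r,
      forall y, boundary Omega y -> C11_chart Omega y r L &
      exists y : 'I_k -> 'rV[R]_n.+1,
        (forall i, boundary Omega (y i)) /\
        boundary Omega `<=` \bigcup_i eball (y i) r].

End C11.

Section euclidean_theory.
Context (R : realType).

Lemma dotp_ge0 n (x : 'rV[R]_n) : 0 <= dotp x x.
Proof. by apply: sumr_ge0 => i _; rewrite -expr2 sqr_ge0. Qed.

Lemma enorm_ge0 n (x : 'rV[R]_n) : 0 <= enorm x.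
Proof. exact: sqrtr_ge0. Qed.

Lemma enorm_sqr n (x : 'rV[R]_n) : enorm x ^+ 2 = dotp x x.
Proof. by rewrite sqr_sqrtr// dotp_ge0. Qed.

Lemma enorm0 n : enorm (0 : 'rV[R]_n) = 0.
Proof. by rewrite /enorm /dotp big1 ?sqrtr0// => i _; rewrite mxE mul0r. Qed.

Lemma enorm_eq0 n (x : 'rV[R]_n) : enorm x = 0 -> x = 0.
Proof.
move=> x0; have /eqP : dotp x x = 0 by rewrite -enorm_sqr x0 expr0n.
rewrite psumr_eq0; last by move=> i _; rewrite -expr2 sqr_ge0.
move=> /allP h; apply/rowP => i; rewrite mxE; apply/eqP.
by have := h i (mem_index_enum i); rewrite /= mulf_eq0 orbb.
Qed.

Lemma dotp_le n (x y : 'rV[R]_n) : dotp x y <= enorm x * enorm y.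
Proof.
have [x0|nx0] := eqVneq (enorm x) 0.
  rewrite x0 mul0r (enorm_eq0 x0) /dotp big1// => i _.
  by rewrite mxE mul0r.
have [y0|ny0] := eqVneq (enorm y) 0.
  rewrite y0 mulr0 (enorm_eq0 y0) /dotp big1// => i _.
  by rewrite mxE mulr0.
set a := enorm x in nx0 *; set b := enorm y in ny0 *.
have ab0 : 0 < a * b by rewrite mulr_gt0// lt_def enorm_ge0 ?nx0 ?ny0.
have : 0 <= dotp (b *: x - a *: y) (b *: x - a *: y) by exact: dotp_ge0.
have -> : dotp (b *: x - a *: y) (b *: x - a *: y) =
          b ^+ 2 * dotp x x + a ^+ 2 * dotp y y - 2 * (a * b) * dotp x y.
  rewrite /dotp !mulr_sumr -!big_split -sumrB /=.
  by apply: eq_bigr => i _; rewrite !mxE; ring.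
rewrite -!enorm_sqr -/a -/b => h.
rewrite -(ler_pM2l ab0); nra.
Qed.

Lemma enormD n (x y : 'rV[R]_n) : enorm (x + y) <= enorm x + enorm y.
Proof.
rewrite -(@ler_pXn2r _ 2)// ?nnegrE ?addr_ge0 ?enorm_ge0//.
rewrite enorm_sqr.
have -> : dotp (x + y) (x + y) = dotp x x + dotp y y + 2 * dotp x y.
  rewrite /dotp !mulr_sumr -!big_split/=.
  by apply: eq_bigr => i _; rewrite !mxE; ring.
by have := dotp_le x y; rewrite -!enorm_sqr; nra.
Qed.

Lemma dotp_mx n (x y : 'rV[R]_n) : dotp x y = (x *m y^T) 0 0.
Proof. by rewrite mxE; apply: eq_bigr => i _; rewrite mxE. Qed.

Lemma enorm_orthogonal n (U : 'M[R]_n) (x : 'rV[R]_n) :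
  U *m U^T = 1%:M -> enorm (x *m U) = enorm x.
Proof.
move=> UU; rewrite /enorm !dotp_mx trmx_mul mulmxA -(mulmxA x).
by rewrite UU mulmx1.
Qed.

Lemma dotp_lift_max n (z : 'rV[R]_n.+1) :
  dotp z z = enorm (init_rV z) ^+ 2 + z 0 ord_max ^+ 2.
Proof.
rewrite enorm_sqr /dotp big_ord_recr /= expr2; congr (_ + _).
apply: eq_bigr => i _; rewrite !mxE.
by rewrite (_ : lift _ _ = widen_ord (leqnSn n) i)//; apply/val_inj; rewrite /= /bump leqNgt ltn_ord.
Qed.

Lemma enorm_lift_max n (z : 'rV[R]_n.+1) :
  enorm (init_rV z) <= enorm z.
Proof.
rewrite -(@ler_pXn2r _ 2)// ?nnegrE ?enorm_ge0//.
by rewrite [leRHS]enorm_sqr dotp_lift_max lerDl sqr_ge0.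
Qed.

Lemma le_enorm_last n (z : 'rV[R]_n.+1) : `|z 0 ord_max| <= enorm z.
Proof.
rewrite -(@ler_pXn2r _ 2)// ?nnegrE ?enorm_ge0// real_normK ?num_real//.
by rewrite enorm_sqr dotp_lift_max lerDr sqr_ge0.
Qed.

Lemma continuous_coordB n (x : 'rV[R]_n) i :
  continuous (fun z : 'rV[R]_n => (z - x) 0 i : R^o).
Proof.
have -> : (fun z : 'rV[R]_n => (z - x) 0 i : R^o) =
    (fun z : 'rV[R]_n => z 0 i : R^o) \- cst (x 0 i).
  by apply/funext => z; rewrite !mxE.
move=> y; apply: continuousB; last exact: cst_continuous.
exact: (@coord_continuous R).
Qed.

Lemma continuous_enormB n (x : 'rV[R]_n) :
  continuous (fun z : 'rV[R]_n => enorm (z - x)).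
Proof.
move=> y.
suff h : dotp (z - x) (z - x) @[z --> y] --> dotp (y - x) (y - x).
  exact: (cvg_comp _ _ h (@sqrt_continuous R _)).
have cD : continuous (fun z : R^o * R^o => z.1 + z.2) by exact: add_continuous.
apply: (@cvg_big R^o _ +%R 0 xpredT cD _ (nbhs y) (index_enum 'I_n)
  (fun i z => (z - x) 0 i * (z - x) 0 i) (fun i => (y - x) 0 i * (y - x) 0 i)).
by move=> i _; apply: (@cvgM R); exact: continuous_coordB.
Qed.

Lemma open_eball n (x : 'rV[R]_n) r : open (eball x r).
Proof.
apply: (open_comp (f := fun y : 'rV[R]_n => enorm (y - x)) (D := [set t | t < r])).
  by move=> y _; exact: continuous_enormB.
exact: open_lt.
Qed.

Lemma compact_boundary n (A : set 'rV[R]_n) :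
  bounded_set A -> compact (boundary A).
Proof.
move=> bA; apply: bounded_closed_compact; last first.
  by apply: closedI; [exact: closed_closure|apply: open_closedC; exact: open_interior].
case: bA => M [Mr HM]; exists M; split => // M' MM'.
move=> x [clA _] /=.
have : closure A `<=` [set y | `|y| <= M'].
  rewrite closureE => y; apply; split; last by move=> z Az; exact: HM.
  apply: (@preimage_closed _ _ (fun y : 'rV[R]_n => `|y|) [set t | t <= M']).
    by move=> *; exact: norm_continuous.
  exact: closed_le.
exact.
Qed.

End euclidean_theory.

Section C11_theory.
Context (R : realType) (n : nat).
Implicit Types (Omega : set 'rV[R]_n.+1) (phi : 'rV[R]_n -> R).

Lemma C11_chartW Omega y r r' L L' :
  r' <= r -> L <= L' -> C11_chart Omega y r L -> C11_chart Omega y r' L'.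
Proof.
move=> rr LL [U [phi [UU nphi Hphi]]]; exists U, phi; split => //.
  move=> z zr; have [d b g l] := nphi z (lt_le_trans zr rr); split => //.
  - exact: le_trans LL.
  - exact: le_trans LL.
  - move=> w wr; apply: le_trans (l w (lt_le_trans wr rr)) _.
    by rewrite ler_wpM2r// enorm_ge0.
by move=> z zr; apply: Hphi; exact: lt_le_trans rr.
Qed.

Lemma grad_shift phi (a : 'rV[R]_n) c z :
  grad (fun z => phi (a + z) - c) z = grad phi (a + z).
Proof.
apply/rowP => i; rewrite !mxE /derive; set F := (X in lim (X @ _)).
set G := (X in _ = lim (X @ _)); suff -> : F = G by [].
apply/funext => h; rewrite /F /G /=; congr (_ *: _).
have subB (b d : R) : b - c - (d - c) = b - d by ring.
by rewrite subB addrCA.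
Qed.

Lemma C11_chart_recenter Omega y y' r L : eball y (r / 2) y' ->
  C11_chart Omega y r L -> C11_chart Omega y' (r / 2) (L + r / 2).
Proof.
move=> yy [U [phi [UU nphi Hphi]]].
have UtU : U^T *m U = 1%:M by exact: mulmx1C.
pose a := (y' - y) *m U^T.
have na : enorm a < r / 2.
  by rewrite enorm_orthogonal// trmxK.
have nD m (b z : 'rV[R]_m) : enorm b < r / 2 -> enorm z < r / 2 -> enorm (b + z) < r.
  by move=> ? ?; rewrite (le_lt_trans (enormD _ _))//; lra.
pose a' : 'rV[R]_n := init_rV a.
have na' : enorm a' < r / 2 by exact: le_lt_trans (enorm_lift_max _) na.
exists U, (fun z => phi (a' + z) - a 0 ord_max); split => //.
  move=> z zr; have [d b g l] := nphi (a' + z) (nD _ _ _ na' zr).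
  have r0 : 0 < r / 2 by exact: le_lt_trans (enorm_ge0 z) zr.
  split.
  - apply: differentiableB => //.
    apply: (@differentiable_comp _ _ _ _ (fun z => a' + z) phi) => //.
  - rewrite (le_trans (ler_normB _ _))// lerD//.
    exact: le_trans (le_enorm_last _) (ltW na).
  - by rewrite grad_shift (le_trans g)// lerDl ltW.
  - move=> w wr; rewrite !grad_shift.
    have := l (a' + w) (nD _ _ _ na' wr).
    rewrite opprD addrACA subrr add0r => /le_trans; apply.
    by rewrite ler_wpM2r ?enorm_ge0// lerDl ltW.
move=> z zr.
have -> : y' + z *m U = y + (a + z) *m U.
  by rewrite mulmxDl /a -mulmxA UtU mulmx1 addrA subrKC.
have <- : init_rV (a + z) = a' + init_rV z by apply/rowP => j; rewrite !mxE.
have -> : a 0 ord_max = (a + z) 0 ord_max - z 0 ord_max by rewrite !mxE addrK.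
rewrite ltrBlDl subrK; apply: Hphi; exact: nD.
Qed.

Lemma C11_domain_character Omega : C11_domain Omega ->
  exists k r L, C11_character k r L Omega.
Proof.
move=> [[_ _ _ bO] chartO].
have /choice[rL HrL] : forall y, exists rL : R * R, boundary Omega y ->
    0 < rL.1 /\ C11_chart Omega y rL.1 rL.2.
  move=> y; have [/chartO[r [L h]]|] := pselect (boundary Omega y).
    by exists (r, L).
  by move=> h; exists (0, 0).
have := compact_boundary bO; rewrite compact_cover => cO.
have e0 (y : 'rV[R]_n.+1) r : 0 < r -> eball y r y.
  by rewrite /eball/= subrr enorm0.
have [//|y Oy|D DO OD] := cO _ (boundary Omega) (fun y => eball y ((rL y).1 / 2)).
- by move=> y _; exact: open_eball.
- by exists y => //; apply: e0; rewrite divr_gt0// (HrL y Oy).1.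
have [r [r0 Hr]] : exists r, 0 < r /\ forall y, y \in enum_fset D -> r <= (rL y).1 / 2.
  have : {in (enum_fset D), forall y, 0 < (rL y).1}.
    by move=> y /DO; rewrite inE => /HrL[].
  elim: (enum_fset D) => [_|y s IH h]; first by exists 1; split.
  have [|r [r0 Hr]] := IH; first by move=> z zs; apply: h; rewrite inE zs orbT.
  exists (Num.min r ((rL y).1 / 2)); split.
    by rewrite lt_min r0 divr_gt0// h// mem_head.
  move=> z; rewrite inE => /predU1P[->|/Hr]; first by rewrite ge_min lexx orbT.
  by rewrite ge_min => ->.
have [L HL] : exists L, forall y, y \in enum_fset D -> (rL y).2 + (rL y).1 / 2 <= L.
  elim: (enum_fset D) => [|y s [L HL]]; first by exists 0.
  exists (Num.max L ((rL y).2 + (rL y).1 / 2)) => z.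
  rewrite inE => /predU1P[->|/HL]; first by rewrite le_max lexx orbT.
  by rewrite le_max => ->.
have [//|y Oy|D' DO' OD'] := cO _ (boundary Omega) (fun y => eball y r).
- by move=> y _; exact: open_eball.
- by exists y => //; exact: e0.
exists #|` D'|, r, L; split => //.
  move=> y /OD[y0 /= y0D yy0].
  have [_ h] : 0 < (rL y0).1 /\ C11_chart Omega y0 (rL y0).1 (rL y0).2.
    by apply: HrL; have := DO _ y0D; rewrite inE.
  exact: C11_chartW (Hr _ y0D) (HL _ y0D) (C11_chart_recenter yy0 h).
exists (fun i => tnth (in_tuple (enum_fset D')) i); split.
  by move=> i; have := DO' _ (mem_tnth i (in_tuple (enum_fset D'))); rewrite inE.
move=> y /OD'[y0 /= y0D yy0].
have /tnthP[i y0i] : y0 \in in_tuple (enum_fset D') by [].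
by exists i => //; rewrite -y0i.
Qed.

End C11_theory.

Section spaces.
Context (R : realType).

Fixpoint iter_derive (V : normedModType R) (vs : seq V) (f : V -> R) : V -> R :=
  if vs is v :: vs' then fun x => 'D_v (iter_derive vs' f) x else f.

(* for [V] of finite dimension, this is the usual notion of C^oo function *)
Definition smooth (V : normedModType R) (f : V -> R) : Prop :=
  forall vs : seq V, continuous (iter_derive vs f) /\
    forall x v, derivable (iter_derive vs f) x v.

Definition test_fun (V : normedModType R) (U : set V) (f : V -> R) : Prop :=
  smooth f /\
  exists2 K : set V, compact K /\ K `<=` U & forall x, f x != 0 -> K x.

Definition in_Lp d (T : measurableType d) (mu : {measure set T -> \bar R})
    (D : set T) (p : R) (f : T -> R) : Prop :=
  measurable_fun D f /\ (\int[mu]_(x in D) (`|f x| `^ p)%:E < +oo)%E.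

Definition cvg_Lp d (T : measurableType d) (mu : {measure set T -> \bar R})
    (D : set T) (p : R) (f_ : nat -> T -> R) (f : T -> R) : Prop :=
  (\int[mu]_(x in D) (`|f_ k x - f x| `^ p)%:E)%E @[k --> \oo] --> 0%E.

Context (n : nat).
Local Notation rV := 'rV[R]_n.
Implicit Types (Omega : set rV) (p r T : R).

Definition weak_gradient Omega (f : rV -> R) (G : rV -> rV) : Prop :=
  forall i (phi : rV -> R), test_fun Omega phi ->
    \int[lebesgue_rV R n]_(x in Omega) (f x * 'D_(basis_vec R i) phi x) =
    - \int[lebesgue_rV R n]_(x in Omega) (G x 0 i * phi x).

(* [f] is in W^{1,p}(Omega) with weak gradient [G] *)
Definition in_W1p Omega p (f : rV -> R) (G : rV -> rV) : Prop :=
  [/\ in_Lp (lebesgue_rV R n) Omega p f,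
      forall i, in_Lp (lebesgue_rV R n) Omega p (fun x => G x 0 i) &
      weak_gradient Omega f G].

(* the closure of C_c^oo(Omega) in W^{1,p}(Omega) *)
Definition in_W1p_0 Omega p (f : rV -> R) (G : rV -> rV) : Prop :=
  in_W1p Omega p f G /\
  exists phi_ : nat -> rV -> R,
    [/\ forall k, test_fun Omega (phi_ k),
        cvg_Lp (lebesgue_rV R n) Omega p phi_ f &
        forall i, cvg_Lp (lebesgue_rV R n) Omega p
          (fun k => 'D_(basis_vec R i) (phi_ k)) (fun x => G x 0 i)].

Definition lebesgue_xt : {measure set (rV * measurableTypeR R) -> \bar R} :=
  (lebesgue_rV R n \x lebesgue_measure)%E.

(* Omega x (0, T); the time slice t = T is negligible *)
Definition cylinder Omega T : set (rV * R) := Omega `*` `]0, T[%classic.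

(* u in C(0, T; L^r(Omega)), continuity being required on the open interval
   only *)
Definition in_C_Lr Omega T r (u : rV * R -> R) : Prop :=
  forall t, 0 < t < T ->
    in_Lp (lebesgue_rV R n) Omega r (fun x => u (x, t)) /\
    (\int[lebesgue_rV R n]_(x in Omega) (`|u (x, tau) - u (x, t)| `^ r)%:E)%E
      @[tau --> t] --> 0%E.

(* u in L^p(0, T; W^{1,p}(Omega)): elements of the Bochner space are represented
   by jointly measurable u and Du on Omega x (0, T) *)
Definition in_Lp_W1p Omega T p (u : rV * R -> R) (Du : rV * R -> rV) : Prop :=
  [/\ in_Lp lebesgue_xt (cylinder Omega T) p u,
      forall i, in_Lp lebesgue_xt (cylinder Omega T) p (fun z => Du z 0 i) &
      {ae lebesgue_measure, forall t : R, 0 < t < T ->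
         in_W1p Omega p (fun x => u (x, t)) (fun x => Du (x, t))}].

Definition in_Lp_W1p_0 Omega T p (u : rV * R -> R) (Du : rV * R -> rV) : Prop :=
  in_Lp_W1p Omega T p u Du /\
  {ae lebesgue_measure, forall t : R, 0 < t < T ->
     in_W1p_0 Omega p (fun x => u (x, t)) (fun x => Du (x, t))}.

(* phi in W^{1,r}_0(0, T; L^r(Omega)), the closure of the smooth functions with
   compact support in (0, T) with values in L^r(Omega); as C_c^oo(Omega) is dense
   in L^r(Omega), smooth functions with compact support in Omega x (0, T) have
   the same closure.  dphi is the weak time derivative of phi. *)
Definition in_W1r_0_time Omega T r (phi dphi : rV * R -> R) : Prop :=
  [/\ in_Lp lebesgue_xt (cylinder Omega T) r phi,
      in_Lp lebesgue_xt (cylinder Omega T) r dphi &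
      exists phi_ : nat -> rV * R -> R,
        [/\ forall k, test_fun (cylinder Omega T) (phi_ k),
            cvg_Lp lebesgue_xt (cylinder Omega T) r phi_ phi &
            cvg_Lp lebesgue_xt (cylinder Omega T) r
              (fun k => 'D_((0 : rV), (1 : R)) (phi_ k)) dphi]].

Definition weak_solution Omega T p (q : R) (u : rV * R -> R) : Prop :=
  [/\ forall z, cylinder Omega T z -> 0 <= u z,
      in_C_Lr Omega T (q + 1) u &
      exists2 Du : rV * R -> rV, in_Lp_W1p Omega T p u Du &
        forall (phi dphi : rV * R -> R) (Dphi : rV * R -> rV),
          (forall z, cylinder Omega T z -> 0 <= phi z) ->
          in_W1r_0_time Omega T (q + 1) phi dphi ->
          in_Lp_W1p_0 Omega T p phi Dphi ->
          \int[lebesgue_xt]_(z in cylinder Omega T)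
            (- (u z `^ q) * dphi z +
             enorm (Du z) `^ (p - 2) * dotp (Du z) (Dphi z)) = 0].

Definition vanishes_on_lateral_boundary Omega (B : set rV) (s T p : R)
    (u : rV * R -> R) : Prop :=
  {ae lebesgue_measure, forall t : R, s < t < T ->
     forall zeta : rV -> R, test_fun B zeta ->
       exists G, in_W1p_0 Omega p (fun x => zeta x * u (x, t)) G}.

End spaces.

(* N (p - 1) / (N - p)_+, with value +oo for p >= N *)
Definition critical_exponent (R : realType) (N : nat) (p : R) : \bar R :=
  if p < N%:R then (N%:R * (p - 1) / (N%:R - p))%:E else +oo%E.

(* Main.v *)
(** At a boundary point [y] with an exterior ball of radius [R], the solution is
    compared on a time interval of length [tau] with the separated supersolution
    [S x + W t], where [S = a (1 - (R / |x - c|)^(2 k))] vanishes at [y] and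
    [W] decreases from [m >= u] to [0].  For [k] large the divergence of the flux of
    [S] is at most [- C a^(p-1) R^(-p)], which absorbs the time derivative
    [m^q / tau] of [W^q] as soon as [R <= alpha rho] and
    [tau = nu m^(q-p+1) rho^p]; hence [u <= S <= C m |x - y| / R].

    As [u] has no time derivative, the comparison tests the equation on
    [(t - h, t)] with [bump (zeta u(t) - S - W t)], integrates in [t], divides by [h]
    and lets [h] go to [0]: convexity bounds the time term below by the increment
    of the energy [int potential(S + W t, u^q)], and Steklov averages converge in
    the flux term, where the monotonicity of the flux replaces [Du] by [DS].  So the
    energy, which starts at [0], stays [0].

    The radius of the exterior ball is bounded by the charts, so [R] is comparable
    with [rho] only up to a fixed scale (in dimension 1 any radius will do).  Beyond
    that scale the domain is small compared with [rho]: the covering of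
    the boundary by [k] balls of radius [r] bounds its width, and barriers centred
    outside the domain halve the supremum in times that sum up to less than
    [nu M^(q-p+1) rho^p], so that [u = 0]. *)
From HB Require Import structures.
Require Import Defs.
From mathcomp Require Import all_boot all_order all_algebra.
From mathcomp Require Import all_classical all_reals all_analysis.
From mathcomp Require Import measurable_realfun.
From mathcomp Require Import ring lra.

Set Implicit Arguments.
Unset Strict Implicit.
Unset Printing Implicit Defensive.

Import Order.TTheory GRing.Theory Num.Theory.
Import numFieldNormedType.Exports.

Local Open Scope classical_set_scope.
Local Open Scope ring_scope.

(** * Smooth functions *)

Section smooth_calculus.
Context {R : realType}.
Implicit Types V W : normedModType R.

Lemma is_derive_line V (f : V -> R) (x v : V) (df : R) :
  is_derive x v f df <-> is_derive (0 : R) 1 (fun h : R => f (h *: v + x)) df.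
Proof.
have E : (fun h : R => h^-1 *: ((f \o shift x) (h *: v) - f x)) =
   (fun h => h^-1 *: (((fun h : R => f (h *: v + x)) \o shift 0) (h *: 1) -
                      (fun h : R => f (h *: v + x)) 0)).
  by apply/funext => h /=; rewrite addr0 scale0r add0r [_%:A]mulr1.
split=> -[d e]; split.
- by move: d; rewrite derivable1P.
- by rewrite -e /derive E.
- by apply/derivable1P.
- by rewrite -e /derive E.
Qed.

Lemma is_derive_comp1 V (f : V -> R) (g : R -> R) (x v : V) (df dg : R) :
  is_derive x v f df -> is_derive (f x) 1 g dg ->
  is_derive x v (fun y => g (f y)) (dg * df).
Proof.
move=> /is_derive_line hf hg; apply/is_derive_line.
apply: (@is_derive1_comp _ g (fun h : R => f (h *: v + x))) => //.
by rewrite scale0r add0r.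
Qed.

Lemma is_deriveM_fun V (f g : V -> R) (x v : V) (df dg : R) :
  is_derive x v f df -> is_derive x v g dg ->
  is_derive x v (fun y => f y * g y) (f x * dg + g x * df).
Proof.
by move=> hf hg; apply: (is_derive_eq (is_deriveM hf hg)).
Qed.

Lemma is_deriveD_fun V (f g : V -> R) (x v : V) (df dg : R) :
  is_derive x v f df -> is_derive x v g dg ->
  is_derive x v (fun y => f y + g y) (df + dg).
Proof. by move=> hf hg; exact: (is_deriveD hf hg). Qed.

Lemma smooth_coind V (P : (V -> R) -> Prop) :
  (forall f, P f -> [/\ continuous f, forall x v, derivable f x v &
                     forall v, P (fun x => 'D_v f x)]) ->
  forall f, P f -> smooth f.
Proof.
move=> H f Pf vs; suff /H[] : P (iter_derive vs f) by [].
by elim: vs => //= v vs /H[_ _]; exact.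
Qed.

Lemma smooth_continuous V (f : V -> R) : smooth f -> continuous f.
Proof. by move=> /(_ [::])[]. Qed.

Lemma smooth_derivable V (f : V -> R) x v : smooth f -> derivable f x v.
Proof. by move=> /(_ [::])[_]; exact. Qed.

Lemma smooth_is_derive V (f : V -> R) x v :
  smooth f -> is_derive x v f ('D_v f x).
Proof. by move=> /smooth_derivable h; exact/derivableP. Qed.

Lemma iter_derive_cat V (f : V -> R) vs ws :
  iter_derive (vs ++ ws) f = iter_derive vs (iter_derive ws f).
Proof. by elim: vs => //= v vs ->. Qed.

Lemma smooth_derive V (f : V -> R) v :
  smooth f -> smooth (fun x => 'D_v f x).
Proof.
by move=> sf vs; have := sf (vs ++ [:: v]); rewrite iter_derive_cat.
Qed.

Inductive smooth_closure V : (V -> R) -> Prop :=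
| closure_base f : smooth f -> smooth_closure f
| closure_cst c : smooth_closure (fun=> c)
| closure_add f g : smooth_closure f -> smooth_closure g ->
    smooth_closure (fun x => f x + g x)
| closure_mul f g : smooth_closure f -> smooth_closure g ->
    smooth_closure (fun x => f x * g x)
| closure_comp (h : R -> R) f : smooth h -> smooth_closure f ->
    smooth_closure (fun x => h (f x))
| closure_pow c f : (forall x, 0 < f x) -> smooth_closure f ->
    smooth_closure (fun x => f x `^ c).

Lemma smooth_closure_smooth V (f : V -> R) : smooth_closure f -> smooth f.
Proof.
move: f; apply: smooth_coind => f; elim=> {f}.
- move=> f sf; split; first exact: smooth_continuous.
    by move=> x v; exact: smooth_derivable.
  by move=> v; apply/closure_base/smooth_derive.
- move=> c; split; first by move=> x; exact: cvg_cst.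
    by move=> x v; exact: derivable_cst.
  move=> v; rewrite [X in smooth_closure X](_ : _ = (fun=> 0)); first exact: closure_cst.
  by apply/funext => x; rewrite derive_cst.
- move=> f g Sf [cf df Df] Sg [cg dg Dg]; split.
  + by move=> x; apply: cvgD; [exact: cf|exact: cg].
  + by move=> x v; apply: derivableD; [exact: df|exact: dg].
  + move=> v; rewrite [X in smooth_closure X](_ : _ = (fun x => 'D_v f x + 'D_v g x)).
      exact: closure_add.
    by apply/funext => x; rewrite -deriveD; [|exact: df|exact: dg].
- move=> f g Sf [cf df Df] Sg [cg dg Dg]; split.
  + by move=> x; apply: (@cvgM R); [exact: cf|exact: cg].
  + by move=> x v; apply: derivableM; [exact: df|exact: dg].
  + move=> v.
    rewrite [X in smooth_closure X](_ : _ = (fun x => f x * 'D_v g x + g x * 'D_v f x)).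
      by apply: closure_add; apply: closure_mul.
    apply/funext => x.
    have [_ E] := is_deriveM_fun (derivableP (df x v)) (derivableP (dg x v)).
    exact: E.
- move=> h f sh Sf [cf df Df].
  have D x v := is_derive_comp1 (derivableP (df x v)) (smooth_is_derive (f x) 1 sh).
  split.
  + by move=> x; apply: (cvg_comp f h); [exact: cf|exact: (smooth_continuous sh)].
  + by move=> x v; have [] := D x v.
  + move=> v; rewrite [X in smooth_closure X](_ : _ = (fun x => 'D_1 h (f x) * 'D_v f x)).
      apply: closure_mul; last exact: Df.
      by apply: (closure_comp (h := fun x => 'D_1 h x)) => //; exact: smooth_derive.
    by apply/funext => x; have [_ ->] := D x v.
- move=> c f f0 Sf [cf df Df].
  have D x v := is_derive_comp1 (derivableP (df x v)) (is_derive1_powR c (f0 x)).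
  split.
  + move=> x; apply: (cvg_comp _ (fun y => y `^ c)); first exact: cf.
    apply: (differentiable_continuous (f := fun y => y `^ c)).
    by apply/derivable1_diffP; have [] := is_derive1_powR c (f0 x).
  + by move=> x v; have [] := D x v.
  + move=> v; rewrite [X in smooth_closure X](_ : _ =
        (fun x => c * f x `^ (c - 1) * 'D_v f x)).
      apply: closure_mul; last exact: Df.
      by apply: closure_mul; [exact: closure_cst|exact: closure_pow].
    by apply/funext => x; have [_ ->] := D x v.
Qed.

Lemma smooth_cst V c : smooth (fun _ : V => c).
Proof. exact/smooth_closure_smooth/closure_cst. Qed.

Lemma smoothD V (f g : V -> R) :
  smooth f -> smooth g -> smooth (fun x => f x + g x).
Proof.
by move=> sf sg; apply/smooth_closure_smooth/closure_add; exact: closure_base.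
Qed.

Lemma smoothM V (f g : V -> R) :
  smooth f -> smooth g -> smooth (fun x => f x * g x).
Proof.
by move=> sf sg; apply/smooth_closure_smooth/closure_mul; exact: closure_base.
Qed.

Lemma smooth_comp V (h : R -> R) (f : V -> R) :
  smooth h -> smooth f -> smooth (fun x => h (f x)).
Proof.
move=> sh sf; apply/smooth_closure_smooth/closure_comp => //.
exact: closure_base.
Qed.

Lemma smooth_powR V c (f : V -> R) :
  (forall x, 0 < f x) -> smooth f -> smooth (fun x => f x `^ c).
Proof.
move=> f0 sf; apply/smooth_closure_smooth/closure_pow => //.
exact: closure_base.
Qed.

Lemma smoothZ V c (f : V -> R) : smooth f -> smooth (fun x => c * f x).
Proof. by move=> sf; apply: smoothM => //; exact: smooth_cst. Qed.

Lemma smoothN V (f : V -> R) : smooth f -> smooth (fun x => - f x).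
Proof.
move=> sf; rewrite (_ : (fun _ => _) = (fun x => (-1) * f x)).
  exact: smoothZ.
by apply/funext => x; rewrite mulN1r.
Qed.

Lemma smoothB V (f g : V -> R) :
  smooth f -> smooth g -> smooth (fun x => f x - g x).
Proof. by move=> sf sg; apply: smoothD => //; exact: smoothN. Qed.

Lemma smooth_sum V (I : Type) (s : seq I) (f : I -> V -> R) :
  (forall i, smooth (f i)) -> smooth (fun x => \sum_(i <- s) f i x).
Proof.
move=> sf; elim: s => [|i s IH].
  by under eq_fun do rewrite big_nil; exact: smooth_cst.
by under eq_fun do rewrite big_cons; exact: smoothD.
Qed.

Lemma smooth_prod V (I : Type) (s : seq I) (f : I -> V -> R) :
  (forall i, smooth (f i)) -> smooth (fun x => \prod_(i <- s) f i x).
Proof.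
move=> sf; elim: s => [|i s IH].
  by under eq_fun do rewrite big_nil; exact: smooth_cst.
by under eq_fun do rewrite big_cons; exact: smoothM.
Qed.

Lemma is_derive_precomp V W (A : W -> V) (f : V -> R) (x v : W) (w : V) df :
  (forall h : R, A (h *: v + x) = h *: w + A x) ->
  is_derive (A x) w f df -> is_derive x v (fun y => f (A y)) df.
Proof.
move=> HA /is_derive_line hf; apply/is_derive_line.
by rewrite (_ : (fun _ => _) = (fun h : R => f (h *: w + A x)))//;
  apply/funext => h; rewrite HA.
Qed.

Lemma smooth_precomp V W (A : W -> V) (B : W -> V) (f : V -> R) :
  continuous A -> (forall (h : R) v x, A (h *: v + x) = h *: B v + A x) ->
  smooth f -> smooth (fun x => f (A x)).
Proof.
move=> cA HA sf.
pose P (g : W -> R) := exists2 f : V -> R, smooth f & g = (fun x => f (A x)).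
apply: (@smooth_coind _ P) => [_ [{sf}f sf ->]|]; last by exists f.
have D x v := is_derive_precomp (fun h => HA h v x) (smooth_is_derive (A x) (B v) sf).
split.
- by move=> x; apply: (cvg_comp A f); [exact: cA|exact: (smooth_continuous sf)].
- by move=> x v; have [] := D x v.
- move=> v; exists (fun x => 'D_(B v) f x); first exact: smooth_derive.
  by apply/funext => x; have [_ ->] := D x v.
Qed.

Lemma smooth_affine V (A : V -> R) (B : V -> R) :
  continuous A -> (forall (h : R) v x, A (h *: v + x) = h *: B v + A x) ->
  smooth A.
Proof.
move=> cA HA.
have D (x v : V) : is_derive x v A (B v).
  apply/is_derive_line; under eq_fun do rewrite HA.
  rewrite (_ : (fun _ => _) = (B v *: (id : R -> R) + cst (A x))); last first.
    by apply/funext => h /=; rewrite fctE /GRing.scale /= mulrC.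
  by apply: is_derive_eq; rewrite addr0 [_ *: _]mulr1.
pose P (g : V -> R) := g = A \/ exists c, g = fun=> c.
apply: (@smooth_coind _ P); last by left.
move=> _ [->|[c ->]]; split.
- exact: cA.
- by move=> x v; have [] := D x v.
- by move=> v; right; exists (B v); apply/funext => x; have [_ ->] := D x v.
- by move=> x; exact: cvg_cst.
- by move=> x v; exact: derivable_cst.
- by move=> v; right; exists 0; apply/funext => x; rewrite derive_cst.
Qed.

Lemma smooth_id : smooth (fun x : R => x).
Proof. by apply: (smooth_affine (B := id)) => // x; exact: cvg_id. Qed.

Lemma smooth_coord n (i : 'I_n) : smooth (fun x : 'rV[R]_n => x 0 i).
Proof.
apply: (smooth_affine (B := fun x : 'rV[R]_n => x 0 i)).
  exact: (@coord_continuous R).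
by move=> h v x; rewrite !mxE.
Qed.

Lemma is_derive_coord n (i j : 'I_n) (x : 'rV[R]_n) :
  is_derive x (basis_vec R j) (fun y : 'rV[R]_n => y 0 i) (i == j)%:R.
Proof.
apply/is_derive_line.
rewrite (_ : (fun _ => _) =
    ((i == j)%:R : R) *: (id : R -> R) + cst (x 0 i)); last first.
  by apply/funext => h; rewrite !mxE fctE eqxx /= mulrC.
by apply: is_derive_eq; rewrite addr0 [_ *: _]mulr1.
Qed.

End smooth_calculus.

(** * Bump and step functions *)

Section bump.
Context {R : realType}.
Implicit Types (s t x y : R) (j : nat).

Definition flat_exp j s : R := if 0 < s then s^-1 ^+ j * expR (- s^-1) else 0.

Lemma pow_expRN_le y j : 0 <= y -> y ^+ j * expR (- y) <= j`!%:R.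
Proof.
move=> y0; case: j => [|j].
  by rewrite expr0 mul1r fact0 -expR0 ler_expR lerNl oppr0.
rewrite expRN ler_pdivrMr ?expR_gt0//.
have := @expR_ge1Dxn R y j y0 => h.
have : y ^+ j.+1 / j.+1`!%:R <= expR y by lra.
by rewrite ler_pdivrMr ?ltr0n ?fact_gt0// mulrC.
Qed.

Lemma flat_exp_ge0 j s : 0 <= flat_exp j s.
Proof.
rewrite /flat_exp; case: ltP => // s0.
by rewrite mulr_ge0 ?expR_ge0// exprn_ge0// invr_ge0 ltW.
Qed.

Lemma flat_exp_le j s : flat_exp j s <= j`!%:R.
Proof.
rewrite /flat_exp; case: ltP => [s0|_]; last by rewrite ler0n.
by apply: pow_expRN_le; rewrite invr_ge0 ltW.
Qed.

Lemma flat_exp0 j s : s <= 0 -> flat_exp j s = 0.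
Proof. by rewrite /flat_exp ltNge => ->. Qed.

Lemma flat_expS j s : flat_exp j.+1 s = s^-1 * flat_exp j s.
Proof.
by rewrite /flat_exp; case: ltP => _; rewrite ?mulr0// exprS mulrA.
Qed.

Definition flat_exp_deriv j s : R := flat_exp j.+2 s - j%:R * flat_exp j.+1 s.

Lemma is_derive_flat_exp j s : is_derive s 1 (flat_exp j) (flat_exp_deriv j s).
Proof.
have [s0|s0|->] := ltgtP s 0.
- apply: (@near_eq_is_derive _ _ _ (cst 0)).
    near=> y; rewrite flat_exp0//; near: y.
    by apply: filterS (lt_nbhsl s0) => y /ltW.
  by rewrite /flat_exp_deriv !flat_exp0 ?mulr0 ?subrr 1?ltW//; exact: is_derive_cst.
- apply: (@near_eq_is_derive _ _ _ (fun y => y^-1 ^+ j * expR (- y^-1))).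
    near=> y; rewrite /flat_exp ifT//; near: y; exact: lt_nbhsr.
  have s_neq0 : s != 0 by rewrite gt_eqF.
  have dV : is_derive s 1 (fun y : R => y^-1) (- (s ^- 2)).
    by apply: (is_derive_eq (is_deriveV s_neq0 (is_derive_id _ _))); rewrite [_ *: _]mulr1.
  have dNV : is_derive s 1 (fun y : R => - y^-1) (s ^- 2).
    by apply: (is_derive_eq (is_deriveN dV)); rewrite opprK.
  have dE := is_derive_comp1 dNV (is_derive_expR _).
  have dX : is_derive s 1 (fun y : R => y^-1 ^+ j) (j%:R * s^-1 ^+ j.-1 * - (s ^- 2)).
    have dP : is_derive s^-1 1 (fun y : R => y ^+ j) (j%:R * s^-1 ^+ j.-1).
      apply: DeriveDef; first exact: exprn_derivable.
      by rewrite exp_derive [_%:A]mulr1.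
    exact: is_derive_comp1 dV dP.
  apply: (is_derive_eq (is_deriveM_fun dX dE)).
  rewrite /flat_exp_deriv /flat_exp s0 -exprVn.
  case: j {dX} => [|j]; first by rewrite !mul0r mulr0 addr0 subr0; ring.
  by rewrite /= !exprS; ring.
- rewrite /flat_exp_deriv !flat_exp0// mulr0 subrr.
  suff h : (fun h : R => h^-1 *: ((flat_exp j \o shift 0) (h *: (1 : R)) -
      flat_exp j 0)) h @[h --> 0^'] --> (0 : R).
    by apply: DeriveDef; [apply/cvg_ex; exists 0|exact: cvg_lim].
  apply/cvgrPdist_le => e e0.
  have d0 : 0 < e / j.+2`!%:R by rewrite divr_gt0// ltr0n fact_gt0.
  near=> h.
  have h0 : h != 0 by near: h; exact: nbhs_dnbhs_neq.
  have hd : `|h| <= e / j.+2`!%:R.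
    by near: h; exact: dnbhs0_le.
  rewrite sub0r normrN (_ : _ *: _ = flat_exp j.+1 h); last first.
    by rewrite flat_expS /= [h *: 1]mulr1 addr0 (@flat_exp0 j 0)// subr0.
  rewrite ger0_norm ?flat_exp_ge0//.
  have [hn|hp] := leP h 0; first by rewrite flat_exp0// ltW.
  have -> : flat_exp j.+1 h = h * flat_exp j.+2 h.
    by rewrite (flat_expS j.+1) mulrA mulfV// mul1r.
  have f0 : j.+2`!%:R != 0 :> R by rewrite pnatr_eq0 -lt0n fact_gt0.
  rewrite -(divfK f0 e) ler_pM ?flat_exp_le ?flat_exp_ge0 ?(ltW hp)//.
  by rewrite -(gtr0_norm hp).
Unshelve. all: by end_near. Qed.

Lemma smooth_flat_exp j : smooth (flat_exp j).
Proof.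
pose P := fix P k (f : R -> R) : Prop := match k with
  | 0 => exists j, f = flat_exp j
  | k.+1 => P k f \/ exists a b g h, [/\ P k g, P k h &
                                      f = (fun x => a * g x + b * h x)]
  end.
have PS k f : P k f -> forall l, (k <= l)%N -> P l f.
  move=> Pk; elim => [|l IH]; first by case: k Pk.
  by rewrite leq_eqVlt => /predU1P[<-//|/IH ?]; left.
apply: (@smooth_coind _ _ (fun f => exists k, P k f)); last by exists 0%N, j.
move=> f [k]; elim: k f => [f [i ->]|k IH f [/IH//|[a [b [g [h [Pg Ph ->]]]]]]].
  split.
  - move=> x; apply: differentiable_continuous; apply/derivable1_diffP.
    by have [] := is_derive_flat_exp i x.
  - move=> x v; have [] // := is_derive_comp1 (is_derive_id x v) (is_derive_flat_exp i x).
  - move=> v; exists 1%N; right; exists v, (- (i%:R * v)), (flat_exp i.+2), (flat_exp i.+1).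
    split; [by exists i.+2|by exists i.+1|].
    apply/funext => x.
    have [_ ->] := is_derive_comp1 (is_derive_id x v) (is_derive_flat_exp i x).
    by rewrite /flat_exp_deriv; ring.
have [cg dg Dg] := IH _ Pg; have [ch dh Dh] := IH _ Ph.
have D x v : is_derive x v (fun y => a * g y + b * h y) (a * 'D_v g x + b * 'D_v h x).
  exact: is_deriveD_fun (is_deriveZ a (derivableP (dg x v)))
                        (is_deriveZ b (derivableP (dh x v))).
split.
- move=> x; apply: (@cvgD R); apply: (@cvgM R); try exact: cvg_cst.
    exact: cg.
  exact: ch.
- by move=> x v; have [] := D x v.
- move=> v; have [k1 P1] := Dg v; have [k2 P2] := Dh v.
  exists (maxn k1 k2).+1; right; exists a, b, (fun x => 'D_v g x), (fun x => 'D_v h x).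
  split; [exact: PS P1 _ (leq_maxl _ _)|exact: PS P2 _ (leq_maxr _ _)|].
  by apply/funext => x; have [_ ->] := D x v.
Qed.

Lemma lipschitz_of_derive (f df : R -> R) K :
  (forall x, is_derive x 1 f (df x)) -> (forall x, `|df x| <= K) ->
  forall x y, `|f x - f y| <= K * `|x - y|.
Proof.
move=> fdf dfK.
have cf x : {for x, continuous f}.
  apply: differentiable_continuous; apply/derivable1_diffP.
  by have [] := fdf x.
suff H x y : x <= y -> `|f y - f x| <= K * `|y - x|.
  move=> x y; have [/H|/ltW/H//] := leP x y.
  by rewrite distrC (distrC y).
move=> xy; have [|c _ ->] := MVT_segment xy (fun x _ => fdf x).
  by apply: continuous_subspaceT => ?; exact: cf.
by rewrite normrM ler_wpM2r.
Qed.

Lemma ndecr_of_derive (f df : R -> R) :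
  (forall x, is_derive x 1 f (df x)) -> (forall x, 0 <= df x) ->
  {homo f : x y / x <= y}.
Proof.
move=> fdf df0 x y xy; rewrite -subr_ge0.
have [|c _ ->] := MVT_segment xy (fun x _ => fdf x).
  apply: continuous_subspaceT => z; apply: differentiable_continuous.
  by apply/derivable1_diffP; have [] := fdf z.
by rewrite mulr_ge0// subr_ge0.
Qed.

Definition bump : R -> R := flat_exp 0.
Definition dbump : R -> R := flat_exp 2.

Lemma bump_ge0 s : 0 <= bump s. Proof. exact: flat_exp_ge0. Qed.
Lemma bump_le1 s : bump s <= 1. Proof. exact: flat_exp_le. Qed.
Lemma bump_le0 s : s <= 0 -> bump s = 0. Proof. exact: flat_exp0. Qed.
Lemma dbump_ge0 s : 0 <= dbump s. Proof. exact: flat_exp_ge0. Qed.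
Lemma dbump_le2 s : dbump s <= 2. Proof. exact: (flat_exp_le 2). Qed.
Lemma dbump_le0 s : s <= 0 -> dbump s = 0. Proof. exact: flat_exp0. Qed.

Lemma bump_gt0 s : (0 < bump s) = (0 < s).
Proof.
have [s0|/bump_le0->] := ltP 0 s; last by rewrite ltxx.
by rewrite /bump /flat_exp s0 mulr_gt0// ?expr0// expR_gt0.
Qed.

Lemma is_derive_bump s : is_derive s 1 bump (dbump s).
Proof.
by apply: (is_derive_eq (is_derive_flat_exp 0 s)); rewrite /flat_exp_deriv mul0r subr0.
Qed.

Lemma smooth_bump : smooth bump. Proof. exact: smooth_flat_exp. Qed.

Lemma ndecr_bump : {homo bump : x y / x <= y}.
Proof. exact: ndecr_of_derive is_derive_bump dbump_ge0. Qed.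

Lemma lipschitz_bump s t : `|bump s - bump t| <= 2 * `|s - t|.
Proof.
apply: lipschitz_of_derive => [x|x]; first exact: is_derive_bump.
by rewrite ger0_norm ?dbump_ge0 ?dbump_le2.
Qed.

Lemma lipschitz_dbump s t : `|dbump s - dbump t| <= 36 * `|s - t|.
Proof.
apply: lipschitz_of_derive => [x|x]; first exact: is_derive_flat_exp.
have := flat_exp_le 4 x; have := flat_exp_le 3 x.
have := flat_exp_ge0 4 x; have := flat_exp_ge0 3 x.
by rewrite (_ : 4`! = 24)%N// (_ : 3`! = 6)%N// /flat_exp_deriv ler_norml; lra.
Qed.

Definition step s : R := bump s * (bump s + bump (1 - s)) `^ (-1).

Let den_gt0 s : 0 < bump s + bump (1 - s).
Proof.
have := bump_ge0 s; have := bump_ge0 (1 - s).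
have [s0|s0] := ltP 0 s; first by move: s0; rewrite -(bump_gt0 s); lra.
have : 0 < 1 - s by lra.
by rewrite -(bump_gt0 (1 - s)); lra.
Qed.

Lemma stepE s : step s = bump s / (bump s + bump (1 - s)).
Proof. by rewrite /step powR_inv1// ltW. Qed.

Lemma smooth_step : smooth step.
Proof.
apply: smoothM; first exact: smooth_bump.
apply: smooth_powR; first exact: den_gt0.
apply: smoothD; first exact: smooth_bump.
apply: smooth_comp; first exact: smooth_bump.
by apply: smoothB; [exact: smooth_cst|exact: smooth_id].
Qed.

Lemma step_ge0 s : 0 <= step s.
Proof. by rewrite stepE divr_ge0 ?bump_ge0// ltW. Qed.

Lemma step_le1 s : step s <= 1.
Proof. by rewrite stepE ler_pdivrMr// mul1r lerDl bump_ge0. Qed.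

Lemma step_le0 s : s <= 0 -> step s = 0.
Proof. by move=> s0; rewrite stepE bump_le0// mul0r. Qed.

Lemma step_ge1 s : 1 <= s -> step s = 1.
Proof.
move=> s1; have b0 : bump (1 - s) = 0 by rewrite bump_le0// subr_le0.
have bs : 0 < bump s by rewrite bump_gt0; lra.
by rewrite stepE b0 addr0 divff// gt_eqF.
Qed.

Lemma ndecr_step : {homo step : x y / x <= y}.
Proof.
move=> x y xy; rewrite !stepE ler_pdivrMr// mulrAC ler_pdivlMr//.
have := ndecr_bump xy; have /ndecr_bump : 1 - y <= 1 - x by lra.
by have := bump_ge0 x; have := bump_ge0 (1 - y); nra.
Qed.

End bump.

(** * Borel sets and boxes of [R^n] *)

Lemma measurable_countable_base d (T : measurableType d) (I : countType)
    (B : I -> set T) (U : set T) :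
  (forall i, measurable (B i)) ->
  (forall x, U x -> exists i, B i x /\ B i `<=` U) -> measurable U.
Proof.
move=> mB HU.
rewrite (_ : U = \bigcup_k (if @unpickle I k is Some i then
    (if `[< B i `<=` U >] then B i else set0) else set0)).
  apply: bigcupT_measurable => k; case: unpickle => // i.
  by case: ifP.
apply/seteqP; split=> [x /HU[i [Bx BU]]|x [k _]].
  by exists (pickle i) => //; rewrite pickleK asboolT.
by case: unpickle => // i; case: asboolP => // BU /BU.
Qed.

Section borel_rV.
Context {R : realType}.
Implicit Types n : nat.

Definition prod_set n (D : 'I_n -> set R) : set 'rV[R]_n :=
  [set x | forall i, D i (x 0 i)].

Lemma measurable_prod_set n (D : 'I_n -> set R) :
  (forall i, measurable (D i)) -> measurable (prod_set D).
Proof.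
move=> mD; rewrite (_ : prod_set D = \bigcap_(i in setT) [set x | D i (x 0 i)]).
  apply: fin_bigcap_measurable => // i _.
  by rewrite -[X in measurable X]setTI; exact: measurable_coord.
by apply/seteqP; split=> x h i; [move=> _; exact: (h i)|exact: (h i I)].
Qed.

Lemma lebesgue_rV_prod_set n (D : 'I_n -> set R) :
  (forall i, measurable (D i)) ->
  lebesgue_rV R n (prod_set D) = (\prod_(i < n) lebesgue_measure (D i))%E.
Proof.
elim: n D => [|n IH] D mD.
  by rewrite big_ord0 /= diracE mem_set//; case.
rewrite big_ord_recl -IH => [|i]; last exact: mD.
rewrite -product_measure1E; [|exact: mD|exact: measurable_prod_set].
rewrite [LHS]/= /lebesgue_cons /pushforward; congr (_ _).
apply/seteqP; split=> -[t y] /=.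
  move=> h; split; first by have := h ord0; rewrite mxE unlift_none.
  by move=> i; have := h (lift ord0 i); rewrite mxE liftK.
by move=> [h0 h] i; rewrite mxE; case: unliftP => [j|] ->; [exact: (h j)|exact: h0].
Qed.

Definition rat_cube n (i : 'rV[rat]_n * nat) : set 'rV[R]_n :=
  prod_set (fun j => `](ratr (i.1 0 j) - i.2.+1%:R^-1), (ratr (i.1 0 j) + i.2.+1%:R^-1)[%classic).

Lemma measurable_rat_cube n i : measurable (@rat_cube n i).
Proof. by apply: measurable_prod_set => j; exact: measurable_itv. Qed.

Lemma rat_approx (x e : R) : 0 < e -> exists q : rat, `|x - ratr q| < e.
Proof.
move=> e0; have xe : x - e < x + e by lra.
have [q] := rat_in_itvoo xe; rewrite in_itv /= => /andP[h1 h2].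
by exists q; rewrite ltr_norml; apply/andP; split; lra.
Qed.

Lemma open_rat_cube n (U : set 'rV[R]_n) x : open U -> U x ->
  exists e : R, 0 < e /\ forall k : nat, k.+1%:R^-1 < e ->
  exists c : 'rV[rat]_n, rat_cube (c, k) x /\
    forall y : 'rV[R]_n, (forall j, `|y 0 j - ratr (c 0 j)| <= k.+1%:R^-1) -> U y.
Proof.
rewrite openE => /[apply] /nbhs_ballP[e /= e0 eU]; exists (e / 2).
split=> [|k ke]; first by rewrite divr_gt0.
have k0 : 0 < k.+1%:R^-1 :> R by rewrite invr_gt0 ltr0n.
have /choice[c Hc] : forall j, exists q : rat, `|x 0 j - ratr q| < k.+1%:R^-1.
  by move=> j; exact: rat_approx.
exists (\row_j c j); split=> [j|y Hy].
  by rewrite /= !mxE in_itv /= -ltr_distlC distrC.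
apply: eU; split=> // i j; rewrite ord1 /ball /=.
have := Hy j; have := Hc j; rewrite mxE => h1 h2.
rewrite (_ : x 0 j - y 0 j = (x 0 j - ratr (c j)) - (y 0 j - ratr (c j))); last by ring.
apply: le_lt_trans (ler_normB _ _) _.
move: (k.+1%:R^-1 : R) ke h1 h2 => d ke h1 h2. lra.
Qed.

Lemma exists_invn_lt (e : R) : 0 < e -> exists k : nat, k.+1%:R^-1 < e.
Proof.
move=> e0; exists (Num.truncn e^-1).
rewrite -[ltRHS]invrK ltf_pV2 ?posrE ?invr_gt0 ?ltr0n//.
exact: truncnS_gt.
Qed.

Lemma open_measurable_rV n (U : set 'rV[R]_n) : open U -> measurable U.
Proof.
move=> oU; apply: (measurable_countable_base (@measurable_rat_cube n)) => x Ux.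
have [e [e0 He]] := open_rat_cube oU Ux; have [k /He[c [cx cU]]] := exists_invn_lt e0.
exists (c, k); split=> // y yc; apply: cU => j.
by have := yc j; rewrite /= in_itv /= -ltr_distlC distrC => /ltW.
Qed.

Lemma open_measurable_rVxR n (U : set ('rV[R]_n * R)) :
  open U -> measurable (U : set ('rV[R]_n * measurableTypeR R)).
Proof.
move=> oU.
pose B (i : 'rV[rat]_n * nat * rat) : set ('rV[R]_n * measurableTypeR R) :=
  rat_cube i.1 `*` `]ratr i.2 - i.1.2.+1%:R^-1, ratr i.2 + i.1.2.+1%:R^-1[%classic.
have mB i : measurable (B i).
  by apply: measurableX; [exact: measurable_rat_cube|exact: measurable_itv].
apply: (measurable_countable_base mB) => -[x t] Uxt.
move: oU; rewrite openE => /(_ _ Uxt)[[P Q] /= [+ Qt] PQ].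
rewrite nbhsE => -[P' [oP' P'x] P'P].
have [e [e0 He]] := open_rat_cube oP' P'x.
move: Qt => /nbhs_ballP[d /= d0 dQ].
have : 0 < Num.min e (d / 2) by rewrite lt_min e0 divr_gt0.
move=> /exists_invn_lt[k]; rewrite lt_min => /andP[/He[c [cx cP]] kd].
have k0 : 0 < k.+1%:R^-1 :> R by rewrite invr_gt0 ltr0n.
have [q qt] := rat_approx t k0.
exists (c, k, q); split; first by split=> //=; rewrite in_itv /= -ltr_distlC distrC.
move=> [y r] [/= yc]; rewrite in_itv /= -ltr_distlC => rq; apply: PQ; split=> /=.
  apply: P'P; apply: cP => j.
  by have := yc j; rewrite /= in_itv /= -ltr_distlC distrC => /ltW.
apply: dQ; rewrite /ball /=.
rewrite (_ : t - r = (t - ratr q) + (ratr q - r)); last by ring.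
apply: le_lt_trans (ler_normD _ _) _.
move: (k.+1%:R^-1 : R) kd qt rq => a kd qt rq; lra.
Qed.

Lemma measurable_fun_open_lt d (T : measurableType d) (D : set T) (f : T -> R) :
  measurable D -> (forall a, measurable (D `&` [set x | a < f x])) ->
  measurable_fun D f.
Proof.
move=> mD H; apply: (measurability _ (measurable_realfun.RGenOInfty.measurableE R)).
move=> /= _ [_ [a ->]] <-; rewrite preimage_itvoy; exact: H.
Qed.

Lemma open_lt_continuous (T : topologicalType) (D : set T) (f : T -> R) a :
  open D -> {in D, continuous f} -> open (D `&` [set x | a < f x]).
Proof.
move=> oD cf; rewrite openE => x [Dx ax].
apply: filterI; first by move: oD; rewrite openE; exact.
apply: (cf x _ [set y | a < y]); first by rewrite inE.
by move: (@open_gt R a); rewrite openE; apply.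
Qed.

Lemma continuous_measurable_rV n (D : set 'rV[R]_n) (f : 'rV[R]_n -> R) :
  open D -> {in D, continuous f} -> measurable_fun D f.
Proof.
move=> oD cf; apply: measurable_fun_open_lt => [|a].
  exact: open_measurable_rV.
by apply: open_measurable_rV; exact: open_lt_continuous.
Qed.

Lemma continuous_measurable_rVxR n (D : set ('rV[R]_n * R)) (f : 'rV[R]_n * R -> R) :
  open D -> {in D, continuous f} ->
  measurable_fun (D : set ('rV[R]_n * measurableTypeR R)) f.
Proof.
move=> oD cf; apply: measurable_fun_open_lt => [|a].
  exact: open_measurable_rVxR.
by apply: open_measurable_rVxR; exact: open_lt_continuous.
Qed.

Lemma continuousT_measurable_rV n (f : 'rV[R]_n -> R) :
  continuous f -> measurable_fun setT f.
Proof. by move=> cf; apply: continuous_measurable_rV => //; exact: openT. Qed.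

Lemma bounded_set_cube n (A : set 'rV[R]_n) : bounded_set A ->
  exists M : R, 0 < M /\ forall x, A x -> forall i, `|x 0 i| <= M.
Proof.
move=> [M [_ HM]]; exists (`|M| + 1); split=> [|x Ax i].
  by rewrite ltr_pwDr.
have := HM (`|M| + 1); rewrite ltr_pwDr ?ler_norm// => /(_ isT x Ax) /=.
apply: le_trans; rewrite [leRHS]/Num.norm /= mx_normrE.
exact: (bigmax_sup (0, i)).
Qed.

Lemma bounded_lebesgue_rV_lty n (A : set 'rV[R]_n) :
  measurable A -> bounded_set A -> (lebesgue_rV R n A < +oo)%E.
Proof.
move=> mA /bounded_set_cube[M [M0 HM]].
pose D := fun _ : 'I_n => `[- M, M]%classic.
apply: (@le_lt_trans _ _ (lebesgue_rV R n (prod_set D))).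
  apply: le_measure; rewrite ?inE//.
    by apply: measurable_prod_set => i; exact: measurable_itv.
  by move=> x Ax i; rewrite /D /= in_itv /= -ler_norml HM.
rewrite lebesgue_rV_prod_set => [|i]; last exact: measurable_itv.
rewrite ltey_eq prode_fin_num// => i _.
by rewrite lebesgue_measure_itv /= lte_fin; case: ifP.
Qed.

Lemma open_lebesgue_rV_gt0 n (U : set 'rV[R]_n) :
  open U -> U !=set0 -> (0 < lebesgue_rV R n U)%E.
Proof.
move=> oU [x Ux].
have [e [e0 He]] := open_rat_cube oU Ux; have [k /He[c [cx cU]]] := exists_invn_lt e0.
have k0 : 0 < k.+1%:R^-1 :> R by rewrite invr_gt0 ltr0n.
apply: (@lt_le_trans _ _ (lebesgue_rV R n (rat_cube (c, k)))); last first.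
  apply: le_measure; rewrite ?inE//; [exact: measurable_rat_cube|exact: open_measurable_rV|].
  move=> y yc; apply: cU => j.
  by have := yc j; rewrite /= in_itv /= -ltr_distlC distrC => /ltW.
rewrite lebesgue_rV_prod_set => [|i]; last exact: measurable_itv.
apply: (big_ind (fun a => (0 < a)%E)) => [|a b|i _]; [exact: lte01|exact: mule_gt0|].
rewrite lebesgue_measure_itv /=.
move: (k.+1%:R^-1 : R) k0 => d d0; rewrite lte_fin ifT; last by lra.
by rewrite -EFinB lte_fin; lra.
Qed.

End borel_rV.

(** * Integration by parts against test functions *)

Section test_functions.
Context {R : realType}.
Implicit Types V : normedModType R.

Lemma test_fun_smooth V (U : set V) f : test_fun U f -> smooth f.
Proof. by case. Qed.

Lemma test_fun_eq0 V (U : set V) (f : V -> R) x : test_fun U f -> ~ U x -> f x = 0.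
Proof.
move=> [_ [K [_ KU] fK]] Ux; apply/eqP/negPn/negP => /fK Kx.
by apply: Ux; exact: KU.
Qed.

Lemma derive_eq0_off_closed V (K : set V) (f : V -> R) v x :
  closed K -> (forall y, f y != 0 -> K y) -> ~ K x -> 'D_v f x = 0.
Proof.
move=> cK fK Kx; rewrite -(derive_cst (0 : R) x v); apply: near_eq_derive.
have : open (~` K) by exact: closed_openC.
rewrite openE => /(_ _ Kx); apply: filterS => y Ky.
by apply/eqP/negPn/negP => /fK.
Qed.

Lemma test_fun_derive V (U : set V) (f : V -> R) v :
  test_fun U f -> test_fun U (fun x => 'D_v f x).
Proof.
move=> [sf [K [cK KU] fK]]; split; first exact: smooth_derive.
exists K => // x; apply: contra_neqP => Kx.
by apply: derive_eq0_off_closed fK Kx; apply: compact_closed => //; exact: norm_hausdorff.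
Qed.

Lemma test_fun_smoothM V (U : set V) (f g : V -> R) :
  smooth f -> test_fun U g -> test_fun U (fun x => f x * g x).
Proof.
move=> sf [sg [K KU gK]]; split; first exact: smoothM.
by exists K => // x; rewrite mulf_eq0 negb_or => /andP[_ /gK].
Qed.

Lemma test_funS V (U U' : set V) (f : V -> R) :
  U `<=` U' -> test_fun U f -> test_fun U' f.
Proof.
move=> UU' [sf [K [cK KU] fK]]; split => //; exists K => //.
by split=> //; exact: subset_trans UU'.
Qed.

Lemma continuous_bounded_on_compact (T : topologicalType) (K : set T) (f : T -> R) :
  compact K -> continuous f -> exists2 C, 0 <= C & forall x, K x -> `|f x| <= C.
Proof.
move=> cK cf; have /compact_bounded[M [_ HM]] : compact (f @` K).
  by apply: continuous_compact => //; exact: continuous_subspaceT.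
exists (`|M| + 1) => // x Kx; apply: HM; last by exists x.
by rewrite ltr_pwDr// ler_norm.
Qed.

Lemma test_fun_bounded V (U : set V) (f : V -> R) :
  test_fun U f -> exists2 C, 0 <= C & forall x, `|f x| <= C.
Proof.
move=> [/smooth_continuous cf [K [cK _] fK]].
have [C C0 HC] := continuous_bounded_on_compact cK cf.
exists C => // x; have [->|/fK/HC//] := eqVneq (f x) 0; by rewrite normr0.
Qed.

End test_functions.

Section ibp.
Context {R : realType}.
Implicit Types n : nat.

Definition supp_cube n (M : R) (f : 'rV[R]_n -> R) :=
  forall (x : 'rV[R]_n) i, M < `|x 0 i| -> f x = 0.

Lemma compact_cube n (M : R) : compact [set x : 'rV[R]_n | `|x| <= M].
Proof.
apply: bounded_closed_compact.
  by exists M; split; rewrite ?num_real// => r Mr x /= xM; exact: le_trans xM (ltW Mr).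
apply: (@preimage_closed _ _ (fun y : 'rV[R]_n => `|y|) [set t | t <= M]).
  by move=> *; exact: norm_continuous.
exact: closed_le.
Qed.

Lemma rV_norm_le n (x : 'rV[R]_n) (M : R) : 0 <= M ->
  (forall i, `|x 0 i| <= M) -> `|x| <= M.
Proof.
move=> M0 H; rewrite [leLHS]/Num.norm /= mx_normrE.
by apply: bigmax_le => // -[i j] _ /=; rewrite ord1.
Qed.

Lemma supp_cube_derive n M (f : 'rV[R]_n -> R) v :
  supp_cube M f -> supp_cube M (fun x => 'D_v f x).
Proof.
move=> sf x i Mx.
apply: (@derive_eq0_off_closed _ _ [set y : 'rV[R]_n | `|y 0 i| <= M]).
- apply: (@preimage_closed _ _ (fun y : 'rV[R]_n => `|y 0 i|) [set t | t <= M]).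
    move=> z _; apply: (cvg_comp _ _ (@coord_continuous R 1 n 0 i z)).
    exact: norm_continuous.
  exact: closed_le.
- move=> y; apply: contra_neqP => /= /negP; rewrite -ltNge; exact: sf.
- by apply/negP; rewrite -ltNge.
Qed.

Lemma supp_cube_integrable n M (f : 'rV[R]_n -> R) :
  continuous f -> supp_cube M f -> (lebesgue_rV R n).-integrable setT (EFin \o f).
Proof.
move=> cf sf.
pose K := [set x : 'rV[R]_n | `|x| <= `|M|].
have cK : closed K.
  by apply: compact_closed; [exact: norm_hausdorff|exact: compact_cube].
have mK : measurable K.
  have oK : open (~` K) by rewrite openC.
  by rewrite -(setCK K); apply: measurableC; exact: open_measurable_rV.
have fK : EFin \o f = (EFin \o f) \_ K.
  apply/funext => x; rewrite patchE; case: ifPn => //= xK.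
  have [/existsP[i]|/existsPn h] := boolP [exists i, M < `|x 0 i|].
    by move=> /sf ->.
  suff : x \in K by rewrite (negPf xK).
  rewrite inE /K /=; apply: rV_norm_le => // i.
  by have := h i; rewrite -leNgt => /le_trans; apply; exact: ler_norm.
rewrite fK; apply: (integrable_mkcond _ mK).1.
apply: (@measurable_bounded_integrable _ _ _ (lebesgue_rV R n) f K mK).
- apply: bounded_lebesgue_rV_lty => //; apply: compact_bounded; exact: compact_cube.
- by apply: measurable_funTS; exact: continuousT_measurable_rV.
- have [C _ HC] := continuous_bounded_on_compact (@compact_cube n `|M|) cf.
  by exists C; split; rewrite ?num_real// => r Cr x /HC/le_trans; apply; exact: ltW.
Qed.

Lemma ftc (F f : R -> R) (a b : R) : a < b ->
  (forall x : R, is_derive x 1 F (f x)) ->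
  continuous f -> (\int[lebesgue_measure]_(x in `[a, b]) (f x)%:E = (F b - F a)%:E)%E.
Proof.
move=> ab dF cf.
have cF x : {for x, continuous F}.
  apply: differentiable_continuous; apply/derivable1_diffP.
  by have [] := dF x.
rewrite (continuous_FTC2 ab _ _ (F := F)) ?EFinB//.
- by apply: continuous_subspaceT => ?; exact: cf.
- split.
  + by move=> x _; have [] := dF x.
  + by apply: cvg_at_right_filter; exact: cF.
  + by apply: cvg_at_left_filter; exact: cF.
- by move=> x _; rewrite derive1E; have [_ ->] := dF x.
Qed.

Lemma cons_rV_lineE n (a b t : R) (y z : 'rV[R]_n) :
  cons_rV (t * a + b, t *: z + y) = t *: cons_rV (a, z) + cons_rV (b, y).
Proof. by apply/rowP => i; rewrite !mxE; case: unliftP => [j|] _; rewrite ?mxE. Qed.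

Lemma cons_rV_basis0 n : cons_rV (1, 0 : 'rV[R]_n) = basis_vec R ord0.
Proof.
apply/rowP => i; rewrite !mxE eqxx /=; case: unliftP => [j ->|->]; rewrite ?mxE//.
Qed.

Lemma cons_rV_basisS n (j : 'I_n) :
  cons_rV (0, basis_vec R j) = basis_vec R (lift ord0 j).
Proof.
apply/rowP => i; rewrite !mxE eqxx /=; case: unliftP => [k ->|->]; rewrite ?mxE//= ?eqxx ?(inj_eq lift_inj)//.
Qed.

Lemma continuous_cons_rVr n (t : R) : continuous (fun y : 'rV[R]_n => cons_rV (t, y)).
Proof.
move=> y P /nbhs_ballP[e /= e0 eP]; apply/nbhs_ballP; exists e => // z [_ yz].
apply: eP; split=> // i j; rewrite ord1 !mxE.
by case: unliftP => [k|] _; [exact: yz|exact: ballxx].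
Qed.

Lemma integral_derive_supp_cube n M (F : 'rV[R]_n -> R) i :
  smooth F -> supp_cube M F ->
  (\int[lebesgue_rV R n]_x ('D_(basis_vec R i) F x)%:E = 0)%E.
Proof.
elim: n M F i => [M F []//|n IH M F i sF sM].
pose g (x : 'rV[R]_n.+1) : R := 'D_(basis_vec R i) F x.
have cg : continuous g by apply: smooth_continuous; exact: smooth_derive.
have gM : supp_cube M g by exact: supp_cube_derive.
have ig := supp_cube_integrable cg gM.
have mg : measurable_fun setT g by exact: continuousT_measurable_rV.
have mc : measurable_fun setT (@cons_rV R n) by exact: measurable_cons_rV.
have ic : (lebesgue_measure \x lebesgue_rV R n)%E.-integrable setT
    ((EFin \o g) \o @cons_rV R n).
  apply/integrableP; split.
    by apply/measurable_EFinP; exact: (measurableT_comp mg mc).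
  move/integrableP: ig => [_]; rewrite [X in (X < _)%E -> _](_ : _ =
    \int[pushforward (lebesgue_measure \x lebesgue_rV R n)%E (@cons_rV R n)]_x
      (abse \o (EFin \o g)) x)%E//.
  rewrite ge0_integral_pushforward//.
    by apply: measurableT_comp => //; exact/measurable_EFinP.
  by move=> y _; exact: abse_ge0.
rewrite [LHS](_ : _ =
    \int[pushforward (lebesgue_measure \x lebesgue_rV R n)%E (@cons_rV R n)]_x
      (EFin \o g) x)%E; last by [].
rewrite integral_pushforward//; last exact/measurable_EFinP.
rewrite preimage_setT.
have [[j ij]|i0] : (exists j, i = lift ord0 j) \/ i = ord0.
- by case: (unliftP ord0 i) => [j ->|->]; [left; exists j|right].
- rewrite -integral12_prod_meas1//; apply: integral0_eq => t _ /=.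
  have sA : smooth (fun y : 'rV[R]_n => F (cons_rV (t, y))).
    apply: (smooth_precomp (B := fun v => cons_rV (0, v))) => //.
      exact: continuous_cons_rVr.
    by move=> h v x; rewrite -cons_rV_lineE mulr0 add0r.
  have sAM : supp_cube M (fun y : 'rV[R]_n => F (cons_rV (t, y))).
    by move=> y k Mk; apply: (sM _ (lift ord0 k)); rewrite mxE liftK.
  rewrite -[RHS](IH M _ j sA sAM).
  apply: eq_integral => y _; congr (_%:E); rewrite /g ij -cons_rV_basisS.
  have H (h : R) : cons_rV (t, h *: basis_vec R j + y) =
      h *: cons_rV (0, basis_vec R j) + cons_rV (t, y).
    by rewrite -cons_rV_lineE mulr0 add0r.
  have dF : is_derive y (basis_vec R j) (fun y : 'rV[R]_n => F (cons_rV (t, y)))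
      ('D_(cons_rV (0, basis_vec R j)) F (cons_rV (t, y))).
    apply: (is_derive_precomp (A := fun y : 'rV[R]_n => cons_rV (t, y)) H).
    exact: smooth_is_derive.
  by have [_ ->] := dF.
- rewrite -integral21_prod_meas1//; apply: integral0_eq => y _ /=.
  have dG (t : R) : is_derive t 1 (fun t => F (cons_rV (t, y))) (g (cons_rV (t, y))).
    rewrite /g i0 -cons_rV_basis0.
    apply: (is_derive_precomp (A := fun t : R => cons_rV (t, y))
      (w := cons_rV (1, 0))).
      by move=> h; rewrite -cons_rV_lineE scaler0 add0r.
    exact: smooth_is_derive.
  have cG : continuous (fun t : R => g (cons_rV (t, y))).
    have sg : smooth g by exact: smooth_derive.
    move=> t; apply: differentiable_continuous; apply/derivable1_diffP.
    have H (h : R) : cons_rV (h *: 1 + t, y) =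
        h *: cons_rV (1, 0) + cons_rV (t, y).
      by rewrite -cons_rV_lineE scaler0 add0r.
    by have [] := is_derive_precomp (A := fun t : R => cons_rV (t, y)) H
      (smooth_is_derive _ _ sg).
  pose A : R := `|M| + 1.
  have A0 : 0 < A by rewrite ltr_pwDr.
  have MA : M < A by rewrite /A (le_lt_trans (ler_norm M))// ltrDl.
  have z0 t : A <= `|t| -> F (cons_rV (t, y)) = 0.
    by move=> At; apply: (sM _ ord0); rewrite mxE unlift_none; exact: lt_le_trans At.
  have NAA : - A < A by lra.
  pose G (t : R) : R := g (cons_rV (t, y)).
  transitivity (\int[lebesgue_measure]_(x in `[(- A)%R, A]) (G x)%:E)%E; last first.
    by rewrite (ftc NAA dG cG) !z0 ?subrr// ?normrN gtr0_norm.
  rewrite [RHS]integral_mkcond; congr (integral _ _ _).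
  apply/funext => t; rewrite patchE; case: ifPn => // /negP tA; congr (_%:E).
  apply: (gM _ ord0); rewrite mxE unlift_none /=.
  rewrite ltNge; apply/negP => tM; apply: tA; rewrite inE /= in_itv /= -ler_norml.
  by apply: (le_trans tM); exact: ltW.
Qed.

Lemma test_fun_supp_cube n (U : set 'rV[R]_n) f :
  test_fun U f -> exists M, supp_cube M f.
Proof.
move=> [_ [K [/compact_bounded/bounded_set_cube[M [_ HM]] _] fK]]; exists M => x i.
by apply: contraTeq => /fK/HM/(_ i); rewrite -leNgt.
Qed.

Lemma test_fun_integrable n (U : set 'rV[R]_n) f :
  test_fun U f -> (lebesgue_rV R n).-integrable setT (EFin \o f).
Proof.
move=> tf; have [M] := test_fun_supp_cube tf; apply: supp_cube_integrable.
by apply: smooth_continuous; exact: test_fun_smooth tf.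
Qed.

Lemma Rintegral_eq0_off d (T : measurableType d) (mu : {measure set T -> \bar R})
    (D : set T) (f : T -> R) :
  (forall x, ~ D x -> f x = 0) -> \int[mu]_(x in D) f x = \int[mu]_x f x.
Proof.
move=> f0; rewrite Rintegral_mkcond; apply: eq_Rintegral => x _.
by rewrite patchE; case: ifPn => // /negP xD; rewrite f0// => Dx; apply: xD; rewrite inE.
Qed.

Lemma integration_by_parts_test_fun n (U : set 'rV[R]_n) (f psi : 'rV[R]_n -> R) i :
  smooth f -> test_fun U psi ->
  \int[lebesgue_rV R n]_(x in U) (f x * 'D_(basis_vec R i) psi x) =
  - \int[lebesgue_rV R n]_(x in U) ('D_(basis_vec R i) f x * psi x).
Proof.
move=> sf tpsi; set e := basis_vec R i.
have tD := test_fun_derive e tpsi.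
have t1 := test_fun_smoothM sf tD.
have t2 := test_fun_smoothM (smooth_derive e sf) tpsi.
have t3 := test_fun_smoothM sf tpsi.
rewrite (@Rintegral_eq0_off _ _ _ U (fun x => f x * 'D_e psi x)); last first.
  by move=> x Ux; rewrite (test_fun_eq0 tD Ux) mulr0.
rewrite (@Rintegral_eq0_off _ _ _ U (fun x => 'D_e f x * psi x)); last first.
  by move=> x Ux; rewrite (test_fun_eq0 tpsi Ux) mulr0.
have [M sM] := test_fun_supp_cube t3.
apply/eqP; rewrite -subr_eq0 opprK; apply/eqP.
have i1 := test_fun_integrable t1; have i2 := test_fun_integrable t2.
rewrite -(RintegralD measurableT i1 i2).
rewrite /Rintegral -[RHS]/(fine 0%E); congr fine.
rewrite -[RHS](integral_derive_supp_cube i t3.1 sM).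
apply: eq_integral => x _; congr (_%:E).
have [_ ->] := is_deriveM_fun (smooth_is_derive x e sf)
                 (smooth_is_derive x e (test_fun_smooth tpsi)).
by rewrite (mulrC (psi x)).
Qed.

End ibp.

(** * Integrals of real-valued functions *)

Notation Rintegrable mu D f := (integrable mu D (EFin \o f)).

Section rintegral.
Context d (T : measurableType d) {R : realType}.
Variables (mu : {measure set T -> \bar R}) (D : set T).
Hypothesis mD : measurable D.
Implicit Types f g : T -> R.

Lemma Rintegrable_measurable f : Rintegrable mu D f -> measurable_fun D f.
Proof. by move=> /measurable_int/measurable_EFinP. Qed.

Lemma Rintegrable_bounded f C : (mu D < +oo)%E -> measurable_fun D f ->
  (forall x, D x -> `|f x| <= C) -> Rintegrable mu D f.
Proof.
move=> muD mf fC; apply: measurable_bounded_integrable => //.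
by exists C; split; rewrite ?num_real// => r Cr x /fC/le_trans; apply; exact: ltW.
Qed.

Lemma Rintegrable_le f g : measurable_fun D f -> Rintegrable mu D g ->
  (forall x, D x -> `|f x| <= g x) -> Rintegrable mu D f.
Proof.
move=> mf ig fg; apply: (le_integrable mD _ _ ig); first exact/measurable_EFinP.
by move=> x Dx /=; rewrite lee_fin (le_trans (fg x Dx))// ler_norm.
Qed.

Lemma RintegrableD f g : Rintegrable mu D f -> Rintegrable mu D g ->
  Rintegrable mu D (fun x => f x + g x).
Proof. by move=> hf hg; exact: (integrableD mD hf hg). Qed.

Lemma RintegrableB f g : Rintegrable mu D f -> Rintegrable mu D g ->
  Rintegrable mu D (fun x => f x - g x).
Proof. by move=> hf hg; exact: (integrableB mD hf hg). Qed.

Lemma RintegrableZ c f : Rintegrable mu D f -> Rintegrable mu D (fun x => c * f x).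
Proof. by move=> hf; exact: (integrableZl mD c hf). Qed.

Lemma RintegrableN f : Rintegrable mu D f -> Rintegrable mu D (fun x => - f x).
Proof. by move=> hf; exact: (integrableN hf). Qed.

Lemma Rintegrable_abs f : Rintegrable mu D f -> Rintegrable mu D (fun x => `|f x|).
Proof. exact: integrable_norm. Qed.

Lemma Rintegrable_sum (I : Type) (s : seq I) (f : I -> T -> R) :
  (forall i, Rintegrable mu D (f i)) -> Rintegrable mu D (fun x => \sum_(i <- s) f i x).
Proof.
move=> hf; elim: s => [|i s IH].
  under eq_fun do rewrite big_nil; exact: integrable0.
by under eq_fun do rewrite big_cons; exact: RintegrableD.
Qed.

Lemma Rintegral_sum (I : Type) (s : seq I) (f : I -> T -> R) :
  (forall i, Rintegrable mu D (f i)) ->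
  \int[mu]_(x in D) (\sum_(i <- s) f i x) = \sum_(i <- s) \int[mu]_(x in D) f i x.
Proof.
move=> hf; elim: s => [|i s IH].
  under eq_Rintegral do rewrite big_nil.
  by rewrite big_nil Rintegral_cst// mul0r.
under eq_Rintegral do rewrite big_cons.
by rewrite big_cons RintegralD// ?IH//; exact: Rintegrable_sum.
Qed.

Lemma RintegralM_bounded f g C : measurable_fun D f ->
  (forall x, D x -> `|f x| <= C) -> Rintegrable mu D g ->
  Rintegrable mu D (fun x => f x * g x).
Proof.
move=> mf fC ig; apply: (@Rintegrable_le _ (fun x => C * `|g x|)).
- by apply: measurable_funM => //; exact: Rintegrable_measurable.
- by apply: RintegrableZ; exact: Rintegrable_abs.
- by move=> x Dx; rewrite normrM ler_wpM2r// fC.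
Qed.

Lemma RintegralN f : Rintegrable mu D f ->
  \int[mu]_(x in D) (- f x) = - \int[mu]_(x in D) f x.
Proof.
move=> hf; rewrite -mulN1r -RintegralZl//.
by apply: eq_Rintegral => x _; rewrite mulN1r.
Qed.

Lemma Rintegral_EFin f : Rintegrable mu D f ->
  (\int[mu]_(x in D) (f x)%:E = (\int[mu]_(x in D) f x)%:E)%E.
Proof. by move=> hf; rewrite /Rintegral fineK//; exact: integrable_fin_num. Qed.

Lemma Rdominated_convergence_ae (f_ : nat -> T -> R) f g :
  (forall k, measurable_fun D (f_ k)) -> measurable_fun D f ->
  {ae mu, forall x, D x -> f_ ^~ x @ \oo --> f x} ->
  Rintegrable mu D g -> {ae mu, forall x, D x -> forall k, `|f_ k x| <= g x} ->
  \int[mu]_(x in D) f_ k x @[k --> \oo] --> \int[mu]_(x in D) f x.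
Proof.
move=> mf_ mf cf ig fg.
have cf' : {ae mu, forall x, D x -> (fun k => (EFin \o f_ k) x) @ \oo --> (EFin \o f) x}.
  by apply: filterS cf => x h Dx; apply: cvg_EFin; [exact: nearW|exact: h].
have fg' : {ae mu, forall x k, D x -> (`|(EFin \o f_ k) x| <= (EFin \o g) x)%E}.
  by apply: filterS fg => x h k Dx /=; rewrite lee_fin h.
have [i1 _ c] := @dominated_convergence _ _ _ mu _ mD
  (fun k => EFin \o f_ k) (EFin \o f) (EFin \o g)
  (fun k => (measurable_EFinP _ _).2 (mf_ k)) ((measurable_EFinP _ _).2 mf)
  cf' ig fg'.
by apply: fine_cvg; rewrite -Rintegral_EFin.
Qed.

Lemma Rdominated_convergence (f_ : nat -> T -> R) f g :
  (forall k, measurable_fun D (f_ k)) -> measurable_fun D f ->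
  {ae mu, forall x, D x -> f_ ^~ x @ \oo --> f x} ->
  Rintegrable mu D g -> (forall k x, D x -> `|f_ k x| <= g x) ->
  \int[mu]_(x in D) f_ k x @[k --> \oo] --> \int[mu]_(x in D) f x.
Proof.
move=> mf_ mf cf ig fg; apply: (Rdominated_convergence_ae mf_ mf cf ig).
by apply: aeW => x Dx k; exact: fg.
Qed.

Lemma ae_eq_Rintegral f g : measurable_fun D f -> measurable_fun D g ->
  {ae mu, forall x, D x -> f x = g x} ->
  \int[mu]_(x in D) f x = \int[mu]_(x in D) g x.
Proof.
move=> mf mg fg; congr fine; apply: ae_eq_integral => //.
- exact/measurable_EFinP.
- exact/measurable_EFinP.
- by apply: filterS fg => x h Dx; rewrite h.
Qed.

Lemma ae_le_Rintegral f g : Rintegrable mu D f -> Rintegrable mu D g ->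
  {ae mu, forall x, D x -> f x <= g x} ->
  \int[mu]_(x in D) f x <= \int[mu]_(x in D) g x.
Proof.
move=> hf hg fg; rewrite -subr_ge0 -RintegralB//.
have hB := RintegrableB hg hf.
rewrite (@ae_eq_Rintegral _ (fun x => `|g x - f x|)).
- exact: Rintegral_ge0.
- exact: Rintegrable_measurable.
- by apply: Rintegrable_measurable; exact: Rintegrable_abs.
- by apply: filterS fg => x h Dx; rewrite ger0_norm// subr_ge0 h.
Qed.

End rintegral.

Section near0.
Context {R : realType}.

Lemma cvg0_squeeze_eps (u : nat -> R) :
  (forall e, 0 < e -> exists2 v : nat -> R, v @ \oo --> 0 &
    \forall k \near \oo, `|u k| <= e + v k) ->
  u @ \oo --> 0.
Proof.
move=> H; apply/cvgr0Pnorm_le => e e0.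
have [|v v0 uv] := H (e / 2); first by rewrite divr_gt0.
have /cvgr0Pnorm_le/(_ (e / 2)) := v0; rewrite divr_gt0// => /(_ isT).
apply: filterS2 uv => k uk vk; apply: (le_trans uk).
by have := ler_norm (v k); lra.
Qed.

Lemma cvg_sub0 (u : nat -> R) l : (fun k => u k - l) @ \oo --> 0 -> u @ \oo --> l.
Proof. by move=> /subr_cvg0. Qed.

End near0.

Section lp_pairing.
Context d (T : measurableType d) {R : realType}.
Variables (mu : {measure set T -> \bar R}) (D : set T).
Hypothesis mD : measurable D.
Variables (p : R).
Hypothesis p1 : 1 < p.
Let p' := p / (p - 1).
Implicit Types f g F : T -> R.

Lemma conj_exponent_gt0 : 0 < p'.
Proof. by apply: divr_gt0; [exact: lt_trans p1|rewrite subr_gt0]. Qed.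

Lemma conj_exponentE : p'^-1 + p^-1 = 1.
Proof.
rewrite /p' invf_div -[X in _ + X]mul1r -mulrDl subrK divff// gt_eqF//.
by apply: lt_trans p1.
Qed.

Lemma young_le (a b : R) : 0 <= a -> 0 <= b -> a * b <= a `^ p' + b `^ p.
Proof.
move=> a0 b0; have p'0 := conj_exponent_gt0; have p0 : 0 < p by exact: lt_trans p1.
apply: (le_trans (conjugate_powR a0 b0 p'0 p0 conj_exponentE)).
have e := conj_exponentE; have i1 : 0 < p'^-1 by rewrite invr_gt0.
have i2 : 0 < p^-1 by rewrite invr_gt0.
apply: lerD; apply: ler_piMr; rewrite ?powR_ge0// -e.
  by rewrite lerDl ltW.
by rewrite lerDr ltW.
Qed.

Lemma young_scaled (K a b : R) : 0 < K -> 0 <= a -> 0 <= b ->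
  a * b <= K `^ (- p') * a `^ p' + K `^ p * b `^ p.
Proof.
move=> K0 a0 b0.
have := @young_le (K^-1 * a) (K * b); rewrite !mulr_ge0 ?invr_ge0 ?(ltW K0)//.
rewrite !powRM ?invr_ge0 ?(ltW K0)// => /(_ isT isT).
rewrite (_ : K^-1 `^ p' = K `^ (- p')); last first.
  by rewrite -powR_inv1 ?ltW// -powRrM mulN1r.
by apply: le_trans; rewrite mulrACA mulVf ?mul1r// gt_eqF.
Qed.

Lemma in_Lp_integrable r f : in_Lp mu D r f -> Rintegrable mu D (fun x => `|f x| `^ r).
Proof.
move=> [mf fr]; apply/integrableP; split.
  apply/measurable_EFinP; apply: (measurableT_comp (measurable_powR r)).
  exact: measurableT_comp.
rewrite (eq_integral (fun x => (`|f x| `^ r)%:E))// => x _ /=.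
by rewrite ger0_norm// powR_ge0.
Qed.

Lemma integrable_in_Lp r f : measurable_fun D f ->
  Rintegrable mu D (fun x => `|f x| `^ r) -> in_Lp mu D r f.
Proof.
move=> mf /integrableP[_ H]; split => //; move: H.
by under eq_integral do rewrite /= ger0_norm ?powR_ge0//.
Qed.

Lemma in_Lp_bounded r f C : 0 <= r -> (mu D < +oo)%E -> measurable_fun D f ->
  (forall x, D x -> `|f x| <= C) -> in_Lp mu D r f.
Proof.
move=> r0 muD mf fC; apply: integrable_in_Lp => //.
apply: (@Rintegrable_bounded _ _ _ _ _ _ _ (`|C| `^ r)) => //.
  apply: (measurableT_comp (measurable_powR r)).
  exact: measurableT_comp.
move=> x Dx; rewrite ger0_norm ?powR_ge0//.
by rewrite ge0_ler_powR ?nnegrE// (le_trans (fC x Dx))// ler_norm.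
Qed.

Lemma Rintegrable_pairing F g : in_Lp mu D p' F -> in_Lp mu D p g ->
  Rintegrable mu D (fun x => F x * g x).
Proof.
move=> LF Lg; apply: (@Rintegrable_le _ _ _ _ _ _ _
    (fun x => `|F x| `^ p' + `|g x| `^ p)) => //.
- by apply: measurable_funM; [case: LF|case: Lg].
- by apply: RintegrableD => //; exact: in_Lp_integrable.
- by move=> x Dx; rewrite normrM young_le.
Qed.

Lemma powR_ge0_large (e C : R) : 0 < e -> 0 <= C ->
  exists2 K, 0 < K & K `^ (- p') * C <= e.
Proof.
move=> e0 C0; have p'0 := conj_exponent_gt0.
pose K := ((C + 1) / e) `^ (p'^-1).
have Ce : 0 < (C + 1) / e by rewrite divr_gt0//; lra.
exists K; first exact: powR_gt0.
rewrite /K -powRrM mulrN mulVf ?gt_eqF// powR_inv1; last exact: ltW.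
rewrite invf_div -mulrA ler_piMr ?(ltW e0)// mulrC ler_pdivrMr; last by lra.
by rewrite mul1r; lra.
Qed.

Lemma pairing_cvg0 F (dk : nat -> T -> R) : in_Lp mu D p' F ->
  (forall k, measurable_fun D (dk k)) ->
  ((\int[mu]_(x in D) (`|dk k x| `^ p)%:E) @[k --> \oo] --> 0)%E ->
  (\forall k \near \oo, Rintegrable mu D (fun x => F x * dk k x)) /\
  \int[mu]_(x in D) (`|F x| * `|dk k x|) @[k --> \oo] --> 0.
Proof.
move=> LF mdk dk0.
have finite : \forall k \near \oo,
    (\int[mu]_(x in D) (`|dk k x| `^ p)%:E < +oo)%E.
  have /fine_fcvg := dk0; move: dk0 => /fine_cvgP[+ _] _.
  by apply: filterS => k; rewrite fin_num_abs => /(le_lt_trans (lee_abs _)).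
have Lp : \forall k \near \oo, in_Lp mu D p (dk k) by apply: filterS finite => k kfin; split; [exact: mdk|exact: kfin].
split; first by apply: filterS Lp => k Lk; exact: (Rintegrable_pairing LF Lk).
apply/cvgr0Pnorm_le => e e0.
have F0 : 0 <= \int[mu]_(x in D) (`|F x| `^ p').
  by apply: Rintegral_ge0 => x _; exact: powR_ge0.
have e20 : 0 < e / 2 by rewrite divr_gt0.
have [K K0 HK] := powR_ge0_large e20 F0.
have : \int[mu]_(x in D) (`|dk k x| `^ p) @[k --> \oo] --> 0 by exact: fine_cvg dk0.
have Kp : 0 < K `^ p by exact: powR_gt0.
move=> /cvgr0Pnorm_le/(_ (e / 2 / K `^ p)); rewrite !divr_gt0// => /(_ isT) H.
near=> k.
have Lk : in_Lp mu D p (dk k) by near: k.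
rewrite ger0_norm; last by apply: Rintegral_ge0 => x _; rewrite mulr_ge0.
have iF := in_Lp_integrable LF; have ik := in_Lp_integrable Lk.
apply: (@le_trans _ _ (\int[mu]_(x in D)
    (K `^ (- p') * `|F x| `^ p' + K `^ p * `|dk k x| `^ p))).
  apply: le_Rintegral => //.
  - apply: eq_integrable (Rintegrable_abs (Rintegrable_pairing LF Lk)) => //.
    by move=> x _ /=; rewrite normrM.
  - by apply: RintegrableD => //; exact: RintegrableZ.
  - by move=> x _; exact: young_scaled.
rewrite RintegralD//; try exact: RintegrableZ.
rewrite !RintegralZl//.
have : `|\int[mu]_(x in D) (`|dk k x| `^ p)| <= e / 2 / K `^ p by near: k.
rewrite ler_pdivlMr// mulrC => Hk.
rewrite [leRHS](splitr e); apply: lerD; first exact: HK.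
apply: le_trans Hk.
by rewrite ler_pM2l// ler_norm.
Unshelve. all: by end_near. Qed.

Lemma truncated_cvg0 f (dk : nat -> T -> R) C : Rintegrable mu D f ->
  (forall k, measurable_fun D (dk k)) -> (forall k x, D x -> 0 <= dk k x <= C) ->
  (\forall k \near \oo, Rintegrable mu D (dk k)) ->
  \int[mu]_(x in D) dk k x @[k --> \oo] --> 0 ->
  \int[mu]_(x in D) (`|f x| * dk k x) @[k --> \oo] --> 0.
Proof.
move=> jf mdk dC idk dk0.
pose g (j : nat) (x : T) : R := `|f x| - Num.min `|f x| j%:R.
have mf := Rintegrable_measurable jf.
have mg j : measurable_fun D (g j).
  apply: measurable_funB; first exact: measurableT_comp.
  by apply: measurable_minr => //; exact: measurableT_comp.
have g0 j x : 0 <= g j x by rewrite /g subr_ge0 ge_min lexx.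
have gf j x : g j x <= `|f x| by rewrite /g lerBlDr lerDl le_min normr_ge0 ler0n.
have ig j : Rintegrable mu D (g j).
  by apply: (Rintegrable_le mD (mg j) (Rintegrable_abs jf)) => x _; rewrite ger0_norm.
have gcvg : \int[mu]_(x in D) g j x @[j --> \oo] --> (0 : R).
  rewrite (_ : 0 = \int[mu]_(x in D) (0 : R)); last by rewrite Rintegral_cst// mul0r.
  apply: (Rdominated_convergence mD mg _ _ (Rintegrable_abs jf)) => //.
  - apply: aeW => x _; apply: cvg_near_cst.
    exists (Num.truncn `|f x|).+1 => // j /= jx.
    rewrite /g min_l ?subrr//; apply: ltW; apply: (lt_le_trans (truncnS_gt `|f x|)).
    by rewrite ler_nat.
  - by move=> j x _; rewrite ger0_norm.
apply: cvg0_squeeze_eps => e e0.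
pose C' := `|C| + 1; have C'0 : 0 < C' by rewrite ltr_pwDr.
have /cvgr0Pnorm_le/(_ (e / C')) := gcvg; rewrite divr_gt0// => /(_ isT).
move=> [j _ /(_ j (leqnn j))]; rewrite ger0_norm; last exact: Rintegral_ge0.
rewrite ler_pdivlMr// => Hj.
exists (fun k => j%:R * \int[mu]_(x in D) dk k x).
  rewrite -(mulr0 j%:R); apply: (@cvgM R) => //; exact: cvg_cst.
apply: filterS idk => k ik.
have dk0k x : D x -> 0 <= dk k x by move=> /(dC k)/andP[].
have ifd : Rintegrable mu D (fun x => `|f x| * dk k x).
  apply: (Rintegrable_le mD _ (RintegrableZ mD C' (Rintegrable_abs jf))).
    by apply: measurable_funM => //; exact: measurableT_comp.
  move=> x Dx; rewrite normrM normr_id mulrC ler_wpM2r// ger0_norm ?dk0k//.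
  have /andP[_ /le_trans] := dC k x Dx; apply.
  by rewrite /C' (le_trans (ler_norm C))// lerDl.
rewrite ger0_norm; last first.
  by apply: Rintegral_ge0 => x Dx; rewrite mulr_ge0 ?dk0k.
apply: (@le_trans _ _ (\int[mu]_(x in D) (C' * g j x + j%:R * dk k x))).
  apply: le_Rintegral => //.
    by apply: RintegrableD => //; exact: RintegrableZ.
  move=> x Dx; have := g0 j x; have -> : `|f x| = g j x + Num.min `|f x| j%:R.
    by rewrite /g subrK.
  have : Num.min `|f x| j%:R <= j%:R by rewrite ge_min lexx orbT.
  move: (Num.min _ _) => m mj gj0; rewrite mulrDl lerD//; last first.
    by rewrite ler_wpM2r// dk0k.
  rewrite mulrC ler_wpM2r//.
  have /andP[_ /le_trans] := dC k x Dx; apply.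
  by rewrite /C' (le_trans (ler_norm C))// lerDl.
rewrite RintegralD//; try exact: RintegrableZ.
by rewrite !RintegralZl// lerD2r mulrC.
Qed.

End lp_pairing.

(** * Cutoffs, box bumps and the fundamental lemma *)

Section cutoffs.
Context {R : realType}.
Implicit Types (a b e t : R) (n : nat).

Definition dstep a e t : R := step (e^-1 * (t - a)).

Lemma smooth_dstep a e : smooth (dstep a e).
Proof.
apply: smooth_comp; first exact: smooth_step.
by apply: smoothZ; apply: smoothB; [exact: smooth_id|exact: smooth_cst].
Qed.

Lemma dstep_ge0 a e t : 0 <= dstep a e t. Proof. exact: step_ge0. Qed.
Lemma dstep_le1 a e t : dstep a e t <= 1. Proof. exact: step_le1. Qed.

Lemma dstep_eq0 a e t : 0 < e -> t <= a -> dstep a e t = 0.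
Proof.
by move=> e0 ta; rewrite /dstep step_le0// mulr_ge0_le0 ?invr_ge0 ?(ltW e0)// subr_le0.
Qed.

Lemma dstep_eq1 a e t : 0 < e -> a + e <= t -> dstep a e t = 1.
Proof. by move=> e0 ta; rewrite /dstep step_ge1// mulrC ler_pdivlMr// mul1r; lra. Qed.

Lemma dstep_cvg a t :
  dstep a k.+1%:R^-1 t @[k --> \oo] --> (if a < t then 1 else 0 : R).
Proof.
apply: cvg_near_cst; case: ltP => [aat|ta].
  have : 0 < t - a by lra.
  move=> /exists_invn_lt[k0 k0t]; exists k0 => // k /= kk.
  apply: dstep_eq1; first by rewrite invr_gt0 ltr0n.
  rewrite -lerBrDl; apply: le_trans (ltW k0t).
  by rewrite lef_pV2 ?posrE ?ltr0n// ler_nat.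
by exists 0%N => // k _; apply: dstep_eq0; rewrite ?invr_gt0 ?ltr0n.
Qed.

Definition box_bump n (a b : 'I_n -> R) e (x : 'rV[R]_n) : R :=
  \prod_(i < n) (dstep (a i) e (x 0 i) * dstep (- b i) e (- x 0 i)).

Lemma box_bump_ge0 n (a b : 'I_n -> R) e x : 0 <= box_bump a b e x.
Proof. by apply: prodr_ge0 => i _; rewrite mulr_ge0 ?dstep_ge0. Qed.

Lemma box_bump_le1 n (a b : 'I_n -> R) e x : box_bump a b e x <= 1.
Proof.
apply: prodr_ile1 => i _; rewrite mulr_ge0 ?dstep_ge0//=.
by rewrite mulr_ile1 ?dstep_ge0 ?dstep_le1.
Qed.

Lemma test_fun_box_bump n (U : set 'rV[R]_n) (a b : 'I_n -> R) e : 0 < e ->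
  (forall x : 'rV[R]_n, (forall i, a i <= x 0 i <= b i) -> U x) ->
  test_fun U (box_bump a b e).
Proof.
move=> e0 HU; split.
  apply: smooth_prod => i; apply: smoothM.
    by apply: smooth_comp; [exact: smooth_dstep|exact: smooth_coord].
  by apply: smooth_comp; [exact: smooth_dstep|apply: smoothN; exact: smooth_coord].
exists [set x : 'rV[R]_n | forall i, `[a i, b i]%classic (x 0 i)].
  split; last by move=> x Hx; apply: HU => i; have := Hx i; rewrite /= in_itv.
  by apply: (@rV_compact _ _ (fun i => `[a i, b i]%classic)) => i; exact: segment_compact.
move=> x; rewrite prodf_seq_neq0 => /allP H i.
have := H i (mem_index_enum i); rewrite implyTb mulf_eq0 negb_or => /andP[h1 h2].
rewrite /= in_itv /=; apply/andP; split.
  by rewrite leNgt; apply: contra_neqN h1 => /ltW; exact: dstep_eq0.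
by rewrite leNgt; apply: contra_neqN h2 => /ltW h; apply: dstep_eq0; rewrite ?lerN2.
Qed.

Lemma box_bump_cvg n (a b : 'I_n -> R) x :
  box_bump a b k.+1%:R^-1 x @[k --> \oo] -->
    (\1_(prod_set (fun i => `]a i, b i[%classic)) x : R).
Proof.
rewrite (_ : \1_ _ x = \prod_(i < n)
    ((if a i < x 0 i then 1 else 0) * (if - b i < - x 0 i then 1 else 0))); last first.
  rewrite indicE; case: (boolP (x \in _)) => [|/negP] xin.
    rewrite big1// => i _; move: xin; rewrite inE => /(_ i).
    by rewrite /= in_itv /= ltrN2 => /andP[-> ->]; rewrite mulr1.
  suff [i /negP Hi] : exists i, ~ (a i < x 0 i < b i).
    rewrite (bigD1 i)//= ltrN2; move: Hi; rewrite negb_and.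
    by case: ltP => //= _; [case: ltP => // _ _|move=> _]; rewrite ?mul0r ?mulr0 ?mul0r.
  apply: contrapT => H; apply: xin; rewrite inE => i /=; rewrite in_itv /=.
  by apply: contrapT => Hi; apply: H; exists i.
rewrite /box_bump; elim: (index_enum _) => [|i s IH].
  by under eq_fun do rewrite big_nil; rewrite big_nil; exact: cvg_cst.
under eq_fun do rewrite big_cons; rewrite big_cons.
by apply: (@cvgM R) => //; apply: (@cvgM R); exact: dstep_cvg.
Qed.

Definition sqdist n (y x : 'rV[R]_n) : R := dotp (x - y) (x - y).

Lemma smooth_sqdist n (y : 'rV[R]_n) : smooth (sqdist y).
Proof.
apply: smooth_sum => i; apply: smoothM.
  by under eq_fun do rewrite !mxE; apply: smoothD; [exact: smooth_coord|exact: smooth_cst].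
by under eq_fun do rewrite !mxE; apply: smoothD; [exact: smooth_coord|exact: smooth_cst].
Qed.

Definition cutoff n (y : 'rV[R]_n) (a b : R) (x : 'rV[R]_n) : R :=
  dstep (- b) (b - a) (- sqdist y x).

Lemma cutoff_le1 n (y : 'rV[R]_n) a b x : cutoff y a b x <= 1.
Proof. exact: dstep_le1. Qed.

Lemma cutoff_eq1 n (y : 'rV[R]_n) a b x : a < b -> sqdist y x <= a -> cutoff y a b x = 1.
Proof. by move=> ab xa; rewrite /cutoff dstep_eq1//; lra. Qed.

Lemma cutoff_eq0 n (y : 'rV[R]_n) a b x : a < b -> b <= sqdist y x -> cutoff y a b x = 0.
Proof. by move=> ab xa; rewrite /cutoff dstep_eq0//; lra. Qed.

Lemma sqdist_enorm n (y x : 'rV[R]_n) : sqdist y x = enorm (x - y) ^+ 2.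
Proof. by rewrite enorm_sqr. Qed.

Lemma coord_le_enorm n (x : 'rV[R]_n) i : `|x 0 i| <= enorm x.
Proof.
rewrite -(@ler_pXn2r _ 2)// ?nnegrE ?enorm_ge0// real_normK ?num_real// enorm_sqr.
rewrite /dotp (bigD1 i)//= expr2 lerDl; apply: sumr_ge0 => j _.
by rewrite -expr2 sqr_ge0.
Qed.

Lemma bounded_enorm_le n (y : 'rV[R]_n) r : bounded_set [set x | enorm (x - y) <= r].
Proof.
exists (r + `|y|); split; rewrite ?num_real// => M rM x /= xr.
have r0 : 0 <= r by exact: le_trans (enorm_ge0 _) xr.
apply: le_trans (ltW rM); rewrite -[x](subrK y).
apply: le_trans (ler_normD _ _) _; rewrite lerD2r; apply: rV_norm_le => // i.
exact: le_trans (coord_le_enorm _ _) xr.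
Qed.

Lemma compact_enorm_le n (y : 'rV[R]_n) r : compact [set x | enorm (x - y) <= r].
Proof.
apply: bounded_closed_compact; first exact: bounded_enorm_le.
apply: (@preimage_closed _ _ (fun x : 'rV[R]_n => enorm (x - y)) [set t | t <= r]).
  by move=> x _; exact: continuous_enormB.
exact: closed_le.
Qed.

Lemma test_fun_cutoff n (y : 'rV[R]_n) a r : a < r ^+ 2 -> 0 < r ->
  test_fun (eball y r) (cutoff y a ((a + r ^+ 2) / 2)).
Proof.
move=> ar r0; set b := (a + _) / 2; have ab : a < b by rewrite /b; lra.
have br : b < r ^+ 2 by rewrite /b; lra.
split.
  apply: smooth_comp; first exact: smooth_dstep.
  by apply: smoothN; exact: smooth_sqdist.
exists [set x | enorm (x - y) <= Num.sqrt b].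
  split; first exact: compact_enorm_le.
  move=> x /= /le_lt_trans; apply; rewrite -[ltRHS]gtr0_norm// -sqrtr_sqr.
  by rewrite ltr_sqrt ?exprn_gt0.
move=> x; apply: contra_neqP => /= /negP; rewrite -ltNge => h.
apply: cutoff_eq0 => //; rewrite sqdist_enorm.
have [b0|b0] := leP 0 b; last by rewrite (le_trans (ltW b0))// sqr_ge0.
by rewrite -(sqr_sqrtr b0) ler_pXn2r// ?nnegrE ?sqrtr_ge0 ?enorm_ge0// ltW.
Qed.

End cutoffs.

Section fundamental_lemma.
Context {R : realType} (n : nat).
Local Notation mu := (lebesgue_rV R n).

Definition open_boxes : set (set 'rV[R]_n) :=
  [set A | exists a b : 'I_n -> R, A = prod_set (fun i => `]a i, b i[%classic)].

Lemma measurable_open_box (a b : 'I_n -> R) :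
  measurable (prod_set (fun i => `]a i, b i[%classic)).
Proof. by apply: measurable_prod_set => i; exact: measurable_itv. Qed.

Lemma open_boxes_generate : @measurable _ 'rV[R]_n = <<s open_boxes >>.
Proof.
have openG (U : set 'rV[R]_n) : open U -> <<s open_boxes >> U.
  move=> oU.
  have /= := @measurable_countable_base _ (g_sigma_algebraType open_boxes)
    ('rV[rat]_n * nat)%type (@rat_cube R n) U; apply.
    by move=> i; apply: sub_sigma_algebra; eexists; eexists.
  move=> x Ux; have [e [e0 He]] := open_rat_cube oU Ux.
  have [k /He[c [cx cU]]] := exists_invn_lt e0; exists (c, k); split=> // y yc.
  apply: cU => j; have := yc j.
  by rewrite /= in_itv /= -ltr_distlC distrC => /ltW.
apply/seteqP; split=> A.
  apply: smallest_sub; first exact: smallest_sigma_algebra.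
  move=> _ [i [B [mB ->]]].
  have mc : measurable_fun [set: g_sigma_algebraType open_boxes]
      (fun x : g_sigma_algebraType open_boxes => (x : 'rV[R]_n) 0 i).
    apply: (measurability _ (RGenOInfty.measurableE R)) => // _ [_ [a ->]] <-.
    rewrite setTI preimage_itvoy; apply: openG.
    apply: (open_comp (f := fun x : 'rV[R]_n => x 0 i) (D := [set t | a < t])).
      by move=> x _; exact: (@coord_continuous R).
    exact: open_gt.
  by have := mc measurableT B mB; rewrite setTI.
apply: smallest_sub; first exact: sigma_algebra_measurable.
by move=> _ [a [b ->]]; exact: measurable_open_box.
Qed.

Lemma setI_open_box (a b a' b' : 'I_n -> R) :
  prod_set (fun i => `]a i, b i[%classic) `&` prod_set (fun i => `]a' i, b' i[%classic) =
  prod_set (fun i => `]Num.max (a i) (a' i), Num.min (b i) (b' i)[%classic).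
Proof.
apply/seteqP; split=> x.
  move=> [h h'] i; have := h i; have := h' i; rewrite /= !in_itv /=.
  by rewrite gt_max lt_min => /andP[-> ->] /andP[-> ->].
move=> h; split=> i; have := h i; rewrite /= !in_itv /= gt_max lt_min.
  by move=> /andP[/andP[-> _] /andP[-> _]].
by move=> /andP[/andP[_ ->] /andP[_ ->]].
Qed.

Lemma setI_closed_open_boxes : setI_closed open_boxes.
Proof.
by move=> _ _ [a [b ->]] [a' [b' ->]]; rewrite setI_open_box; eexists; eexists.
Qed.

Lemma integral_box_eq0 (U : set 'rV[R]_n) (f : 'rV[R]_n -> R) (a b : 'I_n -> R) :
  measurable U -> Rintegrable mu U f ->
  (forall phi, test_fun U phi -> \int[mu]_(x in U) (f x * phi x) = 0) ->
  (forall x : 'rV[R]_n, (forall i, a i <= x 0 i <= b i) -> U x) ->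
  (\int[mu]_(x in prod_set (fun i => `]a i, b i[%classic)) (f x)%:E = 0)%E.
Proof.
move=> mU jf Hf HU; set B := prod_set _.
have BU : B `<=` U.
  by move=> x xB; apply: HU => i; have := xB i; rewrite /= in_itv /= => /andP[/ltW-> /ltW->].
have mB : measurable B by exact: measurable_open_box.
have mf := Rintegrable_measurable jf.
have k0 (k : nat) : 0 < k.+1%:R^-1 :> R by rewrite invr_gt0 ltr0n.
have sbb e : smooth (box_bump a b e).
  apply: smooth_prod => i; apply: smoothM.
    by apply: smooth_comp; [exact: smooth_dstep|exact: smooth_coord].
  by apply: smooth_comp; [exact: smooth_dstep|apply: smoothN; exact: smooth_coord].
have mbb e : measurable_fun U (box_bump a b e).
  apply: measurable_funTS; apply: continuousT_measurable_rV.
  exact: smooth_continuous.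
have : \int[mu]_(x in U) (f x * box_bump a b k.+1%:R^-1 x) @[k --> \oo] -->
    \int[mu]_(x in U) (f x * \1_B x).
  apply: (Rdominated_convergence mU _ _ _ (Rintegrable_abs jf)).
  - by move=> k; apply: measurable_funM.
  - by apply: measurable_funM => //; exact: measurable_indic.
  - by apply: aeW => x _; apply: (@cvgM R); [exact: cvg_cst|exact: box_bump_cvg].
  - move=> k x _; rewrite normrM ler_piMr// ger0_norm ?box_bump_le1//.
    exact: box_bump_ge0.
rewrite (_ : (fun k => _) = (fun=> 0)); last first.
  by apply/funext => k; apply: Hf; exact: test_fun_box_bump (k0 k) HU.
have E : \int[mu]_(x in U) (f x * \1_B x) = \int[mu]_(x in B) f x.
  rewrite [RHS]Rintegral_mkcond [LHS]Rintegral_mkcond; apply: eq_Rintegral => x _.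
  rewrite !patchE indicE; have [xB|xB] := boolP (x \in B).
    by rewrite mulr1 ifT// inE; apply: BU; rewrite inE in xB.
  by rewrite mulr0; case: ifP.
rewrite E => /(cvg_unique _ (cvg_cst 0)) => /(_ (@norm_hausdorff _ _)) E0.
rewrite Rintegral_EFin -?E0//.
exact: integrableS BU jf.
Qed.

Lemma fundamental_lemma (U : set 'rV[R]_n) (f : 'rV[R]_n -> R) :
  open U -> Rintegrable mu U f ->
  (forall phi, test_fun U phi -> \int[mu]_(x in U) (f x * phi x) = 0) ->
  {ae mu, forall x, U x -> f x = 0}.
Proof.
move=> oU jf Hf; have mU := open_measurable_rV oU.
have Hcube (c : 'rV[rat]_n) (k : nat) : (forall y : 'rV[R]_n,
      (forall j, `|y 0 j - ratr (c 0 j)| <= k.+1%:R^-1) -> U y) ->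
    {ae mu, forall x, rat_cube (c, k) x -> f x = 0}.
  move=> HU; set Q := rat_cube (c, k).
  have mQ : measurable Q by exact: measurable_rat_cube.
  have QU : Q `<=` U.
    move=> y yc; apply: HU => j; have := yc j.
    by rewrite /= in_itv /= -ltr_distlC distrC => /ltW.
  have jQ : Rintegrable mu Q f by exact: integrableS jf.
  have boxQ : open_boxes Q by eexists; eexists.
  pose P := [set A | (\int[mu]_(x in Q `&` A) (f x)%:E = 0)%E].
  have jI A : measurable A -> Rintegrable mu (Q `&` A) f.
    by move=> mA; apply: (integrableS mQ) jQ => //; exact: measurableI.
  have boxP A : open_boxes A -> P A.
    move=> [a [b ->]]; rewrite /P /= /Q /rat_cube setI_open_box.
    apply: (integral_box_eq0 mU jf Hf) => x Hx; apply: HU => j.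
    have := Hx j; rewrite /= ge_max le_min => /andP[/andP[h1 _] /andP[h2 _]].
    by rewrite distrC ler_distlC; apply/andP.
  have PT : P setT.
    rewrite /P /= setIT; have [a [b E]] := boxQ.
    by have := boxP _ boxQ; rewrite /P /= setIid.
  have PC A : measurable A -> P A -> P (~` A).
    move=> mA PA; have := PT; rewrite /P /= setIT -[X in integral _ X](setUIDK Q A).
    rewrite integral_setU_EFin//.
    - by move: PA; rewrite /P /= => ->; rewrite add0e setDE.
    - exact: measurableI.
    - exact: measurableD.
    - by rewrite setUIDK; exact: Rintegrable_measurable jQ.
    - by rewrite disj_set2E; apply/eqP; rewrite setDE setIACA setICr setI0.
  have PU (F : (set 'rV[R]_n)^nat) : (forall k, measurable (F k)) ->
      trivIset setT F -> (forall k, P (F k)) -> P (\bigcup_k F k).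
    move=> mF tF PF; rewrite /P /= setI_bigcupr integral_bigcup.
    - by rewrite eseries0// => i _ _; exact: PF.
    - exact: trivIset_setIl.
    - by move=> i; exact: measurableI.
    - by rewrite -setI_bigcupr; apply: jI; exact: bigcupT_measurable.
  have Pall := dynkin_induction open_boxes_generate setI_closed_open_boxes PT boxP PC PU.
  have mP A : measurable A -> P A by rewrite open_boxes_generate; exact: Pall.
  have mfQ := Rintegrable_measurable jQ.
  pose A1 := Q `&` [set x | 0 < f x]; pose A2 := Q `&` [set x | f x < 0].
  have mA1 : measurable A1.
    by have := mfQ mQ `]0, +oo[%classic (measurable_itv _); rewrite preimage_itvoy.
  have mA2 : measurable A2.
    by have := mfQ mQ `]-oo, 0[%classic (measurable_itv _); rewrite preimage_itvNyo.
  have ae1 : {ae mu, forall x, A1 x -> f x = 0}.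
    have i1 : (\int[mu]_(x in A1) `|(f x)%:E| = 0)%E.
      have := mP _ mA1; rewrite /P /= /A1 setIA setIid => E; rewrite -[RHS]E.
      by apply: eq_integral => x; rewrite inE => -[_ fx] /=; rewrite ger0_norm//; exact: ltW.
    have [|/(_ i1) + _] := @ae_eq_integral_abs _ _ _ mu A1 mA1 (EFin \o f).
      by apply/measurable_EFinP; apply: measurable_funS mfQ => // x [].
    by apply: filterS => x h /h [].
  have ae2 : {ae mu, forall x, A2 x -> f x = 0}.
    have i2 : (\int[mu]_(x in A2) `|(f x)%:E| = 0)%E.
      have := mP _ mA2; rewrite /P /= /A2 setIA setIid => E.
      transitivity (\int[mu]_(x in A2) - (f x)%:E)%E.
        by apply: eq_integral => x; rewrite inE => -[_ fx] /=; rewrite ltr0_norm.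
      have jA2 : Rintegrable mu A2 f by apply: (integrableS mQ mA2 _ jQ) => x [].
      rewrite integralN; first by rewrite /A2 E oppe0.
      exact: integrable_add_def jA2.
    have [|/(_ i2) + _] := @ae_eq_integral_abs _ _ _ mu A2 mA2 (EFin \o f).
      by apply/measurable_EFinP; apply: measurable_funS mfQ => // x [].
    by apply: filterS => x h /h [].
  apply: filterS2 ae1 ae2 => x h1 h2 Qx.
  by have [fx|fx|->//] := ltgtP (f x) 0; [apply: h2|apply: h1].
pose good (i : 'rV[rat]_n * nat) := forall y : 'rV[R]_n,
  (forall j, `|y 0 j - ratr (i.1 0 j)| <= i.2.+1%:R^-1) -> U y.
have : {ae mu, forall x, forall m : nat,
    if @unpickle ('rV[rat]_n * nat)%type m is Some i then
      good i -> rat_cube i x -> f x = 0 else True}.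
  apply: ae_foralln => m; case: unpickle => [[c k]|]; last exact: aeW.
  have [HU|nHU] := pselect (good (c, k)); last by apply: aeW => x /nHU.
  by apply: filterS (Hcube c k HU) => x h _.
apply: filterS => x Hx Ux; have [e [e0 He]] := open_rat_cube oU Ux.
have [k /He[c [cx cU]]] := exists_invn_lt e0.
by have := Hx (pickle (c, k)); rewrite pickleK; apply.
Qed.

End fundamental_lemma.

(** * Fubini on cylinders and approximate identities *)

Section fubini_real.
Context d1 d2 (T1 : measurableType d1) (T2 : measurableType d2) {R : realType}.
Variables (m1 : {sigma_finite_measure set T1 -> \bar R}).
Variables (m2 : {sigma_finite_measure set T2 -> \bar R}).
Variables (A : set T1) (B : set T2).
Hypotheses (mA : measurable A) (mB : measurable B).

Lemma measurable_slice1 (f : T1 * T2 -> R) (t : T2) :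
  measurable_fun (A `*` B) f -> B t -> measurable_fun A (fun x => f (x, t)).
Proof.
move=> mf Bt; apply: (@measurable_comp _ _ _ _ _ _ (A `*` B) f A (fun x => (x, t))) => //.
- exact: measurableX.
- by move=> _ [x Ax <-].
- by apply: measurable_funTS; exact: pair2_measurable.
Qed.

Lemma measurable_slice2 (f : T1 * T2 -> R) (x : T1) :
  measurable_fun (A `*` B) f -> A x -> measurable_fun B (fun t => f (x, t)).
Proof.
move=> mf Ax; apply: (@measurable_comp _ _ _ _ _ _ (A `*` B) f B (fun t => (x, t))) => //.
- exact: measurableX.
- by move=> _ [t Bt <-].
- by apply: measurable_funTS; exact: pair1_measurable.
Qed.

Lemma Rfubini2 (f : T1 * T2 -> R) : Rintegrable (m1 \x m2)%E (A `*` B) f ->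
  [/\ Rintegrable m2 B (fun t => \int[m1]_(x in A) f (x, t)),
      {ae m2, forall t, B t -> Rintegrable m1 A (fun x => f (x, t))} &
      \int[(m1 \x m2)%E]_(z in A `*` B) f z =
      \int[m2]_(t in B) \int[m1]_(x in A) f (x, t)].
Proof.
move=> jf; have mAB : measurable (A `*` B) by exact: measurableX.
pose g := (EFin \o f) \_ (A `*` B).
have jg : (m1 \x m2)%E.-integrable setT g by exact: (integrable_mkcond _ mAB).1.
have gB t : B t -> (fun x => g (x, t)) = (EFin \o (fun x => f (x, t))) \_ A.
  move=> Bt; apply/funext => x; rewrite /g !patchE; congr (if _ then _ else _).
  by apply/idP/idP; rewrite !inE; [case|move=> Ax; split].
have gNB t : ~ B t -> (fun x => g (x, t)) = cst 0%E.
  move=> Bt; apply/funext => x; rewrite /g !patchE ifF//.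
  by apply/negP; rewrite inE => -[].
pose G t := (\int[m1]_x g (x, t))%E.
have mg : measurable_fun setT g by exact: measurable_int jg.
have jG : m2.-integrable setT G.
  apply/integrableP; split; first exact: measurable_fubini_G jg.
  apply: le_lt_trans ((integrable21ltyP m1 m2 mg).1 jg).
  apply: ge0_le_integral => //.
  - by apply: measurableT_comp => //; exact: measurable_fubini_G jg.
  - apply: (measurable_fun_fubini_tonelli_G (abse \o g)).
      exact: measurableT_comp.
    by move=> z; exact: abse_ge0.
  - move=> t _; apply: le_abse_integral => //.
    by apply: (measurableT_comp mg); exact: pair2_measurable.
have GE t : B t -> G t = (\int[m1]_(x in A) (f (x, t))%:E)%E.
  by move=> Bt; rewrite /G gB// -integral_mkcond.
have fG t : B t -> fine (G t) = \int[m1]_(x in A) f (x, t) by move=> /GE ->.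
have jGB : m2.-integrable B G by exact: integrableS jG.
have mfG : measurable_fun B (fine \o G).
  by apply: (measurableT_comp (fine_measurable measurableT)); exact: measurable_int jGB.
have jfG : Rintegrable m2 B (fine \o G).
  apply: (le_integrable mB _ _ jGB); first exact/measurable_EFinP.
  by move=> t Bt /=; case: (G t) => [r| |] //=; rewrite ?normr0 ?leey.
have aeG : {ae m2, forall t, B t -> G t \is a fin_num} by exact: integrable_ae jGB.
split.
- by apply: eq_integrable jfG => // t; rewrite inE => Bt /=; rewrite fG.
- have := ae_integrable2 jg; apply: filterS => t h Bt.
  by move: h; rewrite gB// => /(integrable_mkcond _ mA).
- rewrite {1}/Rintegral; transitivity (fine (\int[m2]_(t in B) G t)%E).
    congr fine; rewrite integral_mkcond -(integral21_prod_meas1 jg) [RHS]integral_mkcond.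
    apply: eq_integral => t _; rewrite patchE; case: ifPn => // /negP tB.
    transitivity (G t); first by [].
    by rewrite /G gNB ?integral0// => Bt; apply: tB; rewrite inE.
  rewrite [RHS]/Rintegral; congr fine.
  transitivity (\int[m2]_(t in B) (fine (G t))%:E)%E.
    apply: ae_eq_integral => //; first exact: measurable_int jGB.
      exact: measurable_int jfG.
    by apply: filterS aeG => t h Bt /=; rewrite fineK// h.
  by apply: eq_integral => t; rewrite inE => Bt; rewrite fG.
Qed.

Lemma Rfubini1 (f : T1 * T2 -> R) : Rintegrable (m1 \x m2)%E (A `*` B) f ->
  [/\ Rintegrable m1 A (fun x => \int[m2]_(t in B) f (x, t)),
      {ae m1, forall x, A x -> Rintegrable m2 B (fun t => f (x, t))} &
      \int[(m1 \x m2)%E]_(z in A `*` B) f z =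
      \int[m1]_(x in A) \int[m2]_(t in B) f (x, t)].
Proof.
move=> jf; have mAB : measurable (A `*` B) by exact: measurableX.
pose g := (EFin \o f) \_ (A `*` B).
have jg : (m1 \x m2)%E.-integrable setT g by exact: (integrable_mkcond _ mAB).1.
have gA x : A x -> (fun t => g (x, t)) = (EFin \o (fun t => f (x, t))) \_ B.
  move=> Ax; apply/funext => t; rewrite /g !patchE; congr (if _ then _ else _).
  by apply/idP/idP; rewrite !inE; [case|move=> Bt; split].
have gNA x : ~ A x -> (fun t => g (x, t)) = cst 0%E.
  move=> Ax; apply/funext => t; rewrite /g !patchE ifF//.
  by apply/negP; rewrite inE => -[].
pose G x := (\int[m2]_t g (x, t))%E.
have jG : m1.-integrable setT G by exact: integrable_fubini_F.
have GE x : A x -> G x = (\int[m2]_(t in B) (f (x, t))%:E)%E.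
  by move=> Ax; rewrite /G gA// -integral_mkcond.
have fG x : A x -> fine (G x) = \int[m2]_(t in B) f (x, t) by move=> /GE ->.
have jGA : m1.-integrable A G by exact: integrableS jG.
have mfG : measurable_fun A (fine \o G).
  by apply: (measurableT_comp (fine_measurable measurableT)); exact: measurable_int jGA.
have jfG : Rintegrable m1 A (fine \o G).
  apply: (le_integrable mA _ _ jGA); first exact/measurable_EFinP.
  by move=> t Bt /=; case: (G t) => [r| |] //=; rewrite ?normr0 ?leey.
have aeG : {ae m1, forall t, A t -> G t \is a fin_num} by exact: integrable_ae jGA.
split.
- by apply: eq_integrable jfG => // t; rewrite inE => Bt /=; rewrite fG.
- have := ae_integrable1 jg; apply: filterS => t h Bt.
  by move: h; rewrite gA// => /(integrable_mkcond _ mB).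
- rewrite {1}/Rintegral; transitivity (fine (\int[m1]_(t in A) G t)%E).
    congr fine; rewrite integral_mkcond -(integral12_prod_meas1 jg) [RHS]integral_mkcond.
    apply: eq_integral => t _; rewrite patchE; case: ifPn => // /negP tB.
    transitivity (G t); first by [].
    by rewrite /G gNA ?integral0// => Bt; apply: tB; rewrite inE.
  rewrite [RHS]/Rintegral; congr fine.
  transitivity (\int[m1]_(t in A) (fine (G t))%:E)%E.
    apply: ae_eq_integral => //; first exact: measurable_int jGA.
      exact: measurable_int jfG.
    by apply: filterS aeG => t h Bt /=; rewrite fineK// h.
  by apply: eq_integral => t; rewrite inE => Bt; rewrite fG.
Qed.

End fubini_real.

Section approximate_identity.
Context {R : realType}.
Implicit Types (a b T : R).
Local Notation leb := (@lebesgue_measure R).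

Lemma is_derive_dstep (a e t : R) : is_derive t 1 (dstep a e) (e^-1 * 'D_1 step (e^-1 * (t - a))).
Proof.
have h : is_derive t 1 (fun t : R => e^-1 * (t - a)) e^-1.
  apply: (is_derive_eq (is_deriveZ e^-1 (is_deriveB (is_derive_id t 1) (is_derive_cst a t 1)))).
  by rewrite subr0 [_ *: _]mulr1.
rewrite [X in is_derive _ _ _ X]mulrC.
have H := is_derive_comp1 h (smooth_is_derive (e^-1 * (t - a)) 1 smooth_step).
refine H.
Qed.

Lemma dstep_derive_bound : exists2 C : R, 0 < C &
  forall a e t : R, 0 < e -> `|'D_1 (dstep a e) t| <= C / e /\
    (~ (a <= t <= a + e) -> 'D_1 (dstep a e) t = 0).
Proof.
have cs : continuous (fun t : R => 'D_1 step t).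
  by apply: smooth_continuous; apply: smooth_derive; exact: smooth_step.
have [C C0 HC] := continuous_bounded_on_compact (@segment_compact R 0 1) cs.
have C1 : 0 < C + 1 by lra.
exists (C + 1) => // a e t e0; have [_ ->] := is_derive_dstep a e t.
have e10 : 0 < e^-1 by rewrite invr_gt0.
have out x : ~ (0 <= x <= 1) -> 'D_1 (step : R -> R) x = 0.
  move=> /negP; rewrite negb_and -!ltNge => /orP[x0|x1].
    rewrite -(derive_cst (0 : R) x 1); apply: near_eq_derive.
    by apply: filterS (lt_nbhsl x0) => y /ltW; exact: step_le0.
  rewrite -(derive_cst (1 : R) x 1); apply: near_eq_derive.
  by apply: filterS (lt_nbhsr x1) => y /ltW; exact: step_ge1.
split.
  rewrite normrM gtr0_norm// mulrC ler_wpM2r ?(ltW e10)//.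
  have [xin|/out->] := pselect (0 <= e^-1 * (t - a) <= 1).
    by rewrite (le_trans (HC _ _))//= ?in_itv//= lerDl.
  by rewrite normr0 ltW.
move=> tout; rewrite out ?mulr0// => /andP[h1 h2]; apply: tout.
move: h1 h2; rewrite pmulr_rge0// subr_ge0 => ->.
by rewrite mulrC ler_pdivrMr// mul1r lerBlDl.
Qed.

Lemma ftc_oo (F f : R -> R) a b : a < b -> (forall x : R, is_derive x 1 F (f x)) ->
  continuous f -> \int[leb]_(x in `]a, b[) f x = F b - F a.
Proof.
move=> ab dF cf; have := ftc ab dF cf => E.
rewrite /Rintegral -[RHS]/(fine (F b - F a)%:E); congr fine; rewrite -E.
rewrite integral_itv_bndoo//; apply: measurable_funTS.
by apply/measurable_EFinP; exact: (continuous_measurable_fun cf).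
Qed.

Lemma lebesgue_itv_oo_lty a b : (leb `]a, b[ < +oo)%E.
Proof. by rewrite lebesgue_measure_itv /=; case: ifP => // _; rewrite -EFinB ltry. Qed.

Lemma delta_cvg (I : R -> R) (a T B : R) : 0 < a < T -> measurable_fun `]0, T[ I ->
  (forall t, 0 < t < T -> `|I t| <= B) -> {for a, continuous I} ->
  \int[leb]_(t in `]0, T[) (I t * 'D_1 (dstep a k.+1%:R^-1) t) @[k --> \oo] --> I a.
Proof.
move=> /andP[a0 aT] mI IB cI; have [C C0 HC] := dstep_derive_bound.
have mT : measurable (`]0, T[ : set R) by exact: measurable_itv.
have muT := lebesgue_itv_oo_lty 0 T.
have cD k : continuous (fun t : R => 'D_1 (dstep a k.+1%:R^-1) t).
  by apply: smooth_continuous; apply: smooth_derive; exact: smooth_dstep.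
have mD k : measurable_fun `]0, T[ (fun t : R => 'D_1 (dstep a k.+1%:R^-1) t).
  by apply: measurable_funTS; exact: continuous_measurable_fun.
have k0 (k : nat) : 0 < k.+1%:R^-1 :> R by rewrite invr_gt0 ltr0n.
have jD k : Rintegrable leb `]0, T[ (fun t : R => 'D_1 (dstep a k.+1%:R^-1) t).
  have := @Rintegrable_bounded _ _ _ leb _ mT _ (C / k.+1%:R^-1) muT (mD k).
  by apply=> t _; exact: (HC a _ t (k0 k)).1.
have jID k : Rintegrable leb `]0, T[ (fun t : R => I t * 'D_1 (dstep a k.+1%:R^-1) t).
  apply: (@RintegralM_bounded _ _ _ leb _ mT I _ B mI _ (jD k)) => t /=.
  by rewrite in_itv => /IB; exact.
apply: cvg_sub0; apply/cvgr0Pnorm_le => e e0.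
have eC : 0 < e / C by rewrite divr_gt0.
move/cvgrPdist_le : cI => /(_ _ eC)/nbhs_ballP[d /= d0 Id].
have : 0 < Num.min d (T - a) by rewrite lt_min d0 subr_gt0.
move=> /exists_invn_lt[k1 hk1]; exists k1 => // k /= kk1.
have [kd kT] : k.+1%:R^-1 < d /\ a + k.+1%:R^-1 < T.
  have : k.+1%:R^-1 <= k1.+1%:R^-1 :> R by rewrite lef_pV2 ?posrE ?ltr0n// ler_nat.
  by move=> /le_lt_trans/(_ hk1); rewrite lt_min ltrBrDl => /andP[].
move: (k.+1%:R^-1 : R) (k0 k) (jD k) (jID k) (mD k) kd kT {cD} => h h0 jDk jIDk mDk kd kT.
have E1 : \int[leb]_(t in `]0, T[) 'D_1 (dstep a h) t = 1.
  have cDh : continuous (fun t : R => 'D_1 (dstep a h) t).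
    by apply: smooth_continuous; apply: smooth_derive; exact: smooth_dstep.
  have := ftc_oo (lt_trans a0 aT) (fun x => smooth_is_derive x 1 (smooth_dstep a h)) cDh.
  by rewrite (dstep_eq1 h0 (ltW kT)) (dstep_eq0 h0 (ltW a0)) subr0.
have -> : I a = \int[leb]_(t in `]0, T[) (I a * 'D_1 (dstep a h) t).
  by rewrite RintegralZl// E1 mulr1.
have jIa : Rintegrable leb `]0, T[ (fun t : R => I a * 'D_1 (dstep a h) t).
  exact: RintegrableZ.
rewrite -RintegralB//; apply: le_trans.
  by apply: le_normr_Rintegral => //; exact: RintegrableB.
have mab : measurable (`[a, a + h]%classic : set R) by exact: measurable_itv.
have jc : Rintegrable leb `]0, T[ (fun t : R => e / h * \1_(`[a, a + h]%classic) t).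
  apply: RintegrableZ => //.
  have m1 : measurable_fun `]0, T[ (\1_(`[a, a + h]%classic) : R -> R).
    by apply: measurable_indic.
  apply: (@Rintegrable_bounded _ _ _ leb _ mT _ 1 muT m1) => t _.
  by rewrite indicE ger0_norm ?ler0n// lern1 leq_b1.
apply: (@le_trans _ _ (\int[leb]_(t in `]0, T[) (e / h * \1_(`[a, a + h]%classic) t))).
  apply: le_Rintegral => //.
    by apply: Rintegrable_abs => //; exact: RintegrableB.
  move=> t /=; rewrite in_itv /= => tT; rewrite -mulrBl normrM indicE.
  have [D1 D2] := HC a h t h0.
  have [tin|tout] := pselect (a <= t <= a + h); last first.
    by rewrite D2// normr0 mulr0 mulr_ge0// ltW// divr_gt0.
  have -> : t \in `[a, a + h]%classic by rewrite inE /= in_itv.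
  rewrite mulr1.
  have -> : e / h = e / C * (C / h) by field; rewrite !gt_eqF.
  apply: ler_pM => //; rewrite distrC; apply: Id; rewrite /ball /= distrC ger0_norm.
    by case/andP: tin; lra.
  by case/andP: tin; lra.
have -> : \int[leb]_(t in `]0, T[) (e / h * \1_(`[a, a + h]%classic) t) =
    e / h * fine (leb `[a, a + h]%classic).
  rewrite -Rintegral_cst// Rintegral_mkcond [RHS]Rintegral_mkcond.
  apply: eq_Rintegral => t _; rewrite !patchE indicE.
  have [tin|tout] := boolP (t \in `[a, a + h]%classic).
    rewrite mulr1 ifT// inE /= in_itv /=; move: tin; rewrite inE /= in_itv /= => /andP[t1 t2].
    by apply/andP; split; lra.
  by rewrite mulr0; case: ifP.
rewrite lebesgue_measure_itv /= lte_fin ifT; last by lra.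
by rewrite -EFinB /= addrAC subrr add0r divfK// gt_eqF.
Qed.

End approximate_identity.

(** * Euclidean algebra *)

Section euclidean_algebra.
Context {R : realType}.

Lemma dotpC n (x y : 'rV[R]_n) : dotp x y = dotp y x.
Proof. by apply: eq_bigr => i _; rewrite mulrC. Qed.

Lemma dotpDl n (x y z : 'rV[R]_n) : dotp (x + y) z = dotp x z + dotp y z.
Proof. by rewrite /dotp -big_split; apply: eq_bigr => i _; rewrite !mxE mulrDl. Qed.

Lemma dotpZl n c (x z : 'rV[R]_n) : dotp (c *: x) z = c * dotp x z.
Proof. by rewrite /dotp mulr_sumr; apply: eq_bigr => i _; rewrite !mxE mulrA. Qed.

Lemma dotpNl n (x z : 'rV[R]_n) : dotp (- x) z = - dotp x z.
Proof. by rewrite -scaleN1r dotpZl mulN1r. Qed.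

Lemma dotpBl n (x y z : 'rV[R]_n) : dotp (x - y) z = dotp x z - dotp y z.
Proof. by rewrite dotpDl dotpNl. Qed.

Lemma dotpDr n (x y z : 'rV[R]_n) : dotp z (x + y) = dotp z x + dotp z y.
Proof. by rewrite dotpC dotpDl !(dotpC z). Qed.

Lemma dotpZr n c (x z : 'rV[R]_n) : dotp z (c *: x) = c * dotp z x.
Proof. by rewrite dotpC dotpZl (dotpC z). Qed.

Lemma dotpNr n (x z : 'rV[R]_n) : dotp z (- x) = - dotp z x.
Proof. by rewrite dotpC dotpNl (dotpC z). Qed.

Lemma dotpBr n (x y z : 'rV[R]_n) : dotp z (x - y) = dotp z x - dotp z y.
Proof. by rewrite dotpDr dotpNr. Qed.

Lemma enormN n (x : 'rV[R]_n) : enorm (- x) = enorm x.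
Proof. by rewrite /enorm dotpNl dotpNr opprK. Qed.

Lemma enormZ n c (x : 'rV[R]_n) : enorm (c *: x) = `|c| * enorm x.
Proof. by rewrite /enorm dotpZl dotpZr mulrA -expr2 sqrtrM ?sqr_ge0// sqrtr_sqr. Qed.

Lemma enormB n (x y : 'rV[R]_n) : enorm (x - y) = enorm (y - x).
Proof. by rewrite -enormN opprB. Qed.

Lemma dotp_ge n (x y : 'rV[R]_n) : - (enorm x * enorm y) <= dotp x y.
Proof. by rewrite lerNl -dotpNl -(enormN x); exact: dotp_le. Qed.

Lemma basis_decomp n (v : 'rV[R]_n) : v = \sum_i v 0 i *: basis_vec R i.
Proof. exact: row_sum_delta. Qed.

End euclidean_algebra.

(** * The weak formulation on time slices *)

Section powers.
Context {R : realType}.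

Lemma continuous_pos_powR (q : R) : 0 < q ->
  continuous (fun y : R => Num.max y 0 `^ q).
Proof.
move=> q0 y; have [y0|y0|->] := ltgtP y 0.
- have y0E : Num.max y 0 `^ q = 0 by rewrite max_r ?ltW// powR0// gt_eqF.
  apply/cvgrPdist_lt => e e0; apply: filterS (lt_nbhsl y0) => z z0.
  by rewrite y0E max_r ?ltW// powR0 ?gt_eqF// subrr normr0.
- apply: (@cvg_trans _ ((fun z : R => z `^ q) @ y)).
    apply: near_eq_cvg; apply: filterS (lt_nbhsr y0) => z z0.
    by rewrite max_l// ltW.
  rewrite max_l ?ltW//; apply: (differentiable_continuous (f := fun z : R => z `^ q)).
  by apply/derivable1_diffP; have [] := is_derive1_powR q y0.
- have E0 : Num.max (0 : R) 0 `^ q = 0 by rewrite maxxx powR0// gt_eqF.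
  apply/cvgrPdist_lt => e e0.
  have d0 : 0 < e `^ q^-1 by exact: powR_gt0.
  near=> z; rewrite E0 sub0r normrN ger0_norm ?powR_ge0//.
  rewrite -[ltRHS](_ : (e `^ q^-1) `^ q = e); last first.
    by rewrite -powRrM mulVf ?gt_eqF// powRr1// ltW.
  apply: gt0_ltr_powR => //; rewrite ?nnegrE ?le_max ?lexx ?orbT ?(ltW d0)//.
  rewrite gt_max d0 andbT; apply: le_lt_trans (ler_norm _) _.
  near: z; apply/nbhs_ballP; exists (e `^ q^-1) => // z.
  by rewrite /ball /= sub0r normrN.
Unshelve. all: by end_near. Qed.

Lemma open_cylinder n (Omega : set 'rV[R]_n) T : open Omega -> open (cylinder Omega T).
Proof.
move=> oO; rewrite openE => -[x t] [Ox tT]; exists (Omega, `]0, T[%classic) => //=.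
split=> /=; first by move: oO; rewrite openE; exact.
exact: near_in_itvoo tT.
Qed.

End powers.

Section flux.
Context {R : realType} (n : nat) (p : R).
Hypothesis p1 : 1 < p.
Implicit Types xi eta : 'rV[R]_n.

Definition flux xi : 'rV[R]_n := enorm xi `^ (p - 2) *: xi.

Lemma dotp_flux xi eta : dotp (flux xi) eta = enorm xi `^ (p - 2) * dotp xi eta.
Proof. by rewrite /dotp mulr_sumr; apply: eq_bigr => i _; rewrite !mxE mulrA. Qed.

Lemma powR_mul_pred (x r : R) : 0 <= x -> 0 < r -> x `^ (r - 1) * x = x `^ r.
Proof. by move=> x0 r0; rewrite mulrC mulr_powRB1. Qed.

Lemma flux_coord_le xi i : `|flux xi 0 i| <= enorm xi `^ (p - 1).
Proof.
rewrite mxE normrM ger0_norm ?powR_ge0// -(@powR_mul_pred _ (p - 1)) ?enorm_ge0 ?subr_gt0//.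
rewrite (_ : p - 1 - 1 = p - 2); last by lra.
by rewrite ler_wpM2l ?powR_ge0// coord_le_enorm.
Qed.

Lemma enorm_powR_le xi : enorm xi `^ p <= n%:R `^ p * \sum_i `|xi 0 i| `^ p.
Proof.
have p0 : 0 < p by exact: lt_trans p1.
move: xi; case: n => [|m] xi.
  rewrite (_ : enorm xi = 0) ?powR0 ?mul0r ?gt_eqF//.
  by rewrite /enorm /dotp big_ord0 sqrtr0.
pose i0 := [arg max_(i > (ord0 : 'I_m.+1)) `|xi 0 i|]%O.
have Hi i : `|xi 0 i| <= `|xi 0 i0|.
  by rewrite /i0; case: arg_maxP => // j _ H; exact: H.
have H1 : enorm xi <= m.+1%:R * `|xi 0 i0|.
  rewrite -(@ler_pXn2r _ 2)// ?nnegrE ?enorm_ge0 ?mulr_ge0// enorm_sqr.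
  apply: (@le_trans _ _ (\sum_(i < m.+1) `|xi 0 i0| ^+ 2)).
    apply: ler_sum => i _; rewrite -expr2 -(real_normK (num_real (xi 0 i))).
    by rewrite ler_pXn2r// nnegrE.
  rewrite sumr_const card_ord -[X in X <= _]mulr_natl exprMn ler_wpM2r ?sqr_ge0//.
  by rewrite expr2 ler_peMl// ler1n.
apply: (@le_trans _ _ ((m.+1%:R * `|xi 0 i0|) `^ p)).
  by rewrite ge0_ler_powR ?nnegrE ?enorm_ge0 ?mulr_ge0// ltW.
rewrite powRM// ler_wpM2l ?powR_ge0// (bigD1 i0)//= lerDl.
by apply: sumr_ge0 => i _; exact: powR_ge0.
Qed.

Section flux_Lp.
Context d (X : measurableType d) (mu : {measure set X -> \bar R}) (D : set X).
Hypothesis mD : measurable D.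
Variable G : X -> 'rV[R]_n.
Hypothesis LG : forall i, in_Lp mu D p (fun z => G z 0 i).

Lemma measurable_enorm : measurable_fun D (fun z => enorm (G z)).
Proof.
apply: (@measurableT_comp _ _ _ _ _ _ (@Num.sqrt R)).
  by apply: continuous_measurable_fun; exact: sqrt_continuous.
apply: measurable_sum => i.
by apply: measurable_funM; case: (LG i).
Qed.

Lemma in_Lp_enorm : in_Lp mu D p (fun z => enorm (G z)).
Proof.
have mN := measurable_enorm; apply: integrable_in_Lp => //.
apply: (Rintegrable_le mD (g := fun z => n%:R `^ p * \sum_i `|G z 0 i| `^ p)).
- apply: (measurableT_comp (measurable_powR p)); exact: measurableT_comp.
- apply: RintegrableZ => //; apply: Rintegrable_sum => // i.
  by apply: in_Lp_integrable.
- move=> z _; rewrite ger0_norm ?powR_ge0// ger0_norm ?enorm_ge0//.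
  exact: enorm_powR_le.
Qed.

Lemma in_Lp_flux i : in_Lp mu D (p / (p - 1)) (fun z => flux (G z) 0 i).
Proof.
have mN := measurable_enorm.
have mf : measurable_fun D (fun z => flux (G z) 0 i).
  under eq_fun do rewrite mxE; apply: measurable_funM; last by case: (LG i).
  exact: (measurableT_comp (measurable_powR _)).
apply: integrable_in_Lp => //.
apply: (Rintegrable_le mD (g := fun z => `|enorm (G z)| `^ p)).
- by apply: (measurableT_comp (measurable_powR _)); exact: measurableT_comp.
- exact: (in_Lp_integrable in_Lp_enorm).
move=> z _; rewrite ger0_norm ?powR_ge0// (ger0_norm (enorm_ge0 (G z))).
have p10 : 0 < p - 1 by rewrite subr_gt0.
rewrite (_ : enorm (G z) `^ p = (enorm (G z) `^ (p - 1)) `^ (p / (p - 1))); last first.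
  by rewrite -powRrM mulrCA divff ?mulr1// gt_eqF.
rewrite ge0_ler_powR ?nnegrE ?powR_ge0//; last exact: flux_coord_le.
by rewrite divr_ge0// ltW//; exact: lt_trans p1.
Qed.

End flux_Lp.

End flux.

Section test_functions_W1p.
Context {R : realType} (n : nat) (Omega : set 'rV[R]_n) (p : R).
Hypotheses (oO : open Omega) (bO : bounded_set Omega) (p1 : 1 < p).
Local Notation mu := (lebesgue_rV R n).

Let mO := open_measurable_rV oO.
Let muO := bounded_lebesgue_rV_lty mO bO.
Let p0 : 0 < p. Proof. exact: lt_trans p1. Qed.

Lemma smooth_in_Lp f r : 0 <= r -> smooth f -> in_Lp mu Omega r f.
Proof.
move=> r0 sf; have cf := smooth_continuous sf.
have [B [_ HB]] := bounded_set_cube bO.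
have [C C0 HC] := continuous_bounded_on_compact (@compact_cube R n (Num.max B 0)) cf.
apply: (in_Lp_bounded mO r0 muO (C := C)).
  by apply: measurable_funTS; exact: continuousT_measurable_rV.
move=> x Ox; apply: HC; apply: rV_norm_le; first by rewrite le_max lexx orbT.
by move=> i; rewrite le_max HB.
Qed.

Lemma cvg_Lp_cst d (X : measurableType d) (m : {measure set X -> \bar R}) D (f : X -> R) :
  cvg_Lp m D p (fun=> f) f.
Proof.
rewrite /cvg_Lp (_ : (fun k => _) = cst 0%E); first exact: cvg_cst.
apply/funext => k; apply: integral0_eq => x _.
by rewrite subrr normr0 powR0// gt_eqF.
Qed.

Lemma test_fun_in_W1p_0 f : test_fun Omega f -> in_W1p_0 Omega p f (grad f).
Proof.
move=> tf; have sf := test_fun_smooth tf; split.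
  split=> [|i|i phi tphi].
  - by apply: smooth_in_Lp => //; exact: ltW.
  - under eq_fun do rewrite mxE.
    by apply: smooth_in_Lp; [exact: ltW|exact: smooth_derive].
  - rewrite (integration_by_parts_test_fun i sf tphi); congr (- _).
    by apply: eq_Rintegral => x _; rewrite mxE.
exists (fun=> f); split => // [|i]; first exact: cvg_Lp_cst.
rewrite (_ : (fun x => grad f x 0 i) = 'D_(basis_vec R i) f); first exact: cvg_Lp_cst.
by apply/funext => x; rewrite mxE.
Qed.

End test_functions_W1p.


Section slices.
Context {R : realType} (n : nat) (Omega : set 'rV[R]_n) (T p q M : R).
Variables (u : 'rV[R]_n * R -> R) (Du : 'rV[R]_n * R -> 'rV[R]_n).
Local Notation mu := (lebesgue_rV R n).
Local Notation leb := (@lebesgue_measure R).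
Local Notation nu := (@lebesgue_xt R n).
Hypotheses (oO : open Omega) (bO : bounded_set Omega) (p1 : 1 < p) (q0 : 0 < q).
Hypothesis cu : forall z, cylinder Omega T z -> {for z, continuous u}.
Hypothesis uM : forall z, cylinder Omega T z -> 0 <= u z <= M.
Hypothesis LDu : forall i, in_Lp nu (cylinder Omega T) p (fun z => Du z 0 i).
Hypothesis weak : forall (phi dphi : 'rV[R]_n * R -> R) (Dphi : 'rV[R]_n * R -> 'rV[R]_n),
  (forall z, cylinder Omega T z -> 0 <= phi z) ->
  in_W1r_0_time Omega T (q + 1) phi dphi ->
  in_Lp_W1p_0 Omega T p phi Dphi ->
  \int[nu]_(z in cylinder Omega T)
    (- (u z `^ q) * dphi z +
     enorm (Du z) `^ (p - 2) * dotp (Du z) (Dphi z)) = 0.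

Let mO := open_measurable_rV oO.
Let muO := bounded_lebesgue_rV_lty mO bO.
Let p0 : 0 < p. Proof. exact: lt_trans p1. Qed.

Lemma measurable_strip (I : set R) : measurable I ->
  measurable (Omega `*` I : set ('rV[R]_n * measurableTypeR R)).
Proof. by move=> mI; exact: measurableX. Qed.

Lemma strip_lty (a b : R) I : measurable I -> I `<=` `[a, b] -> (nu (Omega `*` I) < +oo)%E.
Proof.
move=> mI Iab.
have -> : nu (Omega `*` I) = (mu Omega * leb I)%E by exact: product_measure1E.
rewrite lte_mul_pinfty//.
  by rewrite ge0_fin_numE.
apply: (@le_lt_trans _ _ (leb `[a, b]%classic)).
  by apply: le_measure; rewrite ?inE.
by rewrite lebesgue_measure_itv /=; case: ifP => // _; rewrite -EFinB ltry.
Qed.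

Let mC : measurable (cylinder Omega T : set ('rV[R]_n * measurableTypeR R)).
Proof. by apply: measurable_strip; exact: measurable_itv. Qed.

Let nuC : (nu (cylinder Omega T) < +oo)%E.
Proof. by apply: (@strip_lty 0 T); [exact: measurable_itv|exact: subset_itv_oo_cc]. Qed.

Lemma continuous_u_powR z : cylinder Omega T z -> {for z, continuous (fun z => u z `^ q)}.
Proof.
move=> Cz; have /andP[uz _] := uM Cz.
apply: (@cvg_trans _ ((fun z => Num.max (u z) 0 `^ q) @ z)).
  have Hz : nbhs z (cylinder Omega T).
    by apply: open_nbhs_nbhs; split => //; exact: open_cylinder.
  apply: near_eq_cvg; near=> y.
  have /uM/andP[y0 _] : cylinder Omega T y by near: y.
  by rewrite max_l.
have := cvg_comp _ _ (cu Cz) (@continuous_pos_powR R q q0 (u z)).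
by rewrite (max_l uz).
Unshelve. all: by end_near. Qed.

Lemma u_powR_le z : cylinder Omega T z -> `|u z `^ q| <= M `^ q.
Proof.
move=> /uM/andP[u0 uM1]; rewrite ger0_norm ?powR_ge0// ge0_ler_powR ?nnegrE ?(ltW q0)//.
exact: le_trans uM1.
Qed.

Lemma measurable_u_powR :
  measurable_fun (cylinder Omega T : set ('rV[R]_n * measurableTypeR R)) (fun z => u z `^ q).
Proof.
apply: continuous_measurable_rVxR; first exact: open_cylinder.
by move=> z; rewrite inE; exact: continuous_u_powR.
Qed.

Lemma continuous_slice (f : 'rV[R]_n * R -> R) x t :
  {for (x, t), continuous f} -> {for t, continuous (fun t => f (x, t))}.
Proof.
move=> cf P /cf[[A B] /= [Ax Bt] AB].
by apply: filterS Bt => t' Bt'; apply: AB; split=> //=; exact: nbhs_singleton.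
Qed.

Lemma smooth_fst (f : 'rV[R]_n -> R) : smooth f -> smooth (fun z : 'rV[R]_n * R => f z.1).
Proof.
apply: (smooth_precomp (B := fun v : 'rV[R]_n * R => v.1)) => //.
by move=> z; exact: cvg_fst.
Qed.

Lemma smooth_snd (f : R -> R) : smooth f -> smooth (fun z : 'rV[R]_n * R => f z.2).
Proof.
apply: (smooth_precomp (B := fun v : 'rV[R]_n * R => v.2)) => //.
by move=> z; exact: cvg_snd.
Qed.

Lemma smooth_in_Lp_cylinder f r C : 0 <= r -> smooth f ->
  (forall z, cylinder Omega T z -> `|f z| <= C) -> in_Lp nu (cylinder Omega T) r f.
Proof.
move=> r0 sf fC; apply: (in_Lp_bounded mC r0 nuC _ fC).
apply: continuous_measurable_rVxR; first exact: open_cylinder.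
by move=> z _; exact: smooth_continuous.
Qed.

Lemma separated_test_equation (psi : 'rV[R]_n -> R) (theta : R -> R) (a b : R) :
  test_fun Omega psi -> (forall x, 0 <= psi x) ->
  smooth theta -> (forall t, 0 <= theta t) -> (forall t, theta t != 0 -> a <= t <= b) ->
  0 < a -> b < T ->
  \int[nu]_(z in cylinder Omega T)
    (- (u z `^ q) * (psi z.1 * 'D_1 theta z.2) +
     theta z.2 * dotp (flux p (Du z)) (grad psi z.1)) = 0.
Proof.
move=> tpsi psi0 stheta theta0 thab a0 bT.
have spsi := test_fun_smooth tpsi.
pose phi (z : 'rV[R]_n * R) : R := psi z.1 * theta z.2.
pose dphi (z : 'rV[R]_n * R) : R := psi z.1 * 'D_1 theta z.2.
pose Dphi (z : 'rV[R]_n * R) : 'rV[R]_n := theta z.2 *: grad psi z.1.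
have thb : exists2 B, 0 <= B & forall t, `|theta t| <= B.
  have cth := smooth_continuous stheta.
  have [B B0 HB] := continuous_bounded_on_compact (@segment_compact R a b) cth.
  exists B => // t; have [->|/thab tab] := eqVneq (theta t) 0; first by rewrite normr0.
  by apply: HB; rewrite /= in_itv.
have dthab t : 'D_1 theta t != 0 -> a <= t <= b.
  apply: contra_neqP => tab.
  apply: (@derive_eq0_off_closed _ _ `[a, b]%classic) => [|y /thab yab|/=].
  - exact: itv_closed.
  - by rewrite /= in_itv.
  - by rewrite in_itv.
have dthb : exists2 B, 0 <= B & forall t, `|'D_1 theta t| <= B.
  have cth := smooth_continuous (smooth_derive (1 : R) stheta).
  have [B B0 HB] := continuous_bounded_on_compact (@segment_compact R a b) cth.
  exists B => // t; have [->|/dthab tab] := eqVneq ('D_1 theta t) 0; first by rewrite normr0.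
  by apply: HB; rewrite /= in_itv.
have [B B0 HB] := thb; have [B' B'0 HB'] := dthb.
have [P P0 HP] := test_fun_bounded tpsi.
have sphi : smooth phi by apply: smoothM; [exact: smooth_fst|exact: smooth_snd].
have sdphi : smooth dphi.
  by apply: smoothM; [exact: smooth_fst|
    apply: (smooth_snd (f := fun t => 'D_1 theta t)); exact: smooth_derive].
have tphi : test_fun (cylinder Omega T) phi.
  split => //; have [_ [K [cK KO] psiK]] := tpsi.
  exists (K `*` `[a, b]); first split.
  - by apply: compact_setX => //; exact: segment_compact.
  - move=> [x t] [/KO Ox /=]; rewrite in_itv /= => /andP[t1 t2]; split => //=.
    by rewrite in_itv /= (lt_le_trans a0 t1) (le_lt_trans t2 bT).
  - move=> [x t]; rewrite /phi mulf_eq0 negb_or => /andP[/psiK Kx /thab tab].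
    by split=> //=; rewrite in_itv.
have dphiE z : 'D_((0 : 'rV[R]_n), (1 : R)) phi z = dphi z.
  have d1 : is_derive z ((0 : 'rV[R]_n), (1 : R)) (fun z : 'rV[R]_n * R => psi z.1) 0.
    apply: (is_derive_precomp (A := fun z : 'rV[R]_n * R => z.1) (w := 0)) => [h|].
      by rewrite /= !scaler0.
    exact: is_derive0.
  have d2 : is_derive z ((0 : 'rV[R]_n), (1 : R)) (fun z : 'rV[R]_n * R => theta z.2) ('D_1 theta z.2).
    apply: (is_derive_precomp (A := fun z : 'rV[R]_n * R => z.2) (w := 1)) => [h|] //.
    exact: smooth_is_derive.
  by have [_ ->] := is_deriveM_fun d1 d2; rewrite mulr0 addr0.
have q1 : 0 <= q + 1 by rewrite addr_ge0// ltW.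
have phiB z : `|phi z| <= P * B by rewrite normrM ler_pM.
have dphiB z : `|dphi z| <= P * B' by rewrite normrM ler_pM.
have Lphi r : 0 <= r -> in_Lp nu (cylinder Omega T) r phi.
  by move=> r0; apply: (smooth_in_Lp_cylinder r0 sphi) => z _; exact: phiB.
have Ldphi r : 0 <= r -> in_Lp nu (cylinder Omega T) r dphi.
  by move=> r0; apply: (smooth_in_Lp_cylinder r0 sdphi) => z _; exact: dphiB.
have h1 : forall z, cylinder Omega T z -> 0 <= phi z by move=> z _; rewrite mulr_ge0.
have h2 : in_W1r_0_time Omega T (q + 1) phi dphi.
  split; [exact: Lphi|exact: Ldphi|exists (fun=> phi); split => //].
    by apply: cvg_Lp_cst; rewrite ltrDr.
  rewrite (_ : 'D_((0 : 'rV[R]_n), (1 : R)) phi = dphi); last exact/funext.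
  by apply: cvg_Lp_cst; rewrite ltrDr.
have h3 : in_Lp_W1p_0 Omega T p phi Dphi.
  have sl t : in_W1p_0 Omega p (fun x => phi (x, t)) (fun x => Dphi (x, t)).
    have tt : test_fun Omega (fun x => phi (x, t)).
      rewrite (_ : (fun x => _) = (fun x => theta t * psi x)); last first.
        by apply/funext => x; rewrite /phi mulrC.
      by apply: test_fun_smoothM; [exact: smooth_cst|exact: tpsi].
    rewrite (_ : (fun x => Dphi (x, t)) = grad (fun x => phi (x, t))).
      exact: test_fun_in_W1p_0.
    apply/funext => x; apply/rowP => i; rewrite !mxE /phi /=.
    have [_ ->] := is_deriveM_fun (smooth_is_derive x (basis_vec R i) spsi)
      (@is_derive_cst R _ _ (theta t) x (basis_vec R i)).
    by rewrite mulr0 add0r.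
  split; last by apply: aeW => t _; exact: sl.
  split; [exact: Lphi (ltW p0)|move=> i|by apply: aeW => t _; case: (sl t)].
  have [Pi Pi0 HPi] := test_fun_bounded (test_fun_derive (basis_vec R i) tpsi).
  under eq_fun do rewrite !mxE.
  apply: (smooth_in_Lp_cylinder (C := B * Pi) (ltW p0)).
    by apply: smoothM; [exact: smooth_snd|
      apply: (smooth_fst (f := fun x => 'D_(basis_vec R i) psi x)); exact: smooth_derive].
  by move=> z _; rewrite normrM ler_pM.
rewrite -[RHS](weak h1 h2 h3); apply: eq_Rintegral => z _.
by congr (_ + _); rewrite dotp_flux /Dphi dotpZr mulrCA.
Qed.

Definition flux_pairing (psi : 'rV[R]_n -> R) (z : 'rV[R]_n * R) : R :=
  dotp (flux p (Du z)) (grad psi z.1).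

Lemma measurable_fst_comp I (f : 'rV[R]_n -> R) : measurable I -> measurable_fun Omega f ->
  measurable_fun (Omega `*` I : set ('rV[R]_n * measurableTypeR R)) (fun z => f z.1).
Proof.
move=> mI mf; apply: (@measurable_comp _ _ _ _ _ _ Omega f _ fst) => //.
  by move=> _ [z [Oz _] <-].
by apply: measurable_funTS; exact: measurable_fst.
Qed.

Lemma integrable_flux_pairing psi : test_fun Omega psi ->
  Rintegrable nu (cylinder Omega T) (flux_pairing psi).
Proof.
move=> tpsi; apply: Rintegrable_sum => // i.
have [C C0 HC] := test_fun_bounded (test_fun_derive (basis_vec R i) tpsi).
apply: (@Rintegrable_pairing _ _ _ nu _ mC p p1 (fun z => flux p (Du z) 0 i)
  (fun z => grad psi z.1 0 i)).
  exact: in_Lp_flux.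
apply: (in_Lp_bounded mC (ltW p0) nuC (C := C)).
  apply: (@measurable_fst_comp _ (fun x => grad psi x 0 i)); first exact: measurable_itv.
  under eq_fun do rewrite mxE.
  apply: measurable_funTS; apply: continuousT_measurable_rV.
  by apply: smooth_continuous; apply: smooth_derive; exact: test_fun_smooth tpsi.
by move=> z _; rewrite mxE.
Qed.

Definition mass (psi : 'rV[R]_n -> R) (t : R) : R :=
  \int[mu]_(x in Omega) (u (x, t) `^ q * psi x).

Lemma measurable_u_slice t : 0 < t < T -> measurable_fun Omega (fun x => u (x, t) `^ q).
Proof.
move=> tT; apply: (measurable_slice1 mO _ measurable_u_powR); first exact: measurable_itv.
by rewrite /= in_itv.
Qed.

Lemma integrable_mass psi t : 0 < t < T -> Rintegrable mu Omega psi ->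
  Rintegrable mu Omega (fun x => u (x, t) `^ q * psi x).
Proof.
move=> tT jpsi; apply: (RintegralM_bounded mO (C := M `^ q)) => //.
  exact: measurable_u_slice.
by move=> x Ox; apply: u_powR_le; split=> //=; rewrite in_itv.
Qed.

Lemma continuous_mass psi t : 0 < t < T -> Rintegrable mu Omega psi ->
  {for t, continuous (mass psi)}.
Proof.
move=> tT jpsi.
have mpsi := Rintegrable_measurable jpsi.
have := @continuity_under_integral R _ _ mu (fun t x => u (x, t) `^ q * psi x) Omega mO 0 T
  _ _ (fun x => M `^ q * `|psi x|); apply.
- by move=> r rT; apply: integrable_mass => //; move: rT; rewrite /= in_itv.
- apply: aeW => x Ox r; rewrite inE => rT; apply: (@cvgM R); last exact: cvg_cst.
  by apply: (@continuous_slice (fun z => u z `^ q) x r); apply: continuous_u_powR.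
- by apply: RintegrableZ => //; exact: Rintegrable_abs.
- move=> r rT; apply: aeW => x Ox; rewrite normrM ler_wpM2r//.
  by apply: u_powR_le; split.
- by rewrite inE /= in_itv.
Qed.

Lemma slice_identity psi t1 t2 : test_fun Omega psi -> (forall x, 0 <= psi x) ->
  0 < t1 -> t1 < t2 -> t2 < T ->
  mass psi t2 - mass psi t1 =
  - \int[nu]_(z in Omega `*` `]t1, t2]%classic) flux_pairing psi z.
Proof.
move=> tpsi psi0 t10 t12 t2T.
have jpsi : Rintegrable mu Omega psi by apply: integrableS (test_fun_integrable tpsi).
have [P P0 HP] := test_fun_bounded tpsi.
have jJ := integrable_flux_pairing tpsi; have mJ := Rintegrable_measurable jJ.
have mI : measurable_fun `]0, T[ (mass psi).
  apply: open_continuous_measurable_fun; first exact: interval_open.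
  by move=> t; rewrite inE /= in_itv => tT; exact: continuous_mass.
pose th (k : nat) t := dstep t1 k.+1%:R^-1 t - dstep t2 k.+1%:R^-1 t.
have sth k : smooth (th k) by apply: smoothB; exact: smooth_dstep.
have k0 (k : nat) : 0 < k.+1%:R^-1 :> R by rewrite invr_gt0 ltr0n.
have th0 k t : 0 <= th k t.
  rewrite subr_ge0; apply: ndecr_step; apply: ler_wpM2l; last by lra.
  by rewrite invr_ge0 ltW.
have th1 k t : th k t <= 1 by rewrite /th lerBlDr (le_trans (dstep_le1 _ _ _))// lerDl dstep_ge0.
have mth k : measurable_fun (cylinder Omega T : set ('rV[R]_n * measurableTypeR R))
    (fun z => th k z.2).
  apply: continuous_measurable_rVxR; first exact: open_cylinder.
  by move=> z _; apply: smooth_continuous; exact: smooth_snd.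
have hL : \int[leb]_(t in `]0, T[) (mass psi t * 'D_1 (th k) t) @[k --> \oo] -->
    mass psi t1 - mass psi t2.
  have massB t : 0 < t < T -> `|mass psi t| <= \int[mu]_(x in Omega) (M `^ q * `|psi x|).
    move=> tT; have jm := integrable_mass tT jpsi.
    apply: le_trans; first by apply: le_normr_Rintegral.
    apply: le_Rintegral => //.
    - exact: Rintegrable_abs.
    - by apply: RintegrableZ => //; exact: Rintegrable_abs.
    - move=> x Ox; rewrite normrM ler_wpM2r//.
      by apply: u_powR_le; split=> //=; rewrite in_itv.
  have t1T : 0 < t1 < T by apply/andP; split; lra.
  have t2T' : 0 < t2 < T by apply/andP; split; lra.
  have d1 := delta_cvg t1T mI massB (continuous_mass t1T jpsi).
  have d2 := delta_cvg t2T' mI massB (continuous_mass t2T' jpsi).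
  suff EB : (fun k : nat => \int[leb]_(t in `]0, T[) (mass psi t * 'D_1 (th k) t)) =
      (fun k : nat => \int[leb]_(t in `]0, T[) (mass psi t * 'D_1 (dstep t1 k.+1%:R^-1) t) -
        \int[leb]_(t in `]0, T[) (mass psi t * 'D_1 (dstep t2 k.+1%:R^-1) t)).
    by rewrite EB; exact: (cvgB d1 d2).
  apply/funext => k.
  have mT : measurable (`]0, T[%classic : set R) by exact: measurable_itv.
  have jd a : Rintegrable leb `]0, T[ (fun t : R => mass psi t * 'D_1 (dstep a k.+1%:R^-1) t).
    have [C C0 HC] := @dstep_derive_bound R.
    have jda : Rintegrable leb `]0, T[ (fun t : R => 'D_1 (dstep a k.+1%:R^-1) t).
      have md : measurable_fun `]0, T[ (fun t : R => 'D_1 (dstep a k.+1%:R^-1) t).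
        apply: measurable_funTS; apply: continuous_measurable_fun.
        by apply: smooth_continuous; apply: smooth_derive; exact: smooth_dstep.
      apply: (@Rintegrable_bounded _ _ _ leb _ mT _ (C / k.+1%:R^-1) (lebesgue_itv_oo_lty 0 T) md).
      by move=> t _; exact: (HC a _ t (k0 k)).1.
    apply: (@RintegralM_bounded _ _ _ leb _ mT (mass psi) _
      (\int[mu]_(x in Omega) (M `^ q * `|psi x|)) mI _ jda).
    by move=> t /=; rewrite in_itv; exact: massB.
  rewrite -RintegralB//; apply: eq_Rintegral => t _; rewrite -mulrBr; congr (_ * _).
  by apply: deriveB; apply: smooth_derivable; exact: smooth_dstep.
have hR : \int[nu]_(z in cylinder Omega T) (th k z.2 * flux_pairing psi z) @[k --> \oo] -->
    \int[nu]_(z in cylinder Omega T) ((if t1 < z.2 then 1 else 0) *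
       flux_pairing psi z - (if t2 < z.2 then 1 else 0) * flux_pairing psi z).
  have mif a : measurable_fun (cylinder Omega T : set ('rV[R]_n * measurableTypeR R))
      (fun z => (if a < z.2 then 1 else 0 : R)).
    rewrite (_ : (fun _ => _) = \1_(`]a, +oo[%classic) \o snd); last first.
      by apply/funext => z /=; rewrite indicE; case: ifPn => az;
         [rewrite mem_set//= in_itv/= az|rewrite memNset//= in_itv/= andbT; exact/negP].
    apply: measurable_funTS; apply: measurableT_comp => //.
  apply: (Rdominated_convergence mC _ _ _ (Rintegrable_abs jJ)).
  - by move=> k; apply: measurable_funM.
  - by apply: measurable_funB; apply: measurable_funM.
  - apply: aeW => z _; rewrite -mulrBl; apply: (@cvgM R); last exact: cvg_cst.
    by apply: (@cvgB _ R); exact: dstep_cvg.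
  - move=> k z _; rewrite normrM ler_piMl// ger0_norm//; exact: th0.
have E k : t2 + k.+1%:R^-1 < T ->
   \int[leb]_(t in `]0, T[) (mass psi t * 'D_1 (th k) t) =
   \int[nu]_(z in cylinder Omega T) (th k z.2 * flux_pairing psi z).
  move=> kT.
  have thsupp t : th k t != 0 -> t1 <= t <= t2 + k.+1%:R^-1.
    apply: contra_neqP => /negP; rewrite negb_and -!ltNge => /orP[tt|tt].
      by rewrite /th !dstep_eq0 ?subrr// ltW//; exact: lt_trans t12.
    have tt1 : t1 + k.+1%:R^-1 <= t by apply: le_trans (ltW tt); rewrite lerD2r ltW.
    by rewrite /th !dstep_eq1 ?subrr ?(ltW tt).
  have [C C0 HC] := @dstep_derive_bound R.
  have Dth t : `|'D_1 (th k) t| <= C / k.+1%:R^-1 + C / k.+1%:R^-1.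
    rewrite /th deriveB; try by apply: smooth_derivable; exact: smooth_dstep.
    apply: le_trans (ler_normB _ _) _.
    by apply: lerD; [exact: (HC t1 _ t (k0 k)).1|exact: (HC t2 _ t (k0 k)).1].
  have j1 : Rintegrable nu (cylinder Omega T)
      (fun z => u z `^ q * psi z.1 * 'D_1 (th k) z.2).
    apply: (Rintegrable_bounded mC (C := M `^ q * P * (C / k.+1%:R^-1 + C / k.+1%:R^-1)) nuC).
      apply: measurable_funM; first apply: measurable_funM.
      - exact: measurable_u_powR.
      - apply: measurable_fst_comp; first exact: measurable_itv.
        exact: Rintegrable_measurable jpsi.
      - apply: continuous_measurable_rVxR; first exact: open_cylinder.
        move=> z _; apply: (smooth_continuous (f := fun z : 'rV[R]_n * R => 'D_1 (th k) z.2)).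
        by apply: (smooth_snd (f := fun t => 'D_1 (th k) t)); exact: smooth_derive.
    move=> z Cz; rewrite !normrM ler_pM ?mulr_ge0// ler_pM//; exact: u_powR_le.
  have j2 : Rintegrable nu (cylinder Omega T) (fun z => th k z.2 * flux_pairing psi z).
    apply: (RintegralM_bounded mC (mth k) (C := 1) _ jJ) => z _.
    by rewrite ger0_norm.
  have := separated_test_equation tpsi psi0 (sth k) (th0 k) thsupp t10 kT.
  rewrite (@eq_Rintegral _ _ _ nu _ (fun z => th k z.2 * flux_pairing psi z -
      u z `^ q * psi z.1 * 'D_1 (th k) z.2)); last first.
    by move=> z _; rewrite addrC mulNr mulrA.
  rewrite RintegralB// => /eqP; rewrite subr_eq0 => /eqP ->.
  have mT : measurable (`]0, T[%classic : set (measurableTypeR R)) by exact: measurable_itv.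
  have [_ _ ->] := Rfubini2 (m1 := mu) (m2 := leb) mO mT j1.
  apply: eq_Rintegral => t; rewrite inE /= in_itv /= => tT.
  rewrite -RintegralZr//; exact: integrable_mass.
have near1 : \forall k \near \oo, t2 + k.+1%:R^-1 < T.
  have /exists_invn_lt[k1 hk1] : 0 < T - t2 by lra.
  exists k1 => // k /= kk1; rewrite -ltrBrDl; apply: le_lt_trans hk1.
  by rewrite lef_pV2 ?posrE ?ltr0n// ler_nat.
have hR' : \int[leb]_(t in `]0, T[) (mass psi t * 'D_1 (th k) t) @[k --> \oo] -->
    \int[nu]_(z in cylinder Omega T) ((if t1 < z.2 then 1 else 0) *
       flux_pairing psi z - (if t2 < z.2 then 1 else 0) * flux_pairing psi z).
  apply: cvg_trans hR; apply: near_eq_cvg; apply: filterS near1 => k h.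
  by rewrite (E k h).
have EE := cvg_unique (@norm_hausdorff _ _) hL hR'.
rewrite -opprB EE; congr (- _).
rewrite [RHS]Rintegral_mkcond [LHS]Rintegral_mkcond; apply: eq_Rintegral => -[x t] _.
rewrite !patchE /=; case: ifPn => [|/negP] xC.
  move: xC; rewrite inE => -[/= Ox]; rewrite in_itv /= => tT.
  have [xS|xS] := boolP ((x, t) \in Omega `*` `]t1, t2]%classic).
    move: xS; rewrite inE => -[_ /=]; rewrite in_itv /= => /andP[-> tt2].
    by rewrite ltNge tt2 /= mul0r subr0 mul1r.
  case: (ltP t1 t) => tt1; last first.
    by rewrite ifF ?mul0r ?subrr//; apply/negbTE; rewrite -leNgt (le_trans tt1)// ltW.
  case: (ltP t2 t) => tt2; first by rewrite mul1r subrr.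
  by exfalso; move/negP: xS; apply; rewrite inE; split=> //=; rewrite in_itv /= tt1.
rewrite ifF//; apply/negP; rewrite inE => -[/= Ox]; rewrite in_itv /= => /andP[h1 h2].
apply: xC; rewrite inE; split=> //=; rewrite in_itv /=.
by rewrite (lt_trans t10 h1) (le_lt_trans h2 t2T).
Qed.

End slices.

(** * Truncations [bump (v - w)] as test functions *)

Section truncation_limits.
Context d (X : measurableType d) {R : realType}.
Variables (m : {measure set X -> \bar R}) (D : set X) (p : R).
Hypotheses (mD : measurable D) (mfin : (m D < +oo)%E) (p1 : 1 < p).
Let p' := p / (p - 1).
Let p0 : 0 < p. Proof. exact: lt_trans p1. Qed.

Lemma in_Lp_cst r (c : R) : 0 <= r -> in_Lp m D r (fun=> c).
Proof. by move=> r0; apply: (in_Lp_bounded mD r0 mfin (C := `|c|)). Qed.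

Lemma in_Lp_Rintegrable (f : X -> R) : in_Lp m D p f -> Rintegrable m D f.
Proof.
move=> Lf; have p'0 : 0 <= p' by apply: ltW; exact: conj_exponent_gt0.
have := Rintegrable_pairing mD p1 (in_Lp_cst 1 p'0) Lf.
by apply: eq_integrable => // x _ /=; rewrite mul1r.
Qed.

Lemma in_LpB (f g : X -> R) : in_Lp m D p f -> in_Lp m D p g -> in_Lp m D p (fun x => f x - g x).
Proof.
move=> Lf Lg; have mB : measurable_fun D (fun x => f x - g x).
  by apply: measurable_funB; [case: Lf|case: Lg].
apply: integrable_in_Lp => //.
apply: (Rintegrable_le mD (g := fun x => 2 `^ p * (`|f x| `^ p + `|g x| `^ p))).
- by apply: (measurableT_comp (measurable_powR _)); exact: measurableT_comp.
- apply: RintegrableZ => //; apply: RintegrableD => //; exact: in_Lp_integrable.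
- move=> x _; rewrite ger0_norm ?powR_ge0//.
  apply: (@le_trans _ _ ((2 * Num.max `|f x| `|g x|) `^ p)).
    rewrite ge0_ler_powR ?nnegrE ?(ltW p0)// ?mulr_ge0// ?le_max ?normr_ge0//.
    apply: le_trans (ler_normB _ _) _; rewrite mulr2n mulrDl mul1r.
    by apply: lerD; rewrite le_max lexx ?orbT.
  rewrite powRM// ?le_max ?normr_ge0//; apply: ler_wpM2l; first exact: powR_ge0.
  by rewrite /Order.max; case: ifP => _; [rewrite lerDr|rewrite lerDl]; exact: powR_ge0.
Qed.

Lemma in_LpM_bounded (f g : X -> R) C : measurable_fun D f -> (forall x, D x -> `|f x| <= C) ->
  in_Lp m D p g -> in_Lp m D p (fun x => f x * g x).
Proof.
move=> mf fC Lg; have mfg : measurable_fun D (fun x => f x * g x).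
  by apply: measurable_funM => //; case: Lg.
apply: integrable_in_Lp => //.
apply: (Rintegrable_le mD (g := fun x => `|C| `^ p * `|g x| `^ p)).
- by apply: (measurableT_comp (measurable_powR _)); exact: measurableT_comp.
- by apply: RintegrableZ => //; exact: in_Lp_integrable.
- move=> x Dx; rewrite ger0_norm ?powR_ge0// normrM powRM// ler_wpM2r ?powR_ge0//.
  by rewrite ge0_ler_powR ?nnegrE ?(ltW p0)// (le_trans (fC x Dx))// ler_norm.
Qed.

Lemma in_Lp_cvg_Lp (f_ : nat -> X -> R) f : cvg_Lp m D p f_ f ->
  (forall k, measurable_fun D (f_ k)) -> measurable_fun D f ->
  \forall k \near \oo, in_Lp m D p (fun x => f_ k x - f x).
Proof.
move=> cf mf_ mf; have /fine_cvgP[+ _] := cf; apply: filterS => k kfin; split.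
  exact: measurable_funB.
by move: kfin; rewrite fin_num_abs => /(le_lt_trans (lee_abs _)).
Qed.

Variables (F v g w b : X -> R) (v_ g_ : nat -> X -> R).
Hypotheses (LF : in_Lp m D p' F) (Lv : cvg_Lp m D p v_ v) (Lg : cvg_Lp m D p g_ g).
Hypotheses (mv_ : forall k, measurable_fun D (v_ k)) (mv : measurable_fun D v).
Hypotheses (mg_ : forall k, measurable_fun D (g_ k)) (mw : measurable_fun D w).
Hypotheses (Lgg : in_Lp m D p g) (Lb : in_Lp m D p b).

Let mcomp (h : R -> R) (f : X -> R) : continuous h -> measurable_fun D f ->
  measurable_fun D (fun x => h (f x)).
Proof.
by move=> ch mf; apply: (measurableT_comp _ mf); exact: continuous_measurable_fun.
Qed.

Lemma continuous_bump : continuous (@bump R).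
Proof. exact: smooth_continuous (@smooth_bump R). Qed.

Lemma continuous_dbump : continuous (@dbump R).
Proof. exact: smooth_continuous (@smooth_flat_exp R 2). Qed.

Let mtr (h : R -> R) (f : X -> R) : continuous h -> measurable_fun D f ->
  measurable_fun D (fun x => h (f x - w x)).
Proof. by move=> ch mf; apply: mcomp => //; exact: measurable_funB. Qed.

Lemma truncation_cvg :
  \int[m]_(x in D) (F x * bump (v_ k x - w x)) @[k --> \oo] -->
  \int[m]_(x in D) (F x * bump (v x - w x)).
Proof.
have mB k : measurable_fun D (fun x => v_ k x - v x) by exact: measurable_funB.
have [iF cF] := pairing_cvg0 mD p1 LF mB Lv.
have jF : Rintegrable m D F.
  have := Rintegrable_pairing mD p1 LF (in_Lp_cst 1 (ltW p0)).
  by apply: eq_integrable => // x _ /=; rewrite mulr1.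
have jFb (f : X -> R) : measurable_fun D f -> Rintegrable m D (fun x => F x * bump (f x - w x)).
  move=> mf; have mb := mtr continuous_bump mf.
  have := @RintegralM_bounded _ _ _ m D mD _ F 1 mb _ jF.
  rewrite (_ : (fun x => bump (f x - w x) * F x) = (fun x => F x * bump (f x - w x))).
    by apply=> x _; rewrite ger0_norm ?bump_ge0 ?bump_le1.
  by apply/funext => x; rewrite mulrC.
apply: cvg_sub0; apply: cvg0_squeeze_eps => e e0.
exists (fun k => 2 * \int[m]_(x in D) (`|F x| * `|v_ k x - v x|)).
  by rewrite -(mulr0 2); apply: (@cvgM R) => //; exact: cvg_cst.
apply: filterS iF => k iFk.
have iFk' : Rintegrable m D (fun x => `|F x| * `|v_ k x - v x|).
  by apply: eq_integrable (Rintegrable_abs iFk) => // x _ /=; rewrite normrM.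
rewrite -RintegralB//; try exact: jFb.
apply: le_trans.
  by apply: le_normr_Rintegral => //; apply: RintegrableB => //; exact: jFb.
rewrite -RintegralZl// -[leLHS]add0r; apply: lerD; first exact: ltW.
apply: le_Rintegral => //.
- by apply: Rintegrable_abs => //; apply: RintegrableB => //; exact: jFb.
- exact: RintegrableZ.
- move=> x _; rewrite -mulrBr normrM mulrCA ler_wpM2l//.
  apply: le_trans (lipschitz_bump _ _) _.
  by rewrite opprB addrA subrK.
Qed.

Lemma truncation_grad_cvg :
  \int[m]_(x in D) (F x * (dbump (v_ k x - w x) * (g_ k x - b x))) @[k --> \oo] -->
  \int[m]_(x in D) (F x * (dbump (v x - w x) * (g x - b x))).
Proof.
have mg : measurable_fun D g by case: Lgg.
have mBv k : measurable_fun D (fun x => v_ k x - v x) by exact: measurable_funB.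
have mBg k : measurable_fun D (fun x => g_ k x - g x) by exact: measurable_funB.
have [iG cG] := pairing_cvg0 mD p1 LF mBg Lg.
have p'0 : 0 <= p' by apply: ltW; exact: conj_exponent_gt0.
have [iV cV] := pairing_cvg0 mD p1 (in_Lp_cst 1 p'0) mBv Lv.
have Lgb := in_LpB Lgg Lb.
have jFgb := Rintegrable_pairing mD p1 LF Lgb.
have dB x : `|@dbump R x| <= 2 by rewrite ger0_norm ?dbump_ge0 ?dbump_le2.
have mdb (f : X -> R) : measurable_fun D f -> measurable_fun D (fun x => dbump (f x - w x)).
  by apply: mtr; exact: continuous_dbump.
pose dl k x := `|dbump (v_ k x - w x) - dbump (v x - w x)|.
have mdl k : measurable_fun D (dl k).
  by apply: measurableT_comp => //; apply: measurable_funB; exact: mdb.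
have dl4 k x : D x -> 0 <= dl k x <= 4.
  move=> _; rewrite normr_ge0 /=; apply: le_trans (ler_normB _ _) _.
  by rewrite (_ : 4 = 2 + 2) ?lerD//; ring.
have dl36 k x : dl k x <= 36 * `|v_ k x - v x|.
  by apply: le_trans (lipschitz_dbump _ _) _; rewrite opprB addrA subrK.
have jdl k : Rintegrable m D (dl k).
  apply: (Rintegrable_bounded mD (C := 4) mfin (mdl k)) => x Dx.
  by rewrite ger0_norm; have /andP[] := dl4 k x Dx.
have cdl : \int[m]_(x in D) dl k x @[k --> \oo] --> 0.
  apply: cvg0_squeeze_eps => e e0.
  exists (fun k => 36 * \int[m]_(x in D) (`|1| * `|v_ k x - v x|)).
    by rewrite -(mulr0 36); apply: (@cvgM R) => //; exact: cvg_cst.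
  apply: filterS iV => k iVk.
  have iVk' : Rintegrable m D (fun x => `|1| * `|v_ k x - v x|).
    by apply: eq_integrable (Rintegrable_abs iVk) => // x _ /=; rewrite normrM.
  rewrite ger0_norm; last by apply: Rintegral_ge0 => x _; exact: normr_ge0.
  rewrite -RintegralZl// -[leLHS]add0r; apply: lerD; first exact: ltW.
  apply: le_Rintegral => //; first exact: RintegrableZ.
  by move=> x _; rewrite normr1 mul1r.
have jdl' : \forall k \near \oo, Rintegrable m D (dl k) by exact: nearW.
have c2 := truncated_cvg0 mD jFgb mdl dl4 jdl' cdl.
apply: cvg_sub0; apply: cvg0_squeeze_eps => e e0.
exists (fun k => 2 * \int[m]_(x in D) (`|F x| * `|g_ k x - g x|) +
   \int[m]_(x in D) (`|F x * (g x - b x)| * dl k x)).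
  rewrite -[X in _ --> X](addr0 0) -[X in _ --> X + _](mulr0 2).
  apply: (@cvgD R) => //; apply: (@cvgM R) => //; exact: cvg_cst.
apply: filterS2 iG (in_Lp_cvg_Lp Lg mg_ mg) => k iGk LGk.
have iGk' : Rintegrable m D (fun x => `|F x| * `|g_ k x - g x|).
  by apply: eq_integrable (Rintegrable_abs iGk) => // x _ /=; rewrite normrM.
have j1 (f h : X -> R) : measurable_fun D f -> in_Lp m D p h ->
    Rintegrable m D (fun x => F x * (dbump (f x - w x) * h x)).
  move=> mf Lh; apply: (Rintegrable_pairing mD p1 LF).
  exact: in_LpM_bounded (mdb f mf) _ Lh.
have Lgkb : in_Lp m D p (fun x => g_ k x - b x).
  have := in_LpB LGk (in_LpB Lb Lgg).
  rewrite (_ : (fun x => _) = (fun x => g_ k x - b x))//.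
  by apply/funext => x; ring.
rewrite -RintegralB//; try exact: j1.
apply: le_trans.
  by apply: le_normr_Rintegral => //; apply: RintegrableB => //; exact: j1.
have j3 : Rintegrable m D (fun x => `|F x * (g x - b x)| * dl k x).
  rewrite (_ : (fun x => _) = (fun x => dl k x * `|F x * (g x - b x)|)); last first.
    by apply/funext => x; rewrite mulrC.
  apply: (@RintegralM_bounded _ _ _ m D mD _ _ 4 (mdl k) _ (Rintegrable_abs jFgb)).
  by move=> x Dx; rewrite ger0_norm; have /andP[] := dl4 k x Dx.
rewrite -RintegralZl// -RintegralD//; last exact: RintegrableZ.
rewrite -[leLHS]add0r; apply: lerD; first exact: ltW.
apply: le_Rintegral => //.
- by apply: Rintegrable_abs => //; apply: RintegrableB => //; exact: j1.
- by apply: RintegrableD => //; exact: RintegrableZ.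
- move=> x Dx.
  have -> : F x * (dbump (v_ k x - w x) * (g_ k x - b x)) -
     F x * (dbump (v x - w x) * (g x - b x)) =
     dbump (v_ k x - w x) * (F x * (g_ k x - g x)) +
     (F x * (g x - b x)) * (dbump (v_ k x - w x) - dbump (v x - w x)) by ring.
  apply: le_trans (ler_normD _ _) _; apply: lerD.
    by rewrite normrM (normrM (F x)) ler_wpM2r ?mulr_ge0.
  by rewrite (normrM (F x * _)).
Qed.

End truncation_limits.

Section strip_fst.
Context {R : realType} (n : nat) (Omega : set 'rV[R]_n) (I : set R).
Hypotheses (mO : measurable Omega) (mI : measurable (I : set (measurableTypeR R))).
Hypothesis leI : (lebesgue_measure I < +oo)%E.
Local Notation nu := (@lebesgue_xt R n).
Local Notation mu := (lebesgue_rV R n).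
Local Notation S := (Omega `*` I : set ('rV[R]_n * measurableTypeR R)).

Lemma integral_strip_fst (h : 'rV[R]_n -> R) : measurable_fun Omega h ->
  (forall x, Omega x -> 0 <= h x) ->
  (\int[nu]_(z in S) (h z.1)%:E =
   lebesgue_measure I * \int[mu]_(x in Omega) (h x)%:E)%E.
Proof.
move=> mh h0; have mS : measurable S by exact: measurableX.
have mhS : measurable_fun S (fun z => h z.1).
  apply: (@measurable_comp _ _ _ _ _ _ Omega h S fst) => //.
    by move=> _ [z [Oz _] <-].
  by apply: measurable_funTS; exact: measurable_fst.
rewrite integral_mkcond /lebesgue_xt fubini_tonelli1; last 2 first.
- by apply/(measurable_restrictT _ mS)/measurable_EFinP.
- move=> z; rewrite patchE; case: ifPn => //; rewrite inE => -[Oz _].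
  by rewrite lee_fin h0.
rewrite -ge0_integralZl//; last by first [exact/measurable_EFinP|move=> x Ox; rewrite lee_fin h0].
rewrite [RHS]integral_mkcond; apply: eq_integral => x _.
rewrite /fubini_F patchE; case: ifPn => xO.
  transitivity (\int[lebesgue_measure]_t ((cst (h x)%:E \_ I) t))%E.
    apply: eq_integral => t _; rewrite !patchE; congr (if _ then _ else _).
    by apply/idP/idP; rewrite !inE; [case|move=> It; split=> //; rewrite inE in xO].
  by rewrite -integral_mkcond integral_cst// muleC.
apply: integral0_eq => t _; rewrite patchE ifF//.
by apply/negP; rewrite inE => -[/= Ox _]; move/negP: xO; apply; rewrite inE.
Qed.

Lemma cvg_Lp_strip p (f_ : nat -> 'rV[R]_n -> R) f :
  (forall k, measurable_fun Omega (f_ k)) -> measurable_fun Omega f ->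
  cvg_Lp mu Omega p f_ f ->
  cvg_Lp nu S p (fun k z => f_ k z.1) (fun z => f z.1).
Proof.
move=> mf_ mf cf; rewrite /cvg_Lp.
rewrite (_ : (fun k => _) = (fun k => lebesgue_measure I *
    \int[mu]_(x in Omega) (`|f_ k x - f x| `^ p)%:E)%E); last first.
  apply/funext => k; apply: (@integral_strip_fst (fun x => `|f_ k x - f x| `^ p)).
    apply: (measurableT_comp (measurable_powR _)); apply: measurableT_comp => //.
    exact: measurable_funB.
  by move=> x _; exact: powR_ge0.
rewrite -(mule0 (lebesgue_measure I)).
by apply: cvgeZl => //; rewrite ge0_fin_numE.
Qed.

Lemma in_Lp_strip p (f : 'rV[R]_n -> R) : in_Lp mu Omega p f ->
  in_Lp nu S p (fun z => f z.1).
Proof.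
move=> [mf f_fin]; split.
  apply: (@measurable_comp _ _ _ _ _ _ Omega f S fst) => //.
    by move=> _ [z [Oz _] <-].
  by apply: measurable_funTS; exact: measurable_fst.
rewrite (@integral_strip_fst (fun x => `|f x| `^ p)).
- by rewrite lte_mul_pinfty// ge0_fin_numE.
- by apply: (measurableT_comp (measurable_powR _)); exact: measurableT_comp.
- by move=> x _; exact: powR_ge0.
Qed.

End strip_fst.

Section truncated_test_functions.
Context {R : realType} (n : nat) (Omega : set 'rV[R]_n) (p : R).
Hypotheses (oO : open Omega) (bO : bounded_set Omega) (p1 : 1 < p).
Local Notation mu := (lebesgue_rV R n).
Local Notation rV := 'rV[R]_n.
Implicit Types (v w : rV -> R) (G : rV -> rV).

Let mO := open_measurable_rV oO.
Let muO := bounded_lebesgue_rV_lty mO bO.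
Let p0 : 0 < p. Proof. exact: lt_trans p1. Qed.

Definition truncation v w (x : rV) : R := bump (v x - w x).
Definition truncation_grad v G w (x : rV) : rV := dbump (v x - w x) *: (G x - grad w x).

Lemma test_fun_truncation phi w : test_fun Omega phi -> smooth w -> (forall x, 0 <= w x) ->
  test_fun Omega (truncation phi w).
Proof.
move=> [sphi [K KO phiK]] sw w0; split.
  by apply: smooth_comp; [exact: smooth_bump|exact: smoothB].
exists K => // x tx; apply: phiK; apply: contraNneq tx => phix.
by rewrite /truncation phix bump_le0// sub0r oppr_le0.
Qed.

Lemma derive_truncation phi w x i : smooth phi -> smooth w ->
  'D_(basis_vec R i) (truncation phi w) x =
  dbump (phi x - w x) * ('D_(basis_vec R i) phi x - 'D_(basis_vec R i) w x).
Proof.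
move=> sphi sw; set e := basis_vec R i.
have D1 : is_derive x e (fun x => phi x - w x) ('D_e phi x - 'D_e w x).
  exact: is_deriveB (smooth_is_derive x e sphi) (smooth_is_derive x e sw).
by have [_ ->] := is_derive_comp1 D1 (is_derive_bump (phi x - w x)).
Qed.

Lemma measurable_smooth f : smooth f -> measurable_fun Omega f.
Proof.
move=> sf; apply: measurable_funTS; apply: continuousT_measurable_rV.
exact: smooth_continuous.
Qed.

Lemma smooth_in_Lp_coord w i r : 0 <= r -> smooth w -> in_Lp mu Omega r (fun x => grad w x 0 i).
Proof.
move=> r0 sw; under eq_fun do rewrite mxE.
exact: (smooth_in_Lp oO bO r0 (smooth_derive _ sw)).
Qed.

(* truncations of [W^{1,p}_0] functions inherit linear identities from the
   truncations of test functions *)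
Lemma truncation_limit v G w : in_W1p_0 Omega p v G -> smooth w ->
  exists phi_ : nat -> rV -> R, (forall k, test_fun Omega (phi_ k)) /\
  (forall F, in_Lp mu Omega (p / (p - 1)) F ->
    \int[mu]_(x in Omega) (F x * truncation (phi_ k) w x) @[k --> \oo] -->
    \int[mu]_(x in Omega) (F x * truncation v w x)) /\
  (forall I : set R, measurable (I : set (measurableTypeR R)) ->
    (lebesgue_measure I < +oo)%E -> forall F : rV * R -> rV,
    (forall i, in_Lp (@lebesgue_xt R n) (Omega `*` I) (p / (p - 1)) (fun z => F z 0 i)) ->
    \int[@lebesgue_xt R n]_(z in Omega `*` I)
       dotp (F z) (grad (truncation (phi_ k) w) z.1) @[k --> \oo] -->
    \int[@lebesgue_xt R n]_(z in Omega `*` I) dotp (F z) (truncation_grad v G w z.1)) /\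
  (forall F : rV -> rV,
    (forall i, in_Lp mu Omega (p / (p - 1)) (fun x => F x 0 i)) ->
    \int[mu]_(x in Omega) dotp (F x) (grad (truncation (phi_ k) w) x) @[k --> \oo] -->
    \int[mu]_(x in Omega) dotp (F x) (truncation_grad v G w x)).
Proof.
move=> [[Lv LG _] [phi_ [tphi cv cG]]] sw; exists phi_; split => //.
have mphi k : measurable_fun Omega (phi_ k).
  by apply: measurable_smooth; exact: test_fun_smooth (tphi k).
have mDphi k i : measurable_fun Omega ('D_(basis_vec R i) (phi_ k)).
  by apply: measurable_smooth; apply: smooth_derive; exact: test_fun_smooth (tphi k).
have mv : measurable_fun Omega v by case: Lv.
have mG i : measurable_fun Omega (fun x => G x 0 i) by case: (LG i).
have mw := measurable_smooth sw.
have Lw i := smooth_in_Lp_coord i (ltW p0) sw.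
have jphi k : Rintegrable mu Omega (phi_ k).
  by apply: integrableS (test_fun_integrable (tphi k)).
have gradE k x i : grad (truncation (phi_ k) w) x 0 i =
    dbump (phi_ k x - w x) * ('D_(basis_vec R i) (phi_ k) x - grad w x 0 i).
  by rewrite mxE (derive_truncation _ _ (test_fun_smooth (tphi k)) sw) mxE.
have tgradE x i : truncation_grad v G w x 0 i = dbump (v x - w x) * (G x 0 i - grad w x 0 i).
  by rewrite !mxE.
have LDphi k i : in_Lp mu Omega p ('D_(basis_vec R i) (phi_ k)).
  exact: (smooth_in_Lp oO bO (ltW p0) (smooth_derive _ (test_fun_smooth (tphi k)))).
split; first by move=> F LF; exact: (truncation_cvg mO muO p1 LF cv mphi mv mw).
split.
- move=> I mI leI F LF; set S := Omega `*` I.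
  have mS : measurable (S : set (rV * measurableTypeR R)) by exact: measurableX.
  have nuS : (@lebesgue_xt R n S < +oo)%E.
    have -> : @lebesgue_xt R n S = (mu Omega * lebesgue_measure I)%E.
      exact: product_measure1E.
    by rewrite lte_mul_pinfty// ge0_fin_numE.
  have mS1 (f : rV -> R) : measurable_fun Omega f -> measurable_fun (S : set (rV * measurableTypeR R)) (fun z => f z.1).
    move=> mf; apply: (@measurable_comp _ _ _ _ _ _ Omega f S fst) => //.
      by move=> _ [z [Oz _] <-].
    by apply: measurable_funTS; exact: measurable_fst.
  have LSv := cvg_Lp_strip mO mI leI mphi mv cv.
  have LSG i := cvg_Lp_strip mO mI leI (mDphi^~ i) (mG i) (cG i).
  have LSw i := in_Lp_strip mO mI leI (Lw i).
  have LSGG i := in_Lp_strip mO mI leI (LG i).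
  have mdb (f : rV -> R) : measurable_fun Omega f ->
     measurable_fun (S : set (rV * measurableTypeR R)) (fun z => dbump (f z.1 - w z.1)).
    move=> mf; apply: (mS1 (fun x => dbump (f x - w x))).
    apply: (measurableT_comp (f := @dbump R)); last exact: measurable_funB.
    by apply: continuous_measurable_fun; exact: continuous_dbump.
  have dB (x : R) : `|dbump x| <= 2 by rewrite ger0_norm ?dbump_ge0 ?dbump_le2.
  have jj k i : Rintegrable (@lebesgue_xt R n) S
      (fun z => F z 0 i * grad (truncation (phi_ k) w) z.1 0 i).
    apply: (Rintegrable_pairing mS p1 (LF i)); under eq_fun do rewrite gradE.
    apply: (in_LpM_bounded mS p1 (mdb _ (mphi k)) (C := 2)) => [z _|]; first exact: dB.
    exact: (in_LpB mS p1 (in_Lp_strip mO mI leI (LDphi k i)) (LSw i)).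
  have jl i : Rintegrable (@lebesgue_xt R n) S
      (fun z => F z 0 i * truncation_grad v G w z.1 0 i).
    apply: (Rintegrable_pairing mS p1 (LF i)); under eq_fun do rewrite tgradE.
    apply: (in_LpM_bounded mS p1 (mdb _ mv) (C := 2)) => [z _|]; first exact: dB.
    exact: (in_LpB mS p1 (LSGG i) (LSw i)).
  rewrite [X in _ --> X]Rintegral_sum//.
  rewrite (_ : (fun k => _) = (fun k => \sum_i \int[@lebesgue_xt R n]_(z in S)
      (F z 0 i * grad (truncation (phi_ k) w) z.1 0 i))); last first.
    by apply/funext => k; rewrite Rintegral_sum.
  elim: (index_enum _) => [|i s IH].
    by under eq_fun do rewrite big_nil; rewrite big_nil; exact: cvg_cst.
  under eq_fun do rewrite big_cons; rewrite big_cons; apply: (@cvgD R) => //.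
  have := @truncation_grad_cvg _ _ R (@lebesgue_xt R n) S p mS nuS p1 (fun z => F z 0 i)
    (fun z => v z.1) (fun z => G z.1 0 i) (fun z => w z.1) (fun z => grad w z.1 0 i)
    (fun k z => phi_ k z.1) (fun k z => 'D_(basis_vec R i) (phi_ k) z.1)
    (LF i) LSv (LSG i) (fun k => mS1 _ (mphi k)) (mS1 _ mv) (fun k => mS1 _ (mDphi k i))
    (mS1 _ mw) (LSGG i) (LSw i).
  under eq_fun do under eq_Rintegral do rewrite -gradE.
  by under [X in _ --> X -> _]eq_Rintegral do rewrite -tgradE.
- move=> F LF.
  have mdb (f : rV -> R) : measurable_fun Omega f -> measurable_fun Omega (fun x => dbump (f x - w x)).
    move=> mf; apply: (measurableT_comp (f := @dbump R)); last exact: measurable_funB.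
    by apply: continuous_measurable_fun; exact: continuous_dbump.
  have dB (x : R) : `|dbump x| <= 2 by rewrite ger0_norm ?dbump_ge0 ?dbump_le2.
  have jj k i : Rintegrable mu Omega (fun x => F x 0 i * grad (truncation (phi_ k) w) x 0 i).
    apply: (Rintegrable_pairing mO p1 (LF i)); under eq_fun do rewrite gradE.
    apply: (in_LpM_bounded mO p1 (mdb _ (mphi k)) (C := 2)) => [z _|]; first exact: dB.
    exact: (in_LpB mO p1 (LDphi k i) (Lw i)).
  have jl i : Rintegrable mu Omega (fun x => F x 0 i * truncation_grad v G w x 0 i).
    apply: (Rintegrable_pairing mO p1 (LF i)); under eq_fun do rewrite tgradE.
    apply: (in_LpM_bounded mO p1 (mdb _ mv) (C := 2)) => [z _|]; first exact: dB.
    exact: (in_LpB mO p1 (LG i) (Lw i)).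
  rewrite [X in _ --> X]Rintegral_sum//.
  rewrite (_ : (fun k => _) = (fun k => \sum_i \int[mu]_(x in Omega)
      (F x 0 i * grad (truncation (phi_ k) w) x 0 i))); last first.
    by apply/funext => k; rewrite Rintegral_sum.
  elim: (index_enum _) => [|i s IH].
    by under eq_fun do rewrite big_nil; rewrite big_nil; exact: cvg_cst.
  under eq_fun do rewrite big_cons; rewrite big_cons; apply: (@cvgD R) => //.
  have := @truncation_grad_cvg _ _ R mu Omega p mO muO p1 (fun x => F x 0 i)
    v (fun x => G x 0 i) w (fun x => grad w x 0 i)
    phi_ (fun k => 'D_(basis_vec R i) (phi_ k))
    (LF i) cv (cG i) mphi mv (mDphi^~ i) mw (LG i) (Lw i).
  under eq_fun do under eq_Rintegral do rewrite -gradE.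
  by under [X in _ --> X -> _]eq_Rintegral do rewrite -tgradE.
Qed.

Lemma truncation_divergence v G w (F : 'I_n -> rV -> R) :
  in_W1p_0 Omega p v G -> smooth w -> (forall x, 0 <= w x) -> (forall i, smooth (F i)) ->
  \int[mu]_(x in Omega) dotp (\row_i F i x) (truncation_grad v G w x) =
  - \int[mu]_(x in Omega) ((\sum_i 'D_(basis_vec R i) (F i) x) * truncation v w x).
Proof.
move=> Wv sw w0 sF; have [phi_ [tphi [c1 [_ c2]]]] := truncation_limit Wv sw.
have p'0 : 0 <= p / (p - 1) by apply: ltW; exact: conj_exponent_gt0.
have sdiv : smooth (fun x => \sum_i 'D_(basis_vec R i) (F i) x).
  by apply: smooth_sum => i; exact: (smooth_derive _ (sF i)).
have cL := c1 _ (smooth_in_Lp oO bO p'0 sdiv).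
have cR : \int[mu]_(x in Omega) dotp (\row_i F i x) (grad (truncation (phi_ k) w) x) @[k --> \oo]
    --> \int[mu]_(x in Omega) dotp (\row_i F i x) (truncation_grad v G w x).
  by apply: c2 => i; under eq_fun do rewrite mxE; exact: (smooth_in_Lp oO bO p'0 (sF i)).
have E k : \int[mu]_(x in Omega) dotp (\row_i F i x) (grad (truncation (phi_ k) w) x) =
    - \int[mu]_(x in Omega) ((\sum_i 'D_(basis_vec R i) (F i) x) * truncation (phi_ k) w x).
  have tt := test_fun_truncation (tphi k) sw w0.
  have j1 i : Rintegrable mu Omega (fun x => F i x * 'D_(basis_vec R i) (truncation (phi_ k) w) x).
    have := test_fun_smoothM (sF i) (test_fun_derive (basis_vec R i) tt).
    by move=> /test_fun_integrable; apply: integrableS.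
  have j2 i : Rintegrable mu Omega (fun x => 'D_(basis_vec R i) (F i) x * truncation (phi_ k) w x).
    have := test_fun_smoothM (smooth_derive (basis_vec R i) (sF i)) tt.
    by move=> /test_fun_integrable; apply: integrableS.
  transitivity (\int[mu]_(x in Omega) \sum_i (F i x * 'D_(basis_vec R i) (truncation (phi_ k) w) x)).
    by apply: eq_Rintegral => x _; apply: eq_bigr => i _; rewrite !mxE.
  rewrite Rintegral_sum//; transitivity (- \sum_i \int[mu]_(x in Omega)
      ('D_(basis_vec R i) (F i) x * truncation (phi_ k) w x)).
    rewrite -sumrN; apply: eq_bigr => i _.
    exact: (integration_by_parts_test_fun i (sF i) tt).
  rewrite -Rintegral_sum//; congr (- _); apply: eq_Rintegral => x _.
  by rewrite mulr_suml.
apply: (cvg_unique (@norm_hausdorff _ _) cR).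
by rewrite (_ : (fun k => _) = (fun k => - \int[mu]_(x in Omega)
  ((\sum_i 'D_(basis_vec R i) (F i) x) * truncation (phi_ k) w x))); [exact: cvgN cL|exact/funext].
Qed.

Lemma weak_gradient_eq (U : set rV) v zeta G G1 : open U -> U `<=` Omega ->
  (forall x, U x -> zeta x = 1) ->
  in_W1p Omega p v G1 -> in_W1p Omega p (fun x => zeta x * v x) G ->
  {ae mu, forall x, U x -> G x = G1 x}.
Proof.
move=> oU UO zeta1 [_ LG1 wG1] [_ LG wG].
have mU := open_measurable_rV oU.
have H i : {ae mu, forall x, U x -> G x 0 i - G1 x 0 i = 0}.
  have jG : Rintegrable mu Omega (fun x => G x 0 i) by exact: (in_Lp_Rintegrable mO muO p1).
  have jG1 : Rintegrable mu Omega (fun x => G1 x 0 i) by exact: (in_Lp_Rintegrable mO muO p1).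
  apply: fundamental_lemma => //.
    by apply: (integrableS mO mU UO); exact: RintegrableB.
  move=> phi tphi; have tphiO := test_funS UO tphi.
  have tD := test_fun_derive (basis_vec R i) tphi.
  have [C C0 HC] := test_fun_bounded tphi.
  have mphi := measurable_smooth (test_fun_smooth tphi).
  have jp (f : rV -> R) : Rintegrable mu Omega f -> Rintegrable mu Omega (fun x => f x * phi x).
    move=> jf; rewrite (_ : (fun x => _) = (fun x => phi x * f x)); last first.
      by apply/funext => x; rewrite mulrC.
    by apply: (@RintegralM_bounded _ _ _ mu _ mO phi f C mphi _ jf) => x _; exact: HC.
  rewrite Rintegral_eq0_off; last by move=> x Ux; rewrite (test_fun_eq0 tphi Ux) mulr0.
  rewrite -(@Rintegral_eq0_off _ _ _ mu Omega); last first.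
    by move=> x Ox; rewrite (test_fun_eq0 tphiO Ox) mulr0.
  under eq_Rintegral do rewrite mulrBl.
  rewrite RintegralB//; try exact: jp.
  have e1 := wG i phi tphiO; have e2 := wG1 i phi tphiO.
  apply/eqP; rewrite subr_eq0 -eqr_opp -e1 -e2; apply/eqP.
  apply: eq_Rintegral => x _; have [Ux|Ux] := pselect (U x); first by rewrite zeta1// mul1r.
  by rewrite (test_fun_eq0 tD Ux) !mulr0.
have : {ae mu, forall x, forall i : 'I_n, U x -> G x 0 i - G1 x 0 i = 0}.
  exact: filter_forall.
apply: filterS => x Hx Ux; apply/rowP => i; apply/eqP; rewrite -subr_eq0; apply/eqP.
exact: Hx.
Qed.

End truncated_test_functions.

(** * Steklov averages *)

Section product_integrable.
Context d1 d2 (T1 : measurableType d1) (T2 : measurableType d2) {R : realType}.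
Variables (m1 : {sigma_finite_measure set T1 -> \bar R}).
Variables (m2 : {sigma_finite_measure set T2 -> \bar R}).
Variables (A : set T1) (B : set T2).
Hypotheses (mA : measurable A) (mB : measurable B).

Lemma measurable_snd_comp (f : T2 -> R) : measurable_fun B f ->
  measurable_fun (A `*` B) (fun z => f z.2).
Proof.
move=> mf; apply: (@measurable_comp _ _ _ _ _ _ B f (A `*` B) snd) => //.
  by move=> _ [z [_ Bz] <-].
by apply: measurable_funTS; exact: measurable_snd.
Qed.

Lemma Rintegrable_iterated (f : T1 * T2 -> R) (g : T1 -> R) :
  measurable_fun (A `*` B) f -> Rintegrable m1 A g ->
  {ae m1, forall x, A x -> (\int[m2]_(t in B) `|f (x, t)|%:E <= (g x)%:E)%E} ->
  Rintegrable (m1 \x m2)%E (A `*` B) f.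
Proof.
move=> mf jg fg; have mAB : measurable (A `*` B) by exact: measurableX.
apply/(integrable_mkcond _ mAB); set F := _ \_ _.
have mF : measurable_fun setT F.
  by apply/(measurable_restrictT _ mAB)/measurable_EFinP.
apply/(integrable12ltyP m1 m2 mF).
apply: (@le_lt_trans _ _ (\int[m1]_(x in A) `|(g x)%:E|)%E); last first.
  by move/integrableP: jg => [].
rewrite [leRHS]integral_mkcond; apply: ae_ge0_le_integral => //.
- by move=> x _; exact: integral_ge0.
- apply: (measurable_fun_fubini_tonelli_F (abse \o F)).
    exact: measurableT_comp.
  by move=> z; exact: abse_ge0.
- by move=> x _; rewrite patchE; case: ifP => _ //; exact: abse_ge0.
- apply/(measurable_restrictT _ mA); apply: measurableT_comp => //.
  exact: measurable_int jg.
- apply: filterS fg => x fg _; rewrite patchE; case: ifPn => xA.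
    rewrite inE in xA; apply: le_trans; last first.
      by apply: (le_trans (fg xA)); exact: lee_abs.
    rewrite [leRHS]integral_mkcond; apply: ge0_le_integral => //.
    + by apply: measurableT_comp => //; apply: (measurableT_comp mF); exact: pair1_measurable.
    + apply/(measurable_restrictT _ mB)/measurable_EFinP; apply: measurableT_comp => //.
      exact: (measurable_slice2 mA mB mf xA).
    + move=> t _; rewrite /F !patchE; case: (boolP (t \in B)) => tB.
        by rewrite ifT ?mem_set//; split=> //=; rewrite inE in tB.
      by rewrite ifF ?abse0//; apply/negP; rewrite inE => -[_ /= Bt];
         move/negP: tB; apply; rewrite inE.
  rewrite integral0_eq// => t _; rewrite /F patchE ifF ?abse0//.
  by apply/negP; rewrite inE => -[/= Ax _]; move/negP: xA; apply; rewrite inE.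
Qed.

Lemma Rintegrable_snd (f : T2 -> R) : (m1 A < +oo)%E -> Rintegrable m2 B f ->
  Rintegrable (m1 \x m2)%E (A `*` B) (fun z => f z.2).
Proof.
move=> A_fin jf.
apply: (@Rintegrable_iterated _ (fun=> fine (\int[m2]_(t in B) `|f t|%:E))).
- by apply: measurable_snd_comp; exact: Rintegrable_measurable jf.
- by apply: (Rintegrable_bounded mA (C := `|fine (\int[m2]_(t in B) `|f t|%:E)|)).
- apply: aeW => x _; rewrite fineK//; apply: integrable_fin_num => //.
  exact: Rintegrable_abs jf.
Qed.

Lemma Rintegrable_fst (f : T1 -> R) : (m2 B < +oo)%E -> Rintegrable m1 A f ->
  Rintegrable (m1 \x m2)%E (A `*` B) (fun z => f z.1).
Proof.
move=> B_fin jf.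
apply: (@Rintegrable_iterated _ (fun x => `|f x| * fine (m2 B))).
- apply: (@measurable_comp _ _ _ _ _ _ A f (A `*` B) fst) => //.
  + by move=> _ [z [Az _] <-].
  + exact: Rintegrable_measurable jf.
  + by apply: measurable_funTS; exact: measurable_fst.
- apply: eq_integrable (RintegrableZ mA (fine (m2 B)) (Rintegrable_abs jf)) => //.
  by move=> x _ /=; rewrite mulrC.
- by apply: aeW => x _ /=; rewrite integral_cst// EFinM fineK// ge0_fin_numE.
Qed.

End product_integrable.

Section window.
Context {R : realType}.
Local Notation leb := (@lebesgue_measure R).
Implicit Types (h t r : R) (A : set (measurableTypeR R)).

Definition window (h : R) (z : R * R) : R := \1_(`[0, h[%classic) (z.1 - z.2).

Lemma measurable_window h :
  measurable_fun [set: measurableTypeR R * measurableTypeR R] (window h).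
Proof.
apply: (@measurableT_comp _ _ _ _ _ _ (\1_(`[0, h[%classic) : R -> R)) => //.
by apply: measurable_funB; [exact: measurable_fst|exact: measurable_snd].
Qed.

Lemma windowE h t r : window h (t, r) = if (t - h < r) && (r <= t) then 1 else 0.
Proof.
rewrite /window indicE /=; have -> : (t - r \in `[0, h[%classic) = (t - h < r) && (r <= t).
  apply/idP/andP; rewrite inE /= in_itv /= subr_ge0.
    by move=> /andP[-> h1]; split=> //; lra.
  by move=> [h1 ->] /=; lra.
by case: ifP.
Qed.

Lemma window_ge0 h z : 0 <= window h z. Proof. by rewrite /window indicE ler0n. Qed.

Lemma window_le1 h z : window h z <= 1.
Proof. by rewrite /window indicE lern1 leq_b1. Qed.

Lemma integral_le_itv h A (S : set (measurableTypeR R)) (w : R -> R) : 0 < h ->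
  measurable A -> (leb A < +oo)%E -> measurable S -> leb S = h%:E ->
  measurable_fun A w -> (forall t, 0 <= w t <= 1) -> (forall t, ~ S t -> w t = 0) ->
  Rintegrable leb A w /\ \int[leb]_(t in A) w t <= h.
Proof.
move=> h0 mA lA mS leS mw w01 wS.
have jw : Rintegrable leb A w.
  by apply: (@Rintegrable_bounded _ _ _ leb A mA _ 1 lA mw) => t _; rewrite ger0_norm; case/andP: (w01 t).
split=> //.
rewrite Rintegral_mkcond; apply: (@le_trans _ _ (\int[leb]_(t in S) (1 : R))).
  rewrite [leRHS]Rintegral_mkcond; apply: le_Rintegral => //.
  - by rewrite -restrict_EFin; apply: (integrable_mkcond _ mA).1; exact: jw.
  - have jc : Rintegrable leb S (fun _ : R => 1 : R).
      apply: (@Rintegrable_bounded _ _ _ leb _ mS _ 1).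
      - by apply: (@le_lt_trans _ _ h%:E); [rewrite -leS|exact: ltry].
      - exact: measurable_cst.
      - by move=> t _; rewrite normr1.
    by rewrite -restrict_EFin; apply: (integrable_mkcond _ mS).1; exact: jc.
  - move=> t _; rewrite !patchE; have /andP[w0 w1] := w01 t.
    case: (boolP (t \in S)) => tS; first by case: ifP.
    rewrite wS; last by move=> h1; move/negP: tS; apply; rewrite inE.
    by case: ifP.
rewrite Rintegral_cst// mul1r.
suff : fine (leb S) <= h by [].
by rewrite leS.
Qed.

Lemma integral_window_snd h A t : 0 < h -> measurable A -> (leb A < +oo)%E ->
  Rintegrable leb A (fun r => window h (t, r)) /\ \int[leb]_(r in A) window h (t, r) <= h.
Proof.
move=> h0 mA lA; apply: (@integral_le_itv h A `]t - h, t]%classic) => //.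
- rewrite lebesgue_measure_itv /= lte_fin ltrBlDr ltrDl h0.
  by rewrite -EFinB opprB addrC subrK.
- apply: measurable_funTS; apply: (measurableT_comp (measurable_window h)).
  exact: pair1_measurable.
- by move=> r; rewrite window_ge0 window_le1.
- by move=> r; rewrite /= in_itv /= windowE; case: ifP.
Qed.

Lemma integral_window_fst h A r : 0 < h -> measurable A -> (leb A < +oo)%E ->
  Rintegrable leb A (fun t => window h (t, r)) /\ \int[leb]_(t in A) window h (t, r) <= h.
Proof.
move=> h0 mA lA; apply: (@integral_le_itv h A `[r, r + h[%classic) => //.
- by rewrite lebesgue_measure_itv /= lte_fin ltrDl h0 -EFinB addrAC subrr add0r.
- apply: measurable_funTS; apply: (measurableT_comp (measurable_window h)).
  exact: pair2_measurable.
- by move=> t; rewrite window_ge0 window_le1.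
- move=> t; rewrite /= in_itv /= windowE => nt; case: ifP => // /andP[h1 h2].
  by exfalso; apply: nt; rewrite h2 -ltrBlDr.
Qed.

End window.

Section steklov_1d.
Context {R : realType} (I J : set (measurableTypeR R)).
Local Notation leb := (@lebesgue_measure R).
Hypotheses (mI : measurable I) (mJ : measurable J).
Hypotheses (lI : (leb I < +oo)%E) (lJ : (leb J < +oo)%E).
Implicit Types (h : R) (f g F : R -> R).

Lemma steklov_window_integrable F h : Rintegrable leb I F ->
  Rintegrable (leb \x leb)%E (J `*` I) (fun z => window h z * F z.2).
Proof.
move=> jF; apply: (@RintegralM_bounded _ _ _ _ _ (measurableX mJ mI) (window h) _ 1).
- by apply: measurable_funTS; exact: measurable_window.
- by move=> z _; rewrite ger0_norm ?window_ge0 ?window_le1.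
- exact: (Rintegrable_snd mJ mI lJ jF).
Qed.

Lemma steklov_window_integrable_fst F h : Rintegrable leb J F ->
  Rintegrable (leb \x leb)%E (J `*` I) (fun z => window h z * F z.1).
Proof.
move=> jF; apply: (@RintegralM_bounded _ _ _ _ _ (measurableX mJ mI) (window h) _ 1).
- by apply: measurable_funTS; exact: measurable_window.
- by move=> z _; rewrite ger0_norm ?window_ge0 ?window_le1.
- exact: (Rintegrable_fst mJ mI lI jF).
Qed.

Lemma steklov_tonelli F h : 0 < h -> Rintegrable leb I F -> (forall r, 0 <= F r) ->
  \int[(leb \x leb)%E]_(z in J `*` I) (window h z * F z.2) <= h * \int[leb]_(r in I) F r.
Proof.
move=> h0 jF F0; have jw := steklov_window_integrable h jF.
have [j2 _ ->] := Rfubini2 (m1 := leb) (m2 := leb) mJ mI jw.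
rewrite -RintegralZl//; apply: le_Rintegral => //; first exact: RintegrableZ.
move=> r Ir /=; have [jr ler] := integral_window_fst r h0 mJ lJ.
by rewrite RintegralZr// ler_wpM2r.
Qed.

Lemma steklov_tonelli_fst F h : 0 < h -> Rintegrable leb J F -> (forall r, 0 <= F r) ->
  \int[(leb \x leb)%E]_(z in J `*` I) (window h z * F z.1) <= h * \int[leb]_(r in J) F r.
Proof.
move=> h0 jF F0; have jw := steklov_window_integrable_fst h jF.
have [j2 _ ->] := Rfubini1 (m1 := leb) (m2 := leb) mJ mI jw.
rewrite -RintegralZl//; apply: le_Rintegral => //; first exact: RintegrableZ.
move=> r Ir /=; have [jr ler] := integral_window_snd r h0 mI lI.
by rewrite RintegralZr// ler_wpM2r.
Qed.

Section pairing.
Variable p : R.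
Hypothesis p1 : 1 < p.
Let p' := p / (p - 1).
Local Notation JI := (J `*` I).

Definition window_pairing f g (z : R * R) : R := f z.2 * g z.1.

Lemma measurable_window_pairing f g : measurable_fun I f -> measurable_fun J g ->
  measurable_fun (JI : set (measurableTypeR R * measurableTypeR R)) (window_pairing f g).
Proof.
move=> mf mg; apply: measurable_funM; first exact: measurable_snd_comp.
apply: (@measurable_comp _ _ _ _ _ _ J g JI fst) => //.
  by move=> _ [z [Jz _] <-].
by apply: measurable_funTS; exact: measurable_fst.
Qed.

Lemma window_pairing_integrable f g : in_Lp leb I p' f -> in_Lp leb J p g ->
  Rintegrable (leb \x leb)%E JI (window_pairing f g).
Proof.
move=> Lf Lg; have mJI : measurable (JI : set (measurableTypeR R * measurableTypeR R)) by exact: measurableX.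
apply: (Rintegrable_le mJI (g := fun z => `|f z.2| `^ p' + `|g z.1| `^ p)).
- by apply: measurable_window_pairing; [case: Lf|case: Lg].
- apply: RintegrableD => //.
    by apply: (Rintegrable_snd mJ mI lJ (in_Lp_integrable Lf)).
  by apply: (Rintegrable_fst mJ mI lI (in_Lp_integrable Lg)).
- by move=> z _; rewrite /window_pairing normrM young_le.
Qed.

Lemma window_window_pairing_integrable h f g : in_Lp leb I p' f -> in_Lp leb J p g ->
  Rintegrable (leb \x leb)%E JI (fun z => window h z * window_pairing f g z).
Proof.
move=> Lf Lg.
apply: (@RintegralM_bounded _ _ _ _ _ (measurableX mJ mI) (window h) _ 1).
- by apply: measurable_funTS; exact: measurable_window.
- by move=> z _; rewrite ger0_norm ?window_ge0 ?window_le1.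
- exact: (window_pairing_integrable Lf Lg).
Qed.

Definition steklov_form h f g : R :=
  h^-1 * \int[(leb \x leb)%E]_(z in JI) (window h z * window_pairing f g z).

Lemma steklov_form_le h K f g : 0 < h -> 0 < K -> in_Lp leb I p' f -> in_Lp leb J p g ->
  `|steklov_form h f g| <= K `^ (- p') * \int[leb]_(r in I) (`|f r| `^ p') +
                           K `^ p * \int[leb]_(t in J) (`|g t| `^ p).
Proof.
move=> h0 K0 Lf Lg; have mJI : measurable (JI : set (measurableTypeR R * measurableTypeR R)) by exact: measurableX.
have jf := in_Lp_integrable Lf; have jg := in_Lp_integrable Lg.
have j1 := steklov_window_integrable h jf; have j2 := steklov_window_integrable_fst h jg.
rewrite /steklov_form normrM ger0_norm ?invr_ge0 ?(ltW h0)// ler_pdivrMl//.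
apply: (le_trans (le_normr_Rintegral mJI (window_window_pairing_integrable h Lf Lg))).
apply: (@le_trans _ _ (\int[(leb \x leb)%E]_(z in JI) (K `^ (- p') * (window h z * `|f z.2| `^ p') +
    K `^ p * (window h z * `|g z.1| `^ p)))).
  apply: le_Rintegral => //.
  - exact: (Rintegrable_abs (window_window_pairing_integrable h Lf Lg)).
  - exact: (RintegrableD mJI (RintegrableZ mJI _ j1) (RintegrableZ mJI _ j2)).
  - move=> z _; rewrite normrM ger0_norm ?window_ge0// [leRHS](_ : _ = window h z *
      (K `^ (- p') * `|f z.2| `^ p' + K `^ p * `|g z.1| `^ p)); last by ring.
    by rewrite ler_wpM2l ?window_ge0// /window_pairing normrM young_scaled.
rewrite (RintegralD mJI (RintegrableZ mJI _ j1) (RintegrableZ mJI _ j2)).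
rewrite (RintegralZl _ mJI j1) (RintegralZl _ mJI j2) mulrDr; apply: lerD; rewrite mulrCA ler_wpM2l ?powR_ge0//.
  by apply: steklov_tonelli => // r; exact: powR_ge0.
by apply: steklov_tonelli_fst => // r; exact: powR_ge0.
Qed.

Lemma steklov_formD h f1 f2 g : in_Lp leb I p' f1 -> in_Lp leb I p' f2 ->
  in_Lp leb J p g ->
  steklov_form h (fun r => f1 r + f2 r) g = steklov_form h f1 g + steklov_form h f2 g.
Proof.
move=> L1 L2 Lg; have mJI : measurable (JI : set (measurableTypeR R * measurableTypeR R)) by exact: measurableX.
rewrite /steklov_form -mulrDr -(RintegralD mJI (window_window_pairing_integrable h L1 Lg)
  (window_window_pairing_integrable h L2 Lg)).
by congr (_ * _); apply: eq_Rintegral => z _; rewrite /window_pairing; ring.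
Qed.

Lemma steklov_form_fubini h f g : in_Lp leb I p' f -> in_Lp leb J p g ->
  steklov_form h f g = \int[leb]_(t in J) (g t * (h^-1 * \int[leb]_(r in I) (window h (t, r) * f r))).
Proof.
move=> Lf Lg; have jw := window_window_pairing_integrable h Lf Lg.
have jf : Rintegrable leb I f.
  apply: (Rintegrable_le mI (g := fun r => 1 + `|f r| `^ p')).
  - by case: Lf.
  - apply: (RintegrableD mI _ (in_Lp_integrable Lf)).
    by apply: (@Rintegrable_bounded _ _ _ leb I mI _ 1 lI) => [|r _]; [exact: measurable_cst|rewrite normr1].
  - move=> r _; have := @young_le _ _ p1 `|f r| 1 (normr_ge0 _) ler01.
    by rewrite powR1 mulr1 addrC.
have [j1 _ E] := Rfubini1 (m1 := leb) (m2 := leb) mJ mI jw.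
have [j2 _ _] := Rfubini1 (m1 := leb) (m2 := leb) mJ mI (steklov_window_integrable h jf).
rewrite /steklov_form E -RintegralZl//; apply: eq_Rintegral => t; rewrite inE => Jt.
have jwf : Rintegrable leb I (fun r => window h (t, r) * f r).
  apply: (@RintegralM_bounded _ _ _ _ _ mI (fun r => window h (t, r)) _ 1) => //.
  - apply: measurable_funTS; apply: (measurableT_comp (measurable_window h)).
    exact: pair1_measurable.
  - by move=> r _; rewrite ger0_norm ?window_ge0 ?window_le1.
rewrite mulrCA; congr (_ * _); rewrite -RintegralZl//; apply: eq_Rintegral => r _.
by rewrite /window_pairing /=; ring.
Qed.

End pairing.
End steklov_1d.

Section steklov_limit.
Context {R : realType} (s a b T : R).
Hypotheses (sa : s < a) (ab : a < b) (bT : b < T).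
Local Notation leb := (@lebesgue_measure R).
Local Notation I := (`]s, T[%classic : set (measurableTypeR R)).
Local Notation J := (`]a, b[%classic : set (measurableTypeR R)).

Lemma integral_window (h t : R) (F : R -> R) : 0 < h < a - s -> J t ->
  \int[leb]_(r in I) (window h (t, r) * F r) = \int[leb]_(r in `]t - h, t]) F r.
Proof.
move=> /andP[h0 has]; rewrite /= in_itv /= => /andP[at_ tb].
rewrite Rintegral_mkcond [RHS]Rintegral_mkcond; apply: eq_Rintegral => r _.
rewrite !patchE windowE; have [rw|rw] := boolP ((t - h < r) && (r <= t)).
  rewrite mul1r !ifT//; rewrite inE /= in_itv /= ?rw//; case/andP: rw => r1 r2.
  apply/andP; split; first by apply: lt_trans r1; rewrite ltrBrDl (lt_le_trans _ (ltW at_))// -ltrBrDr.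
  by apply: le_lt_trans r2 _; apply: lt_trans tb _.
rewrite mul0r [RHS]ifF; first by case: ifP.
by apply/negP; rewrite inE /= in_itv /=; exact/negP.
Qed.

Let mI : measurable I. Proof. exact: measurable_itv. Qed.
Let mJ : measurable J. Proof. exact: measurable_itv. Qed.
Let lI : (leb I < +oo)%E. Proof. exact: lebesgue_itv_oo_lty. Qed.
Let lJ : (leb J < +oo)%E. Proof. exact: lebesgue_itv_oo_lty. Qed.

Lemma steklov_cvg_ae (f : R -> R) : Rintegrable leb I f ->
  {ae leb, forall t, J t -> k.+1%:R * \int[leb]_(r in I) (window k.+1%:R^-1 (t, r) * f r) @[k --> \oo] --> f t}.
Proof.
move=> jf; pose F (x : R) : R := \int[leb]_(r in `]s, x]) (f \_ I) r.
have jfI : Rintegrable leb setT (f \_ I).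
  by have := (integrable_mkcond _ mI).1 jf; rewrite restrict_EFin.
have jset (A : set R) : measurable A -> Rintegrable leb A (f \_ I).
  by move=> mA; apply: integrableS jfI.
have H := @FTC1 R (f \_ I) (BRight s) (fun y => jset _ (measurable_itv _))
  (integrable_locally mI jf).
apply: (@filterS _ _ (ae_filter_ringOfSetsType leb) _ _ _ H) => t Ht Jt.
have [at_ tb] : a < t /\ t < b.
  by move: Jt; rewrite /= in_itv /= => /andP[].
have [|dF F'] := Ht; first by rewrite /Order.lt /= (lt_trans sa at_).
have It : t \in I by rewrite inE /= in_itv /= (lt_trans sa at_) (lt_trans tb bT).
rewrite (_ : f t = 'D_1 F t); last by rewrite -derive1E F' patchE It.
have cF : (fun h : R => h^-1 *: (F (h *: 1 + t) - F t)) h @[h --> 0^'] --> 'D_1 F t by exact: dF.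
have k0 (k : nat) : 0 < k.+1%:R^-1 :> R by rewrite invr_gt0 ltr0n.
have H2 := (@cvgr_dnbhsP R _ _ _).1 cF (fun k : nat => - k.+1%:R^-1).
have H3 : (fun k : nat => (- k.+1%:R^-1)^-1 *: (F ((- k.+1%:R^-1) *: 1 + t) - F t)) k @[k --> \oo] --> 'D_1 F t.
  apply: H2; split; first by move=> k; rewrite oppr_eq0 gt_eqF.
  by rewrite -[X in _ --> X]oppr0; apply: cvgN; exact: cvg_harmonic.
have sat : 0 < a - s by rewrite subr_gt0.
apply: cvg_trans H3; apply: near_eq_cvg.
have /cvgrPdist_lt/(_ _ sat) := @cvg_harmonic R; apply: filterS => k.
rewrite sub0r normrN /harmonic /= ger0_norm ?(ltW (k0 k))// => hk.
rewrite integral_window ?k0//; set h := k.+1%:R^-1 in hk *.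
rewrite invrN scaleNr -scalerN opprB /h invrK; congr (_ * _).
have sth : s < t - h by rewrite ltrBrDl (lt_trans _ at_)// -ltrBrDr.
rewrite /F [_ *: 1]mulr1 [_ + t]addrC.
rewrite Rintegral_itvB; last 3 first.
- exact: jset.
- by rewrite bnd_simp ltW.
- by rewrite bnd_simp gerDl oppr_le0 invr_ge0 ler0n.
apply: eq_Rintegral => r; rewrite inE /= in_itv /= => /andP[r1 r2].
by rewrite patchE mem_set//= in_itv /= (lt_trans sth r1) (le_lt_trans r2 (lt_trans tb bT)).
Qed.

Section pairing.
Variable p : R.
Hypothesis p1 : 1 < p.
Let p' := p / (p - 1).

Lemma steklov_form_cvg_bounded (f g : R -> R) (C : R) : measurable_fun I f -> (forall r, `|f r| <= C) ->
  in_Lp leb J p g ->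
  steklov_form I J k.+1%:R^-1 f g @[k --> \oo] --> \int[leb]_(t in J) (f t * g t).
Proof.
move=> mf fC Lg; have p'0 : 0 <= p' by exact: (ltW (conj_exponent_gt0 p1)).
have Lf : in_Lp leb I p' f by exact: (@in_Lp_bounded _ _ _ leb I mI _ _ C).
have jf : Rintegrable leb I f by exact: (@Rintegrable_bounded _ _ _ leb I mI _ C lI).
have JI : J `<=` I.
  move=> t /=; rewrite !in_itv /= => /andP[t1 t2].
  by rewrite (lt_trans sa t1) (lt_trans t2 bT).
have jg : Rintegrable leb J g.
  have : Rintegrable leb J (fun t => (cst 1 : R -> R) t * g t).
    refine (Rintegrable_pairing mJ p1 _ Lg).
    by apply: (@in_Lp_bounded _ _ _ leb J mJ _ _ 1) => // x _; rewrite normr1.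
  by apply: eq_integrable => // t _ /=; rewrite mul1r.
have mg := Rintegrable_measurable jg.
have k0 (k : nat) : 0 < k.+1%:R^-1 :> R by rewrite invr_gt0 ltr0n.
have -> : (fun k : nat => steklov_form I J k.+1%:R^-1 f g) = (fun k : nat => \int[leb]_(t in J)
    (g t * (k.+1%:R * \int[leb]_(r in I) (window k.+1%:R^-1 (t, r) * f r)))).
  by apply/funext => k; rewrite (steklov_form_fubini mI mJ lI lJ p1 _ Lf Lg) invrK.
under [X in _ --> X]eq_Rintegral do rewrite mulrC.
apply: (Rdominated_convergence mJ (g := fun t => C * `|g t|)).
- move=> k; apply: measurable_funM => //; apply: measurable_funM => //.
  have [j2 _ _] := Rfubini1 (m1 := leb) (m2 := leb) mJ mI (steklov_window_integrable mI mJ lJ k.+1%:R^-1 jf).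
  exact: Rintegrable_measurable j2.
- by apply: measurable_funM => //; exact: measurable_funS mf.
- apply: (@filterS _ _ (ae_filter_ringOfSetsType leb) _ _ _ (steklov_cvg_ae jf)) => t Ht Jt.
  by apply: cvgM; [exact: cvg_cst|exact: Ht].
- by apply: RintegrableZ => //; exact: Rintegrable_abs.
- move=> k t Jt; rewrite mulrC normrM ler_wpM2r// normrM ger0_norm ?ler0n//.
  have [jw lew] := integral_window_snd t (k0 k) mI lI.
  have jwf : Rintegrable leb I (fun r => window k.+1%:R^-1 (t, r) * f r).
    apply: (@RintegralM_bounded _ _ _ _ _ mI (fun r => window k.+1%:R^-1 (t, r)) _ 1) => //.
    + exact: Rintegrable_measurable jw.
    + by move=> r _; rewrite ger0_norm ?window_ge0 ?window_le1.
  rewrite mulrC -ler_pdivlMr ?ltr0n//.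
  apply: (le_trans (le_normr_Rintegral mI jwf)).
  apply: (@le_trans _ _ (\int[leb]_(r in I) (C * window k.+1%:R^-1 (t, r)))).
    apply: le_Rintegral => //.
    + exact: Rintegrable_abs.
    + exact: RintegrableZ.
    + by move=> r _; rewrite normrM mulrC (ger0_norm (window_ge0 _ _)) ler_wpM2r ?window_ge0.
  rewrite RintegralZl// ler_wpM2l//; exact: le_trans (fC 0).
Qed.

Lemma powR_small (c e C : R) : 0 < c -> 0 < e -> 0 <= C ->
  exists2 K : R, 0 < K & K `^ c * C <= e.
Proof.
move=> c0 e0 C0; have C1 : 0 < e / (C + 1) by rewrite divr_gt0//; lra.
exists ((e / (C + 1)) `^ c^-1); first exact: powR_gt0.
rewrite -powRrM mulVf ?gt_eqF// powRr1 ?(ltW C1)// mulrAC ler_pdivrMr; last by lra.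
by rewrite ler_pM2l//; lra.
Qed.

Lemma steklov_form_cvg (f g : R -> R) : in_Lp leb I p' f -> in_Lp leb J p g ->
  steklov_form I J k.+1%:R^-1 f g @[k --> \oo] --> \int[leb]_(t in J) (f t * g t).
Proof.
move=> Lf Lg; have p'0 := conj_exponent_gt0 p1; have p0 : 0 < p by exact: lt_trans p1.
have k0 (k : nat) : 0 < k.+1%:R^-1 :> R by rewrite invr_gt0 ltr0n.
have JI : J `<=` I.
  move=> t /=; rewrite !in_itv /= => /andP[t1 t2].
  by rewrite (lt_trans sa t1) (lt_trans t2 bT).
have mf : measurable_fun I f by case: Lf.
pose f_ (j : nat) (r : R) : R := Num.max (- j%:R) (Num.min j%:R (f r)).
have f_C j r : `|f_ j r| <= j%:R.
  by rewrite ler_norml le_max lexx /= ge_max ge_min lexx andbT lerNl (le_trans _ (ler0n R j))// oppr_le0.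
have mf_ j : measurable_fun I (f_ j).
  by apply: measurable_maxr => //; apply: measurable_minr.
have f_0 j r : `|f r - f_ j r| <= `|f r|.
  rewrite /f_; have := ler0n R j; move: (j%:R : R) => c c0.
  by rewrite ler_norml; apply/andP; split; case: (lerP c (f r)) => h1; case: (lerP (- c) _) => h2;
    have := ler_norm (f r); have := ler_norm (- f r); rewrite normrN; lra.
have f_eq j r : `|f r| <= j%:R -> f_ j r = f r.
  rewrite ler_norml => /andP[h1 h2]; rewrite /f_ min_r// max_r//.
have Lfj j : in_Lp leb I p' (f_ j).
  by apply: (@in_Lp_bounded _ _ _ leb I mI _ _ j%:R) => //; exact: ltW.
have jf := in_Lp_integrable Lf.
have Ldj j : in_Lp leb I p' (fun r => f r - f_ j r).
  have md : measurable_fun I (fun r => f r - f_ j r) by exact: measurable_funB.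
  apply: integrable_in_Lp => //; apply: (Rintegrable_le mI) jf _.
    by apply: (measurableT_comp (measurable_powR p')); exact: measurableT_comp.
  move=> r _; rewrite ger0_norm ?powR_ge0// ge0_ler_powR ?nnegrE//; exact: ltW.
have d0 : \int[leb]_(r in I) (`|f r - f_ j r| `^ p') @[j --> \oo] --> 0.
  have -> : (0 : R) = \int[leb]_(r in I) (0 : R) by rewrite Rintegral_cst// mul0r.
  apply: (Rdominated_convergence mI (g := fun r => `|f r| `^ p')) => //.
  - by move=> j; apply: Rintegrable_measurable; exact: in_Lp_integrable (Ldj j).
  - apply: aeW => r _; apply: cvg_near_cst; near=> j.
    rewrite f_eq ?subrr ?normr0 ?powR0 ?gt_eqF//; near: j.
    exact: nbhs_infty_ger.
  - by move=> j r _; rewrite ger0_norm ?powR_ge0// ge0_ler_powR ?nnegrE//; exact: ltW.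
set A := \int[leb]_(t in J) (`|g t| `^ p).
have A0 : 0 <= A by apply: Rintegral_ge0 => t _; exact: powR_ge0.
apply: cvg_sub0; apply: cvg0_squeeze_eps => e e0.
have e4 : 0 < e / 4 by rewrite divr_gt0.
have [K K0 HK] := powR_small p0 e4 A0.
have Kp : 0 < K `^ (- p') by exact: powR_gt0.
have [j Hj] : exists j, K `^ (- p') * \int[leb]_(r in I) (`|f r - f_ j r| `^ p') <= e / 4.
  have /cvgr0Pnorm_le/(_ (e / 4 / K `^ (- p'))) := d0; rewrite divr_gt0// => /(_ isT).
  move=> [j _ /(_ j (leqnn j))] /= Hj; exists j.
  by rewrite mulrC -ler_pdivlMr//; apply: le_trans Hj; exact: ler_norm.
have LJ c h : in_Lp leb I c h -> in_Lp leb J c h.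
  move=> [mh fh]; split; first exact: measurable_funS mh.
  apply: le_lt_trans fh; apply: ge0_subset_integral => //.
  apply/measurable_EFinP; apply: (measurableT_comp (measurable_powR c)).
  exact: measurableT_comp.
exists (fun k => `|steklov_form I J k.+1%:R^-1 (f_ j) g - \int[leb]_(t in J) (f_ j t * g t)|).
  apply/norm_cvg0P; apply/subr_cvg0.
  by apply: (steklov_form_cvg_bounded (C := j%:R)).
near=> k.
have -> : steklov_form I J k.+1%:R^-1 f g = steklov_form I J k.+1%:R^-1 (fun r => f r - f_ j r) g +
    steklov_form I J k.+1%:R^-1 (f_ j) g.
  rewrite -(steklov_formD mI mJ lI lJ p1 _ (Ldj j) (Lfj j) Lg); congr (steklov_form _ _ _ _ _).
  by apply/funext => r; rewrite subrK.
have -> : \int[leb]_(t in J) (f t * g t) = \int[leb]_(t in J) ((f t - f_ j t) * g t) +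
    \int[leb]_(t in J) (f_ j t * g t).
  rewrite -(RintegralD mJ (Rintegrable_pairing mJ p1 (LJ _ _ (Ldj j)) Lg)
    (Rintegrable_pairing mJ p1 (LJ _ _ (Lfj j)) Lg)).
  by apply: eq_Rintegral => t _; rewrite -mulrDl subrK.
have H1 := steklov_form_le mI mJ lI lJ p1 (k0 k) K0 (Ldj j) Lg.
have H2 : `|\int[leb]_(t in J) ((f t - f_ j t) * g t)| <=
    K `^ (- p') * \int[leb]_(r in I) (`|f r - f_ j r| `^ p') + K `^ p * A.
  have jp := Rintegrable_pairing mJ p1 (LJ _ _ (Ldj j)) Lg.
  have ji := in_Lp_integrable (LJ _ _ (Ldj j)); have jg := in_Lp_integrable Lg.
  apply: (le_trans (le_normr_Rintegral mJ jp)).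
  apply: (@le_trans _ _ (\int[leb]_(t in J) (K `^ (- p') * `|f t - f_ j t| `^ p' + K `^ p * `|g t| `^ p))).
    apply: le_Rintegral => //.
    - exact: Rintegrable_abs.
    - by apply: RintegrableD => //; exact: RintegrableZ.
    - by move=> t _; rewrite normrM young_scaled.
  rewrite RintegralD//; try exact: RintegrableZ.
  rewrite (RintegralZl _ mJ ji) (RintegralZl _ mJ jg) lerD2r ler_pM2l//.
  rewrite /Rintegral; apply: fine_le.
  - exact: (integrable_fin_num mJ ji).
  - exact: (integrable_fin_num mI (in_Lp_integrable (Ldj j))).
  apply: ge0_subset_integral => //.
  exact: measurable_int (in_Lp_integrable (Ldj j)).
rewrite opprD addrACA; apply: (le_trans (ler_normD _ _)); rewrite lerD2r.
apply: (le_trans (ler_normB _ _)).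
move: H1 H2; rewrite -/p' -/A; lra.
Unshelve. all: by end_near. Qed.

End pairing.
End steklov_limit.


(* the library's canonical sigma-finiteness of product measures is declared for
   products of subprobabilities only *)
Section product_measure.
Context d1 d2 (T1 : measurableType d1) (T2 : measurableType d2) {R : realType}.
Variables (m1 : {sigma_finite_measure set T1 -> \bar R}).
Variables (m2 : {sigma_finite_measure set T2 -> \bar R}).

Definition product_measure : set (T1 * T2) -> \bar R := (m1 \x m2)%E.

HB.instance Definition _ := Measure.copy product_measure (m1 \x m2)%E.

Let product_measure_sigma_finite : sigma_finite setT product_measure.
Proof.
have /sigma_finiteP[F [TF ndF Foo]] := sigma_finiteT m1.
have /sigma_finiteP[G [TG ndG Goo]] := sigma_finiteT m2.
exists (fun k => F k `*` G k).
  apply/seteqP; split=> // -[x y] _.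
  have [k _ Fk] : (\bigcup_i F i) x by rewrite -TF.
  have [l _ Gl] : (\bigcup_i G i) y by rewrite -TG.
  exists (maxn k l) => //; split.
  - by move: Fk; apply/subsetPset/ndF/leq_maxl.
  - by move: Gl; apply/subsetPset/ndG/leq_maxr.
move=> k; have [mF Fk] := Foo k; have [mG Gk] := Goo k.
split; first exact: measurableX.
by rewrite /product_measure product_measure1E// lte_mul_pinfty// ge0_fin_numE.
Qed.

HB.instance Definition _ := Measure_isSigmaFinite.Build _ _ _ product_measure
  product_measure_sigma_finite.

End product_measure.

Section steklov_cylinder.
Context d (X : measurableType d) {R : realType}.
Variables (nu : {sigma_finite_measure set X -> \bar R}) (Om : set X).
Hypotheses (mO : measurable Om) (lO : (nu Om < +oo)%E).
Variables (s a b T p : R).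
Hypotheses (sa : s < a) (ab : a < b) (bT : b < T) (p1 : 1 < p).
Let p' := p / (p - 1).
Local Notation leb := (@lebesgue_measure R).
Local Notation I := (`]s, T[%classic : set (measurableTypeR R)).
Local Notation J := (`]a, b[%classic : set (measurableTypeR R)).
Local Notation pr := (nu \x leb)%E.
Variables (f g : X * measurableTypeR R -> R).
Hypotheses (Lf : in_Lp pr (Om `*` I) p' f) (Lg : in_Lp pr (Om `*` J) p g).

Let mI : measurable I. Proof. exact: measurable_itv. Qed.
Let mJ : measurable J. Proof. exact: measurable_itv. Qed.
Let lI : (leb I < +oo)%E. Proof. exact: lebesgue_itv_oo_lty. Qed.
Let lJ : (leb J < +oo)%E. Proof. exact: lebesgue_itv_oo_lty. Qed.
Let mOI : measurable (Om `*` I). Proof. exact: measurableX. Qed.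
Let mOJ : measurable (Om `*` J). Proof. exact: measurableX. Qed.
Let mJI : measurable (J `*` I). Proof. exact: measurableX. Qed.

Local Notation leb2 := (product_measure leb leb).

Let sliceI : {ae nu, forall x, Om x -> in_Lp leb I p' (fun r => f (x, r))}.
Proof.
have [_ + _] := Rfubini1 (m1 := nu) (m2 := leb) mO mI (in_Lp_integrable Lf).
apply: filterS => x H Ox; apply: integrable_in_Lp; last exact: H.
by apply: (measurable_slice2 mO mI) => //; case: Lf.
Qed.

Let sliceJ : {ae nu, forall x, Om x -> in_Lp leb J p (fun r => g (x, r))}.
Proof.
have [_ + _] := Rfubini1 (m1 := nu) (m2 := leb) mO mJ (in_Lp_integrable Lg).
apply: filterS => x H Ox; apply: integrable_in_Lp; last exact: H.
by apply: (measurable_slice2 mO mJ) => //; case: Lg.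
Qed.

Let kern h (z : X * (measurableTypeR R * measurableTypeR R)) : R :=
  window h z.2 * (f (z.1, z.2.2) * g (z.1, z.2.1)).

Let measurable_kern h : measurable_fun (Om `*` (J `*` I)) (kern h).
Proof.
have mD : measurable (Om `*` (J `*` I)) by exact: measurableX.
apply: measurable_funM.
  apply: measurable_funTS; apply: (measurableT_comp (measurable_window h)).
  exact: measurable_snd.
apply: measurable_funM.
- apply: (@measurable_comp _ _ _ _ _ _ (Om `*` I) f _ (fun z => (z.1, z.2.2))) => //.
  + by move=> _ [z [Oz [_ Iz]] <-].
  + by case: Lf.
  + apply: measurable_funTS; apply: measurable_fun_pair; first exact: measurable_fst.
    exact: (measurableT_comp measurable_snd measurable_snd).
- apply: (@measurable_comp _ _ _ _ _ _ (Om `*` J) g _ (fun z => (z.1, z.2.1))) => //.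
  + by move=> _ [z [Oz [Jz _]] <-].
  + by case: Lg.
  + apply: measurable_funTS; apply: measurable_fun_pair; first exact: measurable_fst.
    exact: (measurableT_comp measurable_fst measurable_snd).
Qed.

Let kern_integrable h : 0 < h ->
  Rintegrable (nu \x (leb \x leb))%E (Om `*` (J `*` I)) (kern h).
Proof.
move=> h0.
have [jF _ _] := Rfubini1 (m1 := nu) (m2 := leb) mO mI (in_Lp_integrable Lf).
have [jG _ _] := Rfubini1 (m1 := nu) (m2 := leb) mO mJ (in_Lp_integrable Lg).
refine (Rintegrable_iterated (m1 := nu) (m2 := leb2) mO mJI (measurable_kern h)
  (RintegrableZ mO h (RintegrableD mO jF jG)) _).
apply: filterS2 sliceI sliceJ => x Hf Hg Ox; have {Hf}Lfx := Hf Ox; have {Hg}Lgx := Hg Ox.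
have jw := window_window_pairing_integrable mI mJ lI lJ p1 h Lfx Lgx.
have ja := Rintegrable_abs jw.
have E : (\int[(leb \x leb)%E]_(t in J `*` I) `|kern h (x, t)|%:E =
  (\int[(leb \x leb)%E]_(z in J `*` I) `|window h z * window_pairing (fun r => f (x, r)) (fun r => g (x, r)) z|)%:E)%E.
  by rewrite -Rintegral_EFin.
rewrite E lee_fin.
have jf := in_Lp_integrable Lfx; have jg := in_Lp_integrable Lgx.
have j1 := steklov_window_integrable mI mJ lJ h jf; have j2 := steklov_window_integrable_fst mI mJ lI h jg.
apply: (@le_trans _ _ (\int[(leb \x leb)%E]_(z in J `*` I) (window h z * `|f (x, z.2)| `^ p' +
    window h z * `|g (x, z.1)| `^ p))).
  apply: le_Rintegral => //; first exact: (RintegrableD mJI j1 j2).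
  move=> z _; rewrite normrM ger0_norm ?window_ge0// -mulrDr.
  by rewrite ler_wpM2l ?window_ge0// /window_pairing normrM young_le.
rewrite (RintegralD mJI j1 j2) mulrDr; apply: lerD.
  by apply: (steklov_tonelli mI mJ lJ h0 jf) => // r; exact: powR_ge0.
by apply: (steklov_tonelli_fst mI mJ lI h0 jg) => // r; exact: powR_ge0.
Qed.

Lemma integral_window_cylinder (h t : R) (F : X * R -> R) : 0 < h < a - s -> J t ->
  \int[pr]_(z in Om `*` I) (window h (t, z.2) * F z) = \int[pr]_(z in Om `*` `]t - h, t]) F z.
Proof.
move=> /andP[h0 has]; rewrite /= in_itv /= => /andP[at_ tb].
rewrite Rintegral_mkcond [RHS]Rintegral_mkcond; apply: eq_Rintegral => -[x r] _.
rewrite !patchE windowE /=; have [rw|rw] := boolP ((t - h < r) && (r <= t)).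
  rewrite mul1r; case: (boolP ((x, r) \in Om `*` `]t - h, t])) => H.
    rewrite ifT//; move: H; rewrite !inE /= !in_itv /= => -[Ox _]; split=> //.
    case/andP: rw => r1 r2; apply/andP; split.
      by apply: lt_trans r1; rewrite ltrBrDl (lt_le_trans _ (ltW at_))// -ltrBrDr.
    by apply: le_lt_trans r2 _; apply: lt_trans tb _.
  rewrite ifF//; apply/negP; rewrite inE /= => -[Ox _]; move/negP: H; apply.
  by rewrite inE; split=> //=; rewrite in_itv.
rewrite mul0r [RHS]ifF; first by case: ifP.
by apply/negP; rewrite inE /= in_itv /= => -[_]; exact/negP.
Qed.

Lemma steklov_cylinder_cvg : exists Phi : nat -> R -> R,
  [/\ forall k, Rintegrable leb J (Phi k),
      forall k : nat, k.+1%:R^-1 < a - s -> {ae leb, forall t, J t ->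
        Phi k t = \int[pr]_(z in Om `*` `]t - k.+1%:R^-1, t]) (f z * g (z.1, t))} &
      k.+1%:R * \int[leb]_(t in J) Phi k t @[k --> \oo] -->
        \int[pr]_(z in Om `*` J) (f z * g z)].
Proof.
have k0 (k : nat) : 0 < k.+1%:R^-1 :> R by rewrite invr_gt0 ltr0n.
have jk k := kern_integrable (k0 k).
have F1 k := Rfubini1 (m1 := nu) (m2 := leb2) mO mJI (jk k).
have F2 k := Rfubini2 (m1 := nu) (m2 := leb2) mO mJI (jk k).
pose K (k : nat) (z : measurableTypeR R * measurableTypeR R) : R := \int[nu]_(x in Om) kern k.+1%:R^-1 (x, z).
have jK k : Rintegrable (leb \x leb)%E (J `*` I) (K k) by case: (F2 k).
have F3 k := Rfubini1 (m1 := leb) (m2 := leb) mJ mI (jK k).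
exists (fun k t => \int[leb]_(r in I) K k (t, r)); split.
- by move=> k; case: (F3 k).
- move=> k ks.
  have [_ + _] := Rfubini2 (m1 := nu) (m2 := leb) mO mJ (in_Lp_integrable Lg).
  apply: (@filterS _ _ (ae_filter_ringOfSetsType leb)) => t H Jt.
  have hk : 0 < (k.+1%:R^-1 : R) < a - s by rewrite k0.
  rewrite -(integral_window_cylinder (fun z => f z * g (z.1, t)) hk Jt).
  have jw : Rintegrable pr (Om `*` I) (fun z => window k.+1%:R^-1 (t, z.2) * (f z * g (z.1, t))).
    apply: (@RintegralM_bounded _ _ _ _ _ mOI (fun z => window k.+1%:R^-1 (t, z.2)) _ 1).
    + apply: measurable_funTS; apply: (measurableT_comp (measurable_window _)).
      by apply: measurable_fun_pair; [exact: measurable_cst|exact: measurable_snd].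
    + by move=> z _; rewrite ger0_norm ?window_ge0 ?window_le1.
    + have mk : measurable_fun (Om `*` I) (fun z => f z * g (z.1, t)).
        apply: measurable_funM; first by case: Lf.
        apply: (@measurable_comp _ _ _ _ _ _ Om (fun x => g (x, t)) (Om `*` I) fst) => //.
        * by move=> _ [z [Oz _] <-].
        * by apply: (measurable_slice1 mO mJ) => //; case: Lg.
        * by apply: measurable_funTS; exact: measurable_fst.
      apply: (Rintegrable_le mOI mk (RintegrableD mOI (in_Lp_integrable Lf)
        (Rintegrable_fst mO mI lI (H Jt)))) => z _ /=.
      by rewrite normrM young_le.
  by have [_ _ ->] := Rfubini2 (m1 := nu) (m2 := leb) mO mI jw.
have -> : (fun k : nat => k.+1%:R * \int[leb]_(t in J) \int[leb]_(r in I) K k (t, r)) =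
    (fun k : nat => \int[nu]_(x in Om) steklov_form I J k.+1%:R^-1 (fun r => f (x, r)) (fun r => g (x, r))).
  apply/funext => k; have [_ _ <-] := F3 k; have [_ _ <-] := F2 k; have [j1 _ ->] := F1 k.
  rewrite -(RintegralZl _ mO j1); apply: eq_Rintegral => x _.
  by rewrite /steklov_form invrK.
have Lg' := Lg.
have jfg : Rintegrable pr (Om `*` J) (fun z => f z * g z).
  apply: (Rintegrable_pairing mOJ p1 _ Lg).
  have sub : Om `*` J `<=` Om `*` I.
    move=> [x t] [/= Ox]; rewrite !in_itv /= => /andP[t1 t2]; split=> //=.
    by rewrite (lt_trans sa t1) (lt_trans t2 bT).
  apply: integrable_in_Lp; first by apply: (measurable_funS mOI sub); case: Lf.
  exact: (integrableS mOI mOJ sub (in_Lp_integrable Lf)).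
have [jl _ ->] := Rfubini1 (m1 := nu) (m2 := leb) mO mJ jfg.
have [jF _ _] := Rfubini1 (m1 := nu) (m2 := leb) mO mI (in_Lp_integrable Lf).
have [jG _ _] := Rfubini1 (m1 := nu) (m2 := leb) mO mJ (in_Lp_integrable Lg).
apply: (Rdominated_convergence_ae mO (g := fun x => \int[leb]_(r in I) (`|f (x, r)| `^ p') +
  \int[leb]_(t in J) (`|g (x, t)| `^ p))).
- move=> k; have [j1 _ _] := F1 k; apply: measurable_funM => //.
  exact: (Rintegrable_measurable j1).
- exact: (Rintegrable_measurable jl).
- apply: filterS2 sliceI sliceJ => x Hf Hg Ox.
  exact: (steklov_form_cvg sa bT p1 (Hf Ox) (Hg Ox)).
- exact: (RintegrableD mO jF jG).
- apply: filterS2 sliceI sliceJ => x Hf Hg Ox k.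
  have := steklov_form_le mI mJ lI lJ p1 (k0 k) ltr01 (Hf Ox) (Hg Ox).
  by rewrite !powR1 !mul1r.
Qed.

End steklov_cylinder.

(** * The energy identity *)

Lemma in_LpS d (X : measurableType d) {R : realType} (m : {measure set X -> \bar R})
    (D E : set X) r (f : X -> R) : measurable D -> measurable E -> E `<=` D ->
  in_Lp m D r f -> in_Lp m E r f.
Proof.
move=> mD mE ED [mf f_fin]; split; first exact: measurable_funS mf.
apply: le_lt_trans f_fin; apply: ge0_subset_integral => //.
apply/measurable_EFinP; apply: (measurableT_comp (measurable_powR r)).
exact: measurableT_comp.
Qed.

Lemma ae_fst {R : realType} n (Q : 'rV[R]_n -> Prop) :
  {ae lebesgue_rV R n, forall x, Q x} -> {ae @lebesgue_xt R n, forall z, Q z.1}.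
Proof.
move=> [N [mN muN QN]]; exists (N `*` setT); split.
- by apply: measurableX.
- have -> : @lebesgue_xt R n (N `*` setT) = (lebesgue_rV R n N * lebesgue_measure setT)%E.
    exact: product_measure1E.
  by rewrite muN mul0e.
- by move=> z /QN Nz; split.
Qed.

Lemma Rintegral_restrict d (X : measurableType d) {R : realType}
    (m : {measure set X -> \bar R}) (D E : set X) (f : X -> R) : E `<=` D ->
  (forall x, D x -> ~ E x -> f x = 0) -> \int[m]_(x in D) f x = \int[m]_(x in E) f x.
Proof.
move=> ED f0; rewrite Rintegral_mkcond [RHS]Rintegral_mkcond; apply: eq_Rintegral => x _.
rewrite !patchE; case: ifPn => [xD|/negP xD]; case: ifPn => [xE|/negP xE] //.
  by apply: f0 => [|Ex]; [rewrite inE in xD|apply: xE; rewrite inE].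
by exfalso; apply: xD; rewrite inE in xE; rewrite inE; exact: ED.
Qed.

Section slice_truncation.
Context {R : realType} (n : nat) (Omega : set 'rV[R]_n) (T p q M : R).
Variables (u : 'rV[R]_n * R -> R) (Du : 'rV[R]_n * R -> 'rV[R]_n).
Local Notation mu := (lebesgue_rV R n).
Local Notation leb := (@lebesgue_measure R).
Local Notation nu := (@lebesgue_xt R n).
Hypotheses (oO : open Omega) (bO : bounded_set Omega) (p1 : 1 < p) (q0 : 0 < q).
Hypothesis cu : forall z, cylinder Omega T z -> {for z, continuous u}.
Hypothesis uM : forall z, cylinder Omega T z -> 0 <= u z <= M.
Hypothesis LDu : forall i, in_Lp nu (cylinder Omega T) p (fun z => Du z 0 i).
Hypothesis weak : forall (phi dphi : 'rV[R]_n * R -> R) (Dphi : 'rV[R]_n * R -> 'rV[R]_n),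
  (forall z, cylinder Omega T z -> 0 <= phi z) ->
  in_W1r_0_time Omega T (q + 1) phi dphi ->
  in_Lp_W1p_0 Omega T p phi Dphi ->
  \int[nu]_(z in cylinder Omega T)
    (- (u z `^ q) * dphi z +
     enorm (Du z) `^ (p - 2) * dotp (Du z) (Dphi z)) = 0.

Let mO := open_measurable_rV oO.
Let muO := bounded_lebesgue_rV_lty mO bO.
Let p0 : 0 < p. Proof. exact: lt_trans p1. Qed.
Let p'0 : 0 < p / (p - 1). Proof. exact: conj_exponent_gt0. Qed.

Let mC : measurable (cylinder Omega T : set ('rV[R]_n * measurableTypeR R)).
Proof. by apply: measurableX => //; exact: measurable_itv. Qed.

Lemma in_Lp_u_slice r t : 0 <= r -> 0 < t < T -> in_Lp mu Omega r (fun x => u (x, t) `^ q).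
Proof.
move=> r0 tT; apply: (in_Lp_bounded mO r0 muO (C := M `^ q)).
  exact: (measurable_u_slice oO q0 cu uM).
by move=> x Ox; apply: (u_powR_le q0 uM); split=> //=; rewrite in_itv.
Qed.

Lemma strip_sub a b : 0 <= a -> b < T -> Omega `*` `]a, b]%classic `<=` cylinder Omega T.
Proof.
move=> a0 bT [x t] [/= Ox]; rewrite in_itv /= => /andP[t1 t2]; split=> //=.
by rewrite in_itv /= (le_lt_trans a0 t1) (le_lt_trans t2 bT).
Qed.

Lemma slice_truncation v G w t1 t2 : in_W1p_0 Omega p v G -> smooth w -> (forall x, 0 <= w x) ->
  0 < t1 -> t1 < t2 -> t2 < T ->
  \int[mu]_(x in Omega) ((u (x, t2) `^ q - u (x, t1) `^ q) * truncation v w x) =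
  - \int[nu]_(z in Omega `*` `]t1, t2]%classic) dotp (flux p (Du z)) (truncation_grad v G w z.1).
Proof.
move=> Wv sw w0 t10 t12 t2T.
have [phi_ [tphi [c1 [c2 _]]]] := truncation_limit oO bO p1 Wv sw.
have tT1 : 0 < t1 < T by rewrite t10 (lt_trans t12).
have tT2 : 0 < t2 < T by rewrite (lt_trans t10).
have L2 := in_Lp_u_slice (ltW p'0) tT2; have L1 := in_Lp_u_slice (ltW p'0) tT1.
have tk k := test_fun_truncation (tphi k) sw w0.
have E k : \int[mu]_(x in Omega) (u (x, t2) `^ q * truncation (phi_ k) w x) -
    \int[mu]_(x in Omega) (u (x, t1) `^ q * truncation (phi_ k) w x) =
    - \int[nu]_(z in Omega `*` `]t1, t2]%classic) dotp (flux p (Du z)) (grad (truncation (phi_ k) w) z.1).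
  apply: (slice_identity oO bO p1 q0 cu uM LDu weak (tk k)) => //.
  by move=> x; exact: bump_ge0.
have mI : measurable (`]t1, t2]%classic : set (measurableTypeR R)) by exact: measurable_itv.
have lI : (leb `]t1, t2]%classic < +oo)%E.
  by rewrite lebesgue_measure_itv /=; case: ifP => // _; rewrite -EFinB ltry.
have mS : measurable (Omega `*` `]t1, t2]%classic : set ('rV[R]_n * measurableTypeR R)) by exact: measurableX.
have c2' := c2 _ mI lI (fun z => flux p (Du z))
  (fun i => in_LpS mC mS (strip_sub (ltW t10) t2T) (in_Lp_flux p1 mC LDu i)).
have cl : (fun k => \int[mu]_(x in Omega) (u (x, t2) `^ q * truncation (phi_ k) w x) -
    \int[mu]_(x in Omega) (u (x, t1) `^ q * truncation (phi_ k) w x)) @ \oo -->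
    \int[mu]_(x in Omega) (u (x, t2) `^ q * truncation v w x) -
    \int[mu]_(x in Omega) (u (x, t1) `^ q * truncation v w x).
  exact: (cvgB (c1 _ L2) (c1 _ L1)).
have cr : (fun k => - \int[nu]_(z in Omega `*` `]t1, t2]%classic)
    dotp (flux p (Du z)) (grad (truncation (phi_ k) w) z.1)) @ \oo -->
    - \int[nu]_(z in Omega `*` `]t1, t2]%classic)
      dotp (flux p (Du z)) (truncation_grad v G w z.1).
  exact: (cvgN c2').
have jv t : 0 < t < T -> Rintegrable mu Omega (fun x => u (x, t) `^ q * truncation v w x).
  move=> tT; rewrite (_ : (fun x => _) = (fun x => truncation v w x * u (x, t) `^ q)); last first.
    by apply/funext => x; rewrite mulrC.
  apply: (@RintegralM_bounded _ _ _ mu _ mO (truncation v w) _ 1).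
  - apply: (measurableT_comp (f := @bump R)).
      by apply: continuous_measurable_fun; exact: continuous_bump.
    have mw := measurable_smooth sw; have mv : measurable_fun Omega v by case: Wv => -[[]].
    exact: measurable_funB.
  - by move=> x _; rewrite ger0_norm ?bump_ge0 ?bump_le1.
  - apply: (Rintegrable_bounded mO (C := M `^ q) muO); first by case: (in_Lp_u_slice (ltW p'0) tT).
    by move=> x Ox; apply: (u_powR_le q0 uM); split=> //=; rewrite in_itv.
under eq_Rintegral do rewrite mulrBl.
rewrite RintegralB//; [|exact: jv|exact: jv].
rewrite (funext E) in cl; rewrite -(cvg_lim (@Rhausdorff R) cl).
exact: (cvg_lim (@Rhausdorff R) cr).
Qed.

Section energy.
Variables (s a b m : R) (B U : set 'rV[R]_n) (zeta S : 'rV[R]_n -> R) (W : R -> R).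
Hypotheses (s0 : 0 < s) (sa : s < a) (ab : a < b) (bT : b < T).
Hypothesis WDu : {ae leb, forall t : R, 0 < t < T ->
  in_W1p Omega p (fun x => u (x, t)) (fun x => Du (x, t))}.
Hypothesis vanish : vanishes_on_lateral_boundary Omega B s T p u.
Hypotheses (tzeta : test_fun B zeta) (oU : open U) (UO : U `<=` Omega).
Hypothesis zeta1 : forall x, U x -> zeta x = 1.
Hypotheses (sS : smooth S) (S0 : forall x, 0 <= S x).
Hypotheses (cW : continuous W) (W0 : forall t, 0 <= W t).
Hypothesis off : forall x t, Omega x -> ~ U x -> s < t < T -> zeta x * u (x, t) <= S x.

Local Notation J := (`]a, b[%classic : set (measurableTypeR R)).
Local Notation I := (`]s, T[%classic : set (measurableTypeR R)).

Definition excess (z : 'rV[R]_n * R) : R := u z - (S z.1 + W z.2).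

Let mU := open_measurable_rV oU.
Let mJ : measurable J. Proof. exact: measurable_itv. Qed.
Let mI : measurable I. Proof. exact: measurable_itv. Qed.
Let lJ : (leb J < +oo)%E. Proof. exact: lebesgue_itv_oo_lty. Qed.
Let mOJ : measurable (Omega `*` J : set ('rV[R]_n * measurableTypeR R)).
Proof. exact: measurableX. Qed.
Let mUJ : measurable (U `*` J : set ('rV[R]_n * measurableTypeR R)).
Proof. exact: measurableX. Qed.
Let mOI : measurable (Omega `*` I : set ('rV[R]_n * measurableTypeR R)).
Proof. exact: measurableX. Qed.

Let OIC : Omega `*` I `<=` cylinder Omega T.
Proof.
move=> [x t] [/= Ox]; rewrite in_itv /= => /andP[t1 t2]; split=> //=.
by rewrite in_itv /= (lt_trans s0 t1) t2.
Qed.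

Let OJI : Omega `*` J `<=` Omega `*` I.
Proof.
move=> [x t] [/= Ox]; rewrite !in_itv /= => /andP[t1 t2]; split=> //=.
by rewrite (lt_trans sa t1) (lt_trans t2 bT).
Qed.

Let UJO : U `*` J `<=` Omega `*` J.
Proof. by move=> [x t] [/= /UO Ox Jt]. Qed.

Lemma continuous_excess z : cylinder Omega T z -> {for z, continuous excess}.
Proof.
move=> Cz; apply: cvgB; first exact: cu.
apply: cvgD.
  apply: (@continuous_comp _ _ _ (fun z : 'rV[R]_n * R => z.1) S); first exact: cvg_fst.
  exact: (smooth_continuous sS).
by apply: (@continuous_comp _ _ _ (fun z : 'rV[R]_n * R => z.2) W); [exact: cvg_snd|exact: cW].
Qed.

Lemma measurable_excess : measurable_fun (Omega `*` I : set ('rV[R]_n * measurableTypeR R)) excess.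
Proof.
apply: (measurable_funS mC OIC); apply: continuous_measurable_rVxR; first exact: open_cylinder.
by move=> z; rewrite inE; exact: continuous_excess.
Qed.

Let g i (z : 'rV[R]_n * R) : R :=
  \1_U z.1 * (dbump (excess z) * (Du z 0 i - grad S z.1 0 i)).

Let dbump_bound (x : R) : `|dbump x| <= 2.
Proof. by rewrite ger0_norm ?dbump_ge0 ?dbump_le2. Qed.

Let indic_bound (A : set 'rV[R]_n) (x : 'rV[R]_n) : `|\1_A x : R| <= 1.
Proof. by rewrite indicE ger0_norm ?ler0n// lern1 leq_b1. Qed.

Let lOJ : (nu (Omega `*` J) < +oo)%E.
Proof. by apply: (strip_lty oO bO (a := a) (b := b) mJ); exact: subset_itv_oo_cc. Qed.

Lemma in_Lp_energy_gradient i : in_Lp nu (Omega `*` J) p (g i).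
Proof.
have L1 : in_Lp nu (Omega `*` J) p (fun z => Du z 0 i - grad S z.1 0 i).
  apply: (in_LpB mOJ p1).
    exact: (in_LpS mC mOJ (subset_trans OJI OIC) (LDu i)).
  exact: (in_Lp_strip mO mJ lJ (smooth_in_Lp_coord oO bO i (ltW p0) sS)).
have L2 : in_Lp nu (Omega `*` J) p (fun z => dbump (excess z) * (Du z 0 i - grad S z.1 0 i)).
  apply: (in_LpM_bounded mOJ p1 _ (C := 2)) => //.
  apply: (measurableT_comp (f := @dbump R)).
    by apply: continuous_measurable_fun; exact: continuous_dbump.
  exact: (measurable_funS mOI OJI measurable_excess).
apply: (in_LpM_bounded mOJ p1 _ (C := 1)) L2 => //.
apply: measurable_funTS; apply: (measurableT_comp (f := (\1_U : 'rV[R]_n -> R))) => //.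
Qed.

Let smoothw t : smooth (fun x => S x + W t).
Proof. exact: (smoothD sS (smooth_cst (W t))). Qed.

Lemma grad_addr_cst t x : grad (fun x => S x + W t) x = grad S x.
Proof.
apply/rowP => i; rewrite !mxE.
have d1 := is_deriveD (smooth_is_derive x (basis_vec R i) sS) (is_derive_cst (W t) x (basis_vec R i)).
by have [_ ->] := d1; rewrite addr0.
Qed.

Lemma energy_slice t h : a < t < b -> 0 < h < a - s ->
  in_W1p Omega p (fun x => u (x, t)) (fun x => Du (x, t)) ->
  (exists G, in_W1p_0 Omega p (fun x => zeta x * u (x, t)) G) ->
  \int[mu]_(x in U) ((u (x, t) `^ q - u (x, t - h) `^ q) * bump (excess (x, t))) =
  - \sum_i \int[nu]_(z in Omega `*` `]t - h, t]%classic) (flux p (Du z) 0 i * g i (z.1, t)).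
Proof.
move=> /andP[at_ tb] /andP[h0 has] Wu [G WG].
have sth : s < t - h by rewrite ltrBrDl (lt_trans _ at_)// -ltrBrDr.
have tT : t < T by exact: lt_trans tb bT.
have st : s < t < T by rewrite (lt_trans sa at_).
pose w x := S x + W t; have w0 x : 0 <= w x by exact: addr_ge0.
have offw x : Omega x -> ~ U x -> zeta x * u (x, t) - w x <= 0.
  by move=> Ox Ux; rewrite subr_le0 (le_trans (off Ox Ux st))// lerDl.
have := slice_truncation WG (smoothw t) w0 (lt_trans s0 sth) _ tT.
rewrite ltrBlDr ltrDl => /(_ h0).
rewrite (Rintegral_restrict _ UO); last first.
  by move=> x Ox Ux; rewrite /truncation (bump_le0 (offw x Ox Ux)) mulr0.
move=> E; transitivity (\int[mu]_(x in U) ((u (x, t) `^ q - u (x, t - h) `^ q) *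
    truncation (fun x => zeta x * u (x, t)) w x)).
  apply: eq_Rintegral => x; rewrite inE => Ux.
  by rewrite /truncation zeta1// mul1r.
rewrite E; congr (- _).
have GDu := weak_gradient_eq oO bO p1 oU UO zeta1 Wu WG.1.
have mth : measurable (`]t - h, t]%classic : set (measurableTypeR R)) by exact: measurable_itv.
have lth : (leb `](t - h)%R, t]%classic < +oo)%E.
  by rewrite lebesgue_measure_itv /=; case: ifP => // _; rewrite -EFinB ltry.
have mS : measurable (Omega `*` `]t - h, t]%classic : set ('rV[R]_n * measurableTypeR R)) by exact: measurableX.
have sth0 : 0 <= t - h by rewrite ltW// (lt_trans s0).
have Lf i := in_LpS mC mS (strip_sub sth0 tT) (in_Lp_flux p1 mC LDu i).
have mg i : in_Lp mu Omega p (fun x => g i (x, t)).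
  case: Wu => _ LDut _.
  have L1 : in_Lp mu Omega p (fun x => Du (x, t) 0 i - grad S x 0 i).
    exact: (in_LpB mO p1 (LDut i) (smooth_in_Lp_coord oO bO i (ltW p0) sS)).
  have L2 : in_Lp mu Omega p (fun x => dbump (excess (x, t)) * (Du (x, t) 0 i - grad S x 0 i)).
    apply: (in_LpM_bounded mO p1 _ (C := 2)) => //.
    apply: (measurableT_comp (f := @dbump R)).
      by apply: continuous_measurable_fun; exact: continuous_dbump.
    by apply: (measurable_slice1 mO mI measurable_excess); rewrite /= in_itv.
  have mi : measurable_fun setT (\1_U : 'rV[R]_n -> R) by [].
  by apply: (in_LpM_bounded mO p1 (measurable_funTS mi) (C := 1)) L2 => x _; exact: indic_bound.
have Lg i : in_Lp nu (Omega `*` `]t - h, t]%classic) p (fun z => g i (z.1, t)).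
  exact: (in_Lp_strip mO mth lth (mg i)).
have jj i : Rintegrable nu (Omega `*` `]t - h, t]%classic)
    (fun z => flux p (Du z) 0 i * g i (z.1, t)) by exact: (Rintegrable_pairing mS p1 (Lf i) (Lg i)).
rewrite -(Rintegral_sum mS _ jj).
have Lt i : in_Lp nu (Omega `*` `]t - h, t]%classic) p
    (fun z => truncation_grad (fun x => zeta x * u (x, t)) G w z.1 0 i).
  apply: (in_Lp_strip mO mth lth (f := fun x => truncation_grad (fun x => zeta x * u (x, t)) G w x 0 i)).
  under eq_fun do rewrite mxE.
  case: WG => -[[mv _] LG _] _.
  apply: (in_LpM_bounded mO p1 _ (C := 2)) => //.
    apply: (measurableT_comp (f := @dbump R)).
      by apply: continuous_measurable_fun; exact: continuous_dbump.
    by apply: measurable_funB => //; exact: (measurable_smooth (smoothw t)).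
  have E2 : (fun x => (G x - grad w x) 0 i) = (fun x => G x 0 i - grad S x 0 i).
    apply/funext => x; have := congr1 (fun v : 'rV[R]_n => v 0 i) (grad_addr_cst t x).
    by rewrite !mxE => ->.
  rewrite E2; exact: (in_LpB mO p1 (LG i) (smooth_in_Lp_coord oO bO i (ltW p0) sS)).
apply: (ae_eq_Rintegral mS).
- apply: measurable_sum => i; apply: measurable_funM; first by case: (Lf i).
  by case: (Lt i).
- exact: (Rintegrable_measurable (Rintegrable_sum mS _ jj)).
- apply: filterS (ae_fst GDu) => z Hz [/= Oz _]; apply: eq_bigr => i _; congr (_ * _).
  rewrite /g indicE; have [Uz|Uz] := pselect (U z.1).
    rewrite mem_set// mul1r 2!mxE (zeta1 Uz) mul1r (Hz Uz) /w grad_addr_cst.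
    by rewrite /excess; congr (_ * _); rewrite !mxE.
  by rewrite memNset// mul0r mxE (dbump_le0 (offw _ Oz Uz)) mul0r.
Qed.

Lemma energy_limit : exists h_ : nat -> R,
  [/\ forall k, 0 < h_ k < a - s, h_ @ \oo --> 0 &
    (h_ k)^-1 * \int[nu]_(z in U `*` J)
      ((u z `^ q - u (z.1, z.2 - h_ k) `^ q) * bump (excess z)) @[k --> \oo] -->
    - \int[nu]_(z in U `*` J)
      (dbump (excess z) * dotp (flux p (Du z)) (Du z - grad S z.1))].
Proof.
have as0 : 0 < a - s by rewrite subr_gt0.
have [N HN] := exists_invn_lt as0.
pose h_ (k : nat) : R := (k + N).+1%:R^-1.
have h_gt0 k : 0 < h_ k by rewrite invr_gt0 ltr0n.
have h_lt k : h_ k < a - s.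
  by apply: le_lt_trans HN; rewrite lef_pV2 ?posrE ?ltr0n// ler_nat ltnS leq_addl.
have h_hs k : 0 < h_ k < a - s by rewrite h_gt0 h_lt.
exists h_; split => //.
  have := @cvg_harmonic R; rewrite -(cvg_shiftn N); exact.
have Lf i : in_Lp nu (Omega `*` I) (p / (p - 1)) (fun z => flux p (Du z) 0 i).
  exact: (in_LpS mC mOI OIC (in_Lp_flux p1 mC LDu i)).
have /choice[Phi HPhi] i := steklov_cylinder_cvg mO sa bT p1 (Lf i) (in_Lp_energy_gradient i).
have jPhi k : Rintegrable leb J (fun t => \sum_i Phi i k t).
  by apply: (Rintegrable_sum mJ) => i; case: (HPhi i).
have mD k : measurable_fun (U `*` J : set ('rV[R]_n * measurableTypeR R))
    (fun z => (u z `^ q - u (z.1, z.2 - h_ k) `^ q) * bump (excess z)).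
  have shiftC z : (U `*` J) z -> cylinder Omega T (z.1, z.2 - h_ k).
    move: z => [x t] [/= /UO Ox]; rewrite in_itv /= => /andP[t1 t2]; apply: OIC; split=> //=.
    have := h_lt k; have := h_gt0 k; rewrite in_itv /= => h1 h2; apply/andP; split.
      by rewrite ltrBrDl (lt_trans _ t1)// -ltrBrDr.
    by rewrite (lt_trans _ bT)// (lt_trans _ t2)// gtrBl.
  apply: measurable_funM.
    apply: measurable_funB.
      exact: (measurable_funS mC (subset_trans UJO (subset_trans OJI OIC)) (measurable_u_powR oO q0 cu uM)).
    apply: (@measurable_comp _ _ _ _ _ _ (cylinder Omega T) (fun z => u z `^ q) _
      (fun z : 'rV[R]_n * measurableTypeR R => (z.1, z.2 - h_ k : measurableTypeR R))) => //.
    + by move=> _ [z Hz <-]; exact: shiftC.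
    + exact: (measurable_u_powR oO q0 cu uM).
    + apply: measurable_funTS; apply: measurable_fun_pair; first exact: measurable_fst.
      by apply: measurable_funB; [exact: measurable_snd|exact: measurable_cst].
  apply: (measurableT_comp (f := @bump R)).
    by apply: continuous_measurable_fun; exact: continuous_bump.
  exact: (measurable_funS mOI (subset_trans UJO OJI) measurable_excess).
have uC z k : (U `*` J) z -> `|u (z.1, z.2 - h_ k) `^ q| <= M `^ q.
  move: z => [x t] [/= /UO Ox]; rewrite in_itv /= => /andP[t1 t2]; apply: (u_powR_le q0 uM); apply: OIC; split=> //=.
  have := h_lt k; have := h_gt0 k; rewrite in_itv /= => h1 h2; apply/andP; split.
    by rewrite ltrBrDl (lt_trans _ t1)// -ltrBrDr.
  by rewrite (lt_trans _ bT)// (lt_trans _ t2)// gtrBl.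
have lUJ : (nu (U `*` J) < +oo)%E.
  apply: le_lt_trans lOJ; apply: le_measure; rewrite ?inE//.
have jD k : Rintegrable nu (U `*` J)
    (fun z => (u z `^ q - u (z.1, z.2 - h_ k) `^ q) * bump (excess z)).
  apply: (Rintegrable_bounded mUJ (C := M `^ q + M `^ q) lUJ (mD k)) => z UJz.
  rewrite normrM -[leRHS]mulr1; apply: ler_pM => //; last by rewrite ger0_norm ?bump_ge0 ?bump_le1.
  apply: (le_trans (ler_normB _ _)); apply: lerD; last exact: uC.
  apply: (u_powR_le q0 uM); apply: OIC; apply: OJI; exact: UJO.
have -> : (fun k => (h_ k)^-1 * \int[nu]_(z in U `*` J)
      ((u z `^ q - u (z.1, z.2 - h_ k) `^ q) * bump (excess z))) =
    (fun k => - \sum_i ((k + N).+1%:R * \int[leb]_(t in J) Phi i (k + N)%N t)).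
  apply/funext => k; rewrite -mulr_sumr -mulrN /h_ invrK; congr (_ * _).
  rewrite -(Rintegral_sum mJ); last by move=> i; case: (HPhi i).
  have [jt _ ->] := Rfubini2 (m1 := mu) (m2 := leb) mU mJ (jD k).
  rewrite -(RintegralN mJ (jPhi _)).
  apply: (ae_eq_Rintegral mJ).
  - exact: (Rintegrable_measurable jt).
  - exact: (Rintegrable_measurable (RintegrableN (jPhi _))).
  - have ae1 : {ae leb, forall t, forall i, J t -> Phi i (k + N)%N t =
        \int[nu]_(z in Omega `*` `]t - h_ k, t]%classic) (flux p (Du z) 0 i * g i (z.1, t))}.
      by apply: filter_forall => i; case: (HPhi i) => _ /(_ (k + N)%N (h_lt k)).
    have ae2 := @filterI _ _ (ae_filter_ringOfSetsType leb) _ _ WDu vanish.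
    have ae3 := @filterI _ _ (ae_filter_ringOfSetsType leb) _ _ ae1 ae2.
    apply: (@filterS _ _ (ae_filter_ringOfSetsType leb) _ _ _ ae3) => t [H1 [H2 H3]] Jt.
    have Jt' := Jt; rewrite /= in_itv /= in Jt'; have /andP[at_ tb] := Jt'.
    have st : s < t < T by rewrite (lt_trans sa at_) (lt_trans tb bT).
    have tT : 0 < t < T by case/andP: st => h1 ->; rewrite (lt_trans s0 h1).
    rewrite (energy_slice Jt' (h_hs k) (H2 tT) (H3 st zeta tzeta)); congr (- _).
    by apply: eq_bigr => i _; rewrite H1.
have -> : \int[nu]_(z in U `*` J) (dbump (excess z) * dotp (flux p (Du z)) (Du z - grad S z.1)) =
    \sum_i \int[nu]_(z in Omega `*` J) (flux p (Du z) 0 i * g i z).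
  rewrite -(Rintegral_sum mOJ); last first.
    by move=> i; exact: (Rintegrable_pairing mOJ p1 (in_LpS mOI mOJ OJI (Lf i)) (in_Lp_energy_gradient i)).
  rewrite [RHS](Rintegral_restrict _ UJO); last first.
    move=> z [Oz Jz] Uz; apply: big1 => i _; rewrite /g indicE memNset ?mul0r ?mulr0//.
    by move=> Uz1; apply: Uz.
  apply: eq_Rintegral => z; rewrite inE => -[Uz Jz].
  rewrite /dotp mulr_sumr; apply: eq_bigr => i _; rewrite /g indicE mem_set// mul1r mulrCA.
  by congr (_ * (_ * _)); rewrite !mxE.
apply: cvgN; elim: (index_enum _) => [|i l IH].
  by under eq_fun do rewrite big_nil; rewrite big_nil; exact: cvg_cst.
under eq_fun do rewrite big_cons; rewrite big_cons; apply: (@cvgD R) => //.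
case: (HPhi i) => _ _; rewrite -(cvg_shiftn N); exact.
Qed.

End energy.
End slice_truncation.

(** * Comparison with separated supersolutions *)

Section local_calculus.
Context {R : realType}.
Implicit Types (f df F : R -> R) (x y : R).

Lemma is_derive_continuous f x l : is_derive x 1 f l -> {for x, continuous f}.
Proof.
move=> df; apply: differentiable_continuous; apply/derivable1_diffP.
by have [] := df.
Qed.

Lemma mvt_gt r f df : (forall x, r < x -> is_derive x 1 f (df x)) ->
  forall x y, r < x -> x <= y -> exists2 c, x <= c <= y & f y - f x = df c * (y - x).
Proof.
move=> fdf x y rx xy; have [|z zxy|c cxy E] := @MVT_segment R f df x y xy.
- by move=> z; rewrite in_itv /= => /andP[xz _]; apply: fdf; exact: lt_trans xz.
- apply: continuous_in_subspaceT => t; rewrite inE /= in_itv /= => /andP[xt _].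
  by apply: (is_derive_continuous (fdf t _)); exact: lt_le_trans xt.
- by exists c => //; move: cxy; rewrite in_itv.
Qed.

Lemma ftc_local F f x y : x < y -> (forall t, x <= t <= y -> is_derive t 1 F (f t)) ->
  (forall t, x <= t <= y -> {for t, continuous f}) ->
  \int[lebesgue_measure]_(t in `]x, y[) f t = F y - F x.
Proof.
move=> xy dF cf.
have cF t : x <= t <= y -> {for t, continuous F} by move=> /dF; exact: is_derive_continuous.
have wf : {within `[x, y], continuous f}.
  by apply: continuous_in_subspaceT => t; rewrite inE /= in_itv /=; exact: cf.
have H : (\int[lebesgue_measure]_(t in `[x, y]) (f t)%:E = (F y)%:E - (F x)%:E)%E.
  apply: continuous_FTC2 => //; first split.
  - move=> t; rewrite in_itv /= => /andP[t1 t2].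
    by have [] : is_derive t 1 F (f t) by apply: dF; rewrite !ltW.
  - by apply: cvg_at_right_filter; apply: cF; rewrite lexx ltW.
  - by apply: cvg_at_left_filter; apply: cF; rewrite lexx ltW.
  - move=> t; rewrite in_itv /= => /andP[t1 t2]; rewrite derive1E.
    by have [_ ->] : is_derive t 1 F (f t) by apply: dF; rewrite !ltW.
rewrite /Rintegral -[RHS]/(fine (F y - F x)%:E) EFinB -H; congr fine.
rewrite integral_itv_bndoo//.
apply/measurable_EFinP; apply: open_continuous_measurable_fun; first exact: interval_open.
by move=> t; rewrite inE /= in_itv /= => /andP[t1 t2]; apply: cf; rewrite !ltW.
Qed.

Lemma is_derive_powR r x : 0 < x -> is_derive x 1 (fun y : R => y `^ r) (r * x `^ (r - 1)).
Proof.
move=> x0; have xin : x \in `]0, +oo[ by rewrite in_itv /= x0.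
apply: DeriveDef; first exact: derivable_powR.
by rewrite -derive1E powR_derive1.
Qed.

Lemma powR_increment_concave r x y d : 0 < r <= 1 -> 0 < x -> x <= y -> 0 <= d ->
  (y + d) `^ r - y `^ r <= (x + d) `^ r - x `^ r.
Proof.
move=> /andP[r0 r1] x0 xy d0.
pose df (z : R) : R := r * (z + d) `^ (r - 1) - r * z `^ (r - 1).
have dD (z : R) : 0 < z -> is_derive z 1 (fun z : R => (z + d) `^ r - z `^ r) (df z).
  move=> z0; apply: is_deriveB; last exact: is_derive_powR.
  have h1 : is_derive z 1 (fun z : R => z + d) 1.
    by apply: (is_derive_eq (is_deriveD (is_derive_id z 1) (is_derive_cst d z 1))); rewrite addr0.
  have h2 : is_derive (z + d) 1 (fun y : R => y `^ r) (r * (z + d) `^ (r - 1)).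
    by apply: is_derive_powR; exact: ltr_wpDr.
  by have := is_derive_comp1 h1 h2; rewrite mulr1.
have [c /andP[xc _] E] := mvt_gt dD x0 xy.
have c0 : 0 < c by exact: lt_le_trans xc.
rewrite -subr_le0 E; apply: mulr_le0_ge0; last by rewrite subr_ge0.
rewrite /df -mulrBr; apply: mulr_ge0_le0; first exact: ltW.
have cd0 : 0 < c + d by exact: ltr_wpDr.
have H (z : R) : z `^ (r - 1) = (z `^ (1 - r))^-1 by rewrite -powRN opprB.
rewrite subr_le0 !H lef_pV2 ?posrE ?powR_gt0//.
have r10 : 0 <= 1 - r by rewrite subr_ge0.
by apply: (ge0_ler_powR r10); rewrite ?nnegrE ?lerDl// ltW.
Qed.

Lemma powR_increment_convex r y d m : 1 <= r -> 0 < y -> 0 <= d -> y + d <= m ->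
  (y + d) `^ r <= y `^ r + r * m `^ (r - 1) * d.
Proof.
move=> r1 y0 d0 ydm; rewrite -lerBlDl.
have yyd : y <= y + d by rewrite lerDl.
have [c /andP[yc cyd] ->] := mvt_gt (fun z => @is_derive_powR r z) y0 yyd.
rewrite addrAC subrr add0r ler_wpM2r// ler_wpM2l ?(le_trans ler01)//.
rewrite ge0_ler_powR ?nnegrE ?subr_ge0//.
- exact: le_trans (ltW y0) yc.
- exact: (le_trans (ltW y0) (le_trans yyd ydm)).
- exact: le_trans ydm.
Qed.

End local_calculus.

Section potential.
Context {R : realType} (q : R).
Hypothesis q0 : 0 < q.
Implicit Types (v w s : R).
Local Notation leb := (@lebesgue_measure R).

Definition excess_bump w s : R := bump (Num.max s 0 `^ q^-1 - w).

(* as [excess_bump w] vanishes on the negative axis, the lower limit only has to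
   be negative, so that [0] is an interior point *)
Definition potential w v : R := \int[leb]_(s in `]-1, v]) excess_bump w s.

Let iq0 : 0 < q^-1. Proof. by rewrite invr_gt0. Qed.

Lemma continuous_excess_bump w : continuous (excess_bump w).
Proof.
move=> s; apply: (@continuous_comp _ _ _ (fun s => Num.max s 0 `^ q^-1 - w) (@bump R)).
  by apply: cvgB; [exact: continuous_pos_powR|exact: cvg_cst].
exact: continuous_bump.
Qed.

Lemma ndecr_excess_bump w : {homo excess_bump w : x y / x <= y}.
Proof.
move=> x y xy; apply: ndecr_bump; rewrite lerD2r.
have mxy : Num.max x 0 <= Num.max y 0 by rewrite ge_max !le_max xy lexx orbT.
by apply: (ge0_ler_powR (ltW iq0)) => //; rewrite nnegrE le_max lexx orbT.
Qed.

Lemma excess_bump_eq0 w s : 0 <= w -> s <= w `^ q -> excess_bump w s = 0.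
Proof.
move=> w0 sw; apply: bump_le0; rewrite subr_le0 -[leRHS]powRr1//.
rewrite -(mulfV (lt0r_neq0 q0)) powRrM.
by rewrite ge0_ler_powR ?nnegrE ?(ltW iq0) ?le_max ?lexx ?orbT ?powR_ge0// ge_max sw powR_ge0.
Qed.

Lemma excess_bump_powR w y : 0 <= y -> excess_bump w (y `^ q) = bump (y - w).
Proof.
by move=> y0; rewrite /excess_bump max_l ?powR_ge0// -powRrM mulfV ?gt_eqF// powRr1.
Qed.

Lemma is_derive_potential w v : -1 < v -> is_derive v 1 (potential w) (excess_bump w v).
Proof.
move=> v1; have vv : v < v + 1 by rewrite ltrDl.
have jB : Rintegrable leb `]-1, v + 1] (excess_bump w).
  have mI : measurable (`]-1, v + 1]%classic : set (measurableTypeR R)) by exact: measurable_itv.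
  have lI : (leb `](- 1)%R, (v + 1)%R]%classic < +oo)%E.
    by rewrite lebesgue_measure_itv /=; case: ifP => // _; rewrite -EFinB ltry.
  apply: (Rintegrable_bounded mI (C := 1) lI).
  - apply: measurable_funTS; apply: continuous_measurable_fun; exact: continuous_excess_bump.
  - by move=> x _; rewrite ger0_norm ?bump_ge0 ?bump_le1.
have [|d1 d2] := @continuous_FTC1 R (excess_bump w) (BRight (-1)) v (v + 1) vv jB _ (@continuous_excess_bump w v).
  by rewrite /Order.lt /= v1.
by apply: DeriveDef; [exact: d1|rewrite -derive1E; exact: d2].
Qed.

Let m10 : -1 < 0 :> R. Proof. by rewrite oppr_lt0. Qed.

Lemma potential_mvt w x y : 0 <= x -> x <= y ->
  exists2 c, x <= c <= y & potential w y - potential w x = excess_bump w c * (y - x).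
Proof.
by move=> x0 xy; apply: (mvt_gt (@is_derive_potential w)) => //; exact: lt_le_trans m10 x0.
Qed.

Lemma potential0 w : 0 <= w -> potential w 0 = 0.
Proof.
move=> w0; rewrite /potential (@eq_Rintegral _ _ _ _ _ (fun=> 0)).
  by rewrite Rintegral_cst ?mul0r//; exact: measurable_itv.
move=> s; rewrite inE /= in_itv /= => /andP[_ s0].
by rewrite excess_bump_eq0// (le_trans s0)// powR_ge0.
Qed.

Lemma potential_ge0 w v : 0 <= w -> 0 <= v -> 0 <= potential w v.
Proof.
move=> w0 v0; have [c _] := potential_mvt w (lexx 0) v0.
by rewrite potential0// !subr0 => ->; rewrite mulr_ge0 ?bump_ge0.
Qed.

Lemma potential_eq0 w v : 0 <= w -> 0 <= v -> v <= w `^ q -> potential w v = 0.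
Proof.
move=> w0 v0 vw; have [c /andP[_ cv]] := potential_mvt w (lexx 0) v0.
by rewrite potential0// !subr0 => ->; rewrite excess_bump_eq0 ?mul0r// (le_trans cv).
Qed.

Lemma potential_gt0 w y : 0 <= w -> w < y -> 0 < potential w (y `^ q).
Proof.
move=> w0 wy; have y0 : 0 <= y by exact: le_trans (ltW wy).
pose z := (w + y) / 2; have wz : w < z by rewrite /z; lra.
have zy : z < y by rewrite /z; lra.
have z0 : 0 <= z by exact: le_trans (ltW wz).
have zyq : z `^ q < y `^ q by rewrite gt0_ltr_powR ?nnegrE.
have [c /andP[zc _]] := potential_mvt w (powR_ge0 z q) (ltW zyq).
move/eqP; rewrite subr_eq => /eqP ->; apply: ltr_wpDr; first by apply: potential_ge0 => //; exact: powR_ge0.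
rewrite mulr_gt0 ?subr_gt0//; apply: lt_le_trans (ndecr_excess_bump w zc).
by rewrite excess_bump_powR// bump_gt0 subr_gt0.
Qed.

Lemma potential_le w v1 v2 : 0 <= v1 -> 0 <= v2 ->
  potential w v1 - potential w v2 <= (v1 - v2) * excess_bump w v1.
Proof.
move=> v10 v20; have [v12|v21] := leP v1 v2.
  have [c /andP[c1 _] E] := potential_mvt w v10 v12.
  move: (ndecr_excess_bump w c1) E; move: (excess_bump w c) (excess_bump w v1)
    (potential w v1) (potential w v2) => C B P1 P2 CB E; nra.
have [c /andP[_ c1] ->] := potential_mvt w v20 (ltW v21).
move: (ndecr_excess_bump w c1); move: (excess_bump w c) (excess_bump w v1) => C B CB; nra.
Qed.

Lemma potential_lipschitz w w' v v' : 0 <= w -> 0 <= w' -> 0 <= v -> 0 <= v' ->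
  `|potential w v - potential w' v'| <= 2 * `|w - w'| * v + `|v - v'|.
Proof.
move=> w0 w'0 v0 v'0.
have H1 : `|potential w v - potential w' v| <= 2 * `|w - w'| * v.
  have dD (z : R) : -1 < z -> is_derive z 1 (fun v => potential w v - potential w' v)
      (excess_bump w z - excess_bump w' z).
    by move=> z1; apply: is_deriveB; exact: is_derive_potential.
  have [c _] := mvt_gt dD m10 v0.
  rewrite !potential0// !subr0 => ->; rewrite normrM (ger0_norm v0) ler_wpM2r//.
  apply: (le_trans (lipschitz_bump _ _)); rewrite ler_pM2l// distrC.
  by rewrite opprB addrC addrA subrK.
have H2 : `|potential w' v - potential w' v'| <= `|v - v'|.
  have aux x y : 0 <= x -> x <= y -> `|potential w' y - potential w' x| <= `|y - x|.
    move=> x0 xy; have [c _ ->] := potential_mvt w' x0 xy.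
    by rewrite normrM ler_piMl// ger0_norm ?bump_ge0 ?bump_le1.
  have [vv|/ltW vv] := leP v' v; first exact: aux.
  by rewrite distrC (distrC v); exact: aux.
apply: le_trans (lerD H1 H2); apply: le_trans (ler_normD _ _).
by rewrite addrA subrK.
Qed.

Lemma potential_shift w d k v : 0 <= w -> 0 <= d -> 0 <= k -> 0 <= v ->
  (forall y, w <= y -> y `^ q <= v -> (y + d) `^ q <= y `^ q + k) ->
  potential w v <= potential (w + d) v + k * excess_bump w v.
Proof.
move=> w0 d0 k0 v0 H; have wd0 : 0 <= w + d by exact: addr_ge0.
have [vk|kv] := leP v k.
  have [c /andP[_ cv]] := potential_mvt w (lexx 0) v0; rewrite potential0// !subr0 => ->.
  move: (ndecr_excess_bump w cv) (bump_ge0 _ : 0 <= excess_bump w c) (potential_ge0 wd0 v0).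
  move: (excess_bump w c) (excess_bump w v) (potential (w + d) v) => C B P CB C0 P0; nra.
have dD (z : R) : -1 < z -> is_derive z 1 (fun s => potential (w + d) (s + k) - potential w s)
    (excess_bump (w + d) (z + k) - excess_bump w z).
  move=> z1; apply: is_deriveB; last exact: is_derive_potential.
  have h1 : is_derive z 1 (fun z : R => z + k) 1.
    by apply: (is_derive_eq (is_deriveD (is_derive_id z 1) (is_derive_cst k z 1))); rewrite addr0.
  have h2 : is_derive (z + k) 1 (potential (w + d)) (excess_bump (w + d) (z + k)).
    by apply: is_derive_potential; rewrite ltr_wpDr.
  by have := is_derive_comp1 h1 h2; rewrite mulr1.
have vk0 : 0 <= v - k by rewrite subr_ge0 ltW.
have [c /andP[c0 cvk]] := mvt_gt dD m10 vk0.
rewrite subrK add0r potential0// !subr0 => E.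
have c_ge0 : 0 <= excess_bump (w + d) (c + k) - excess_bump w c.
  rewrite subr_ge0; have [cw|wc] := leP c (w `^ q).
    by rewrite excess_bump_eq0 ?bump_ge0.
  pose y := c `^ q^-1; have y0 : 0 <= y by exact: powR_ge0.
  have yq : y `^ q = c by rewrite -powRrM mulVf ?gt_eqF// powRr1.
  have wy : w <= y.
    rewrite -[leLHS]powRr1// -(mulfV (lt0r_neq0 q0)) powRrM.
    by rewrite ge0_ler_powR ?nnegrE ?(ltW iq0) ?powR_ge0// ltW.
  have cv : c <= v by rewrite (le_trans cvk)// gerBl.
  have := H y wy; rewrite yq => /(_ cv) Hy.
  apply: (@le_trans _ _ (excess_bump (w + d) ((y + d) `^ q))); last exact: ndecr_excess_bump.
  rewrite excess_bump_powR; last exact: addr_ge0.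
  rewrite -{1}yq excess_bump_powR//; apply: ndecr_bump.
  by rewrite opprD addrACA subrr addr0.
have H1 : potential w (v - k) <= potential (w + d) v.
  have : 0 <= potential (w + d) v - potential w (v - k) - potential (w + d) k.
    by rewrite E mulr_ge0.
  move: (potential_ge0 wd0 k0); move: (potential _ _) (potential _ _) (potential _ _) => P1 P2 P3; lra.
have := potential_le w v0 vk0; rewrite subKr; move: H1.
by move: (potential w v) (potential w (v - k)) (potential (w + d) v) (k * _) => P1 P2 P3 P4; lra.
Qed.

End potential.

Lemma flux_monotone {R : realType} n (p : R) (x y : 'rV[R]_n) : 1 < p ->
  0 <= dotp (flux p x - flux p y) (x - y).
Proof.
move=> p1; rewrite dotpBl !dotp_flux !dotpBr.
have p10 : 0 < p - 1 by rewrite subr_gt0.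
have E z : enorm z `^ (p - 2) * enorm z = enorm z `^ (p - 1) :> R.
  have := @powR_mul_pred R (enorm z) (p - 1) (enorm_ge0 z) p10.
  by rewrite (_ : p - 1 - 1 = p - 2); last by lra.
rewrite -!enorm_sqr !expr2.
have dxy := dotp_le x y; rewrite (dotpC y x).
have := E n x; have := E n y; have := powR_ge0 (enorm x) (p - 2); have := powR_ge0 (enorm y) (p - 2).
have mono : 0 <= (enorm x `^ (p - 1) - enorm y `^ (p - 1)) * (enorm x - enorm y).
  have [xy|/ltW xy] := leP (enorm x) (enorm y).
    by apply: mulr_le0; rewrite subr_le0// ge0_ler_powR ?nnegrE ?enorm_ge0// ltW.
  by apply: mulr_ge0; rewrite subr_ge0// ge0_ler_powR ?nnegrE ?enorm_ge0// ltW.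
move: dxy mono; have := enorm_ge0 x; have := enorm_ge0 y.
move: (enorm x) (enorm y) (dotp x y) (enorm x `^ (p - 2)) (enorm y `^ (p - 2))
  (enorm x `^ (p - 1)) (enorm y `^ (p - 1)) => a b d A B A' B' b0 a0 dab m A0 B0 E1 E2.
nra.
Qed.

Lemma difference_quotient_cvg {R : realType} (F : R -> R) (x l : R) (h_ : nat -> R) :
  is_derive x 1 F l -> (forall k, 0 < h_ k) -> h_ @ \oo --> 0 ->
  (h_ k)^-1 * (F x - F (x - h_ k)) @[k --> \oo] --> l.
Proof.
move=> [dF <-] h0 hc.
have cF : (fun h : R => h^-1 *: (F (h *: 1 + x) - F x)) h @[h --> 0^'] --> 'D_1 F x by exact: dF.
have H := (@cvgr_dnbhsP R _ _ _).1 cF (fun k : nat => - h_ k).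
have H3 : (fun k : nat => (- h_ k)^-1 *: (F ((- h_ k) *: 1 + x) - F x)) k @[k --> \oo] --> 'D_1 F x.
  apply: H; split; first by move=> k; rewrite oppr_eq0 gt_eqF.
  by rewrite -[X in _ --> X]oppr0; apply: cvgN.
apply: cvg_trans H3; apply: near_eq_cvg; apply: nearW => k.
by rewrite invrN scaleNr -scalerN opprB [_ *: 1]mulr1 [_ + x]addrC.
Qed.

Lemma le_of_dissipation {R : realType} (K c I l e1 e2 : R) : K <= c -> 0 <= I ->
  (e1 - e2) - K * I <= l -> l <= - (c * I) -> e1 <= e2.
Proof. by move=> Kc I0 h1 h2; nra. Qed.

Lemma half_le_of_dist {R : realType} (r1 r2 : R) : `|r1 - r2| < r1 / 2 -> r1 / 2 <= r2.
Proof. by rewrite ltr_norml => /andP[h1 h2]; lra. Qed.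

Lemma opp_mul_le {R : realType} (c d b : R) : 0 <= b -> b = 0 \/ d <= - c ->
  c * b <= - (d * b).
Proof. by move=> b0 [->|dc]; [rewrite !mulr0 oppr0|rewrite -mulNr ler_wpM2r// lerNr]. Qed.

Section comparison.
Context {R : realType} (n : nat) (Omega : set 'rV[R]_n) (T p q M : R).
Variables (u : 'rV[R]_n * R -> R) (Du : 'rV[R]_n * R -> 'rV[R]_n).
Local Notation mu := (lebesgue_rV R n).
Local Notation leb := (@lebesgue_measure R).
Local Notation nu := (@lebesgue_xt R n).
Hypotheses (oO : open Omega) (bO : bounded_set Omega) (p1 : 1 < p) (q0 : 0 < q).
Hypothesis cu : forall z, cylinder Omega T z -> {for z, continuous u}.
Hypothesis uM : forall z, cylinder Omega T z -> 0 <= u z <= M.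
Hypothesis LDu : forall i, in_Lp nu (cylinder Omega T) p (fun z => Du z 0 i).
Hypothesis weak : forall (phi dphi : 'rV[R]_n * R -> R) (Dphi : 'rV[R]_n * R -> 'rV[R]_n),
  (forall z, cylinder Omega T z -> 0 <= phi z) ->
  in_W1r_0_time Omega T (q + 1) phi dphi ->
  in_Lp_W1p_0 Omega T p phi Dphi ->
  \int[nu]_(z in cylinder Omega T)
    (- (u z `^ q) * dphi z +
     enorm (Du z) `^ (p - 2) * dotp (Du z) (Dphi z)) = 0.
Variables (s a b m c K : R) (B U : set 'rV[R]_n) (zeta S : 'rV[R]_n -> R) (W : R -> R).
Variable (F : 'I_n -> 'rV[R]_n -> R).
Hypotheses (s0 : 0 < s) (sa : s < a) (ab : a < b) (bT : b < T).
Hypothesis WDu : {ae leb, forall t : R, 0 < t < T ->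
  in_W1p Omega p (fun x => u (x, t)) (fun x => Du (x, t))}.
Hypothesis vanish : vanishes_on_lateral_boundary Omega B s T p u.
Hypotheses (tzeta : test_fun B zeta) (oU : open U) (UO : U `<=` Omega).
Hypothesis zeta1 : forall x, U x -> zeta x = 1.
Hypotheses (sS : smooth S) (S0 : forall x, 0 <= S x).
Hypotheses (cW : continuous W) (W0 : forall t, 0 <= W t).
Hypothesis off : forall x t, Omega x -> ~ U x -> s < t < T -> zeta x * u (x, t) <= S x.
Hypothesis um : forall x t, U x -> s < t < T -> u (x, t) <= m.
Hypothesis Wni : forall t t', t <= t' -> W t' <= W t.
Hypothesis Wdec : forall t h y, a < t < b -> 0 < h < a - s -> W t <= y -> y <= m ->
  (y + (W (t - h) - W t)) `^ q <= y `^ q + K * h.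
Hypotheses (K0 : 0 <= K) (Kc : K <= c) (sF : forall i, smooth (F i)).
Hypothesis FS : forall x, U x -> S x < m -> forall i, F i x = flux p (grad S x) 0 i.
Hypothesis divF : forall x, U x -> S x < m -> \sum_i 'D_(basis_vec R i) (F i) x <= - c.

Local Notation J := (`]a, b[%classic : set (measurableTypeR R)).
Local Notation P z := (bump (excess u S W z)).
Local Notation xt := ('rV[R]_n * measurableTypeR R)%type.

Let mO := open_measurable_rV oO.
Let mU := open_measurable_rV oU.
Let muO := bounded_lebesgue_rV_lty mO bO.
Let muU : (mu U < +oo)%E.
Proof. by apply: le_lt_trans muO; apply: le_measure; rewrite ?inE. Qed.
Let mJ : measurable J. Proof. exact: measurable_itv. Qed.
Let lJ : (leb J < +oo)%E. Proof. exact: lebesgue_itv_oo_lty. Qed.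
Let mUJ : measurable (U `*` J : set xt). Proof. exact: measurableX. Qed.
Let mC : measurable (cylinder Omega T : set xt).
Proof. by apply: measurableX => //; exact: measurable_itv. Qed.
Let lUJ : (nu (U `*` J) < +oo)%E.
Proof.
have -> : nu (U `*` J) = (mu U * leb J)%E by exact: product_measure1E.
by rewrite lte_mul_pinfty// ge0_fin_numE.
Qed.

Let t_in t : a < t < b -> s < t < T.
Proof. by case/andP=> t1 t2; rewrite (lt_trans sa t1) (lt_trans t2 bT). Qed.

Let st0 t : s < t < T -> 0 < t < T.
Proof. by case/andP=> t1 ->; rewrite (lt_trans s0 t1). Qed.

Let inC x t : U x -> 0 < t < T -> cylinder Omega T (x, t).
Proof. by move=> Ux tT; split=> /=; [exact: UO|rewrite in_itv]. Qed.

Let shift_in t h : a < t < b -> 0 < h < a - s -> s < t - h < T.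
Proof.
move=> /andP[t1 t2] /andP[h0 has]; apply/andP; split.
  by rewrite ltrBrDl (lt_trans _ t1)// -ltrBrDr.
by rewrite (lt_trans _ bT)// (lt_trans _ t2)// gtrBl.
Qed.

Let UJC : U `*` J `<=` cylinder Omega T.
Proof. by move=> [x t] [/= Ux]; rewrite in_itv /= => /t_in/st0; exact: inC. Qed.

Lemma measurable_time_shift (f : xt -> R) h : 0 < h < a - s ->
  measurable_fun (cylinder Omega T : set xt) f ->
  measurable_fun (U `*` J : set xt) (fun z => f (z.1, z.2 - h)).
Proof.
move=> hh mf; apply: (@measurable_comp _ _ _ _ _ _ (cylinder Omega T) f _
  (fun z : xt => (z.1, z.2 - h : measurableTypeR R))) => //.
- move=> _ [[x t] [/= Ux Jt] <-]; move: Jt; rewrite in_itv /= => tab; apply: inC => //.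
  by apply: st0; exact: shift_in.
- apply: measurable_funTS; apply: measurable_fun_pair; first exact: measurable_fst.
  by apply: measurable_funB; [exact: measurable_snd|exact: measurable_cst].
Qed.

Let E (z : 'rV[R]_n * R) : R := potential q (S z.1 + W z.2) (u z `^ q).
Let e (t : R) : R := \int[mu]_(x in U) E (x, t).

Let w0 z : 0 <= S z.1 + W z.2.
Proof. exact: addr_ge0. Qed.

Let E_ge0 z : 0 <= E z.
Proof. by apply: potential_ge0 => //; exact: powR_ge0. Qed.

Let E_le z : cylinder Omega T z -> `|E z| <= M `^ q.
Proof.
move=> Cz; have := potential_lipschitz q0 (w0 z) (w0 z) (powR_ge0 (u z) q) (lexx 0).
rewrite potential0// !subr0 subrr normr0 mulr0 mul0r add0r => /le_trans; apply.
exact: (u_powR_le q0 uM).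
Qed.

Let continuous_w z : {for z, continuous (fun z : 'rV[R]_n * R => S z.1 + W z.2)}.
Proof.
apply: cvgD.
  apply: (@continuous_comp _ _ _ (fun z : 'rV[R]_n * R => z.1) S); first exact: cvg_fst.
  exact: (smooth_continuous sS).
by apply: (@continuous_comp _ _ _ (fun z : 'rV[R]_n * R => z.2) W); [exact: cvg_snd|exact: cW].
Qed.

Let continuous_E z : cylinder Omega T z -> {for z, continuous E}.
Proof.
move=> Cz; have cv := continuous_u_powR oO q0 cu uM Cz; have cw := @continuous_w z.
have H0 : 2 * `|(S z'.1 + W z'.2) - (S z.1 + W z.2)| * (M `^ q) + `|u z' `^ q - u z `^ q| @[z' --> z] --> 0.
  have -> : 0 = 2 * `|(S z.1 + W z.2) - (S z.1 + W z.2)| * (M `^ q) + `|u z `^ q - u z `^ q| :> R.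
    by rewrite !subrr normr0 mulr0 mul0r addr0.
  apply: cvgD; last by apply: cvg_norm; apply: cvgB => //; exact: cvg_cst.
  apply: cvgM; last exact: cvg_cst; apply: cvgM; first exact: cvg_cst.
  by apply: cvg_norm; apply: cvgB => //; exact: cvg_cst.
apply/cvgrPdist_le => eps eps0.
have Hz : nbhs z (cylinder Omega T).
  by apply: open_nbhs_nbhs; split => //; exact: open_cylinder.
have /cvgr0Pnorm_le/(_ _ eps0) := H0; apply: filterS2 Hz => z' Cz' H.
rewrite distrC; apply: le_trans (le_trans (ler_norm _) H).
apply: (le_trans (potential_lipschitz q0 (w0 z') (w0 z) (powR_ge0 _ _) (powR_ge0 _ _))).
rewrite lerD2r ler_wpM2l ?mulr_ge0//.
by have := u_powR_le q0 uM Cz'; rewrite ger0_norm ?powR_ge0.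
Qed.

Let measurable_E : measurable_fun (cylinder Omega T : set xt) E.
Proof.
apply: continuous_measurable_rVxR; first exact: open_cylinder.
by move=> z; rewrite inE; exact: continuous_E.
Qed.

Let integrable_E t : 0 < t < T -> Rintegrable mu U (fun x => E (x, t)).
Proof.
move=> tT; apply: (Rintegrable_bounded mU (C := M `^ q) muU).
  apply: (measurable_funS mO UO); apply: (measurable_slice1 mO _ measurable_E); first exact: measurable_itv.
  by rewrite /= in_itv.
by move=> x Ux; apply: E_le; exact: inC.
Qed.

Let continuous_e t : 0 < t < T -> {for t, continuous e}.
Proof.
move=> tT; apply: (@continuity_under_integral R _ _ mu (fun t x => E (x, t)) U mU 0 T
  _ _ (fun x => M `^ q)).
- by move=> r; rewrite /= in_itv /=; exact: integrable_E.
- apply: aeW => x Ux r; rewrite inE /= in_itv /= => rT.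
  by apply: continuous_slice; apply: continuous_E; exact: inC.
- by apply: (Rintegrable_bounded mU (C := `|M `^ q|) muU).
- by move=> r; rewrite /= in_itv /= => rT; apply: aeW => x Ux; apply: E_le; exact: inC.
- by rewrite inE /= in_itv.
Qed.

Let F0 (t : R) : R := \int[leb]_(r in `]s, t]) e r.

Let e_le t : 0 < t < T -> `|e t| <= \int[mu]_(x in U) (M `^ q).
Proof.
move=> tT; apply: (le_trans (le_normr_Rintegral mU (integrable_E tT))).
apply: le_Rintegral => //; first exact: (Rintegrable_abs (integrable_E tT)).
  by apply: (Rintegrable_bounded mU (C := `|M `^ q|) muU).
by move=> x Ux; apply: E_le; exact: inC.
Qed.

Let is_derive_F0 t : s < t < T -> is_derive t 1 F0 (e t).
Proof.
move=> /[dup] stT /andP[st tT]; pose r := (t + T) / 2.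
have tr : t < r by rewrite /r; lra.
have rT : r < T by rewrite /r; lra.
have mI : measurable (`]s, r]%classic : set (measurableTypeR R)) by exact: measurable_itv.
have lI : (leb `]s, r]%classic < +oo)%E.
  by rewrite lebesgue_measure_itv /=; case: ifP => // _; rewrite -EFinB ltry.
have je : Rintegrable leb `]s, r] e.
  apply: (Rintegrable_bounded mI (C := \int[mu]_(x in U) (M `^ q)) lI).
    apply: (@measurable_funS _ _ _ _ (`]0, T[%classic : set (measurableTypeR R))); first exact: measurable_itv.
      move=> y /=; rewrite !in_itv /= => /andP[y1 y2].
      by rewrite (lt_trans s0 y1) (le_lt_trans y2 rT).
    apply: open_continuous_measurable_fun; first exact: interval_open.
    by move=> y; rewrite inE /= in_itv; exact: continuous_e.
  move=> y /=; rewrite in_itv /= => /andP[y1 y2].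
  by apply: e_le; rewrite (lt_trans s0 y1) (le_lt_trans y2 rT).
have [|d1 d2] := @continuous_FTC1 R e (BRight s) t r tr je _ (continuous_e (st0 stT)).
  by rewrite /Order.lt /= st.
by apply: DeriveDef; [exact: d1|rewrite -derive1E; exact: d2].
Qed.

Let integral_e_shift h : 0 < h < a - s ->
  \int[leb]_(t in J) (e t - e (t - h)) = (F0 b - F0 (b - h)) - (F0 a - F0 (a - h)).
Proof.
move=> hh; have [h0 has] := andP hh.
have inI t : a <= t <= b -> s < t < T.
  by case/andP=> t1 t2; rewrite (lt_le_trans sa t1) (le_lt_trans t2 bT).
have inIh t : a <= t <= b -> s < t - h < T.
  case/andP=> t1 t2; apply/andP; split; first by rewrite ltrBrDl (lt_le_trans _ t1)// -ltrBrDr.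
  by rewrite (lt_trans _ (le_lt_trans t2 bT))// gtrBl.
have cs t : {for t, continuous (fun t : R => t - h)} by apply: cvgB; [exact: cvg_id|exact: cvg_cst].
have ce t : a <= t <= b -> {for t, continuous e} by move=> /inI/st0; exact: continuous_e.
have ceh t : a <= t <= b -> {for t, continuous (fun t => e (t - h))}.
  by move=> /inIh/st0 ht; apply: (@continuous_comp _ _ _ (fun t : R => t - h) e); [exact: cs|exact: continuous_e].
have bounded_on (f : R -> R) : (forall t, a <= t <= b -> {for t, continuous f}) ->
    (forall t, a <= t <= b -> `|f t| <= \int[mu]_(x in U) (M `^ q)) -> Rintegrable leb J f.
  move=> cf fb; apply: (Rintegrable_bounded mJ (C := \int[mu]_(x in U) (M `^ q)) lJ).
    apply: open_continuous_measurable_fun; first exact: interval_open.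
    by move=> t; rewrite inE /= in_itv /= => /andP[t1 t2]; apply: cf; rewrite !ltW.
  by move=> t /=; rewrite in_itv /= => /andP[t1 t2]; apply: fb; rewrite !ltW.
rewrite (RintegralB mJ (bounded_on _ ce _) (bounded_on _ ceh _)); last 2 first.
- by move=> t /inI/st0; exact: e_le.
- by move=> t /inIh/st0; exact: e_le.
have I1 : \int[leb]_(t in J) e t = F0 b - F0 a.
  exact: (ftc_local ab (fun t tab => is_derive_F0 (inI t tab)) ce).
have dFh t : a <= t <= b -> is_derive t 1 (fun t => F0 (t - h)) (e (t - h)).
  move=> tab; have h1 : is_derive t 1 (fun t : R => t - h) 1.
    by apply: (is_derive_eq (is_deriveB (is_derive_id t 1) (is_derive_cst h t 1))); rewrite subr0.
  by have := is_derive_comp1 h1 (is_derive_F0 (inIh t tab)); rewrite mulr1.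
have I2 : \int[leb]_(t in J) e (t - h) = F0 (b - h) - F0 (a - h) by exact: (@ftc_local R (fun t => F0 (t - h)) (fun t => e (t - h)) a b ab dFh ceh).
have aux (A1 A2 f1 f2 f3 f4 : R) : A1 = f1 - f2 -> A2 = f3 - f4 ->
    A1 - A2 = (f1 - f3) - (f2 - f4) by move=> -> ->; ring.
exact: (aux _ _ _ _ _ _ I1 I2).
Qed.

Let measurable_P : measurable_fun (U `*` J : set xt) (fun z => P z).
Proof.
apply: (measurable_funS mC UJC); apply: continuous_measurable_rVxR; first exact: open_cylinder.
move=> z; rewrite inE => Cz; apply: (@continuous_comp _ _ _ (excess u S W) (@bump R)).
  exact: (continuous_excess cu sS cW).
exact: continuous_bump.
Qed.

Let Q h (z : 'rV[R]_n * R) : R := bump (u (z.1, z.2 - h) - (S z.1 + W z.2)).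

Let measurable_u : measurable_fun (cylinder Omega T : set xt) u.
Proof.
apply: continuous_measurable_rVxR; first exact: open_cylinder.
by move=> z; rewrite inE; exact: cu.
Qed.

Let measurable_Q h : 0 < h < a - s -> measurable_fun (U `*` J : set xt) (Q h).
Proof.
move=> hh; apply: (measurableT_comp (f := @bump R)).
  by apply: continuous_measurable_fun; exact: continuous_bump.
apply: measurable_funB; first exact: (measurable_time_shift hh measurable_u).
apply: (measurable_funS mC UJC); apply: continuous_measurable_rVxR; first exact: open_cylinder.
by move=> z _; exact: continuous_w.
Qed.

Let jP : Rintegrable nu (U `*` J) (fun z => P z).
Proof.
apply: (Rintegrable_bounded mUJ (C := 1) lUJ measurable_P) => z _.
by rewrite ger0_norm ?bump_ge0 ?bump_le1.
Qed.

Let jQ h : 0 < h < a - s -> Rintegrable nu (U `*` J) (Q h).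
Proof.
move=> hh; apply: (Rintegrable_bounded mUJ (C := 1) lUJ (measurable_Q hh)) => z _.
by rewrite ger0_norm ?bump_ge0 ?bump_le1.
Qed.

Let energy_increment h : 0 < h < a - s ->
  (F0 b - F0 (b - h)) - (F0 a - F0 (a - h)) - K * h * \int[nu]_(z in U `*` J) Q h z <=
  \int[nu]_(z in U `*` J) ((u z `^ q - u (z.1, z.2 - h) `^ q) * P z).
Proof.
move=> hh; have [h0 has] := andP hh.
have mE1 := measurable_funS mC UJC measurable_E.
have mE2 := measurable_time_shift hh measurable_E.
have Eh_le z : (U `*` J) z -> `|E (z.1, z.2 - h)| <= M `^ q.
  move: z => [x t] [/= Ux]; rewrite in_itv /= => tab; apply: E_le; apply: inC => //.
  by apply: st0; exact: shift_in.
have jE1 : Rintegrable nu (U `*` J) E.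
  by apply: (Rintegrable_bounded mUJ (C := M `^ q) lUJ mE1) => z /UJC; exact: E_le.
have jE2 : Rintegrable nu (U `*` J) (fun z => E (z.1, z.2 - h)).
  exact: (Rintegrable_bounded mUJ (C := M `^ q) lUJ mE2).
rewrite -integral_e_shift//.
have -> : \int[leb]_(t in J) (e t - e (t - h)) = \int[nu]_(z in U `*` J) (E z - E (z.1, z.2 - h)).
  have [_ _ ->] := Rfubini2 (m1 := mu) (m2 := leb) mU mJ (RintegrableB mUJ jE1 jE2).
  apply: eq_Rintegral => t; rewrite inE /= in_itv /= => tab.
  by rewrite (RintegralB mU (integrable_E _) (integrable_E _))//; apply: st0; [exact: t_in|exact: shift_in].
have jKQ := RintegrableZ mUJ (K * h) (jQ hh).
rewrite -(RintegralZl _ mUJ (jQ hh)) -(RintegralB mUJ (RintegrableB mUJ jE1 jE2) jKQ).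
have mv := measurable_u_powR oO q0 cu uM.
have jl : Rintegrable nu (U `*` J) (fun z => (u z `^ q - u (z.1, z.2 - h) `^ q) * P z).
  apply: (Rintegrable_bounded mUJ (C := M `^ q + M `^ q) lUJ).
    apply: measurable_funM measurable_P; apply: measurable_funB; first exact: measurable_funS mC UJC mv.
    exact: (measurable_time_shift hh mv).
  move=> [x t] [/= Ux]; rewrite in_itv /= => tab.
  rewrite normrM -[leRHS]mulr1; apply: ler_pM => //; last by rewrite ger0_norm ?bump_ge0 ?bump_le1.
  apply: (le_trans (ler_normB _ _)); apply: lerD; apply: (u_powR_le q0 uM); apply: inC => //; apply: st0.
    exact: t_in.
  exact: shift_in.
apply: le_Rintegral => //; first exact: (RintegrableB mUJ (RintegrableB mUJ jE1 jE2) jKQ).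
move=> [x t] [/= Ux]; rewrite in_itv /= => tab.
have C1 := inC Ux (st0 (t_in tab)); have C2 := inC Ux (st0 (shift_in tab hh)).
have /andP[u1 _] := uM C1; have /andP[u2 _] := uM C2.
have H1 := potential_le q0 (S x + W t) (powR_ge0 (u (x, t)) q) (powR_ge0 (u (x, t - h)) q).
have Wth : W t <= W (t - h) by apply: Wni; rewrite gerBl ltW.
have dW : 0 <= W (t - h) - W t by rewrite subr_ge0.
have Kh0 : 0 <= K * h by rewrite mulr_ge0// ltW.
have H2 : potential q (S x + W t) (u (x, t - h) `^ q) <=
    potential q (S x + W t + (W (t - h) - W t)) (u (x, t - h) `^ q) +
    K * h * excess_bump q (S x + W t) (u (x, t - h) `^ q).
  apply: (potential_shift q0 (w0 (x, t)) dW Kh0 (powR_ge0 _ _)) => y wy yv.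
  have y0 : 0 <= y by exact: le_trans (w0 (x, t)) wy.
  apply: Wdec => //; first by apply: le_trans wy; rewrite lerDr.
  apply: le_trans (um Ux (shift_in tab hh)).
  by move: yv; rewrite ler_pXn2r || rewrite leNgt => /negP yv; rewrite leNgt; apply/negP => h1; apply: yv; rewrite gt0_ltr_powR ?nnegrE.
have EW : S x + W t + (W (t - h) - W t) = S x + W (t - h).
  by move: (W t) (W (t - h)) (S x) => w1 w2 w3; ring.
move: H1 H2; rewrite !excess_bump_powR// EW /E /Q /excess /=.
move: (potential _ _ _) (potential _ _ _) (potential _ _ _) (bump _) (bump _) => P1 P2 P3 B1 B2.
by move=> H1 H2; lra.
Qed.

Let dissipation :
  - (\int[nu]_(z in U `*` J) (dbump (excess u S W z) * dotp (flux p (Du z)) (Du z - grad S z.1))) <=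
  - (c * \int[nu]_(z in U `*` J) P z).
Proof.
pose X (z : xt) : 'rV[R]_n := dbump (excess u S W z) *: (Du z - grad S z.1).
have mex : measurable_fun (U `*` J : set xt) (fun z => dbump (excess u S W z)).
  apply: (measurable_funS mC UJC); apply: continuous_measurable_rVxR; first exact: open_cylinder.
  move=> z; rewrite inE => Cz; apply: (@continuous_comp _ _ _ (excess u S W) (@dbump R)).
    exact: (continuous_excess cu sS cW).
  exact: continuous_dbump.
have p0 : 0 <= p by rewrite ltW// (lt_trans ltr01).
have p'0 : 0 <= p / (p - 1) by rewrite ltW// conj_exponent_gt0.
have LDuU i : in_Lp nu (U `*` J) p (fun z => Du z 0 i) by exact: (in_LpS mC mUJ UJC (LDu i)).
have Lsm r (f : 'rV[R]_n -> R) : 0 <= r -> smooth f -> in_Lp nu (U `*` J) r (fun z => f z.1).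
  move=> r0 sf; apply: (in_Lp_strip mU mJ lJ).
  exact: (in_LpS mO mU UO (smooth_in_Lp oO bO r0 sf)).
have LX i : in_Lp nu (U `*` J) p (fun z => X z 0 i).
  have L1 : in_Lp nu (U `*` J) p (fun z => (Du z - grad S z.1) 0 i).
    have -> : (fun z : xt => (Du z - grad S z.1) 0 i) = (fun z => Du z 0 i - 'D_(basis_vec R i) S z.1).
      by apply/funext => z; rewrite !mxE.
    exact: (in_LpB mUJ p1 (LDuU i) (Lsm _ _ p0 (smooth_derive _ sS))).
  have -> : (fun z => X z 0 i) = (fun z => dbump (excess u S W z) * (Du z - grad S z.1) 0 i).
    by apply/funext => z; rewrite /X mxE.
  apply: (in_LpM_bounded mUJ p1 mex (C := 2)) L1 => z _.
  by rewrite ger0_norm ?dbump_ge0 ?dbump_le2.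
have jdot (G : xt -> 'rV[R]_n) : (forall i, in_Lp nu (U `*` J) (p / (p - 1)) (fun z => G z 0 i)) ->
    Rintegrable nu (U `*` J) (fun z => dotp (G z) (X z)).
  by move=> LG; apply: (Rintegrable_sum mUJ) => i; exact: (Rintegrable_pairing mUJ p1 (LG i) (LX i)).
have j1 := jdot (fun z => flux p (Du z)) (in_Lp_flux p1 mUJ LDuU).
have LF i : in_Lp nu (U `*` J) (p / (p - 1)) (fun z : xt => (\row_i F i z.1) 0 i).
  have -> : (fun z : xt => (\row_i F i z.1) 0 i) = (fun z => F i z.1) by apply/funext => z; rewrite mxE.
  exact: (Lsm _ _ p'0 (sF i)).
have j2 := jdot (fun z => \row_i F i z.1) LF.
have E1 : \int[nu]_(z in U `*` J) (dbump (excess u S W z) * dotp (flux p (Du z)) (Du z - grad S z.1)) =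
    \int[nu]_(z in U `*` J) dotp (flux p (Du z)) (X z).
  by apply: eq_Rintegral => z _; rewrite /X dotpZr.
rewrite E1 lerN2; apply: (@le_trans _ _ (\int[nu]_(z in U `*` J) dotp (\row_i F i z.1) (X z))); last first.
  apply: le_Rintegral => //; move=> [x t] [/= Ux]; rewrite in_itv /= => tab.
  rewrite -subr_ge0 -dotpBl /X dotpZr.
  have [ex|ex] := leP (excess u S W (x, t)) 0; first by rewrite dbump_le0 ?mul0r.
  have Sm : S x < m.
    apply: lt_le_trans (um Ux (t_in tab)); move: ex; rewrite /excess /= subr_gt0; apply: le_lt_trans.
    by rewrite lerDl.
  rewrite mulr_ge0 ?dbump_ge0//.
  have -> : \row_i F i x = flux p (grad S x) by apply/rowP => i; rewrite mxE FS.
  exact: flux_monotone.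
have [jt _ ->] := Rfubini2 (m1 := mu) (m2 := leb) mU mJ j2.
have [jPt aeP ->] := Rfubini2 (m1 := mu) (m2 := leb) mU mJ jP.
rewrite -(RintegralZl _ mJ jPt).
apply: (ae_le_Rintegral mJ _ jt); first exact: (RintegrableZ mJ _ jPt).
have ae2 := @filterI _ _ (ae_filter_ringOfSetsType leb) _ _ WDu vanish.
have ae3 := @filterI _ _ (ae_filter_ringOfSetsType leb) _ _ aeP ae2.
apply: (@filterS _ _ (ae_filter_ringOfSetsType leb) _ _ _ ae3) => t [H1 [H2 H3]] Jt.
have Jt' := Jt; rewrite /= in_itv /= in Jt'; have stT := t_in Jt'.
have [G WG] := H3 stT zeta tzeta; have Wu := H2 (st0 stT).
pose w x := S x + W t; have w_ge0 x : 0 <= w x by exact: addr_ge0.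
have sw : smooth w by exact: (smoothD sS (smooth_cst (W t))).
pose v x := zeta x * u (x, t).
have offw x : Omega x -> ~ U x -> v x - w x <= 0.
  by move=> Ox Ux; rewrite subr_le0 (le_trans (off Ox Ux stT))// lerDl.
have GDu := weak_gradient_eq oO bO p1 oU UO zeta1 Wu WG.1.
have div_eq := truncation_divergence oO bO p1 WG sw w_ge0 sF.
have vE x : U x -> v x - w x = excess u S W (x, t) by move=> Ux; rewrite /v zeta1// mul1r.
have EX : \int[mu]_(x in U) dotp (\row_i F i x) (X (x, t)) =
    \int[mu]_(x in Omega) dotp (\row_i F i x) (truncation_grad v G w x).
  rewrite [RHS](Rintegral_restrict _ UO); last first.
    by move=> x Ox Ux; rewrite /truncation_grad (dbump_le0 (offw x Ox Ux)) scale0r /dotp big1// => i _; rewrite !mxE mulr0.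
  have mdv : measurable_fun U (fun x => dbump (v x - w x)).
    apply: (measurableT_comp (f := @dbump R)).
      by apply: continuous_measurable_fun; exact: continuous_dbump.
    apply: measurable_funB; last exact: measurable_smooth sw.
    by case: WG => -[[mv _] _ _] _; exact: (measurable_funS mO UO mv).
  have mdot (Y : 'rV[R]_n -> 'rV[R]_n) : (forall i, measurable_fun U (fun x => Y x 0 i)) ->
      measurable_fun U (fun x => dotp (\row_i F i x) (Y x)).
    move=> mY; apply: measurable_sum => i; apply: measurable_funM => //.
    by under eq_fun do rewrite mxE; exact: measurable_smooth (sF i).
  apply: (ae_eq_Rintegral mU).
  - apply: mdot => i; apply: (measurable_slice1 mU mJ (f := fun z => X z 0 i) _ Jt).
    by case: (LX i).
  - apply: mdot => i; have -> : (fun x => truncation_grad v G w x 0 i) =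
        (fun x => dbump (v x - w x) * (G x 0 i - 'D_(basis_vec R i) w x)).
      by apply/funext => x; rewrite /truncation_grad !mxE.
    apply: measurable_funM => //; apply: measurable_funB.
      by case: WG => -[_ LG _] _; case: (LG i) => mG _; exact: (measurable_funS mO UO mG).
    exact: measurable_smooth (smooth_derive _ sw).
  - apply: filterS GDu => x Hx Ux; rewrite /X /truncation_grad (vE x Ux) (Hx Ux).
    by rewrite (grad_addr_cst W sS).
have jB : Rintegrable mu U (fun x => P (x, t)) by exact: H1.
have [C C0 HC] : exists2 C, 0 <= C & forall x, U x -> `|\sum_i 'D_(basis_vec R i) (F i) x| <= C.
  have sdiv : smooth (fun x => \sum_i 'D_(basis_vec R i) (F i) x).
    by apply: smooth_sum => i; exact: (smooth_derive _ (sF i)).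
  have [C [Cr HC]] := bounded_set_cube bO.
  have [D D0 HD] := continuous_bounded_on_compact (@compact_cube R n C) (smooth_continuous sdiv).
  exists D; first exact: D0.
  by move=> x /UO Ox; apply: (HD x); apply: rV_norm_le; [exact: ltW Cr|exact: HC].
have EI : \int[mu]_(x in Omega) ((\sum_i 'D_(basis_vec R i) (F i) x) * truncation v w x) =
    \int[mu]_(x in U) ((\sum_i 'D_(basis_vec R i) (F i) x) * P (x, t)).
  rewrite (Rintegral_restrict _ UO); last first.
    by move=> x Ox Ux; rewrite /truncation (bump_le0 (offw x Ox Ux)) mulr0.
  by apply: eq_Rintegral => x; rewrite inE => Ux; rewrite /truncation vE.
have jd : Rintegrable mu U (fun x => (\sum_i 'D_(basis_vec R i) (F i) x) * P (x, t)).
  have md : measurable_fun U (fun x => \sum_i 'D_(basis_vec R i) (F i) x).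
    apply: measurable_sum => i; exact: measurable_smooth (smooth_derive _ (sF i)).
  exact: (@RintegralM_bounded _ _ _ mu _ mU _ (fun x => P (x, t)) C md HC jB).
have EE : - (\int[mu]_(x in U) ((\sum_i 'D_(basis_vec R i) (F i) x) * P (x, t))) <=
    \int[mu]_(x in U) dotp (\row_i F i x) (X (x, t)).
  by rewrite (etrans EX (etrans div_eq (congr1 -%R EI))).
apply: le_trans EE.
rewrite -(RintegralZl _ mU jB) -(RintegralN mU jd).
apply: (le_Rintegral mU (RintegrableZ mU c jB) (RintegrableN jd)).
move=> x Ux; apply: opp_mul_le; first exact: bump_ge0.
have [ex|ex] := leP (excess u S W (x, t)) 0; [left; exact: bump_le0|right; apply: divF; first exact: Ux].
apply: lt_le_trans (um Ux stT); move: ex; rewrite /excess /= subr_gt0; apply: le_lt_trans.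
by rewrite lerDl.
Qed.

Lemma comparison : (forall x, U x -> m <= S x + W a) ->
  forall x, U x -> u (x, b) <= S x + W b.
Proof.
move=> Wa.
have [h_ [hh h0c lim]] := energy_limit oO bO p1 q0 cu uM LDu weak s0 sa bT WDu vanish
  tzeta oU UO zeta1 sS S0 cW W0 off.
have h0 k : 0 < h_ k by case/andP: (hh k).
have inab t : a <= t <= b -> s < t < T.
  by case/andP=> t1 t2; rewrite (lt_le_trans sa t1) (le_lt_trans t2 bT).
have sbT : s < b < T by apply: inab; rewrite lexx ltW.
have saT : s < a < T by apply: inab; rewrite lexx ltW.
have cQ : \int[nu]_(z in U `*` J) Q (h_ k) z @[k --> \oo] --> \int[nu]_(z in U `*` J) P z.
  apply: (Rdominated_convergence mUJ (g := fun=> 1)).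
  - by move=> k; exact: measurable_Q.
  - exact: measurable_P.
  - apply: aeW => -[x t] [/= Ux]; rewrite in_itv /= => tab.
    apply: (@continuous_cvg _ _ _ _ _ _ (@bump R)); first exact: continuous_bump.
    apply: cvgB; last exact: cvg_cst.
    have cut := continuous_slice (cu (inC Ux (st0 (t_in tab)))).
    apply: (cvg_comp (fun k => t - h_ k) (fun t => u (x, t)) _ cut).
    by have := cvgB (cvg_cst t) h0c; rewrite subr0; exact.
  - by apply: (Rintegrable_bounded mUJ (C := 1) lUJ) => // z _; rewrite normr1.
  - by move=> k z _; rewrite ger0_norm ?bump_ge0 ?bump_le1.
have cl : ((h_ k)^-1 * (F0 b - F0 (b - h_ k)) - (h_ k)^-1 * (F0 a - F0 (a - h_ k))) -
    K * \int[nu]_(z in U `*` J) Q (h_ k) z @[k --> \oo] -->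
    (e b - e a) - K * \int[nu]_(z in U `*` J) P z.
  apply: cvgB; last by apply: cvgM cQ; exact: cvg_cst.
  by apply: cvgB; apply: difference_quotient_cvg => //; exact: is_derive_F0.
have le1 : (e b - e a) - K * \int[nu]_(z in U `*` J) P z <=
    - \int[nu]_(z in U `*` J) (dbump (excess u S W z) * dotp (flux p (Du z)) (Du z - grad S z.1)).
  apply: (ler_cvg_to cl lim); apply: nearW => k.
  rewrite ler_pdivlMl//; apply: le_trans (energy_increment (hh k)).
  have hn : h_ k != 0 by rewrite gt_eqF.
  move: (\int[nu]_(z in _) Q _ z) (F0 b) (F0 a) (F0 (b - h_ k)) (F0 (a - h_ k)) => I0 f1 f2 f3 f4.
  by rewrite le_eqVlt; apply/orP; left; apply/eqP; field.
have eba : e b <= e a.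
  have P0 : 0 <= \int[nu]_(z in U `*` J) P z by apply: Rintegral_ge0 => z _; exact: bump_ge0.
  exact: (le_of_dissipation Kc P0 le1 dissipation).
have Ea x : U x -> E (x, a) = 0.
  move=> Ux; have /andP[u0 _] := uM (inC Ux (st0 saT)).
  apply: (potential_eq0 q0 (w0 (x, a)) (powR_ge0 _ _)).
  apply: (ge0_ler_powR (ltW q0)).
  - by rewrite nnegrE.
  - by rewrite nnegrE; exact: (w0 (x, a)).
  - exact: le_trans (um Ux saT) (Wa x Ux).
have ea0 : e a = 0.
  transitivity (\int[mu]_(x in U) (0 : R)); last by rewrite Rintegral_cst// mul0r.
  by apply: eq_Rintegral => x; rewrite inE; exact: Ea.
move=> x Ux; rewrite leNgt; apply/negP => ubS.
have Ex : 0 < E (x, b) by apply: potential_gt0 => //; exact: (w0 (x, b)).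
have cEb y : U y -> {for y, continuous (fun y => E (y, b))}.
  move=> Uy; have cE := continuous_E (inC Uy (st0 sbT)).
  move=> A /cE[[A1 A2] /= [A1y A2b] sub].
  by apply: filterS A1y => y' A1y'; apply: sub; split=> //=; exact: nbhs_singleton.
have [V [oV Vx VU EV]] : exists V : set 'rV[R]_n, [/\ open V, V x, V `<=` U & forall y, V y -> E (x, b) / 2 <= E (y, b)].
  have E2 : 0 < E (x, b) / 2 by rewrite divr_gt0.
  have H1 : \forall y \near x, E (x, b) / 2 <= E (y, b).
    have /cvgrPdist_lt/(_ _ E2) := cEb x Ux.
    by apply: filterS => y; exact: half_le_of_dist.
  have H2 : nbhs x U by exact: open_nbhs_nbhs.
  have : nbhs x [set y | E (x, b) / 2 <= E (y, b) /\ U y] by apply: filterS2 H1 H2 => y h1 h2.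
  rewrite nbhsE => -[V [oV Vx] HV].
  by exists V; split=> // y /HV[].
have mV := open_measurable_rV oV.
have lV : (mu V < +oo)%E by apply: le_lt_trans muU; apply: le_measure; rewrite ?inE.
have V0 := open_lebesgue_rV_gt0 oV (ex_intro _ x Vx).
have : 0 < e b.
  apply: (@lt_le_trans _ _ (\int[mu]_(y in V) (E (x, b) / 2))).
    by rewrite Rintegral_cst// mulr_gt0 ?divr_gt0// fine_gt0// V0.
  apply: (@le_trans _ _ (\int[mu]_(y in V) E (y, b))).
    apply: le_Rintegral => //.
    - by apply: (Rintegrable_bounded mV (C := `|E (x, b) / 2|) lV).
    - exact: (integrableS mU mV VU (integrable_E (st0 sbT))).
  rewrite /e /Rintegral; apply: fine_le.
  - exact: (integrable_fin_num mV (integrableS mU mV VU (integrable_E (st0 sbT)))).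
  - exact: (integrable_fin_num mU (integrable_E (st0 sbT))).
  apply: ge0_subset_integral => //; first exact: measurable_int (integrable_E (st0 sbT)).
  by move=> y _; rewrite lee_fin.
by move: eba; rewrite ea0 => /le_lt_trans h /h; rewrite ltxx.
Qed.

End comparison.


Section time_weight.
Context {R : realType} (q m b tau : R).
Hypotheses (q0 : 0 < q) (m0 : 0 < m) (tau0 : 0 < tau).

(* the exponent makes the [q]-th power of the weight Lipschitz down to its zero *)
Definition time_weight (t : R) : R :=
  m * Num.max ((b - t) / tau) 0 `^ (if q <= 1 then q^-1 else 1).

Definition time_weight_cst : R := if q <= 1 then 1 else q * 2 `^ (q - 1).

Let r := if q <= 1 then q^-1 else 1.

Let r0 : 0 < r. Proof. by rewrite /r; case: ifP; rewrite ?invr_gt0. Qed.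

Lemma time_weight_cst_gt0 : 0 < time_weight_cst.
Proof. by rewrite /time_weight_cst; case: ifP => // _; rewrite mulr_gt0// powR_gt0. Qed.

Lemma continuous_time_weight : continuous time_weight.
Proof.
move=> t; apply: cvgM; first exact: cvg_cst.
apply: (@continuous_comp _ _ _ (fun t : R => (b - t) / tau) (fun y : R => Num.max y 0 `^ r)).
  by apply: cvgM; [apply: cvgB; [exact: cvg_cst|exact: cvg_id]|exact: cvg_cst].
exact: continuous_pos_powR.
Qed.

Lemma time_weight_ge0 t : 0 <= time_weight t.
Proof. by rewrite /time_weight mulr_ge0 ?powR_ge0// ltW. Qed.

Lemma time_weight_end : time_weight b = 0.
Proof.
by rewrite /time_weight subrr mul0r maxxx -/r powR0 ?mulr0// gt_eqF.
Qed.

Lemma time_weight_start : time_weight (b - tau) = m.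
Proof.
by rewrite /time_weight subKr divff ?gt_eqF// max_l// powR1 mulr1.
Qed.

Lemma ninc_time_weight t t' : t <= t' -> time_weight t' <= time_weight t.
Proof.
move=> tt'; rewrite /time_weight ler_pM2l// -/r.
have le_arg : (b - t') / tau <= (b - t) / tau by rewrite ler_pM2r ?invr_gt0// lerD2l lerN2.
have le_max0 : Num.max ((b - t') / tau) 0 <= Num.max ((b - t) / tau) 0.
  by rewrite ge_max !le_max le_arg lexx orbT.
by apply: (ge0_ler_powR (ltW r0)) => //; rewrite nnegrE le_max lexx orbT.
Qed.

Lemma time_weight_gt0 t : t < b -> 0 < time_weight t.
Proof.
move=> tb; rewrite /time_weight mulr_gt0// powR_gt0// lt_max divr_gt0//.
by rewrite subr_gt0.
Qed.

Lemma time_weight_dec t h y : t < b -> 0 < h <= tau -> time_weight t <= y -> y <= m ->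
  (y + (time_weight (t - h) - time_weight t)) `^ q <=
  y `^ q + time_weight_cst * m `^ q / tau * h.
Proof.
move=> tb /andP[h0 htau] Wy ym; have W0 := time_weight_gt0 tb.
have d0 : 0 <= time_weight (t - h) - time_weight t.
  by rewrite subr_ge0; apply: ninc_time_weight; rewrite gerBl ltW.
have y0 : 0 < y by exact: lt_le_trans Wy.
have t1 : 0 <= (b - t) / tau by rewrite divr_ge0 ?subr_ge0// ltW.
have t2 : 0 <= (b - (t - h)) / tau.
  by rewrite divr_ge0 ?subr_ge0 ?(ltW tau0)// (le_trans _ (ltW tb))// gerBl ltW.
have diff : (b - (t - h)) / tau - (b - t) / tau = h / tau.
  by rewrite -mulrBl (_ : b - (t - h) - (b - t) = h)//; ring.
rewrite /time_weight_cst; have [q1|q1] := leP q 1.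
  have := powR_increment_concave (_ : 0 < q <= 1) W0 Wy d0.
  rewrite q0 q1 => /(_ isT); rewrite [time_weight t + _]addrC subrK.
  have WE (z : R) : 0 <= (b - z) / tau -> time_weight z `^ q = m `^ q * ((b - z) / tau).
    move=> z0; rewrite /time_weight q1 max_l// powRM ?powR_ge0 ?(ltW m0)//.
    by rewrite -powRrM mulVf ?gt_eqF// powRr1.
  rewrite (WE t t1) (WE (t - h) t2).
  have -> : m `^ q * ((b - (t - h)) / tau) - m `^ q * ((b - t) / tau) = m `^ q * (h / tau).
    by rewrite -diff mulrBr.
  move=> H.
  by rewrite mul1r -lerBlDl -mulrA [_^-1 * _]mulrC.
have rE : r = 1 by rewrite /r leNgt q1.
have WE (z : R) : 0 <= (b - z) / tau -> time_weight z = m * ((b - z) / tau).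
  by move=> z0; rewrite /time_weight -/r rE max_l// powRr1.
have dE : time_weight (t - h) - time_weight t = m * (h / tau).
  by rewrite (WE t t1) (WE (t - h) t2) -diff mulrBr.
have dm : m * (h / tau) <= m by rewrite ler_piMr ?(ltW m0)// ler_pdivrMr// mul1r.
rewrite dE in d0 *.
apply: (le_trans (powR_increment_convex (m := 2 * m) (ltW q1) y0 d0 _)).
  by rewrite mulrDl mul1r lerD.
rewrite lerD2l powRM ?(ltW m0)// le_eqVlt; apply/orP; left; apply/eqP.
have -> : m `^ q = m `^ (q - 1) * m.
  by rewrite powR_mul_pred// ltW.
move: (2 `^ (q - 1)) (m `^ (q - 1)) => A B.
have tn : tau != 0 by rewrite gt_eqF.
by field.
Qed.

End time_weight.

Section stationary_comparison.
Context {R : realType} (n : nat) (Omega : set 'rV[R]_n) (T p q M : R).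
Variables (u : 'rV[R]_n * R -> R) (s rho : R) (x0 : 'rV[R]_n).
Hypotheses (oO : open Omega) (bO : bounded_set Omega) (p1 : 1 < p) (q0 : 0 < q).
Hypothesis cu : forall z, cylinder Omega T z -> {for z, continuous u}.
Hypothesis uM : forall z, cylinder Omega T z -> 0 <= u z <= M.
Hypothesis Wu : weak_solution Omega T p q u.
Hypotheses (s0 : 0 < s) (rho0 : 0 < rho).
Hypothesis vanish : vanishes_on_lateral_boundary Omega (eball x0 (2 * rho)) s T p u.

Lemma stationary_comparison (b tau m c s1 : R) (S : 'rV[R]_n -> R) (F : 'I_n -> 'rV[R]_n -> R) :
  s <= s1 -> 0 < tau -> s1 < b - tau -> b < T -> 0 < m ->
  (forall x t, Omega x -> enorm (x - x0) < 2 * rho -> s1 < t < T -> u (x, t) <= m) ->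
  smooth S -> (forall x, 0 <= S x) -> (forall i, smooth (F i)) ->
  (forall x, Omega x -> 3 / 2 * rho <= enorm (x - x0) < 2 * rho -> m <= S x) ->
  (forall x, Omega x -> enorm (x - x0) < 2 * rho -> S x < m ->
     (forall i, F i x = flux p (grad S x) 0 i) /\
     \sum_i 'D_(basis_vec R i) (F i) x <= - c) ->
  time_weight_cst q * m `^ q / tau <= c ->
  forall x, Omega x -> enorm (x - x0) < 3 / 2 * rho -> u (x, b) <= S x.
Proof.
move=> ss1 tau0 s1b bT m0 um sS S0 sF Sm HF Kc x Ox xx0.
have [_ _ [Du [_ LDu WDu] weak]] := Wu.
pose s2 := Num.max s1 (b - 2 * tau).
have s2b : s2 < b - tau by rewrite gt_max s1b /=; lra.
have s1s2 : s1 <= s2 by rewrite le_max lexx.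
have s20 : 0 < s2 by exact: lt_le_trans s0 (le_trans ss1 s1s2).
have s2T t : s2 < t < T -> s1 < t < T by case/andP=> h ->; rewrite (le_lt_trans s1s2 h).
have tb : b - tau < b by rewrite gtrBl.
have bs : b - tau - s2 <= tau.
  have : b - 2 * tau <= s2 by rewrite le_max lexx orbT.
  by lra.
pose U := Omega `&` eball x0 (3 / 2 * rho).
have oU : open U by apply: openI => //; exact: open_eball.
have UO : U `<=` Omega by move=> y [].
have van : vanishes_on_lateral_boundary Omega (eball x0 (2 * rho)) s2 T p u.
  apply: (@filterS _ _ (ae_filter_ringOfSetsType _) _ _ _ vanish) => t Ht s2t; apply: Ht.
  by case/andP: s2t => h ->; rewrite (le_lt_trans (le_trans ss1 s1s2) h).
have r20 : 0 < 2 * rho by rewrite mulr_gt0.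
have r30 : 0 <= 3 / 2 * rho by rewrite mulr_ge0// ltW.
have [al alE] : exists al, al = (3 / 2 * rho) ^+ 2 by exists ((3 / 2 * rho) ^+ 2).
have al_lt : al < (2 * rho) ^+ 2 by rewrite alE !exprMn ltr_pM2r ?exprn_gt0//; lra.
pose zeta := cutoff x0 al ((al + (2 * rho) ^+ 2) / 2).
have tz : test_fun (eball x0 (2 * rho)) zeta by exact: test_fun_cutoff.
have zeta1 y : U y -> zeta y = 1.
  move=> [_ Hy]; apply: cutoff_eq1; first by lra.
  by rewrite sqdist_enorm alE ler_pXn2r ?nnegrE ?enorm_ge0// ltW.
have off y t : Omega y -> ~ U y -> s2 < t < T -> zeta y * u (y, t) <= S y.
  move=> Oy Uy s2t; have t1 := s2T t s2t.
  have Cy : cylinder Omega T (y, t).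
    by split=> //=; rewrite in_itv /=; case/andP: s2t => h ->; rewrite (lt_trans s20 h).
  have [y2|y2] := ltP (enorm (y - x0)) (2 * rho); last first.
    rewrite (_ : zeta y = 0) ?mul0r//; apply: cutoff_eq0; first by lra.
    rewrite sqdist_enorm (@le_trans _ _ ((2 * rho) ^+ 2))//; first by lra.
    by rewrite ler_pXn2r ?nnegrE ?enorm_ge0// ltW.
  have y3 : 3 / 2 * rho <= enorm (y - x0) by rewrite leNgt; apply/negP => h; apply: Uy; split.
  have /andP[u0 _] := uM Cy.
  apply: (@le_trans _ _ (u (y, t))); first by rewrite ler_piMl ?cutoff_le1.
  by apply: le_trans (um y t Oy y2 t1) _; apply: Sm => //; rewrite y3.
have U2 y : U y -> enorm (y - x0) < 2 * rho.
  by move=> [_ /= h]; apply: lt_trans h _; lra.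
have K0 : 0 <= time_weight_cst q * m `^ q / tau.
  by rewrite divr_ge0 ?(ltW tau0)// mulr_ge0 ?powR_ge0// ltW// time_weight_cst_gt0.
have umU y t : U y -> s2 < t < T -> u (y, t) <= m.
  by move=> Uy /s2T; apply: um; [exact: UO|exact: U2].
have := @comparison R n Omega T p q M u Du oO bO p1 q0 cu uM LDu weak s2 (b - tau) b m c
  (time_weight_cst q * m `^ q / tau) (eball x0 (2 * rho)) U zeta S (time_weight q m b tau) F
  s20 s2b tb bT WDu van tz oU UO zeta1 sS S0 (@continuous_time_weight _ q m b tau q0)
  (@time_weight_ge0 _ q m b tau m0) off umU (@ninc_time_weight _ q m b tau q0 m0 tau0) _ K0 Kc sF _ _ _ x _.
rewrite time_weight_end// addr0; apply.
- move=> t h y /andP[_ tb'] /andP[h0 hs] Wy ym; apply: time_weight_dec => //.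
  by rewrite h0 (le_trans (ltW hs)).
- by move=> y Uy Sy; case: (HF y (UO y Uy) (U2 y Uy) Sy).
- by move=> y Uy Sy; case: (HF y (UO y Uy) (U2 y Uy) Sy).
- by move=> y Uy; rewrite time_weight_start// lerDr.
- by split.
Qed.

End stationary_comparison.

(** * Radial supersolutions *)

Section radial.
Context {R : realType}.

Definition floored (A B s : R) : R := A + (s - A) * step ((B - A)^-1 * (s - A)).

Lemma smooth_floored A B : smooth (floored A B).
Proof.
have sA : smooth (fun s : R => s - A) by exact: (smoothB smooth_id (smooth_cst A)).
exact: (smoothD (smooth_cst A) (smoothM sA (smooth_comp smooth_step (smoothZ (B - A)^-1 sA)))).
Qed.

Lemma floored_id A B s : A < B -> B <= s -> floored A B s = s.
Proof.
move=> AB Bs; rewrite /floored step_ge1 ?mulr1 ?subrKC//.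
by rewrite ler_pdivlMl ?subr_gt0// mulr1 lerD2r.
Qed.

Lemma floored_ge A B s : A < B -> A <= floored A B s.
Proof.
move=> AB; rewrite /floored lerDl; have [sA|As] := leP s A.
  by rewrite step_le0 ?mulr0// mulr_ge0_le0 ?subr_le0// invr_ge0 subr_ge0 ltW.
by rewrite mulr_ge0 ?step_ge0// subr_ge0 ltW.
Qed.

Lemma is_derive_sqdist n (y x : 'rV[R]_n) i :
  is_derive x (basis_vec R i) (sqdist y) (2 * (x - y) 0 i).
Proof.
have dc j : is_derive x (basis_vec R i) (fun x : 'rV[R]_n => (x - y) 0 j) (j == i)%:R.
  have -> : (fun x : 'rV[R]_n => (x - y) 0 j) = (fun x => x 0 j - y 0 j).
    by apply/funext => z; rewrite !mxE.
  by apply: (is_derive_eq (is_deriveB (is_derive_coord j i x) (is_derive_cst (y 0 j) x _))); rewrite subr0.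
have -> : sqdist y = \sum_(j < n) (fun x : 'rV[R]_n => (x - y) 0 j * (x - y) 0 j).
  by apply/funext => z; rewrite fct_sumE.
apply: (is_derive_eq (is_derive_sum (fun j => is_deriveM_fun (dc j) (dc j)))).
rewrite (bigD1 i)//= big1 ?addr0; last by move=> j /negPf ->; rewrite mulr0 addr0.
by rewrite eqxx mulr1 mulr2n mulrDl mul1r.
Qed.

Lemma is_derive_sqdist_powR n (y x : 'rV[R]_n) i c : 0 < sqdist y x ->
  is_derive x (basis_vec R i) (fun x => sqdist y x `^ c)
    (c * sqdist y x `^ (c - 1) * (2 * (x - y) 0 i)).
Proof.
by move=> s0; exact: (is_derive_comp1 (is_derive_sqdist y x i) (is_derive_powR c s0)).
Qed.

Variables (n : nat) (p : R).
Hypothesis p1 : 1 < p.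

Definition radial_exponent : R := 1 + (n%:R + p) / (2 * (p - 1)).
Local Notation k := radial_exponent.

Definition flux_exponent : R := - (k + 1) * (p - 1) + (p - 2) / 2.
Local Notation e := flux_exponent.

Let p10 : 0 < p - 1. Proof. by rewrite subr_gt0. Qed.
Let p0 : 0 < p. Proof. exact: lt_trans p1. Qed.

Lemma radial_exponent_ge1 : 1 <= k.
Proof.
rewrite /radial_exponent lerDl; apply: divr_ge0; first by apply: addr_ge0; [exact: ler0n|exact: ltW].
by apply: mulr_ge0 => //; exact: ltW.
Qed.

Lemma flux_exponentE : 2 * e + n%:R = - (4 * p - 2).
Proof.
rewrite /flux_exponent /radial_exponent; have pn : p - 1 != 0 by rewrite gt_eqF.
by field.
Qed.

Lemma flux_exponent_lt0 : e < 0.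
Proof. by have := flux_exponentE; have := ler0n R n; move: p1; move: e (n%:R : R) => f N; lra. Qed.

Definition radial_cst : R := (2 * k) `^ (p - 1) * 4^-1 `^ (k * (p - 1)) * 9 `^ e.

Lemma radial_cst_gt0 : 0 < radial_cst.
Proof.
have k0 : 0 < k by exact: lt_le_trans ltr01 radial_exponent_ge1.
by rewrite /radial_cst !mulr_gt0 ?powR_gt0 ?mulr_gt0 ?invr_gt0.
Qed.

Section barrier.
Variables (Omega : set 'rV[R]_n) (y : 'rV[R]_n) (rad rad' a : R).
Hypotheses (oO : open Omega) (rad'0 : 0 < rad') (rad'rad : rad' < rad).
Hypotheses (rad2 : rad <= 2 * rad') (a0 : 0 < a).
Hypothesis ext : forall x, Omega x -> rad <= enorm (x - y).

Let A := rad' ^+ 2.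
Let B := rad ^+ 2.
Let A0 : 0 < A. Proof. by rewrite exprn_gt0. Qed.
Let rad0 : 0 < rad. Proof. exact: lt_trans rad'rad. Qed.
Let AB : A < B.
Proof. by rewrite ltr_pXn2r// nnegrE ltW. Qed.
Let k0 : 0 < k. Proof. exact: lt_le_trans ltr01 radial_exponent_ge1. Qed.

Definition barrier (x : 'rV[R]_n) : R :=
  a - a * A `^ k * floored A B (sqdist y x) `^ (- k).

Definition barrier_flux (i : 'I_n) (x : 'rV[R]_n) : R :=
  (2 * a * k * A `^ k) `^ (p - 1) * (floored A B (sqdist y x) `^ e * (x - y) 0 i).

Let floored_gt0 x : 0 < floored A B (sqdist y x).
Proof. exact: lt_le_trans A0 (floored_ge _ AB). Qed.

Let smooth_fs : smooth (fun x => floored A B (sqdist y x)).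
Proof. exact: (smooth_comp (smooth_floored A B) (smooth_sqdist y)). Qed.

Lemma smooth_barrier : smooth barrier.
Proof.
exact: (smoothB (smooth_cst a) (smoothZ (a * A `^ k) (smooth_powR (- k) floored_gt0 smooth_fs))).
Qed.

Lemma smooth_barrier_flux i : smooth (barrier_flux i).
Proof.
apply: smoothZ; apply: smoothM; first exact: (smooth_powR e floored_gt0 smooth_fs).
have -> : (fun x : 'rV[R]_n => (x - y) 0 i) = (fun x => x 0 i - y 0 i).
  by apply/funext => z; rewrite !mxE.
exact: (smoothB (smooth_coord i) (smooth_cst (y 0 i))).
Qed.

Lemma barrier_ge0 x : 0 <= barrier x.
Proof.
rewrite /barrier subr_ge0 -mulrA ler_piMr ?(ltW a0)// powRN ler_pdivrMr ?powR_gt0// mul1r.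
by apply: (ge0_ler_powR (ltW k0)); rewrite ?nnegrE ?(ltW A0) ?(ltW (floored_gt0 x))// floored_ge.
Qed.

Let sq_ge x : Omega x -> B <= sqdist y x.
Proof. by move=> Ox; rewrite sqdist_enorm ler_pXn2r ?nnegrE ?enorm_ge0 ?(ltW rad0)// ext. Qed.

Let sq_gt0 x : Omega x -> 0 < sqdist y x.
Proof. by move=> Ox; apply: lt_le_trans (sq_ge Ox); exact: lt_trans AB. Qed.

Let nearO x (f : R -> 'rV[R]_n -> R) : Omega x ->
  {near x, (fun x => f (sqdist y x) x) =1 (fun x => f (floored A B (sqdist y x)) x)}.
Proof.
move=> Ox; have : \forall z \near x, Omega z by apply: open_nbhs_nbhs; split.
by apply: filterS => z Oz; rewrite floored_id// sq_ge.
Qed.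

Lemma barrierE x : Omega x -> barrier x = a * (1 - (rad' / enorm (x - y)) `^ (2 * k)).
Proof.
move=> Ox; rewrite /barrier floored_id ?sq_ge// sqdist_enorm.
have d0 : 0 < enorm (x - y) by apply: lt_le_trans rad0 (ext Ox).
have sqp (z : R) : 0 <= z -> (z ^+ 2) `^ k = z `^ (2 * k).
  by move=> z0; rewrite -powR_mulrn// -powRrM.
rewrite powRN sqp ?(ltW d0)// /A sqp ?(ltW rad'0)// powRM ?invr_ge0 ?(ltW rad'0) ?(ltW d0)//.
have -> : (enorm (x - y))^-1 `^ (2 * k) = (enorm (x - y) `^ (2 * k))^-1.
  by rewrite -powR_inv1 ?(ltW d0)// -powRrM mulN1r powRN.
by rewrite mulrBr mulr1 mulrA.
Qed.

Lemma grad_barrier x : Omega x ->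
  grad barrier x = (2 * a * k * A `^ k * sqdist y x `^ (- k - 1)) *: (x - y).
Proof.
move=> Ox; apply/rowP => i; rewrite mxE [RHS]mxE.
have D1 : is_derive x (basis_vec R i) (fun x => a - a * A `^ k * sqdist y x `^ (- k))
    (0 - a * A `^ k *: (- k * sqdist y x `^ (- k - 1) * (2 * (x - y) 0 i))).
  apply: is_deriveB; apply: is_deriveZ; exact: (is_derive_sqdist_powR i (- k) (sq_gt0 Ox)).
have [_ ->] := near_eq_is_derive (nearO (fun s _ => a - a * A `^ k * s `^ (- k)) Ox) D1.
by rewrite sub0r /GRing.scale /=; ring.
Qed.

Lemma barrier_fluxE x i : Omega x -> barrier_flux i x = flux p (grad barrier x) 0 i.
Proof.
move=> Ox; rewrite /barrier_flux floored_id ?sq_ge// (grad_barrier Ox).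
set G := 2 * a * k * A `^ k; have G0 : 0 < G by rewrite !mulr_gt0 ?powR_gt0.
have s0 := sq_gt0 Ox; set s := sqdist y x in s0 *.
have dE : enorm (x - y) = s `^ (2^-1).
  rewrite /s sqdist_enorm -powR_mulrn ?enorm_ge0// -powRrM divff ?powRr1 ?enorm_ge0//.
have nE : enorm ((G * s `^ (- k - 1)) *: (x - y)) = G * s `^ (- k - 1) * s `^ 2^-1.
  rewrite enormZ ger0_norm; last by rewrite mulr_ge0 ?powR_ge0 ?(ltW G0).
  by congr (_ * _); exact: dE.
rewrite /flux nE -mulrA -powRD; last first.
  by rewrite (gt_eqF s0) implybT.
rewrite powRM ?(ltW G0) ?powR_ge0// -powRrM scalerA [RHS]mxE.
have -> : G `^ (p - 1) = G `^ (p - 2) * G.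
  by rewrite -(powR_mul_pred (ltW G0) p10); congr (_ `^ _ * _); lra.
have -> : s `^ e = s `^ ((- k - 1 + 2^-1) * (p - 2)) * s `^ (- k - 1).
  rewrite -powRD; last by rewrite (gt_eqF s0) implybT.
  by congr (_ `^ _); rewrite /flux_exponent; move: k => K; field.
by move: (s `^ _) (s `^ _) (G `^ _) (fun_of_matrix _ _ _) => *; ring.
Qed.

Lemma barrier_flux_divergence x : Omega x -> enorm (x - y) <= 3 * rad ->
  \sum_i 'D_(basis_vec R i) (barrier_flux i) x <= - (radial_cst * a `^ (p - 1) * rad `^ (- p)).
Proof.
move=> Ox xy3; have s0 := sq_gt0 Ox; set s := sqdist y x in s0 *.
set C := (2 * a * k * A `^ k) `^ (p - 1).
have D i : 'D_(basis_vec R i) (barrier_flux i) x =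
    C * (s `^ e) + 2 * e * C * s `^ (e - 1) * ((x - y) 0 i * (x - y) 0 i).
  have dc : is_derive x (basis_vec R i) (fun x : 'rV[R]_n => (x - y) 0 i) 1.
    have -> : (fun x : 'rV[R]_n => (x - y) 0 i) = (fun x => x 0 i - y 0 i).
      by apply/funext => z; rewrite !mxE.
    by apply: (is_derive_eq (is_deriveB (is_derive_coord i i x) (is_derive_cst (y 0 i) x _))); rewrite subr0 eqxx.
  have D1 := is_deriveZ C (is_deriveM_fun (is_derive_sqdist_powR i e s0) dc).
  have [_ ->] := near_eq_is_derive (nearO (fun s x => C * (s `^ e * (x - y) 0 i)) Ox) D1.
  by rewrite /GRing.scale /= -/s; ring.
under eq_bigr do rewrite D.
rewrite big_split /= sumr_const card_ord -mulr_sumr -/(dotp (x - y) (x - y)) -/(sqdist y x) -/s.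
have -> : C * s `^ e *+ n + 2 * e * C * s `^ (e - 1) * s = C * s `^ e * (2 * e + n%:R).
  have -> : s `^ e = s `^ (e - 1) * s.
    by rewrite -[X in _ * X]powRr1 ?(ltW s0)// -powRD ?subrK// (gt_eqF s0) implybT.
  by rewrite -mulr_natr; ring.
rewrite flux_exponentE mulrN lerN2.
have C0 : 0 <= C * s `^ e by rewrite mulr_ge0 ?powR_ge0.
apply: (@le_trans _ _ (C * s `^ e)); last by rewrite ler_peMr//; move: p1; lra.
have rn : rad != 0 by rewrite gt_eqF.
have sle : (9 * rad ^+ 2) `^ e <= s `^ e.
  have e0 := flux_exponent_lt0.
  rewrite -[e]opprK !(powRN _ (- e)) lef_pV2 ?posrE ?powR_gt0//; last first.
    by rewrite mulr_gt0 ?exprn_gt0.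
  have ne0 : 0 <= - e by rewrite oppr_ge0 ltW.
  apply: (ge0_ler_powR ne0); rewrite ?nnegrE ?(ltW s0)//; first by rewrite mulr_ge0 ?exprn_ge0// ltW.
  rewrite /s sqdist_enorm (_ : 9 * rad ^+ 2 = (3 * rad) ^+ 2); last by ring.
  by rewrite ler_pXn2r ?nnegrE ?enorm_ge0// mulr_ge0// ltW.
have Cge : (2 * k) `^ (p - 1) * a `^ (p - 1) * (4^-1 `^ (k * (p - 1)) * rad `^ (2 * (k * (p - 1)))) <= C.
  have -> : C = (2 * k) `^ (p - 1) * a `^ (p - 1) * A `^ (k * (p - 1)).
    rewrite /C (_ : 2 * a * k * A `^ k = 2 * k * a * A `^ k); last by ring.
    have k20 : 0 <= 2 * k by rewrite mulr_ge0// ltW.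
    rewrite (powRM _ (mulr_ge0 k20 (ltW a0)) (powR_ge0 A k)) (powRM _ k20 (ltW a0)).
    by rewrite -powRrM.
  rewrite ler_wpM2l ?mulr_ge0 ?powR_ge0//.
  have -> : rad `^ (2 * (k * (p - 1))) = (rad ^+ 2) `^ (k * (p - 1)).
    by rewrite powRrM powR_mulrn// ltW.
  rewrite -powRM ?invr_ge0 ?exprn_ge0 ?(ltW rad0)//.
  have kp : 0 <= k * (p - 1) by rewrite mulr_ge0 ?(ltW k0) ?(ltW p10).
  apply: (ge0_ler_powR kp); rewrite ?nnegrE ?(ltW A0) ?mulr_ge0 ?invr_ge0 ?exprn_ge0 ?(ltW rad0)//.
  rewrite /A ler_pdivrMl// (_ : 4 * rad' ^+ 2 = (2 * rad') ^+ 2); last by ring.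
  by rewrite ler_pXn2r ?nnegrE ?mulr_ge0 ?(ltW rad0) ?(ltW rad'0).
apply: (@le_trans _ _ ((2 * k) `^ (p - 1) * a `^ (p - 1) *
    (4^-1 `^ (k * (p - 1)) * rad `^ (2 * (k * (p - 1)))) * (9 * rad ^+ 2) `^ e)); last first.
  by apply: ler_pM => //; rewrite ?mulr_ge0 ?powR_ge0.
have -> : rad `^ (- p) = rad `^ (2 * (k * (p - 1))) * (rad ^+ 2) `^ e.
  rewrite -(powR_mulrn _ (ltW rad0)) -powRrM -powRD; last by rewrite (negPf rn) implybT.
  by congr (_ `^ _); rewrite /flux_exponent; move: k => K; field.
rewrite /radial_cst (@powRM _ 9 (rad ^+ 2)) ?exprn_ge0 ?(ltW rad0)// le_eqVlt; apply/orP; left; apply/eqP.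
by ring.
Qed.

End barrier.
End radial.

(** * Geometry of domains of class [C^{1,1}] *)

Section exterior_ball.
Context {R : realType}.

Lemma derive_grad n (phi : 'rV[R]_n -> R) (z v : 'rV[R]_n) :
  differentiable phi z -> 'D_v phi z = dotp (grad phi z) v.
Proof.
move=> dphi; rewrite deriveE// [in LHS](basis_decomp v) linear_sum /dotp.
by apply: eq_bigr => i _; rewrite linearZ /= mxE deriveE// mulrC.
Qed.

Lemma C11_mvt n (phi : 'rV[R]_n -> R) r L (z : 'rV[R]_n) :
  C11_norm_le r L phi -> enorm z < r ->
  exists2 t : R, 0 <= t <= 1 & phi z - phi 0 = dotp (grad phi (t *: z)) z.
Proof.
move=> nphi zr.
have tr (t : R) : 0 <= t <= 1 -> enorm (t *: z) < r.
  move=> /andP[t0 t1]; rewrite enormZ ger0_norm//; apply: le_lt_trans zr.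
  by rewrite ler_piMl ?enorm_ge0.
have dg (t : R) : 0 <= t <= 1 ->
    is_derive t 1 (fun t : R => phi (t *: z)) (dotp (grad phi (t *: z)) z).
  move=> t01; have [dphi _ _ _] := nphi _ (tr t t01).
  apply: (is_derive_precomp (A := fun t : R => t *: z) (w := z)).
    by move=> h; rewrite -scalerDl [h *: 1]mulr1.
  by apply: DeriveDef; [exact: diff_derivable|exact: derive_grad].
have der (t : R) : t \in `]0, 1[%R ->
    is_derive t 1 (fun t : R => phi (t *: z)) (dotp (grad phi (t *: z)) z).
  by rewrite in_itv /= => /andP[t0 t1]; apply: dg; rewrite !ltW.
have cont : {within `[0, 1 : R], continuous (fun t : R => phi (t *: z))}.
  apply: derivable_within_continuous => t; rewrite in_itv /= => t01.
  by have [] := dg t t01.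
have [t] := MVT_segment ler01 der cont.
by rewrite in_itv /= => t01; rewrite scale1r scale0r subr0 mulr1; exists t.
Qed.

Definition up_vec n (g : 'rV[R]_n) : 'rV[R]_n.+1 :=
  \row_i (if unlift ord_max i is Some j then - g 0 j else 1).

Lemma dotp_up_vec n (g : 'rV[R]_n) (z : 'rV[R]_n.+1) :
  dotp z (up_vec g) = z 0 ord_max - dotp g (init_rV z).
Proof.
rewrite /dotp big_ord_recr /= mxE unlift_none mulr1 addrC; congr (_ + _).
rewrite -sumrN; apply: eq_bigr => i _; rewrite !mxE.
have <- : lift ord_max i = widen_ord (leqnSn n) i.
  by apply: ord_inj; exact: lift_max.
by rewrite liftK mulrN mulrC.
Qed.

Lemma dotp_up_vec_self n (g : 'rV[R]_n) : dotp (up_vec g) (up_vec g) = 1 + dotp g g.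
Proof.
rewrite dotp_up_vec mxE unlift_none; congr (_ + _).
rewrite -sumrN; apply: eq_bigr => i _; rewrite !mxE liftK; ring.
Qed.

Lemma boundary_notin n (Omega : set 'rV[R]_n) y : open Omega -> boundary Omega y -> ~ Omega y.
Proof. by move=> oO [_ +] Oy; apply; move: oO; rewrite openE; exact. Qed.

Lemma boundary_near n (Omega : set 'rV[R]_n) y d : boundary Omega y -> 0 < d ->
  exists2 x, Omega x & enorm (x - y) < d.
Proof.
move=> [cl _] d0; have [|x [Ox xy]] := cl (eball y d).
  apply: open_nbhs_nbhs; split; first exact: open_eball.
  by rewrite /eball /= subrr enorm0.
by exists x.
Qed.

Let exterior_ball_arith (k R0 L a b zz zw : R) : 0 < R0 -> 1 <= k -> 0 <= a ->
  0 <= b -> zz = a + b -> 2 * R0 * L <= 1 -> - (L * a) <= zw ->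
  zz + R0 / k * zw + (R0 / k * zw + R0 ^+ 2) < R0 ^+ 2 -> False.
Proof.
move=> R0gt k1 a0 b0 -> R0L h8 h6; have k0 : 0 < k by lra.
have h7 : k * (a + b) + 2 * R0 * zw < 0.
  have : k * (a + b + R0 / k * zw + (R0 / k * zw + R0 ^+ 2)) < k * R0 ^+ 2.
    by rewrite ltr_pM2l.
  have -> : k * (a + b + R0 / k * zw + (R0 / k * zw + R0 ^+ 2)) =
     k * (a + b) + 2 * R0 * zw + k * R0 ^+ 2 by field; rewrite gt_eqF.
  lra.
have i5 : a + b <= k * (a + b) by rewrite ler_peMl// addr_ge0.
have i6 : 2 * R0 * - (L * a) <= 2 * R0 * zw by rewrite ler_wpM2l//; lra.
have i7 : 2 * R0 * L * a <= a by rewrite ler_piMl.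
have i8 : 2 * R0 * - (L * a) = - (2 * R0 * L * a) by ring.
lra.
Qed.

Lemma exterior_ball n (Omega : set 'rV[R]_n.+1) y r L R0 :
  open Omega -> boundary Omega y -> C11_chart Omega y r L ->
  0 < R0 -> 2 * R0 <= r -> 2 * R0 * L <= 1 ->
  exists c, enorm (c - y) = R0 /\ forall x, Omega x -> R0 <= enorm (x - c).
Proof.
move=> oO By [U [phi [UU nphi Hphi]]] R0gt R0r R0L.
have r0 : 0 < r by lra.
have UtU : U^T *m U = 1%:M by exact: mulmx1C.
have e0r : enorm (0 : 'rV[R]_n) < r by rewrite enorm0.
have [_ _ g0L Lip] := nphi 0 e0r.
have L0 : 0 <= L by exact: le_trans (enorm_ge0 _) g0L.
pose co (x : 'rV[R]_n.+1) := (x - y) *m U^T.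
have coK x : y + co x *m U = x by rewrite /co -mulmxA UtU mulmx1 subrKC.
have nco x : enorm (co x) = enorm (x - y) by rewrite enorm_orthogonal// trmxK.
have init0 : init_rV (0 : 'rV[R]_n.+1) = 0 by apply/rowP => j; rewrite !mxE.
have phi0 : phi 0 = 0.
  apply/eqP; rewrite eq_le; apply/andP; split; last first.
    rewrite leNgt; apply/negP => phi0; apply: (boundary_notin oO By).
    have := Hphi 0; rewrite enorm0 => /(_ r0)[_].
    by rewrite mul0mx addr0 init0 mxE; apply.
  apply/ler_addgt0Pr => e e0; rewrite add0r.
  pose d := Num.min (r / 2) (e / (L + 1)).
  have L1 : 0 < L + 1 by lra.
  have d0 : 0 < d by rewrite lt_min !divr_gt0.
  have dr : d < r by rewrite gt_min; apply/orP; left; lra.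
  have dL : (L + 1) * d <= e by rewrite mulrC -ler_pdivlMr// ge_min lexx orbT.
  have [x Ox xd] := boundary_near By d0.
  have xr : enorm (co x) < r by rewrite nco; exact: lt_trans dr.
  have := (Hphi (co x) xr).1; rewrite coK => /(_ Ox) h1.
  have ir : enorm (init_rV (co x)) < r by exact: le_lt_trans (enorm_lift_max _) xr.
  have [t /andP[t0 t1] E] := C11_mvt nphi ir.
  have itr : enorm (t *: init_rV (co x)) < r.
    by rewrite enormZ ger0_norm//; apply: le_lt_trans ir; rewrite ler_piMl ?enorm_ge0.
  have [_ _ gL _] := nphi _ itr.
  have h2 := dotp_ge (grad phi (t *: init_rV (co x))) (init_rV (co x)).
  have h3 : enorm (grad phi (t *: init_rV (co x))) * enorm (init_rV (co x)) <= L * d.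
    apply: ler_pM; rewrite ?enorm_ge0//.
    by apply: le_trans (enorm_lift_max _) _; rewrite nco ltW.
  have h4 := le_enorm_last (co x); have h5 := ler_norm (co x 0 ord_max).
  rewrite nco in h4; rewrite -E in h2; lra.
pose g := grad phi 0; pose w := up_vec g.
have ww : dotp w w = 1 + enorm g ^+ 2.
  by rewrite enorm_sqr; exact: dotp_up_vec_self.
pose k := enorm w.
have kk : k ^+ 2 = 1 + enorm g ^+ 2 by rewrite -ww; exact: enorm_sqr.
have k1 : 1 <= k.
  by rewrite -(@ler_pXn2r _ 2)// ?nnegrE ?enorm_ge0// kk expr1n lerDl sqr_ge0.
have k0 : 0 < k by lra.
pose v := (R0 / k) *: w *m U.
have nv : enorm v = R0.
  by rewrite enorm_orthogonal// enormZ ger0_norm ?divr_ge0 ?ltW// -/k divfK ?gt_eqF.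
exists (y - v); split; first by rewrite addrAC subrr sub0r enormN.
move=> x Ox; rewrite leNgt; apply/negP => xc.
have xyr : enorm (co x) < r.
  rewrite nco (_ : x - y = (x - (y - v)) - v); last by rewrite opprB [v - y]addrC addrA addrK.
  by apply: le_lt_trans (enormD _ _) _; rewrite enormN nv; lra.
have := (Hphi (co x) xyr).1; rewrite coK => /(_ Ox) h1.
set z := co x in xyr h1.
have ir : enorm (init_rV z) < r by exact: le_lt_trans (enorm_lift_max _) xyr.
have [t /andP[t0 t1]] := C11_mvt nphi ir; rewrite phi0 subr0 => E.
have itr : enorm (t *: init_rV z) < r.
  by rewrite enormZ ger0_norm//; apply: le_lt_trans ir; rewrite ler_piMl ?enorm_ge0.
have := Lip _ itr; rewrite sub0r enormN enormZ ger0_norm// => Lz.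
have h2 := dotp_ge (grad phi (t *: init_rV z) - g) (init_rV z).
have iz := enorm_ge0 (init_rV z).
have h3 : enorm (grad phi (t *: init_rV z) - g) * enorm (init_rV z) <=
    L * enorm (init_rV z) ^+ 2.
  rewrite expr2 mulrA; apply: ler_wpM2r => //.
  rewrite enormB; apply: (le_trans Lz); rewrite ler_wpM2l//.
  by rewrite ler_piMl.
rewrite dotpBl -E in h2.
have zw : dotp z w = z 0 ord_max - dotp g (init_rV z) by exact: dotp_up_vec.
have zz := dotp_lift_max z.
have : enorm (z + (R0 / k) *: w) < R0.
  have Exc : (z + (R0 / k) *: w) *m U = x - (y - v).
    by rewrite mulmxDl /z /co -mulmxA UtU mulmx1 -/v opprB addrCA addrC.
  by rewrite -(enorm_orthogonal _ UU) Exc.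
rewrite -(@ltr_pXn2r _ 2)// ?nnegrE ?enorm_ge0 ?(ltW R0gt)// enorm_sqr.
rewrite dotpDl !dotpDr !dotpZl !dotpZr (dotpC w z) -[dotp w w]enorm_sqr -/k.
have -> : R0 / k * (R0 / k * k ^+ 2) = R0 ^+ 2 by field; rewrite gt_eqF.
have h8 : - (L * enorm (init_rV z) ^+ 2) <= dotp z w.
  rewrite zw; apply: (@le_trans _ _ (phi (init_rV z) - dotp g (init_rV z))).
    by apply: le_trans h2; rewrite lerN2.
  by rewrite lerD2r ltW.
exact: exterior_ball_arith R0gt k1 (sqr_ge0 _) (sqr_ge0 _) zz R0L h8.
Qed.

End exterior_ball.

Section boundary_slices.
Context {R : realType}.

Lemma closure_continuous_image (T1 T2 : topologicalType) (f : T1 -> T2) (A : set T1) (B : set T2) x :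
  continuous f -> (forall y, A y -> B (f y)) -> closure A x -> closure B (f x).
Proof.
move=> cf AB cA V /(cf x) Vx; have [y [Ay Vy]] := cA _ Vx.
by exists (f y); split; [exact: AB|exact: Vy].
Qed.

Lemma boundary_on_line n (Omega : set 'rV[R]_n) (x v : 'rV[R]_n) :
  open Omega -> bounded_set Omega -> Omega x -> v != 0 ->
  exists t : R, boundary Omega (x + t *: v).
Proof.
move=> oO bO Ox v0; pose h (t : R) : 'rV[R]_n := x + t *: v; pose A := h @^-1` Omega.
have ch : continuous h.
  by move=> t; apply: cvgD; [exact: cvg_cst|apply: cvgZl; exact: cvg_id].
have A0 : A 0 by rewrite /A /h /= scale0r addr0.
have [j vj] : exists j, v 0 j != 0.
  apply/existsP; apply: contraNT v0; rewrite negb_exists => /forallP H.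
  by apply/eqP/rowP => j; rewrite mxE; apply/eqP; have := H j; rewrite negbK.
have [C [C0 HC]] := bounded_set_cube bO.
have Aub : has_ubound A.
  exists ((C + `|x 0 j|) / `|v 0 j|) => t At; rewrite ler_pdivlMr ?normr_gt0//.
  have := HC _ At j; rewrite /h !mxE => H.
  apply: (@le_trans _ _ `|t * v 0 j|); first by rewrite normrM ler_wpM2r// ler_norm.
  have -> : t * v 0 j = (x 0 j + t * v 0 j) - x 0 j by rewrite addrAC subrr add0r.
  by apply: (le_trans (ler_normB _ _)); rewrite lerD2r.
have oA : open A by apply: open_comp => // t _; exact: ch.
have cA : closure A (sup A) by apply: closure_sup => //; exists 0.
exists (sup A); split; first exact: (closure_continuous_image ch (A := A)).
move=> iO; have {iO} AsA : A (sup A) by exact: interior_subset iO.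
have : nbhs (sup A) A by apply: open_nbhs_nbhs.
move=> /nbhs_ballP[e /= e0 He].
have : A (sup A + e / 2).
  apply: He; rewrite /ball /= opprD addrA subrr sub0r normrN ger0_norm ?divr_ge0 ?(ltW e0)//.
  by rewrite gtr_pMr// invf_lt1// ltr1n.
by move=> /(ub_le_sup Aub); rewrite gerDl leNgt divr_gt0.
Qed.

Lemma coord_range n (Omega : set 'rV[R]_n) (x x' : 'rV[R]_n) i (c : R) :
  connected Omega -> Omega x -> Omega x' -> x 0 i <= c <= x' 0 i ->
  exists2 z, Omega z & z 0 i = c.
Proof.
move=> cO Ox Ox' xcx; pose f (z : 'rV[R]_n) : R := z 0 i.
have cf : {within Omega, continuous f}.
  by apply: continuous_subspaceT; exact: (@coord_continuous R).
have /connected_intervalP ifO := connected_continuous_connected cO cf.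
have [z Oz <-] : (f @` Omega) c by apply: (ifO (x 0 i) (x' 0 i)) => //; [exists x|exists x'].
by exists z.
Qed.

Lemma itv_cover_le (k : nat) (r a b : R) (y : 'I_k -> R) : 0 < r -> a <= b ->
  (forall c, a <= c <= b -> exists l, `|c - y l| < r) -> b - a <= k%:R * (2 * r).
Proof.
move=> r0 ab H; pose leb := @lebesgue_measure R.
have mI l : measurable (`]y l - r, y l + r[%classic : set (measurableTypeR R)) by exact: measurable_itv.
pose A (i : nat) : set (measurableTypeR R) :=
  if insub i is Some l then `]y l - r, y l + r[%classic else set0.
have AE (l : 'I_k) : A l = `]y l - r, y l + r[%classic by rewrite /A valK.
have sub : (`[a, b]%classic : set (measurableTypeR R)) `<=` \big[setU/set0]_(l < k) A l.
  move=> c /=; rewrite in_itv /= => /H[l cl].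
  by rewrite (bigD1 l)//=; left; rewrite AE /= in_itv /= -ltr_distl.
have le1 : (leb `[a, b]%classic <= \sum_(l < k) leb (A l))%E.
  refine (content_subadditive leb _ _ sub); last exact: measurable_itv.
  by move=> i ik; rewrite /A; case: insub => [l|]; [exact: mI|exact: measurable0].
have eab : leb `[a, b]%classic = (b - a)%:E.
  rewrite /leb lebesgue_measure_itv /= lte_fin; case: ltP => // ba.
  by have -> : b = a by [apply/le_anti; rewrite ba ab]; rewrite subrr.
have el l : leb `]y l - r, y l + r[%classic = (2 * r)%:E.
  rewrite /leb lebesgue_measure_itv /= lte_fin ifT; last by rewrite ltrD2l gtrN.
  by rewrite -EFinB; congr _%:E; ring.
move: le1; rewrite eab; under eq_bigr do rewrite AE el.
by rewrite sumEFin lee_fin sumr_const card_ord (mulr_natl (2 * r) k).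
Qed.

Lemma coord_width n (Omega : set 'rV[R]_n.+2) k r (y : 'I_k -> 'rV[R]_n.+2) x x' i :
  bounded_domain Omega -> 0 < r -> boundary Omega `<=` \bigcup_l eball (y l) r ->
  Omega x -> Omega x' -> `|x 0 i - x' 0 i| <= k%:R * (2 * r).
Proof.
move=> [oO cO _ bO] r0 cover Ox Ox'.
wlog xx : x x' Ox Ox' / x 0 i <= x' 0 i.
  have [xx|/ltW xx] := leP (x 0 i) (x' 0 i); first exact.
  by rewrite distrC; apply.
rewrite distrC ger0_norm ?subr_ge0//; apply: (itv_cover_le (y := fun l => y l 0 i)) => // c cab.
have [z Oz zc] := coord_range cO Ox Ox' cab.
pose j := if i == ord0 then lift ord0 ord0 else ord0 : 'I_n.+2.
have ji : j != i by rewrite /j; have [->|] := eqVneq i ord0; rewrite // eq_sym.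
have v0 : basis_vec R j != 0.
  by apply/eqP => /rowP/(_ j)/eqP; rewrite !mxE !eqxx oner_eq0.
have [t /cover[l _ Hl]] := boundary_on_line oO bO Oz v0.
exists l; apply: le_lt_trans Hl; apply: le_trans (coord_le_enorm _ i).
have ij : (i == j) = false by rewrite eq_sym; exact: negPf.
by rewrite !mxE ij andbF mulr0 addr0 zc.
Qed.

Lemma enorm_le_coords n (x : 'rV[R]_n) (D : R) : (forall i, `|x 0 i| <= D) ->
  enorm x <= n%:R * D.
Proof.
move=> xD; apply: (@le_trans _ _ (\sum_i `|x 0 i|)); last first.
  by apply: (le_trans (ler_sum _ (fun i _ => xD i))); rewrite sumr_const card_ord mulr_natl.
have -> : x = \sum_i x 0 i *: basis_vec R i by exact: basis_decomp.
have -> : \sum_i `|(\sum_i0 x 0 i0 *: basis_vec R i0) 0 i| = \sum_i `|x 0 i|.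
  by apply: eq_bigr => i _; rewrite -basis_decomp.
elim: (index_enum _) => [|i l IH]; first by rewrite !big_nil enorm0.
rewrite !big_cons; apply: (le_trans (enormD _ _)); apply: lerD => //.
rewrite enormZ ler_piMr//.
rewrite /enorm /dotp (bigD1 i)//= big1 ?addr0; last by move=> j /negPf ji; rewrite !mxE eqxx ji mulr0.
by rewrite !mxE !eqxx mulr1 sqrtr1.
Qed.

Lemma domain_width n (Omega : set 'rV[R]_n.+2) k r (y : 'I_k -> 'rV[R]_n.+2) x0 x :
  bounded_domain Omega -> 0 < r -> boundary Omega `<=` \bigcup_l eball (y l) r ->
  boundary Omega x0 -> Omega x -> enorm (x - x0) <= n.+2%:R * (k%:R * (2 * r)).
Proof.
move=> bd r0 cover Bx0 Ox; rewrite leNgt; apply/negP => lt.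
have d0 : 0 < enorm (x - x0) - n.+2%:R * (k%:R * (2 * r)) by rewrite subr_gt0.
have [x' Ox' x'd] := boundary_near Bx0 d0.
have H : enorm (x - x') <= n.+2%:R * (k%:R * (2 * r)).
  by apply: enorm_le_coords => i; rewrite !mxE; exact: (coord_width i bd r0 cover Ox Ox').
have := enormD (x - x') (x' - x0); rewrite addrA subrK => H2.
by move: x'd H H2; move: (enorm _) (enorm _) (enorm _) (_ * _) => *; lra.
Qed.

Lemma exterior_ball1 (Omega : set 'rV[R]_1) y (R0 : R) : bounded_domain Omega ->
  boundary Omega y -> 0 < R0 ->
  exists c, enorm (c - y) = R0 /\ forall x, Omega x -> R0 <= enorm (x - c).
Proof.
move=> [oO cO [z Oz] _] By R00; have nOy := boundary_notin oO By.
have e1 (x : 'rV[R]_1) : enorm x = `|x 0 0|.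
  by rewrite /enorm /dotp big_ord1 -expr2 sqrtr_sqr.
have neq x : Omega x -> x 0 0 != y 0 0.
  move=> Ox; apply/eqP => xy; apply: nOy; suff <- : x = y by [].
  by apply/rowP => i; rewrite ord1.
have side x x' : Omega x -> Omega x' -> x 0 0 < y 0 0 -> x' 0 0 < y 0 0.
  move=> Ox Ox' xy; rewrite ltNge; apply/negP => yx'.
  have [w Ow wy] : exists2 w, Omega w & w 0 0 = y 0 0.
    by apply: (coord_range cO Ox Ox'); rewrite yx' ltW.
  by move: (neq w Ow); rewrite wy eqxx.
have [zy|zy] := leP (y 0 0) (z 0 0).
- exists (y - const_mx R0); split.
    by rewrite e1 !mxE addrAC subrr sub0r normrN ger0_norm ?ltW.
  move=> x Ox; rewrite e1 !mxE.
  have yx : y 0 0 <= x 0 0.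
    by rewrite leNgt; apply/negP => /(side x z Ox Oz); rewrite ltNge zy.
  apply: le_trans (ler_norm _); move: yx; move: (x 0 0) (y 0 0) => *; lra.
- exists (y + const_mx R0); split.
    by rewrite e1 !mxE addrAC subrr add0r ger0_norm ?ltW.
  move=> x Ox; rewrite e1 !mxE; have xy := side z x Oz Ox zy.
  rewrite -normrN; apply: le_trans (ler_norm _); move: xy; move: (x 0 0) (y 0 0) => *; lra.
Qed.

Lemma exterior_ball_line n (Omega : set 'rV[R]_n.+1) y (R0 : R) : n = 0%N ->
  bounded_domain Omega -> boundary Omega y -> 0 < R0 ->
  exists c, enorm (c - y) = R0 /\ forall x, Omega x -> R0 <= enorm (x - c).
Proof. by move=> n0; subst n; exact: exterior_ball1. Qed.

End boundary_slices.


(** * Boundary decay and extinction *)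

Section real_lemmas.
Context {R : realType}.

Lemma one_minus_powR_le (r x : R) : 1 <= r -> 0 < x <= 1 -> 1 - x `^ r <= r * (1 - x).
Proof.
move=> r1 /andP[x0 x1]; have d0 : 0 <= 1 - x by rewrite subr_ge0.
have := powR_increment_convex (m := 1) r1 x0 d0; rewrite subrKC powR1 lexx mulr1.
by move=> /(_ isT); rewrite lerBlDl.
Qed.

Lemma le_of_shrinking_radius (u K d rad : R) : 0 <= u -> 0 <= K -> 0 < rad ->
  (forall rad', rad / 2 <= rad' < rad -> u * rad' <= K * (d + rad - rad')) ->
  u * rad <= K * d.
Proof.
move=> u0 K0 rad0 H; rewrite leNgt; apply/negP => lt.
have D0 : 0 < u * rad - K * d by rewrite subr_gt0.
have s0 : 0 < 2 * (u + K + 1) by lra.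
pose eta := Num.min (rad / 2) ((u * rad - K * d) / (2 * (u + K + 1))).
have eta0 : 0 < eta by rewrite lt_min !divr_gt0.
have eta1 : eta <= rad / 2 by rewrite ge_min lexx.
have eta2 : eta * (2 * (u + K + 1)) <= u * rad - K * d.
  by rewrite -ler_pdivlMr// ge_min lexx orbT.
have /H : rad / 2 <= rad - eta < rad by apply/andP; split; lra.
move=> He; have etaM : (u + K) * eta < u * rad - K * d.
  by move: eta0 eta2 D0; clear -u0 K0; move: eta => e e0 e2 D0; nra.
move: He etaM; clear; move: eta => e He etaM; lra.
Qed.

Lemma powR_root_le (p c x : R) : 0 < p -> 0 <= x -> 0 <= c -> x <= c `^ p^-1 -> x `^ p <= c.
Proof.
move=> p0 x0 c0 xc; have -> : c = (c `^ p^-1) `^ p by rewrite -powRrM mulVf ?gt_eqF// powRr1.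
by apply: (ge0_ler_powR (ltW p0)) => //; rewrite nnegrE// powR_ge0.
Qed.

Lemma weight_cst_le (p q C rc lam m rad K : R) : 0 < m -> 0 < rad -> 0 < K -> 0 < lam ->
  C * rad `^ p <= rc * lam `^ (p - 1) * K ->
  C * m `^ q / (K * m `^ (q - p + 1)) <= rc * (lam * m) `^ (p - 1) * rad `^ (- p).
Proof.
move=> m0 rad0 K0 lam0 H.
have -> : m `^ q = m `^ (q - p + 1) * m `^ (p - 1).
  rewrite -powRD; last by rewrite (gt_eqF m0) implybT.
  by congr (_ `^ _); ring.
rewrite powRM ?(ltW m0) ?(ltW lam0)// powRN.
have X0 : 0 < m `^ (q - p + 1) by exact: powR_gt0.
have Y0 : 0 < m `^ (p - 1) by exact: powR_gt0.
have Z0 : 0 < rad `^ p by exact: powR_gt0.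
move: (m `^ (q - p + 1)) (m `^ (p - 1)) (rad `^ p) (lam `^ (p - 1)) X0 Y0 Z0 H => X Y Z P X0 Y0 Z0 H.
have -> : C * (X * Y) / (K * X) = Y * (C / K).
  by have := lt0r_neq0 X0; have := lt0r_neq0 K0 => h1 h2; field; rewrite h1 h2.
have -> : rc * (P * Y) * Z^-1 = Y * (rc * P / Z) by ring.
by rewrite ler_pM2l// ler_pdivrMr// mulrAC ler_pdivlMr.
Qed.

Lemma ring_distance (zx0 zc cx0 yx0 xy xx0 sr rad rad' rho : R) : 0 < rho ->
  zx0 <= zc + cx0 -> cx0 <= rad + yx0 -> yx0 <= xy + xx0 -> xx0 < 2 * sr -> xy < sr ->
  3 / 2 * rho <= zx0 -> rad' < rad -> sr <= 8^-1 * rho -> rad <= 4^-1 * rho ->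
  2 * rad' <= zc.
Proof. by move=> *; lra. Qed.

Lemma annulus (a b D : R) : a <= D -> b <= a + 2 * D -> 2 * D <= a + b -> D <= b <= 3 * D.
Proof. by move=> *; apply/andP; split; lra. Qed.

Lemma small_radius (e sr rho : R) : 0 < rho -> e < 2 * sr -> sr <= 8^-1 * rho ->
  e < 3 / 2 * rho.
Proof. by move=> *; lra. Qed.

Lemma le0_of_geometric (u m : R) : (forall j, u <= m * 2^-1 ^+ j) -> u <= 0.
Proof.
move=> H; have c : m * 2^-1 ^+ j @[j --> \oo] --> m * 0.
  apply: cvgM; first exact: cvg_cst.
  by apply: cvg_expr; rewrite ger0_norm ?invr_ge0// invf_lt1// ltr1n.
rewrite -(mulr0 m); apply: (ler_cvg_to (cvg_cst u) c); exact: nearW.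
Qed.

End real_lemmas.

Section boundary_decay.
Context {R : realType} (n : nat) (Omega : set 'rV[R]_n) (T p q M : R).
Variables (u : 'rV[R]_n * R -> R) (s rho : R) (x0 : 'rV[R]_n).
Hypotheses (oO : open Omega) (bO : bounded_set Omega) (p1 : 1 < p) (q0 : 0 < q).
Hypothesis cu : forall z, cylinder Omega T z -> {for z, continuous u}.
Hypothesis uM : forall z, cylinder Omega T z -> 0 <= u z <= M.
Hypothesis Wu : weak_solution Omega T p q u.
Hypotheses (s0 : 0 < s) (rho0 : 0 < rho).
Hypothesis vanish : vanishes_on_lateral_boundary Omega (eball x0 (2 * rho)) s T p u.
Local Notation k := (radial_exponent n p).

Let p0 : 0 < p. Proof. exact: lt_trans p1. Qed.

Lemma barrier_comparison (b tau m s1 rad rad' a : R) (y x : 'rV[R]_n) :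
  s <= s1 -> 0 < tau -> s1 < b - tau -> b < T -> 0 < m ->
  (forall x t, Omega x -> enorm (x - x0) < 2 * rho -> s1 < t < T -> u (x, t) <= m) ->
  0 < rad' -> rad' < rad -> rad <= 2 * rad' -> 0 < a ->
  (forall x, Omega x -> rad <= enorm (x - y)) ->
  (forall x, Omega x -> 3 / 2 * rho <= enorm (x - x0) < 2 * rho ->
     m <= a * (1 - (rad' / enorm (x - y)) `^ (2 * k))) ->
  (forall x, Omega x -> enorm (x - x0) < 2 * rho ->
     a * (1 - (rad' / enorm (x - y)) `^ (2 * k)) < m -> enorm (x - y) <= 3 * rad) ->
  time_weight_cst q * m `^ q / tau <= radial_cst n p * a `^ (p - 1) * rad `^ (- p) ->
  Omega x -> enorm (x - x0) < 3 / 2 * rho ->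
  u (x, b) <= a * (1 - (rad' / enorm (x - y)) `^ (2 * k)).
Proof.
move=> ss1 tau0 s1b bT m0 um r'0 r'r r2 a0 ext ring_ge low Kc Ox xx0.
rewrite -(barrierE p a r'0 r'r ext Ox)//.
refine (stationary_comparison oO bO p1 q0 cu uM Wu s0 rho0 vanish ss1 tau0 s1b bT m0 um
  (smooth_barrier p y a r'0 r'r) (barrier_ge0 p1 y r'0 r'r a0)
  (fun i => smooth_barrier_flux p y a r'0 r'r i) _ _ Kc Ox xx0).
- by move=> z Oz zr; rewrite (barrierE p a r'0 r'r ext Oz); exact: ring_ge.
- move=> z Oz z2; rewrite (barrierE p a r'0 r'r ext Oz) => /(low z Oz z2) zy; split.
    by move=> i; exact: (barrier_fluxE p1 oO r'0 r'r a0 ext i Oz).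
  exact: (barrier_flux_divergence p1 oO r'0 r'r r2 a0 ext Oz zy).
Qed.

Lemma local_decay (nu m alpha sbar t : R) (y x : 'rV[R]_n) :
  0 < nu -> 0 < m -> 0 < alpha <= 4^-1 -> 0 < sbar <= 8^-1 ->
  alpha `^ p <= radial_cst n p * 2 `^ (p - 1) * nu / time_weight_cst q ->
  (forall x t, Omega x -> enorm (x - x0) < 2 * rho -> s < t < T -> u (x, t) <= m) ->
  s + nu * m `^ (q - p + 1) * rho `^ p < t < T ->
  (exists c, enorm (c - y) = alpha * rho /\ forall x, Omega x -> alpha * rho <= enorm (x - c)) ->
  Omega x -> enorm (x - x0) < 2 * sbar * rho -> enorm (x - y) < sbar * rho ->
  u (x, t) <= 4 * k / alpha * (enorm (x - y) / rho) * m.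
Proof.
move=> nu0 m0 /andP[al0 al4] /andP[sb0 sb8] alp um /andP[st tT] [c [cy ext]] Ox xx0 xy.
set rad := alpha * rho in cy ext; have rad0 : 0 < rad by rewrite mulr_gt0.
pose tau := nu * m `^ (q - p + 1) * rho `^ p.
have tau0 : 0 < tau by rewrite !mulr_gt0 ?powR_gt0.
have k1 : 1 <= k := radial_exponent_ge1 n p1.
have rad4 : rad <= 4^-1 * rho by rewrite ler_wpM2r// ltW.
have sr8 : sbar * rho <= 8^-1 * rho by rewrite ler_wpM2r// ltW.
have xc : enorm (x - c) <= enorm (x - y) + rad.
  by rewrite -cy -(enormB y c) -[x - c](subrKA y); exact: enormD.
have dx0 : 0 < enorm (x - c) by exact: lt_le_trans (ext x Ox).
have Cx : cylinder Omega T (x, t).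
  split=> //=; rewrite in_itv /= tT andbT; apply: lt_trans s0 (lt_trans _ st).
  by rewrite ltrDl.
have /andP[u0 _] := uM Cx.
suff H : u (x, t) * rad <= 4 * k * m * enorm (x - y).
  have -> : 4 * k / alpha * (enorm (x - y) / rho) * m = 4 * k * m * enorm (x - y) / rad.
    have an : alpha != 0 by rewrite gt_eqF.
    have rn : rho != 0 by rewrite gt_eqF.
    by rewrite /rad; field; rewrite rn an.
  by rewrite ler_pdivlMr.
apply: le_of_shrinking_radius => //; first by rewrite !mulr_ge0 ?(ltW m0)// (le_trans ler01 k1).
move=> rad' /andP[r'2 r'r].
have r'0 : 0 < rad' by apply: lt_le_trans r'2; rewrite divr_gt0.
have r2 : rad <= 2 * rad' by rewrite -ler_pdivrMl// mulrC.
have far z : 2 * rad' <= enorm (z - c) -> m <= 2 * m * (1 - (rad' / enorm (z - c)) `^ (2 * k)).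
  move=> zc; have z0 : 0 < enorm (z - c) by apply: lt_le_trans zc; rewrite mulr_gt0.
  have h1 : rad' / enorm (z - c) <= 2^-1.
    by rewrite ler_pdivrMr// ler_pdivlMl.
  have h2 : (rad' / enorm (z - c)) `^ (2 * k) <= 2^-1.
    apply: (le_trans _ h1); apply: ge1r_powR; last first.
      by apply: (le_trans k1); rewrite ler_peMl ?ler1n// (le_trans ler01 k1).
    rewrite divr_gt0//=; apply: (le_trans h1).
    by rewrite invf_le1// ler1n.
  by move: h2 m0; move: (_ `^ _) => w; nra.
have ring_ge z : Omega z -> 3 / 2 * rho <= enorm (z - x0) < 2 * rho ->
    m <= 2 * m * (1 - (rad' / enorm (z - c)) `^ (2 * k)).
  move=> Oz /andP[z1 _]; apply: far.
  have h1 := enormD (z - c) (c - x0); rewrite addrA subrK in h1.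
  have h2 := enormD (c - y) (y - x0); rewrite addrA subrK cy in h2.
  have h3 := enormD (y - x) (x - x0); rewrite addrA subrK (enormB y x) in h3.
  have xx0' : enorm (x - x0) < 2 * (sbar * rho) by rewrite mulrA.
  exact: (ring_distance rho0 h1 h2 h3 xx0' xy z1 r'r sr8 rad4).
have low z : Omega z -> enorm (z - x0) < 2 * rho ->
    2 * m * (1 - (rad' / enorm (z - c)) `^ (2 * k)) < m -> enorm (z - c) <= 3 * rad.
  move=> _ _ Sm; have : ~~ (2 * rad' <= enorm (z - c)).
    by apply/negP => /far; rewrite leNgt Sm.
  rewrite -ltNge => zc; apply: (le_trans (ltW zc)).
  by apply: ler_pM => //; rewrite ?ler_nat// ltW.
have K0 : 0 < nu * rho `^ p by rewrite mulr_gt0 ?powR_gt0.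
have Kc : time_weight_cst q * m `^ q / tau <= radial_cst n p * (2 * m) `^ (p - 1) * rad `^ (- p).
  have -> : tau = nu * rho `^ p * m `^ (q - p + 1) by rewrite /tau mulrAC.
  apply: weight_cst_le => //.
  rewrite /rad powRM ?(ltW al0) ?(ltW rho0)//.
  have C0 := time_weight_cst_gt0 q0.
  move: alp; rewrite ler_pdivlMr// => alp.
  have -> : time_weight_cst q * (alpha `^ p * rho `^ p) = alpha `^ p * time_weight_cst q * rho `^ p by ring.
  by rewrite mulrA ler_wpM2r ?powR_ge0.
have xx : enorm (x - x0) < 3 / 2 * rho.
  have xx0' : enorm (x - x0) < 2 * (sbar * rho) by rewrite mulrA.
  exact: (small_radius rho0 xx0' sr8).
have st' : s < t - tau by rewrite ltrBrDr.
have m2 : 0 < 2 * m by rewrite mulr_gt0.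
have H := barrier_comparison (lexx s) tau0 st' tT m0 um r'0 r'r r2 m2 ext ring_ge low Kc Ox xx.
have w01 : 0 < rad' / enorm (x - c) <= 1.
  by rewrite divr_gt0//= ler_pdivrMr// mul1r (le_trans (ltW r'r) (ext x Ox)).
have k2 : 1 <= 2 * k by apply: (le_trans k1); rewrite ler_peMl ?ler1n// (le_trans ler01 k1).
have B := one_minus_powR_le k2 w01.
have H2 : u (x, t) <= 2 * m * (2 * k * (1 - rad' / enorm (x - c))).
  by apply: (le_trans H); rewrite ler_pM2l.
apply: (@le_trans _ _ (2 * m * (2 * k * (1 - rad' / enorm (x - c))) * rad')).
  by rewrite ler_pM2r.
have -> : 4 * k * m * (enorm (x - y) + rad - rad') = 2 * m * (2 * k) * (enorm (x - y) + rad - rad') by ring.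
have k_gt0 : 0 < k by exact: lt_le_trans ltr01 k1.
rewrite -!mulrA !ler_pM2l//.
apply: (@le_trans _ _ ((1 - rad' / enorm (x - c)) * enorm (x - c))).
  rewrite ler_wpM2l// ?subr_ge0; first by case/andP: w01.
  exact: le_trans (ltW r'r) (ext x Ox).
by rewrite mulrBl mul1r divfK ?gt_eqF// lerD2r.
Qed.

Lemma halving (m s1 tau D : R) (c : 'rV[R]_n) : s <= s1 -> 0 < m -> 0 < tau -> 0 < D ->
  (forall x, Omega x -> enorm (x - x0) < 3 / 2 * rho) ->
  (forall x, Omega x -> D <= enorm (x - c) <= 3 * D) ->
  time_weight_cst q * m `^ q / tau <= radial_cst n p * (2^-1 * m) `^ (p - 1) * D `^ (- p) ->
  (forall x t, Omega x -> s1 < t < T -> u (x, t) <= m) ->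
  forall x t, Omega x -> s1 + tau < t < T -> u (x, t) <= 2^-1 * m.
Proof.
move=> ss1 m0 tau0 D0 Ox0 Oc Kc um x t Ox /andP[st tT].
have st' : s1 < t - tau by rewrite ltrBrDr.
have a0 : 0 < 2^-1 * m by rewrite mulr_gt0.
have r'0 : 0 < D / 2 by rewrite divr_gt0.
have r'r : D / 2 < D by rewrite gtr_pMr// invf_lt1// ltr1n.
have r2 : D <= 2 * (D / 2) by rewrite mulrC divfK.
have ext z : Omega z -> D <= enorm (z - c) by move=> /Oc/andP[].
apply: le_trans (_ : 2^-1 * m * (1 - (D / 2 / enorm (x - c)) `^ (2 * k)) <= _); last first.
  by rewrite ler_piMr ?(ltW a0)// gerBl powR_ge0.
apply: (barrier_comparison ss1 tau0 st' tT m0 _ r'0 r'r r2 a0 ext _ _ Kc Ox (Ox0 x Ox)).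
- by move=> z t' Oz _; exact: um.
- by move=> z Oz; rewrite leNgt Ox0.
- by move=> z Oz _ _; case/andP: (Oc z Oz).
Qed.

Lemma extinction (m D : R) (c : 'rV[R]_n) : 0 < q - p + 1 -> 0 < m -> 0 < D ->
  (forall x, Omega x -> enorm (x - x0) < 3 / 2 * rho) ->
  (forall x, Omega x -> D <= enorm (x - c) <= 3 * D) ->
  (forall x t, Omega x -> s < t < T -> u (x, t) <= m) ->
  forall x t, Omega x ->
    s + time_weight_cst q * 2 `^ (p - 1) / radial_cst n p * D `^ p * m `^ (q - p + 1) /
      (1 - 2^-1 `^ (q - p + 1)) < t < T -> u (x, t) <= 0.
Proof.
move=> d0 m0 D0 Ox0 Oc um x t Ox; set CE := time_weight_cst q * 2 `^ (p - 1) / radial_cst n p.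
set th := 2^-1 `^ (q - p + 1).
have th0 : 0 < th by rewrite powR_gt0 ?invr_gt0.
have th1 : th < 1.
  have e1 : 1 `^ (q - p + 1) = 1 :> R by rewrite powR1.
  by rewrite /th -[ltRHS]e1 gt0_ltr_powR ?nnegrE ?invr_ge0// invf_lt1// ltr1n.
have rc0 := radial_cst_gt0 n p1.
have C0 := time_weight_cst_gt0 q0.
have CE0 : 0 < CE by rewrite divr_gt0// mulr_gt0// powR_gt0.
have th10 : 0 < 1 - th by rewrite subr_gt0.
set Bt := CE * D `^ p * m `^ (q - p + 1) / (1 - th).
have Bt0 : 0 < Bt by rewrite !mulr_gt0 ?invr_gt0 ?powR_gt0.
move=> /andP[st tT].
have key j : forall x t, Omega x -> s + Bt * (1 - th ^+ j) < t < T -> u (x, t) <= m * 2^-1 ^+ j.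
  elim: j => [|j IH] z t' Oz.
    by rewrite !expr0 subrr mulr0 addr0 mulr1; exact: um.
  pose mj := m * 2^-1 ^+ j; have mj0 : 0 < mj by rewrite mulr_gt0// exprn_gt0 ?invr_gt0.
  pose tauj := CE * D `^ p * mj `^ (q - p + 1).
  have tauj0 : 0 < tauj.
    by rewrite /tauj; apply: mulr_gt0; [apply: mulr_gt0 => //; exact: powR_gt0|exact: powR_gt0].
  have thj : (2^-1 ^+ j) `^ (q - p + 1) = th ^+ j :> R.
    have h2 : 0 <= 2^-1 :> R by rewrite invr_ge0.
    by rewrite -(powR_mulrn j h2) powRAC -(powR_mulrn j (ltW th0)).
  have taujE : tauj = Bt * (1 - th) * th ^+ j.
    rewrite /tauj /mj powRM ?(ltW m0) ?exprn_ge0 ?invr_ge0// thj /Bt divfK ?gt_eqF//.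
    by rewrite mulrA.
  have sE : s + Bt * (1 - th ^+ j.+1) = s + Bt * (1 - th ^+ j) + tauj.
    by rewrite taujE exprS; ring.
  rewrite sE [2^-1 ^+ j.+1]exprS mulrCA => Ht.
  have thj1 : th ^+ j <= 1 by rewrite exprn_ile1// ltW.
  have ssj : s <= s + Bt * (1 - th ^+ j) by rewrite lerDl mulr_ge0 ?(ltW Bt0)// subr_ge0.
  apply: (halving ssj mj0 tauj0 D0 Ox0 Oc _ IH Oz Ht).
  apply: weight_cst_le; [exact: mj0|exact: D0|by apply: mulr_gt0 => //; exact: powR_gt0|by rewrite invr_gt0|].
  rewrite /CE le_eqVlt; apply/orP; left; apply/eqP.
  have -> : 2^-1 `^ (p - 1) = (2 `^ (p - 1))^-1 :> R.
    by rewrite -[2^-1]powR_inv1// -powRrM mulN1r powRN.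
  have P0 : 0 < 2 `^ (p - 1) :> R by rewrite powR_gt0.
  move: (2 `^ (p - 1)) (D `^ p) (radial_cst n p) (time_weight_cst q) rc0 C0 P0 => P Dp rc C rc0 C0 P0.
  by have := lt0r_neq0 rc0; have := lt0r_neq0 P0 => h1 h2; field; rewrite h1 h2.
apply: (@le0_of_geometric _ _ m) => j; apply: key => //.
by rewrite tT andbT; apply: le_lt_trans st; rewrite lerD2l ler_piMr ?(ltW Bt0)// gerBl exprn_ge0// ltW.
Qed.

End boundary_decay.


Section boundary_estimate.
Context {R : realType} (n : nat) (p q nu : R) (k : nat) (r L : R).
Hypotheses (p10 : 0 < p - 1) (pq : p - 1 < q) (nu0 : 0 < nu) (r0 : 0 < r).

Let p1 : 1 < p. Proof. by rewrite -subr_gt0. Qed.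
Let p0 : 0 < p. Proof. exact: lt_trans p1. Qed.
Let q0 : 0 < q. Proof. exact: lt_trans pq. Qed.
Let d0 : 0 < q - p + 1. Proof. by move: pq; lra. Qed.

Definition exterior_radius : R := Num.min (r / 2) ((2 * (`|L| + 1))^-1).

Lemma exterior_radius_gt0 : 0 < exterior_radius.
Proof.
by rewrite lt_min divr_gt0// invr_gt0 mulr_gt0// ltr_wpDl.
Qed.

Lemma exterior_radius_bound R0 : 0 < R0 -> R0 <= exterior_radius ->
  2 * R0 <= r /\ 2 * R0 * L <= 1.
Proof.
rewrite le_min => R00 /andP[h1 h2]; split; first by rewrite mulrC -ler_pdivlMr.
have L1 : 0 < `|L| + 1 by rewrite ltr_wpDl.
have h3 : 2 * R0 * (`|L| + 1) <= 1.
  by rewrite mulrAC -ler_pdivlMl ?mulr_gt0// mulr1.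
apply: le_trans h3; rewrite ler_wpM2l ?mulr_ge0 ?(ltW R00)//.
by rewrite (le_trans (ler_norm L))// lerDl.
Qed.

Definition domain_size : R := n.+1%:R * (k%:R * (2 * r)) + r.

Lemma domain_size_gt0 : 0 < domain_size.
Proof. by rewrite ltr_wpDl// !mulr_ge0 ?ler0n// ltW. Qed.

Let CE : R := time_weight_cst q * 2 `^ (p - 1) / radial_cst n.+1 p.
Let th : R := 2^-1 `^ (q - p + 1).

(* beyond this scale the solution is extinct at the times of the theorem *)
Definition extinction_scale : R :=
  Num.max domain_size ((CE * domain_size `^ p / (nu * (1 - th))) `^ p^-1).

Lemma extinction_scale_gt0 : 0 < extinction_scale.
Proof. by rewrite lt_max domain_size_gt0. Qed.

Definition decay_ratio : R :=
  Num.min (Num.min 4^-1 ((radial_cst n.+1 p * 2 `^ (p - 1) * nu / time_weight_cst q) `^ p^-1))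
    (exterior_radius / extinction_scale).

Let rc0 : 0 < radial_cst n.+1 p. Proof. exact: radial_cst_gt0. Qed.
Let C0 : 0 < time_weight_cst q. Proof. exact: time_weight_cst_gt0. Qed.
Let P0 : 0 < 2 `^ (p - 1) :> R. Proof. exact: powR_gt0. Qed.
Let CE0 : 0 < CE. Proof. by rewrite divr_gt0// mulr_gt0. Qed.
Let th1 : 0 < 1 - th.
Proof.
have e1 : 1 `^ (q - p + 1) = 1 :> R by rewrite powR1.
rewrite subr_gt0 /th -[ltRHS]e1; apply: gt0_ltr_powR; rewrite ?nnegrE ?invr_ge0//.
by rewrite invf_lt1// ltr1n.
Qed.

Let decay_bound_gt0 : 0 < radial_cst n.+1 p * 2 `^ (p - 1) * nu / time_weight_cst q.
Proof. by apply: divr_gt0 => //; apply: mulr_gt0 => //; exact: mulr_gt0. Qed.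

Lemma decay_ratio_gt0 : 0 < decay_ratio.
Proof.
rewrite /decay_ratio !lt_min invr_gt0 ltr0n /=; apply/andP; split.
  exact: powR_gt0 decay_bound_gt0.
by rewrite divr_gt0 ?exterior_radius_gt0 ?extinction_scale_gt0.
Qed.

Lemma decay_ratio_powR_le :
  decay_ratio `^ p <= radial_cst n.+1 p * 2 `^ (p - 1) * nu / time_weight_cst q.
Proof.
apply: powR_root_le => //; first exact: ltW decay_ratio_gt0.
  exact: ltW decay_bound_gt0.
by rewrite /decay_ratio !ge_min lexx orbT.
Qed.

Variables (Omega : set 'rV[R]_n.+1) (T M s rho : R) (x0 : 'rV[R]_n.+1).
Variable (u : 'rV[R]_n.+1 * R -> R).
Hypotheses (dO : C11_domain Omega) (chO : C11_character k r L Omega) (T0 : 0 < T).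
Hypothesis Wu : weak_solution Omega T p q u.
Hypothesis cu : forall z, cylinder Omega T z -> {for z, continuous u}.
Hypothesis uM : forall z, cylinder Omega T z -> 0 <= u z <= M.
Hypotheses (s0 : 0 < s) (Bx0 : boundary Omega x0) (rho0 : 0 < rho).
Hypothesis vanish : vanishes_on_lateral_boundary Omega (eball x0 (2 * rho)) s T p u.

Let oO : open Omega. Proof. by case: dO => -[]. Qed.
Let bO : bounded_set Omega. Proof. by case: dO => -[]. Qed.

Lemma local_boundary_estimate (m t : R) (y x : 'rV[R]_n.+1) :
  n = 0 \/ rho <= extinction_scale -> 0 < m ->
  (forall x t, Omega x -> enorm (x - x0) < 2 * rho -> s < t < T -> u (x, t) <= m) ->
  s + nu * m `^ (q - p + 1) * rho `^ p < t < T -> boundary Omega y ->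
  Omega x -> enorm (x - x0) < 2 * 8^-1 * rho -> enorm (x - y) < 8^-1 * rho ->
  u (x, t) <= 4 * radial_exponent n.+1 p / decay_ratio * (enorm (x - y) / rho) * m.
Proof.
move=> small m0 um tT By Ox xx0 xy.
have al0 := decay_ratio_gt0; have ar0 : 0 < decay_ratio * rho by rewrite mulr_gt0.
apply: (local_decay oO bO p1 q0 cu uM Wu s0 rho0 vanish nu0 m0 _ _ decay_ratio_powR_le um tT _ Ox xx0 xy).
- by rewrite al0 /decay_ratio !ge_min lexx.
- by rewrite invr_gt0 ltr0n lexx.
case: small => [n0|rhoS].
  by have [bd _] := dO; exact: (exterior_ball_line n0 bd By ar0).
have [_ charts _] := chO.
have aR : decay_ratio * rho <= exterior_radius.
  have S0 := extinction_scale_gt0; apply: (@le_trans _ _ (exterior_radius / extinction_scale * extinction_scale)).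
    apply: ler_pM => //; rewrite ?(ltW al0) ?(ltW rho0)//.
    by rewrite /decay_ratio ge_min lexx orbT.
  by rewrite divfK// gt_eqF.
have [h1 h2] := exterior_radius_bound ar0 aR.
exact: (exterior_ball oO By (charts y By) ar0 h1 h2).
Qed.

Lemma extinction_estimate (m t : R) (x : 'rV[R]_n.+1) :
  n != 0%N -> extinction_scale <= rho -> 0 < m -> m <= M ->
  (forall x t, Omega x -> enorm (x - x0) < 2 * rho -> s < t < T -> u (x, t) <= m) ->
  s + nu * M `^ (q - p + 1) * rho `^ p < t < T -> Omega x -> u (x, t) <= 0.
Proof.
move=> n0 rhoS m0 mM um /andP[st tT] Ox.
have D0 := domain_size_gt0; set D := domain_size in D0.
have Drho : D <= rho by apply: le_trans rhoS; rewrite le_max lexx.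
have [bd _] := dO; have [_ _ [yc [_ cover]]] := chO.
have width z : Omega z -> enorm (z - x0) <= D.
  move=> Oz; apply: (@le_trans _ _ (n.+1%:R * (k%:R * (2 * r)))); last by rewrite lerDl ltW.
  case: n n0 Omega x0 yc bd cover Bx0 z Oz => // n' _ Om z0 yc' bd' cover' Bz0 z Oz.
  exact: (domain_width bd' r0 cover' Bz0 Oz).
pose c := x0 + (2 * D) *: basis_vec R ord0.
have nb : enorm (basis_vec R ord0 : 'rV[R]_n.+1) = 1.
  rewrite /enorm /dotp (bigD1 ord0)//= big1 ?addr0; last by move=> j /negPf ji; rewrite !mxE eqxx ji mulr0.
  by rewrite !mxE !eqxx mulr1 sqrtr1.
have cx0 : enorm (x0 - c) = 2 * D.
  by rewrite /c opprD addrA subrr sub0r enormN enormZ nb mulr1 ger0_norm// mulr_ge0// ltW.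
have Oc z : Omega z -> D <= enorm (z - c) <= 3 * D.
  move=> /width zD; have h1 := enormD (z - x0) (x0 - c); rewrite addrA subrK cx0 in h1.
  have h2 := enormD (x0 - z) (z - c); rewrite addrA subrK cx0 (enormB x0) in h2.
  exact: (annulus zD h1 h2).
have rho32 z : Omega z -> enorm (z - x0) < 3 / 2 * rho.
  move=> /width zD; apply: (le_lt_trans (le_trans zD Drho)).
  by rewrite ltr_pMl// ltr_pdivlMr// mul1r ltr_nat.
have rho2 z : Omega z -> enorm (z - x0) < 2 * rho.
  move=> /width zD; apply: (le_lt_trans (le_trans zD Drho)).
  by rewrite ltr_pMl// ltr1n.
have um' z t' : Omega z -> s < t' < T -> u (z, t') <= m.
  by move=> Oz; apply: um => //; exact: rho2.
apply: (extinction oO bO p1 q0 cu uM Wu s0 rho0 vanish d0 m0 D0 rho32 Oc um' Ox).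
rewrite tT andbT; apply: le_lt_trans st; rewrite lerD2l ler_pdivrMr//.
have mMd : m `^ (q - p + 1) <= M `^ (q - p + 1).
  by apply: (ge0_ler_powR (ltW d0)) => //; rewrite nnegrE ?(ltW m0)// (le_trans (ltW m0)).
have scale : CE * D `^ p <= nu * (1 - th) * rho `^ p.
  have Z0 : 0 <= CE * D `^ p / (nu * (1 - th)).
    apply: divr_ge0; first by apply: mulr_ge0; [exact: ltW|exact: powR_ge0].
    by apply: mulr_ge0; exact: ltW.
  have h : CE * D `^ p / (nu * (1 - th)) <= rho `^ p.
    have -> : CE * D `^ p / (nu * (1 - th)) = ((CE * D `^ p / (nu * (1 - th))) `^ p^-1) `^ p.
      by rewrite -powRrM mulVf ?gt_eqF// powRr1.
    apply: (ge0_ler_powR (ltW p0)); rewrite ?nnegrE ?powR_ge0 ?(ltW rho0)//.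
    by apply: le_trans rhoS; rewrite le_max lexx orbT.
  by move: h; rewrite ler_pdivrMr ?[rho `^ p * _]mulrC//; apply: mulr_gt0.
apply: (@le_trans _ _ (nu * (1 - th) * rho `^ p * M `^ (q - p + 1))).
  by apply: ler_pM => //; rewrite ?powR_ge0// mulr_ge0 ?powR_ge0// ltW.
by rewrite le_eqVlt /th; apply/orP; left; apply/eqP; ring.
Qed.

End boundary_estimate.

Lemma le_mul_inf {R : realType} (E : set R) (v K bound : R) : 0 <= v -> 0 < K ->
  E !=set0 -> (forall e, E e -> 0 <= e) -> inf E < bound ->
  (forall e, E e -> e < bound -> v <= K * e) -> v <= K * inf E.
Proof.
move=> v0 K0 E0 Ege Eb H.
have [lt|ge] := ltP (inf E) (v / K); last by rewrite mulrC -ler_pdivrMr.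
have lb : lbound E (Num.min (v / K) bound).
  move=> e Ee; rewrite ge_min; have [|eb] := leP bound e; first by rewrite orbT.
  by rewrite ler_pdivrMr// mulrC H.
have := lb_le_inf E0 lb; rewrite leNgt lt_min lt Eb.
by [].
Qed.

Theorem proposition5p1 (R : realType) (n : nat) (p q nu : R)
    (k : nat) (r L : R) :
  0 < p - 1 -> p - 1 < q -> (q%:E < critical_exponent n.+1 p)%E -> 0 < nu ->
  exists gamma1 sbar : R, 0 < gamma1 /\ 0 < sbar < 2^-1 /\
  forall (Omega : set 'rV[R]_n.+1) (T M s rho : R) (x0 : 'rV[R]_n.+1)
         (u : 'rV[R]_n.+1 * R -> R),
    C11_domain Omega -> C11_character k r L Omega ->
    0 < T ->
    weak_solution Omega T p q u ->
    (forall z, cylinder Omega T z -> {for z, continuous u}) ->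
    (forall z, cylinder Omega T z -> 0 <= u z <= M) ->
    0 < s < T -> boundary Omega x0 -> 0 < rho ->
    vanishes_on_lateral_boundary Omega (eball x0 (2 * rho)) s T p u ->
    forall (t : R) (x : 'rV[R]_n.+1),
      s + nu * M `^ (q - p + 1) * rho `^ p < t < T ->
      (Omega `&` eball x0 (2 * sbar * rho)) x ->
      eucl_dist x (boundary Omega) < sbar * rho ->
      u (x, t) <= gamma1 * (eucl_dist x (boundary Omega) / rho) *
        sup [set u z | z in (Omega `&` eball x0 (2 * rho)) `*` `]s, T[%classic].
Proof.
Proof.
move=> p10 pq _ nu0; have [r0|r0] := ltP 0 r; last first.
  exists 1, 4^-1; split=> //; split; first by apply/andP; split; [by rewrite invr_gt0|by rewrite ltf_pV2 ?posrE// ltr_nat].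
  by move=> Omega T M s rho x0 u _ [r_gt0 _ _]; move: r0; rewrite leNgt r_gt0.
have p1 : 1 < p by rewrite -subr_gt0.
have al0 := decay_ratio_gt0 n k L p10 pq nu0 r0.
have k1 := radial_exponent_ge1 n.+1 p1.
have g0 : 0 < 4 * radial_exponent n.+1 p / decay_ratio n p q nu k r L.
  by rewrite divr_gt0// mulr_gt0// (lt_le_trans ltr01 k1).
exists (4 * radial_exponent n.+1 p / decay_ratio n p q nu k r L), 8^-1; split=> //.
split; first by apply/andP; split; [by rewrite invr_gt0|by rewrite ltf_pV2 ?posrE// ltr_nat].
move=> Omega T M s rho x0 u dO chO T0 Wu cu uM /andP[s0 sT] Bx0 rho0 vanish t x /andP[st tT] [Ox xx0] dx.
set E := (X in sup X); set m := sup E.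
have Eub : ubound E M.
  move=> _ [[z t'] [[Oz zx0] /= t's] <-]; move: t's; rewrite in_itv /= => /andP[st' t'T].
  by have /andP[] : 0 <= u (z, t') <= M by apply: uM; split=> //=; rewrite in_itv /= (lt_trans s0 st').
have um z t' : Omega z -> enorm (z - x0) < 2 * rho -> s < t' < T -> u (z, t') <= m.
  move=> Oz zx0 t's; apply: ub_le_sup; first by exists M.
  by exists (z, t') => //; split=> //=; rewrite in_itv.
have Mpos : 0 <= nu * M `^ (q - p + 1) * rho `^ p by rewrite !mulr_ge0 ?powR_ge0// ltW.
have st' : s < t by apply: le_lt_trans st; rewrite lerDl.
have Cx : cylinder Omega T (x, t) by split=> //=; rewrite in_itv /= tT (lt_trans s0 st').
have /andP[u0 _] := uM _ Cx.
have xx2 : enorm (x - x0) < 2 * rho.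
  apply: lt_le_trans xx0 _; rewrite ler_pM2r// ler_piMr// invf_le1// ler1n//.
have uxm : u (x, t) <= m by apply: um => //; rewrite st'.
have mM : m <= M by apply: ge_sup => //; exists (u (x, t)), (x, t) => //; split=> //=; rewrite in_itv /= st'.
have dist0 : 0 <= eucl_dist x (boundary Omega).
  apply: lb_le_inf; first by exists (enorm (x - x0)), x0.
  by move=> _ [y _ <-]; exact: enorm_ge0.
have rhs0 : 0 <= 4 * radial_exponent n.+1 p / decay_ratio n p q nu k r L *
    (eucl_dist x (boundary Omega) / rho) * m.
  apply: mulr_ge0; last exact: le_trans u0 uxm.
  by apply: mulr_ge0; [exact: ltW|apply: divr_ge0 => //; exact: ltW].
have [m0|m0] := ltP 0 m; last exact: le_trans (le_trans uxm m0) rhs0.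
have d0 : 0 <= q - p + 1 by move: pq; lra.
have st_m : s + nu * m `^ (q - p + 1) * rho `^ p < t < T.
  rewrite tT andbT; apply: le_lt_trans st; rewrite lerD2l ler_wpM2r ?powR_ge0// ler_wpM2l ?(ltW nu0)//.
  by apply: (ge0_ler_powR d0) => //; rewrite nnegrE ?(ltW m0)// (le_trans (ltW m0)).
have [small|] := pselect (n = 0%N \/ rho <= extinction_scale n p q nu k r); last first.
  move=> /not_orP[/eqP n0 /negP]; rewrite -ltNge => /ltW large.
  apply: le_trans rhs0.
  refine (extinction_estimate p10 pq nu0 r0 dO chO Wu cu uM s0 Bx0 rho0 vanish n0 large m0 mM um _ Ox).
  by rewrite st.
have -> : 4 * radial_exponent n.+1 p / decay_ratio n p q nu k r L *
    (eucl_dist x (boundary Omega) / rho) * m =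
    4 * radial_exponent n.+1 p / decay_ratio n p q nu k r L / rho * m * eucl_dist x (boundary Omega).
  by ring.
apply: (@le_mul_inf _ _ _ _ (8^-1 * rho)) => //.
- by apply: mulr_gt0 => //; apply: divr_gt0.
- by exists (enorm (x - x0)), x0.
- by move=> _ [y _ <-]; exact: enorm_ge0.
move=> _ [y By <-] xy.
have := local_boundary_estimate p10 pq nu0 r0 dO chO Wu cu uM s0 rho0 vanish small m0 um st_m By Ox xx0 xy.
by rewrite (_ : _ * (enorm (x - y) / rho) * m = 4 * radial_exponent n.+1 p / decay_ratio n p q nu k r L / rho * m * enorm (x - y))//; ring.
Qed.
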